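(* Let $\upsilon\in A_1$, $k,\ell\in\mathbb{N}$ with $\ell\le k$, $p\in[1,\infty)$, let $q\in(0,\infty)$ satisfy $n(\frac1p-\frac1q)<\ell$, and let $\gamma\in\Gamma_{p,q}$. Then there exist a positive constant $C$, independent of $\upsilon$, and an increasing continuous function $\psi$ on $[0,\infty)$ such that, for any $f\in\dot W^{\ell,p}_\upsilon$, $$\sup_{\lambda\in(0,\infty)}\lambda^p\int_{\mathbb{R}^n}\left[\int_{\mathbb{R}^n}\mathbf 1_{E_{\lambda,\frac\gamma q,k,\ell}[f]}(x,h)|h|^{\gamma-n}\,dh\right]^{\frac pq}\upsilon(x)\,dx\le C\psi\left([\upsilon]_{A_1}\right)\int_{\mathbb{R}^n}|\nabla^\ell f(x)|^p\upsilon(x)\,dx.$$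
   Context: Work in $\mathbb{R}^n$. An $A_1$-weight is a nonnegative locally integrable function $\upsilon$ with $[\upsilon]_{A_1}:=\sup_Q[\frac1{|Q|}\int_Q\upsilon]\|\upsilon^{-1}\|_{L^\infty(Q)}<\infty$, the supremum over all cubes $Q$. $L^p_\upsilon$ has norm $[\int|f|^p\upsilon]^{1/p}$, and $\dot W^{\ell,p}_\upsilon$ is the set of all $f\in L^1_{\rm loc}$ (with weak derivatives of order $\ell$) with $|\nabla^\ell f|:=[\sum_{|\alpha|=\ell}|\partial^\alpha f|^2]^{1/2}\in L^p_\upsilon$. $\Gamma_{p,q}:=(-\infty,-q)\cup(0,\infty)$ if $p=1$, and $\Gamma_{p,q}:=\mathbb{R}\setminus\{0\}$ if $p\in(1,\infty)$. $\Delta_h^kf(x):=\sum_{j=0}^k(-1)^{k-j}\binom kjf(x+jh)$. For $\lambda\in(0,\infty)$, $b\in\mathbb{R}$: $E_{\lambda,b,k,\ell}[f]:=\{(x,h)\in\mathbb{R}^n\times(\mathbb{R}^n\setminus\{\mathbf 0\}):|\Delta_h^kf(x)|>\lambda|h|^{b+\ell}\}$. *)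

(* Defs.v *)
From HB Require Import structures.
From mathcomp Require Import all_boot all_order all_algebra.
From mathcomp Require Import all_classical all_reals all_analysis ess_sup_inf.

Set Implicit Arguments.
Unset Strict Implicit.
Unset Printing Implicit Defensive.

Import Order.TTheory GRing.Theory Num.Theory.
Import numFieldNormedType.Exports.

Local Open Scope classical_set_scope.
Local Open Scope ring_scope.

Definition rV_display : measure_display. Proof. exact: default_measure_display. Qed.

Section borel_rV.
Context {R : realType} (n : nat).

Let coord (i : 'I_n) (x : 'rV[R]_n) : measurableTypeR R := x ord0 i.

Let rV_set0 : g_sigma_preimage coord set0.
Proof. exact: sigma_algebra0. Qed.

Let rV_setC A : g_sigma_preimage coord A -> g_sigma_preimage coord (~` A).
Proof. exact: sigma_algebraC. Qed.

Let rV_bigcup (F : (set 'rV[R]_n)^nat) :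
  (forall i, g_sigma_preimage coord (F i)) ->
  g_sigma_preimage coord (\bigcup_i F i).
Proof. exact: sigma_algebra_bigcup. Qed.

HB.instance Definition _ := @isMeasurable.Build rV_display
  'rV[R]_n (g_sigma_preimage coord) rV_set0 rV_setC rV_bigcup.

Lemma measurable_coord (i : 'I_n) :
  measurable_fun [set: 'rV[R]_n] (fun x => x ord0 i : measurableTypeR R).
Proof.
move=> _ Y mY; rewrite setTI; apply: sub_sigma_algebra => /=.
rewrite -bigcup_seq/=; exists i => /=; first by rewrite mem_index_enum.
by exists Y => //; rewrite setTI.
Qed.

Lemma measurable_fun_rVP d (T : measurableType d) (f : T -> 'rV[R]_n) :
  (forall i, measurable_fun [set: T] (fun x => f x ord0 i : measurableTypeR R)) ->
  measurable_fun [set: T] f.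
Proof.
move=> mf _ A mA; rewrite setTI.
suff : g_sigma_preimage coord `<=` [set B | measurable (f @^-1` B)] by exact.
apply: smallest_sub.
  split => /=; first by rewrite preimage_set0.
    by move=> B; rewrite setTD => mB; rewrite preimage_setC; exact: measurableC.
  by move=> F mF; rewrite preimage_bigcup; exact: bigcup_measurable.
rewrite -bigcup_seq; apply: bigcup_sub => i _ B [C mC <-] /=.
by rewrite setTI -comp_preimage -[X in measurable X]setTI; exact: mf.
Qed.

End borel_rV.

Section borel_measure.
Context {R : realType}.

Definition rV_cons n (p : measurableTypeR R * 'rV[R]_n) : 'rV[R]_n.+1 :=
  row_mx (p.1%:M : 'M[R]_1) p.2 : 'rV_(1 + n).

Lemma rV_cons0 n p : @rV_cons n p ord0 ord0 = p.1.
Proof.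
rewrite /rV_cons (_ : ord0 = lshift n (ord0 : 'I_1)); last exact/val_inj.
by rewrite (row_mxEl (p.1%:M : 'M[R]_1)) !mxE.
Qed.

Lemma rV_consS n p (j : 'I_n) : @rV_cons n p ord0 (lift ord0 j) = p.2 ord0 j.
Proof.
rewrite /rV_cons (_ : lift ord0 j = rshift 1 j); last exact/val_inj.
by rewrite (row_mxEr (p.1%:M : 'M[R]_1)).
Qed.

Lemma measurable_rV_cons n : measurable_fun setT (@rV_cons n).
Proof.
apply: measurable_fun_rVP => i; case: (unliftP ord0 i) => [j|] ->.
  under eq_fun do rewrite rV_consS.
  exact: (measurableT_comp (measurable_coord j) measurable_snd).
by under eq_fun do rewrite rV_cons0; exact: measurable_fst.
Qed.

Definition rV_uncons n (x : 'rV[R]_n.+1) : measurableTypeR R * 'rV[R]_n :=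
  (x ord0 ord0, \row_j x ord0 (lift ord0 j)).

Lemma rV_consK n : cancel (@rV_cons n) (@rV_uncons n).
Proof.
move=> [a x]; rewrite /rV_uncons rV_cons0/=; congr pair.
by apply/rowP => j; rewrite mxE rV_consS.
Qed.

Lemma measurable_rV_uncons n : measurable_fun setT (@rV_uncons n).
Proof.
apply/measurable_fun_pairP; split; first exact: measurable_coord.
apply: measurable_fun_rVP => i /=.
under eq_fun do rewrite mxE.
exact: measurable_coord.
Qed.

Section step.
Context (n : nat) (m : {sigma_finite_measure set 'rV[R]_n -> \bar R}).

Definition borel_step : set 'rV[R]_n.+1 -> \bar R :=
  pushforward (lebesgue_measure \x m)%E (@rV_cons n).

Let step0 : borel_step set0 = 0%E.
Proof. by rewrite /borel_step /pushforward preimage_set0 measure0. Qed.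

Let step_ge0 A : (0 <= borel_step A)%E.
Proof. exact: integral_ge0. Qed.


Let measurable_pre (A : set 'rV[R]_n.+1) :
  measurable A -> measurable (@rV_cons n @^-1` A).
Proof. by move=> mA; rewrite -[X in measurable X]setTI; exact: measurable_rV_cons. Qed.

Let step_sigma_additive : semi_sigma_additive borel_step.
Proof.
move=> F mF tF mUF; rewrite /borel_step /pushforward preimage_bigcup.
apply: measure_semi_sigma_additive.
- by move=> i; exact: measurable_pre.
- apply/trivIsetP => i j _ _ ij; rewrite -preimage_setI.
  by move/trivIsetP : tF => /(_ _ _ _ _ ij) ->//; rewrite preimage_set0.
- by rewrite -preimage_bigcup; exact: measurable_pre.
Qed.

HB.instance Definition _ := isMeasure.Build _ _ _ borel_step
  step0 step_ge0 step_sigma_additive.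

Let step_sigma_finite : sigma_finite setT borel_step.
Proof.
have /sigma_finiteP[F [FT ndF Foo]] : sigma_finite setT (@lebesgue_measure R).
  exact: sigma_finiteT.
have /sigma_finiteP[G [GT ndG Goo]] := sigma_finiteT m.
exists (fun k => @rV_uncons n @^-1` (F k `*` G k)).
  rewrite -preimage_bigcup (_ : \bigcup_i _ = setT) ?preimage_setT//.
  apply/seteqP; split => // -[x y] _.
  have [i _ Fix] : (\bigcup_i F i) x by rewrite -FT.
  have [j _ Gjy] : (\bigcup_j G j) y by rewrite -GT.
  exists (maxn i j) => //; split => /=.
  - by move: x Fix; exact/subsetPset/ndF/leq_maxl.
  - by move: y Gjy; exact/subsetPset/ndG/leq_maxr.
move=> k; have [mF Fk] := Foo k; have [mG Gk] := Goo k; split.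
  rewrite -[X in measurable X]setTI; apply: measurable_rV_uncons => //.
  exact: measurableX.
rewrite /borel_step /pushforward -comp_preimage.
rewrite (_ : _ \o _ = id); last exact/funext/rV_consK.
by rewrite product_measure1E// lte_mul_pinfty// ge0_fin_numE.
Qed.

HB.instance Definition _ := @Measure_isSigmaFinite.Build _ _ _ borel_step
  step_sigma_finite.

Definition borel_next : {sigma_finite_measure set 'rV[R]_n.+1 -> \bar R} := borel_step.

End step.

(* Lebesgue measure on the Borel sets, by iterated products. *)
Fixpoint borel_rV n : {sigma_finite_measure set 'rV[R]_n -> \bar R} :=
  match n with
  | 0 => \d_(0 : 'rV[R]_0)
  | n.+1 => borel_next (borel_rV n)
  end.

Lemma measurable_box n (a b : 'rV[R]_n) :
  measurable [set x : 'rV[R]_n | forall i, a ord0 i <= x ord0 i <= b ord0 i].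
Proof.
have -> : [set x : 'rV[R]_n | forall i, a ord0 i <= x ord0 i <= b ord0 i] =
    \bigcap_(i in [set: 'I_n])
      ((fun x : 'rV[R]_n => x ord0 i : measurableTypeR R) @^-1`
         `[a ord0 i, b ord0 i]).
  apply/seteqP; split => x /= xab i; first by move=> _; rewrite /= in_itv/=.
  by have /(_ Logic.I) := xab i; rewrite /= in_itv.
apply: fin_bigcap_measurable; first exact: finite_finset.
move=> i _; rewrite -[X in measurable X]setTI.
by apply: measurable_coord => //; exact: measurable_itv.
Qed.

Lemma borel_rV_box n (a b : 'rV[R]_n) : (forall i, a ord0 i <= b ord0 i) ->
  borel_rV n [set x : 'rV[R]_n | forall i, a ord0 i <= x ord0 i <= b ord0 i] =
  (\prod_(i < n) (b ord0 i - a ord0 i))%:E.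
Proof.
elim: n a b => [|n IHn] a b ab.
  by rewrite big_ord0 /= diracE mem_set// => -[].
pose a' := (rV_uncons a).2; pose b' := (rV_uncons b).2.
rewrite big_ord_recl/= /borel_step /pushforward.
have -> : @rV_cons n @^-1`
      [set x : 'rV[R]_n.+1 | forall i, a ord0 i <= x ord0 i <= b ord0 i] =
    `[a ord0 ord0, b ord0 ord0] `*`
      [set x : 'rV[R]_n | forall i, a' ord0 i <= x ord0 i <= b' ord0 i].
  apply/seteqP; split => -[t x] /=.
    move=> H; split; first by have := H ord0; rewrite rV_cons0 in_itv.
    by move=> i; have := H (lift ord0 i); rewrite rV_consS !mxE.
  move=> [H1 H2] i; case: (unliftP ord0 i) => [j|] ->.
    by rewrite rV_consS; have := H2 j; rewrite !mxE.
  by rewrite rV_cons0; move: H1; rewrite in_itv.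
rewrite product_measure1E//; last exact: measurable_box.
rewrite IHn => [|i]; last by rewrite !mxE.
have leb_itv : (lebesgue_measure (`[a ord0 ord0, b ord0 ord0] : set R) =
    (b ord0 ord0 - a ord0 ord0)%:E)%classic.
  rewrite lebesgue_measure_itv/= lte_fin; case: ltP => // ba.
  suff -> : b ord0 ord0 = a ord0 ord0 by rewrite subrr.
  by apply/eqP; rewrite eq_le ba ab.
rewrite [X in (X * _)%E = _]leb_itv.
rewrite -EFinM; congr (_ * _)%:E.
by apply: eq_bigr => i _; rewrite !mxE.
Qed.

End borel_measure.

(* R^n with the sigma-algebra of Lebesgue measurable sets, i.e. the completion
   of the Borel sets. *)
Definition lebesgue_space (R : realType) n : measurableType _ :=
  caratheodory_type ((@borel_rV R n)^*)%mu.

Definition lebesgue_rV (R : realType) n :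
    {measure set (lebesgue_space R n) -> \bar R} :=
  @completed_measure_extension _ _ _ (@borel_rV R n).

Lemma lebesgue_rV_box (R : realType) n (a b : 'rV[R]_n) :
  (forall i, a ord0 i <= b ord0 i) ->
  lebesgue_rV R n [set x : 'rV[R]_n | forall i, a ord0 i <= x ord0 i <= b ord0 i] =
  (\prod_(i < n) (b ord0 i - a ord0 i))%:E.
Proof.
move=> ab; rewrite /lebesgue_rV /= /completed_measure_extension.
rewrite -borel_rV_box//; apply: measurable_mu_extE; exact: measurable_box.
Qed.

Section weighted_sobolev.
Context {R : realType} {n : nat}.
Implicit Types (f g phi v : 'rV[R]_n -> R).

Local Notation mu := (lebesgue_rV R n).

Definition enorm (x : 'rV[R]_n) : R := Num.sqrt (\sum_(i < n) x ord0 i ^+ 2).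

Definition loc_integrable f :=
  measurable_fun [set: lebesgue_space R n] f /\
  forall K : set 'rV[R]_n, compact K -> (\int[mu]_(x in K) `|f x|%:E < +oo)%E.

(* Cubes have edges parallel to the axes; c is the center, r half the side. *)
Definition cube (c : 'rV[R]_n) (r : R) : set 'rV[R]_n :=
  [set x | forall i, `|x ord0 i - c ord0 i| <= r].

(* The inverse of v is taken in \bar R, where 0^-1 = +oo. As it is nonnegative
   and mu Q > 0, extending it by 0 outside Q does not affect its essential
   supremum over Q. *)
Definition A1_const v : \bar R :=
  ereal_sup [set ((mu Q)^-1 * \int[mu]_(x in Q) (v x)%:E *
                  ess_sup mu ((fun x => (v x)%:E^-1) \_ Q))%E
            | Q in [set Q | exists c r, 0 < r /\ Q = cube c r]].

Definition A1_weight v :=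
  [/\ forall x, 0 <= v x, loc_integrable v & (A1_const v < +oo)%E].

Definition partial (i : 'I_n) f : 'rV[R]_n -> R :=
  fun x => 'D_(delta_mx ord0 i) f x.

Definition partial_multi (a : 'I_n -> nat) f : 'rV[R]_n -> R :=
  foldr (fun i g => iter (a i) (partial i) g) f (enum 'I_n).

Definition smooth phi := forall s : seq 'I_n,
  continuous (foldr partial phi s) /\
  forall i x, derivable (foldr partial phi s) x (delta_mx ord0 i).

Definition test_function phi :=
  smooth phi /\ compact (closure [set x | phi x != 0]).

Definition is_weak_partial (a : 'I_n -> nat) f g :=
  loc_integrable g /\
  forall phi, test_function phi ->
    \int[mu]_x (f x * partial_multi a phi x) =
    (-1) ^+ (\sum_(i < n) a i) * \int[mu]_x (g x * phi x).

(* Weak derivatives are unique up to null sets; this picks one, if any. *)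
Definition weak_partial (a : 'I_n -> nat) f : 'rV[R]_n -> R :=
  xget (fun=> 0) [set g | is_weak_partial a f g].

(* The functions from 'I_n to 'I_l.+1 whose values sum to l are exactly the
   multi-indices of order l. *)
Definition grad_norm (l : nat) f (x : 'rV[R]_n) : R :=
  Num.sqrt (\sum_(a : {ffun 'I_n -> 'I_l.+1} | (\sum_(i < n) a i == l)%N)
              weak_partial (fun i => a i) f x ^+ 2).

Definition dotW (l : nat) (p : R) v : set ('rV[R]_n -> R) :=
  [set f | [/\ loc_integrable f,
     forall a : 'I_n -> nat, (\sum_(i < n) a i)%N = l ->
       exists g, is_weak_partial a f g &
     (\int[mu]_x (grad_norm l f x `^ p * v x)%:E < +oo)%E]].

Definition fdiff (k : nat) (h : 'rV[R]_n) f (x : 'rV[R]_n) : R :=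
  \sum_(j < k.+1) (-1) ^+ (k - j) * 'C(k, j)%:R * f (x + j%:R *: h).

Definition superlevel (lam b : R) (k l : nat) f : set ('rV[R]_n * 'rV[R]_n) :=
  [set xh | xh.2 != 0 /\
     `|fdiff k xh.2 f xh.1| > lam * enorm xh.2 `^ (b + l%:R)].

End weighted_sobolev.

Definition Gamma {R : realType} (p q : R) : set R :=
  if p == 1 then [set gamma | gamma < - q \/ 0 < gamma]
  else [set gamma | gamma != 0].

(* Main.v *)
From HB Require Import structures.
Require Import Defs.
From mathcomp Require Import all_boot all_order all_algebra.
From mathcomp Require Import all_classical all_reals all_analysis.
From mathcomp Require Import measurable_realfun ess_sup_inf.
From mathcomp Require Import ring lra zify.
Import Order.TTheory GRing.Theory Num.Theory.
Import numFieldNormedType.Exports.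
Set Implicit Arguments.
Unset Strict Implicit.
Unset Printing Implicit Defensive.
Local Open Scope classical_set_scope.
Local Open Scope ring_scope.

(** Fix [lam] and put [b = gamma / q]. For each [x] the left-hand side measures the
    set of steps [h] with [|Delta_h^k f(x)| > lam |h|^(b + l)], where [Delta_h^k] is the
    difference of order [k]. Write [g] for the length of the gradient of order [l],
    [v] for the weight and [A] for its [A_1] constant. The function [f] enters the
    argument only through the line estimate

      [|Delta_h^k f(x)| <= C |h|^l * int_0^k g(x + t h) dt],

    for every [h] and almost every [x]. It is proved by testing the weak derivatives
    against products of smooth plateaus, on which the difference is represented by
    its Peano kernel ([weak_difference], [weak_line_estimate]).

    Heavy points. A point [y] is heavy at scale [s] and threshold [tau] if a fixed
    share of the pairs [(x, h)] around it at scale [s] has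
    [|Delta_h^k f(x)| > tau]. The two ways of summing a double difference
    ([fdiff_exchange]) show that a difference is small if the points of its
    progression are good, that is, have few bad steps, and the pairs around are
    mostly small ([fdiff_le_of_good]). They also show that goodness passes from a
    scale to twice that scale with an additive loss, if the point is not heavy
    ([good_up]). Almost every point is good at arbitrarily fine scales
    ([ae_regular]). Hence a large difference at [(x, h)] makes one of the points
    [x + j h] heavy at a scale [2^-i |h|], with a threshold that decays as slowly as
    desired in [i] ([bad_heavy]).

    Charging. By the line estimate, a point that is heavy at scale [s] for the
    threshold [lam s^(b + l)] is paid for by a mass of at least [c lam s^(b + n)] of
    [g] in a cube of comparable size ([heavy_charge]). Let the thick set of scale [s]
    be a neighbourhood of these points. Then

      [sum_s (lam s^b)^p v(thick set of s) <= C (1 + A)^2 * int g^p v]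

    ([thick_sum_le]). If [p > 1], only the part of [g] above a multiple of [lam s^b]
    is needed, and the sum over [s] is geometric. If [p = 1], no mass may be charged
    at too many scales. For [b > 0] a cube near the thick set of a much coarser scale
    is counted with that set. For [b < -1] the mass near much finer thick sets is
    left out, and if most segments hit these sets then they fill a large part of the
    cube; a hit is more frequent than the measure of the sets suggests by the ratio of
    the scales, which is why [b < -1] is required. In both cases the sets that are
    not charged are absorbed by the left-hand side, after skipping a number of scales
    that is linear in [A].

    Summation. The superlevel set is covered by translates of thick sets. For
    [q >= p] the power [p / q] is subadditive, and [n (1/p - 1/q) < l] makes the sum
    over [i] converge ([two_scales], [double_sum_le]). For [q < p] the inner integral
    is controlled pointwise by the one for [q = p] ([exponent_reduction]). This gives
    the estimate for Borel functions with the factor [(1 + A)^3] ([borel_estimate]). A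
    Lebesgue measurable function becomes Borel once it is set to zero on a suitable
    null set ([completion_fun]), which changes neither side of the inequality. *)

(** * Integrals of nonnegative functions and Lebesgue measure on boxes *)

Section LowerIntegral.
Context d (T : measurableType d) (R : realType) (m : {measure set T -> \bar R}).
Implicit Types f g : T -> \bar R.

Import HBNNSimple.

(** The integral of a nonnegative function is a supremum over simple minorants,
    hence monotone on all nonnegative functions. *)
Lemma le_integral_ge0 f g : (forall x, 0 <= f x)%E -> (forall x, f x <= g x)%E ->
  (\int[m]_x f x <= \int[m]_x g x)%E.
Proof.
move=> f0 fg; rewrite !ge0_integralTE//; last first.
  by move=> x; apply: le_trans (fg x).
apply: ge_ereal_sup => _ [h /= hf <-]; apply: ereal_sup_ubound; exists h => //= x.
exact: le_trans (fg x).
Qed.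

Lemma ae_le_integral_ge0 f g (N : set T) : measurable N -> m N = 0%E ->
  (forall x, 0 <= f x)%E -> (forall x, 0 <= g x)%E ->
  (forall x, ~ N x -> f x <= g x)%E ->
  (\int[m]_x f x <= \int[m]_x g x)%E.
Proof.
move=> mN N0 f0 g0 fg; rewrite !ge0_integralTE//.
apply: ge_ereal_sup => _ [h /= hf <-].
pose h' := mul_nnsfun h (indic_nnsfun R (measurableC mN)).
have h'E x : h' x = h x * \1_(~` N) x by [].
apply: (@le_trans _ _ (sintegral m h')); last first.
  apply: ereal_sup_ubound; exists h' => [x|//]; rewrite h'E indicE.
  have [xN|xN] := boolP (x \in ~` N).
    rewrite mulr1; apply: le_trans (hf x) _; apply: fg.
    by move: xN; rewrite inE.
  by rewrite mulr0.
rewrite -!integralT_nnsfun.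
apply: ae_ge0_le_integral => //.
- by move=> x _; rewrite lee_fin.
- by apply/measurable_EFinP.
- by move=> x _; rewrite lee_fin.
- by apply/measurable_EFinP.
- exists N; split => // x /not_implyP[_] hx; apply: contrapT => xN; apply: hx.
  by rewrite h'E indicE mem_set ?mulr1.
Qed.
End LowerIntegral.

Section Boxes.
Context {R : realType} {n : nat}.
Local Notation V := 'rV[R]_n.
Local Notation mu := (@borel_rV R n).

Definition box (a b : V) : set V :=
  [set x : V | forall i, a ord0 i <= x ord0 i <= b ord0 i].

Lemma cubeE (c : V) r :
  cube c r = box (\row_i (c ord0 i - r)) (\row_i (c ord0 i + r)).
Proof.
apply/seteqP; split => x /= h i; have := h i; rewrite !mxE ler_norml.
  by move=> /andP[h1 h2]; apply/andP; split; lra.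
by move=> /andP[h1 h2]; apply/andP; split; lra.
Qed.

Lemma measurable_cube (c : V) r : measurable (cube c r).
Proof. by rewrite cubeE; exact: measurable_box. Qed.

Lemma mu_cube (c : V) r : 0 <= r -> mu (cube c r) = ((2 * r) ^+ n)%:E.
Proof.
move=> r0; rewrite cubeE borel_rV_box; last by move=> i; rewrite !mxE; lra.
congr (_%:E); rewrite -[X in _ = _ ^+ X]card_ord -prodr_const.
by apply: eq_bigr => i _; rewrite !mxE; lra.
Qed.

Lemma rV_bounded (y : V) (c : R) : exists N : nat, forall j, `|y ord0 j| + c <= N%:R.
Proof.
have s0 : 0 <= \sum_j `|y ord0 j| + `|c| by rewrite addr_ge0// sumr_ge0.
exists (Num.bound (\sum_j `|y ord0 j| + `|c|)) => j.
apply/ltW/(le_lt_trans _ (archi_boundP s0)).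
by rewrite lerD ?ler_norm// (bigD1 j)//= lerDl sumr_ge0.
Qed.

Definition boxes : set (set V) := [set A | exists a b, A = box a b].

Lemma setI_closed_boxes : setI_closed boxes.
Proof.
move=> _ _ [a [b ->]] [a' [b' ->]].
exists (\row_i Num.max (a ord0 i) (a' ord0 i)), (\row_i Num.min (b ord0 i) (b' ord0 i)).
apply/seteqP; split => x /=.
  by move=> [h h'] i; rewrite !mxE ge_max le_min; have /andP[-> ->] := h i;
    have /andP[-> ->] := h' i.
by move=> h; split => i; have := h i; rewrite !mxE ge_max le_min => /andP[/andP[h1 h2] /andP[h3 h4]];
  rewrite ?h1 ?h2 ?h3 ?h4.
Qed.

Lemma measurable_rV_boxes : @measurable _ V = <<s boxes >>.
Proof.
apply/seteqP; split; last first.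
  apply: smallest_sub; first exact: sigma_algebra_measurable.
  by move=> _ [a [b ->]]; exact: measurable_box.
apply: smallest_sub; first exact: smallest_sigma_algebra.
rewrite -bigcup_seq; apply: bigcup_sub => i _ _ [B mB <-]; rewrite setTI.
pose sig := [set B : set (measurableTypeR R) |
  <<s boxes >> ((fun x : V => x ord0 i) @^-1` B)].
suff : (@measurable _ (measurableTypeR R)) `<=` sig by exact.
rewrite [X in X `<=` _](RGenCInfty.measurableE R).
apply: smallest_sub.
  split => /=.
  - by rewrite /sig/= preimage_set0; exact: sigma_algebra0.
  - by move=> C; rewrite /sig/= setTD preimage_setC => /sigma_algebraC.
  - move=> F mF; rewrite /sig/= preimage_bigcup; exact: sigma_algebra_bigcup.
move=> _ [x ->]; rewrite /sig/=.
rewrite (_ : _ @^-1` _ = \bigcup_N box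
   (\row_j (if j == i then x else - N%:R)) (\row_j (if j == i then x + N%:R else N%:R))).
  apply: sigma_algebra_bigcup => N; apply: sub_sigma_algebra; by do 2 eexists.
apply/seteqP; split => y /=.
  rewrite in_itv/= andbT => xy.
  have [N yN] := rV_bounded y `|x|.
  exists N => // j; rewrite !mxE.
  have := yN j; case: eqP => [->|_] h; have := normr_ge0 x.
    by move=> ?; rewrite xy/=; have := ler_norm (y ord0 i); have := ler_norm (-x);
      rewrite normrN; lra.
  by move=> ?; rewrite -ler_norml; lra.
by move=> [N _ /(_ i)]; rewrite !mxE eqxx in_itv/= andbT => /andP[].
Qed.

(** Closed boxes form a generating intersection-stable family, so they
    determine a measure. *)
Lemma boxes_unique (m1 m2 : {measure set V -> \bar R}) :
  (forall a b : V, (forall i, a ord0 i <= b ord0 i) -> m1 (box a b) = m2 (box a b)) ->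
  (forall a b, m1 (box a b) < +oo)%E ->
  forall A, measurable A -> m1 A = m2 A.
Proof.
move=> m12 m1oo.
apply: (measure_unique boxes
  (fun N : nat => box (const_mx (- N%:R)) (const_mx N%:R))).
- exact: measurable_rV_boxes.
- exact: setI_closed_boxes.
- by move=> N; do 2 eexists.
- apply/seteqP; split => // y _.
  have [N yN] := rV_bounded y 0.
  by exists N => // j; rewrite !mxE -ler_norml; have := yN j; rewrite addr0.
- move=> _ [a [b ->]].
  have [ab|/existsNP[i /negP]] := pselect (forall i, a ord0 i <= b ord0 i).
    exact: m12.
  rewrite -ltNge => ba; rewrite (_ : box a b = set0) ?measure0//.
  by apply/seteqP; split => // x /(_ i)/andP[h1 h2]; have := le_trans h1 h2;
    rewrite leNgt ba.
- by move=> N; exact: m1oo.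
Qed.

Lemma mu_box_fin (a b : V) : (mu (box a b) < +oo)%E.
Proof.
apply: (@le_lt_trans _ _ (mu (box a (\row_i Num.max (a ord0 i) (b ord0 i))))).
  apply: le_measure; rewrite ?inE; try exact: measurable_box.
  by move=> x /= h i; rewrite !mxE le_max; have /andP[-> ->] := h i; rewrite orbT.
rewrite borel_rV_box ?ltry// => i; by rewrite !mxE le_max lexx.
Qed.

Lemma measurable_affine (a : V) (c : R) : measurable_fun setT (fun x : V => a + c *: x).
Proof.
apply: measurable_fun_rVP => i.
under eq_fun do rewrite !mxE.
apply: measurable_funD => //; apply: measurable_funM => //.
exact: measurable_coord.
Qed.

(** Translation invariance and scaling of Lebesgue measure, in one formula. *)
Lemma integral_affine (a : V) (c : R) (G : V -> \bar R) : 0 < c ->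
  measurable_fun setT G -> (forall x, 0 <= G x)%E ->
  (\int[mu]_x G (a + c *: x)%R = (c ^- n)%R%:E * \int[mu]_x G x)%E.
Proof.
move=> c0 mG G0.
have cn0 : 0 <= c ^- n by rewrite invr_ge0 exprn_ge0// ltW.
transitivity (\int[pushforward mu (fun x : V => a + c *: x)%R]_x G x)%E.
  by rewrite ge0_integral_pushforward//; exact: measurable_affine.
rewrite (_ : c ^- n = (NngNum cn0)%:num)// -ge0_integral_mscale//.
pose aff : V -> V := fun x : V => a + c *: x.
have maff : measurable_fun setT aff := measurable_affine a c.
pose m1 := measure_function_pushforward__canonical__measure_function_Measure mu maff.
rewrite (@eq_measure_integral _ _ _ _ (mscale (NngNum cn0) mu) m1)//.
move=> A mA _; apply: (boxes_unique (m1 := m1) (m2 := mscale (NngNum cn0) mu)) => //.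
- move=> a' b' ab.
  transitivity (mu (box (c^-1 *: (a' - a)) (c^-1 *: (b' - a)))).
    rewrite /= /pushforward; congr (mu _); apply/seteqP; split => x /= h i;
      have := h i; rewrite !mxE ler_pdivrMl// ler_pdivlMl//;
      by move=> /andP[h1 h2]; apply/andP; split; lra.
  rewrite borel_rV_box; last first.
    by move=> i; rewrite !mxE ler_pM2l ?invr_gt0// lerD2r.
  rewrite /= /mscale/= borel_rV_box// -EFinM; congr (_%:E).
  rewrite -exprVn -[X in _ ^+ X](card_ord n) -prodr_const -big_split/=.
  by apply: eq_bigr => i _; rewrite !mxE -mulrBr; congr (_ * _); lra.
- move=> a' b' /=; rewrite /pushforward.
  rewrite (_ : _ @^-1` _ = box (c^-1 *: (a' - a)) (c^-1 *: (b' - a))).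
    exact: mu_box_fin.
  apply/seteqP; split => x /= h i;
      have := h i; rewrite !mxE ler_pdivrMl// ler_pdivlMl//;
      by move=> /andP[h1 h2]; apply/andP; split; lra.
Qed.

Lemma integral_translate (a : V) (G : V -> \bar R) :
  measurable_fun setT G -> (forall x, 0 <= G x)%E ->
  (\int[mu]_x G (a + x)%R = \int[mu]_x G x)%E.
Proof.
move=> mG G0; have := integral_affine a ltr01 mG G0.
rewrite expr1n invr1 mul1e => <-; apply: eq_integral => x _.
by rewrite scale1r.
Qed.

End Boxes.

(** * Indicators, cubes, neighbourhoods and weights *)

Section Indicators.
Context d (T : measurableType d) (R : realType).

Definition ind (A : set T) (x : T) : \bar R := (\1_A x)%:E.

Lemma ind_ge0 A x : (0 <= ind A x)%E.
Proof. by rewrite /ind lee_fin indicE. Qed.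

Lemma ind_in (A : set T) x : A x -> ind A x = 1%E.
Proof. by move=> Ax; rewrite /ind indicE mem_set. Qed.

Lemma ind_out (A : set T) x : ~ A x -> ind A x = 0%E.
Proof. by move=> Ax; rewrite /ind indicE memNset. Qed.

Lemma ind_le1 A x : (ind A x <= 1)%E.
Proof. by rewrite /ind lee_fin indicE lern1 leq_b1. Qed.

Lemma le_ind (A B : set T) x : (A x -> B x) -> (ind A x <= ind B x)%E.
Proof.
move=> AB; have [/AB Bx|nAx] := pselect (A x); first by rewrite (ind_in Bx) ind_le1.
by rewrite (ind_out nAx) ind_ge0.
Qed.

Lemma ind_eq (S : Type) (A : set T) (B : set S) x y : (A x <-> B y) ->
  ind A x = (\1_B y)%:E.
Proof.
move=> [AB BA]; rewrite /ind !indicE; congr ((nat_of_bool _)%:R%:E).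
by apply/idP/idP => /set_mem h; apply: mem_set; auto.
Qed.

Lemma measurable_ind A : measurable A -> measurable_fun setT (ind A).
Proof. by move=> mA; apply/measurable_EFinP; exact: measurable_indic. Qed.

Lemma integral_ind (m : {measure set T -> \bar R}) A : measurable A ->
  (\int[m]_x ind A x = m A)%E.
Proof. by move=> mA; rewrite integral_indic// setIT. Qed.

End Indicators.
Arguments ind {d T R} A x.

Section VectorMaps.
Context {R : realType} {n : nat} d (T : measurableType d).
Local Notation V := 'rV[R]_n.
Implicit Types (f g : T -> V).

Lemma measurable_coord_comp f i : measurable_fun setT f ->
  measurable_fun setT (fun x => f x ord0 i : measurableTypeR R).
Proof. by move=> mf; exact: (measurableT_comp (measurable_coord i) mf). Qed.

Lemma measurable_rV_add f g : measurable_fun setT f -> measurable_fun setT g ->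
  measurable_fun setT (fun x => f x + g x).
Proof.
move=> mf mg; apply: measurable_fun_rVP => i; under eq_fun do rewrite !mxE.
apply: (@measurable_funD _ T R setT (fun x => f x ord0 i) (fun x => g x ord0 i));
  exact: measurable_coord_comp.
Qed.

Lemma measurable_rV_scale (c : T -> R) f : measurable_fun setT c ->
  measurable_fun setT f -> measurable_fun setT (fun x => c x *: f x).
Proof.
move=> mc mf; apply: measurable_fun_rVP => i; under eq_fun do rewrite !mxE.
apply: (@measurable_funM _ T R setT c (fun x => f x ord0 i)) => //.
exact: measurable_coord_comp.
Qed.

End VectorMaps.

Section GridCover.
Context {R : realType} {n : nat}.
Local Notation V := 'rV[R]_n.
Local Notation mu := (@borel_rV R n).

Lemma cubeC (x y : V) r : cube x r y <-> cube y r x.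
Proof. by split => h i; rewrite distrC; exact: h. Qed.

Lemma cube_refl (x : V) r : 0 <= r -> cube x r x.
Proof. by move=> r0 i; rewrite subrr normr0. Qed.

Lemma cube_trans (x y z : V) r s t : r + s <= t -> cube x r y -> cube y s z -> cube x t z.
Proof.
move=> rst xy yz i; apply: le_trans rst.
have := xy i; have := yz i; have := ler_distD (y ord0 i) (z ord0 i) (x ord0 i); lra.
Qed.

Lemma cube_subset (x : V) r s : r <= s -> cube x r `<=` cube x s.
Proof. by move=> rs y h i; exact: le_trans (h i) rs. Qed.

Definition grid (r : R) (z : 'rV[int]_n) : V := \row_i (r * (z ord0 i)%:~R).

Lemma grid_cover (r : R) (x : V) : 0 < r -> exists z, cube (grid r z) r x.
Proof.
move=> r0; exists (\row_i Num.floor (x ord0 i / r)) => i; rewrite !mxE.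
set y := x ord0 i / r; have -> : x ord0 i = r * y by rewrite /y mulrC divfK// gt_eqF.
rewrite -mulrBr normrM gtr0_norm// -[leRHS]mulr1 ler_pM2l//.
rewrite ger0_norm ?subr_ge0 ?floor_le//.
have := lt_succ_floor y; rewrite intrD; lra.
Qed.

(** Openness for the maximum norm, phrased with cubes. *)
Definition copen (A : set V) := forall x, A x -> exists2 e, 0 < e & cube x e `<=` A.

(** Such a set is the union of the grid cubes that it contains, and there are
    countably many of these. *)
Lemma measurable_copen (A : set V) : copen A -> measurable A.
Proof.
move=> oA.
pose F (zk : 'rV[int]_n * nat) : set V :=
  if pselect (cube (grid (zk.2.+1%:R^-1) zk.1) (zk.2.+1%:R^-1) `<=` A)
  then cube (grid (zk.2.+1%:R^-1) zk.1) (zk.2.+1%:R^-1) else set0.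
rewrite (_ : A = \bigcup_zk F zk); last first.
  apply/seteqP; split => x; last by move=> [zk _]; rewrite /F; case: pselect => // h /h.
  move=> Ax; have [e e0 xe] := oA _ Ax.
  have k0 := archi_boundP (ltW (divr_gt0 (@ltr0n R 2) e0)).
  pose k := Num.bound (2 / e).
  have r0 : 0 < k.+1%:R^-1 :> R by rewrite invr_gt0.
  have rk : k.+1%:R^-1 + k.+1%:R^-1 <= e.
    rewrite -mulr2n -[_ *+ 2]mulr_natl ler_pdivrMr ?ltr0n// mulrC -ler_pdivrMr//.
    apply/ltW/(lt_trans k0); by rewrite ltr_nat.
  have [z zx] := grid_cover x r0.
  exists (z, k) => //; rewrite /F /=; case: pselect => // -[] y zy; apply: xe.
  by apply: cube_trans rk _ zy; exact/cubeC.
apply: countable_bigcupT_measurable; first exact: countableP.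
by move=> zk; rewrite /F; case: pselect => ?; [exact: measurable_cube|exact: measurable0].
Qed.

(** The slack [t < r] makes a neighbourhood open, hence measurable, whatever the
    set [A] is. *)
Definition nb (A : set V) (r : R) : set V :=
  [set x | exists y t, [/\ A y, t < r & cube y t x]].

Lemma nb_copen A r : copen (nb A r).
Proof.
move=> x [y [t [Ay tr yx]]]; exists ((r - t) / 2); first by rewrite divr_gt0// subr_gt0.
move=> z xz; exists y, (t + (r - t) / 2); split => //; first lra.
exact: cube_trans yx xz.
Qed.

Lemma measurable_nb A r : measurable (nb A r).
Proof. by apply: measurable_copen; exact: nb_copen. Qed.

Lemma nb_cube A r (y : V) t : A y -> t < r -> cube y t `<=` nb A r.
Proof. by move=> Ay tr x yx; exists y, t. Qed.

Lemma nb_near A r x : nb A r x -> exists2 y, A y & cube y r x.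
Proof.
by move=> [y [t [Ay tr yx]]]; exists y => //; apply: cube_subset yx; exact: ltW.
Qed.

End GridCover.

Section Weight.
Context {R : realType} {n : nat}.
Local Notation V := 'rV[R]_n.
Local Notation mu := (@borel_rV R n).

(** The [A_1] condition in the form in which it is used: no inverse of the weight,
    and an exceptional set that may depend on the cube. *)
Definition A1_at (v : V -> R) (A : R) := forall c r, 0 < r ->
  {ae mu, forall z, cube c r z ->
    (\int[mu]_w (ind (cube c r) w * (v w)%:E) <= ((2 * r) ^+ n * A * v z)%:E)%E}.

Context (v : V -> R) (A : R).
Hypotheses (v0 : forall x, 0 <= v x) (mv : measurable_fun setT v) (A0 : 0 <= A).
Hypothesis Av : A1_at v A.

Lemma measurable_subcube (r : R) : measurable [set wz : V * V | cube wz.1 r wz.2].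
Proof.
have -> : [set wz : V * V | cube wz.1 r wz.2] =
  (fun wz : V * V => wz.2 + (-1) *: wz.1) @^-1` (cube 0 r).
  by apply/seteqP; split => -[w z] /= h i; have := h i; rewrite !mxE ?subr0 mulN1r.
rewrite -[X in measurable X]setTI.
suff : measurable_fun setT (fun wz : V * V => wz.2 + (-1) *: wz.1).
  by apply => //; exact: measurable_cube.
apply: measurable_rV_add; first exact: measurable_snd.
by apply: measurable_rV_scale => //; exact: measurable_fst.
Qed.

(** A cube of radius [r] lies in one of countably many grid cubes of radius [2 r],
    so that one null set serves for all centres. *)
Lemma maximal_A1 (r : R) : 0 < r ->
  {ae mu, forall z, (\int[mu]_w (ind (cube z r) w * (v w)%:E) <=
     ((4 * r) ^+ n * A * v z)%:E)%E}.
Proof.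
move=> r0.
have r20 : 0 < 2 * r by rewrite mulr_gt0.
have H : {ae mu, forall z, forall k : nat,
   if @unpickle 'rV[int]_n k is Some g then
     cube (grid r g) (2 * r) z -> (\int[mu]_w (ind (cube (grid r g) (2 * r)) w * (v w)%:E) <=
       ((2 * (2 * r)) ^+ n * A * v z)%:E)%E else True}.
  apply: ae_foralln => k; case: (unpickle k) => [g|]; last exact: aeW.
  exact: Av.
apply: filterS H => z Hz.
have [g gz] := grid_cover z r0.
have := Hz (pickle g); rewrite pickleK => /(_ _)/wrap[].
  by apply: cube_subset gz; lra.
rewrite (_ : 2 * (2 * r) = 4 * r); last lra.
apply: le_trans; apply: le_integral_ge0 => w.
  by rewrite mule_ge0 ?ind_ge0// lee_fin.
rewrite lee_wpmul2r ?lee_fin//; apply: le_ind => zw.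
by apply: cube_trans gz zw; lra.
Qed.

(** The averages of [v] over cubes centred at a point are controlled by the
    value of [v] there, so averaging [G] against [v] costs a factor [A]. *)
Lemma A1_average (r : R) (G : V -> \bar R) : 0 < r ->
  measurable_fun setT G -> (forall x, 0 <= G x)%E ->
  (\int[mu]_w ((v w)%:E * \int[mu]_z (ind (cube w r) z * G z)) <=
   ((4 * r) ^+ n * A)%:E * \int[mu]_z (G z * (v z)%:E))%E.
Proof.
move=> r0 mG G0.
have mE : measurable_fun setT (EFin \o v) by exact/measurable_EFinP.
pose F (wz : V * V) : \bar R := ((v wz.1)%:E * (ind [set wz : V * V | cube wz.1 r wz.2] wz * G wz.2))%E.
have F0 wz : (0 <= F wz)%E.
  by rewrite !mule_ge0 ?ind_ge0// lee_fin.
have mF : measurable_fun setT F.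
  apply: emeasurable_funM; first by apply: (measurableT_comp mE); exact: measurable_fst.
  apply: emeasurable_funM; last by apply: (measurableT_comp mG); exact: measurable_snd.
  by apply: measurable_ind; exact: measurable_subcube.
have mi w : measurable_fun setT (ind (cube w r) : V -> \bar R).
  by apply: measurable_ind; exact: measurable_cube.
rewrite (_ : (\int[mu]_w _)%E = \int[mu]_w \int[mu]_z F (w, z))%E; last first.
  apply: eq_integral => w _.
  rewrite -ge0_integralZl_EFin//.
  - by move=> z _; rewrite mule_ge0 ?ind_ge0.
  - exact: emeasurable_funM.
rewrite (fubini_tonelli F)//.
rewrite -ge0_integralZl_EFin//; last 3 first.
- by move=> z _; rewrite mule_ge0 // lee_fin.
- exact: emeasurable_funM.
- by rewrite mulr_ge0// exprn_ge0// mulr_ge0// ltW.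
apply: ae_ge0_le_integral => //.
- by move=> z _; apply: integral_ge0 => w _.
- exact: measurable_fun_fubini_tonelli_G.
- move=> z _; rewrite !mule_ge0// ?lee_fin// mulr_ge0// exprn_ge0// mulr_ge0// ltW//.
- by apply: emeasurable_funM => //; exact: emeasurable_funM.
apply: filterS (maximal_A1 r0) => z Hz _.
rewrite (_ : (\int[mu]_x _)%E = G z * \int[mu]_w (ind (cube z r) w * (v w)%:E))%E; last first.
  rewrite -ge0_integralZl//; last 2 first.
  - exact: emeasurable_funM.
  - by move=> w _; rewrite mule_ge0 ?ind_ge0// lee_fin.
  apply: eq_integral => w _.
  rewrite /F/= [RHS]muleA [RHS]muleC; congr (_ * _)%E.
  rewrite muleC; congr (_ * _)%E; apply: ind_eq => /=; exact: cubeC.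
rewrite [leRHS]muleCA; apply: lee_wpmul2l => //.
Qed.

End Weight.

(** * Iterated integrals and finite differences *)

Section Iterated.
Context {R : realType} {n : nat}.
Local Notation V := 'rV[R]_n.
Local Notation mu := (@borel_rV R n).
Implicit Types F G : V * V -> \bar R.

Definition I2 F : \bar R := (\int[mu]_x \int[mu]_h F (x, h))%E.

Lemma I2_ge0 F : (forall z, 0 <= F z)%E -> (0 <= I2 F)%E.
Proof. by move=> F0; apply: integral_ge0 => x _; apply: integral_ge0. Qed.

Lemma le_I2 F G : (forall z, 0 <= F z)%E -> (forall z, F z <= G z)%E ->
  (I2 F <= I2 G)%E.
Proof.
move=> F0 FG; apply: le_integral_ge0 => x; first exact: integral_ge0.
exact: le_integral_ge0.
Qed.

Lemma I2_swap F : measurable_fun setT F -> (forall z, 0 <= F z)%E ->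
  I2 F = I2 (fun z => F (z.2, z.1)).
Proof. by move=> mF F0; rewrite /I2 (fubini_tonelli F). Qed.

Lemma measurable_section F x : measurable_fun setT F ->
  measurable_fun setT (fun h => F (x, h)).
Proof.
by move=> mF; apply: (measurableT_comp mF); exact: pair1_measurable.
Qed.

Lemma I2_sum (I : Type) (s : seq I) (F : I -> V * V -> \bar R) :
  (forall i, measurable_fun setT (F i)) -> (forall i z, 0 <= F i z)%E ->
  I2 (fun z => \sum_(i <- s) F i z)%E = (\sum_(i <- s) I2 (F i))%E.
Proof.
move=> mF F0; rewrite /I2 -ge0_integral_sum//; last 2 first.
- by move=> i; exact: measurable_fun_fubini_tonelli_F.
- by move=> i x _; exact: integral_ge0.
apply: eq_integral => x _; rewrite ge0_integral_sum//.
by move=> i; exact: measurable_section.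
Qed.

Lemma I2_add F G : measurable_fun setT F -> measurable_fun setT G ->
  (forall z, 0 <= F z)%E -> (forall z, 0 <= G z)%E ->
  I2 (fun z => F z + G z)%E = (I2 F + I2 G)%E.
Proof.
move=> mF mG F0 G0; rewrite /I2 -ge0_integralD//; last 4 first.
- by move=> x _; exact: integral_ge0.
- exact: measurable_fun_fubini_tonelli_F.
- by move=> x _; exact: integral_ge0.
- exact: measurable_fun_fubini_tonelli_F.
apply: eq_integral => x _; rewrite ge0_integralD//; exact: measurable_section.
Qed.

Lemma I2_scale (c : R) (F : V * V -> \bar R) : 0 <= c -> measurable_fun setT F ->
  (forall z, 0 <= F z)%E -> (c%:E * I2 F)%E = I2 (fun z => c%:E * F z)%E.
Proof.
move=> c0 mF F0; rewrite /I2 -ge0_integralZl//; last 2 first.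
- exact: measurable_fun_fubini_tonelli_F.
- by move=> x _; exact: integral_ge0.
apply: eq_integral => x _; rewrite ge0_integralZl//.
by apply: (measurableT_comp mF); exact: pair1_measurable.
Qed.

Lemma I2_prod (f g : V -> \bar R) : measurable_fun setT f -> measurable_fun setT g ->
  (forall z, 0 <= f z)%E -> (forall z, 0 <= g z)%E ->
  I2 (fun z => f z.1 * g z.2)%E = (\int[mu]_x f x * \int[mu]_x g x)%E.
Proof.
move=> mf mg f0 g0; rewrite /I2 -ge0_integralZr//; last exact: integral_ge0.
by apply: eq_integral => x _; rewrite /= ge0_integralZl.
Qed.

Lemma measurable_affine2 (y u : V) (c : R) :
  measurable_fun setT (fun z : V * V => (y + c *: z.1, u + c *: z.2)).
Proof.
apply: measurable_fun_pair.
  by apply: measurable_rV_add; [exact: measurable_cst|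
    apply: measurable_rV_scale; [exact: measurable_cst|exact: measurable_fst]].
by apply: measurable_rV_add; [exact: measurable_cst|
    apply: measurable_rV_scale; [exact: measurable_cst|exact: measurable_snd]].
Qed.

Lemma I2_affine (y u : V) (c : R) F : 1 <= c ->
  measurable_fun setT F -> (forall z, 0 <= F z)%E ->
  (I2 (fun z => F (y + c *: z.1, u + c *: z.2)%R) <= I2 F)%E.
Proof.
move=> c1 mF F0; have c0 : 0 < c by apply: lt_le_trans c1.
have cn : c ^- n <= 1 by rewrite invf_le1 ?exprn_gt0// exprn_ege1.
have cn0 : (0 <= (c ^- n)%:E)%E by rewrite lee_fin invr_ge0 exprn_ge0// ltW.
have le1 (a : \bar R) : (0 <= a)%E -> ((c ^- n)%:E * a <= a)%E.
  by move=> a0; rewrite -[leRHS]mul1e lee_wpmul2r ?lee_fin.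
rewrite /I2 /=.
rewrite (_ : (\int[mu]_x _)%E = \int[mu]_x ((c ^- n)%R%:E * \int[mu]_h F (y + c *: x, h)%R))%E; last first.
  by apply: eq_integral => x _; rewrite (integral_affine u c0 (G := fun h => F (y + c *: x, h)))//;
    exact: measurable_section.
have mI : measurable_fun setT (fun x => \int[mu]_h F (x, h))%E.
  exact: measurable_fun_fubini_tonelli_F.
rewrite ge0_integralZl//; last 2 first.
- by apply: (measurableT_comp mI); exact: measurable_affine.
- by move=> x _; exact: integral_ge0.
rewrite (integral_affine y c0 (G := fun x => \int[mu]_h F (x, h))%E)//; last first.
  by move=> x; exact: integral_ge0.
apply: le_trans (le1 _ _); first by rewrite lee_wpmul2l// le1// integral_ge0// => x _; exact: integral_ge0.
by apply: integral_ge0 => x _; exact: integral_ge0.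
Qed.

End Iterated.

Section Differences.
Context {R : realType} {n : nat}.
Local Notation V := 'rV[R]_n.
Local Notation mu := (@borel_rV R n).
Variables (k : nat) (f : V -> R).
Hypothesis mf : measurable_fun setT f.

Definition dcoef (j : nat) : R := (-1) ^+ (k - j) * 'C(k, j)%:R.

Lemma fdiffE h x : fdiff k h f x = \sum_(j < k.+1) dcoef j * f (x + j%:R *: h).
Proof. by []. Qed.

Lemma sum_norm_dcoef : \sum_(j < k.+1) `|dcoef j| = 2 ^+ k.
Proof.
rewrite -[2]/(1 + 1) exprDn; apply: eq_bigr => j _.
by rewrite !expr1n mulr1 /dcoef normrM normrX normrN normr1 expr1n mul1r normr_nat.
Qed.

Lemma norm_dcoef0 : `|dcoef 0| = 1.
Proof. by rewrite /dcoef bin0 mulr1 normrX normrN normr1 expr1n. Qed.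

(** Both sides expand to the same double sum of
    [f (x + j h + i (u + j w))], read by rows or by columns. *)
Lemma fdiff_exchange (x h u w : V) :
  \sum_(j < k.+1) dcoef j * fdiff k (u + j%:R *: w) f (x + j%:R *: h) =
  \sum_(i < k.+1) dcoef i * fdiff k (h + i%:R *: w) f (x + i%:R *: u).
Proof.
under eq_bigr do rewrite fdiffE mulr_sumr.
rewrite exchange_big/=; apply: eq_bigr => i _.
rewrite fdiffE mulr_sumr; apply: eq_bigr => j _.
rewrite mulrCA; congr (_ * (_ * f _)).
rewrite !scalerDr !scalerA -!addrA; congr (_ + _).
by rewrite [(i%:R * _)]mulrC addrA [X in X + _]addrC addrA.
Qed.

Lemma measurable_fdiff d (T : measurableType d) (p q : T -> V) :
  measurable_fun setT p -> measurable_fun setT q ->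
  measurable_fun setT (fun z => fdiff k (p z) f (q z)).
Proof.
move=> mp mq; under eq_fun do rewrite fdiffE.
apply: measurable_sum => j; apply: measurable_funM; first exact: measurable_cst.
apply: (measurableT_comp mf); apply: measurable_rV_add => //.
by apply: measurable_rV_scale => //; exact: measurable_cst.
Qed.

(** Shares that are small enough for the union bounds of [fdiff_le_of_good] and
    [good_up]. *)
Definition eps_good : R := (4 * k.+1%:R * 2 ^+ n)^-1.
Definition eps_light : R := (16 * k.+1%:R ^+ (n + 2))^-1.

(** Steps, and pairs of a base point and a step. The larger cubes of the pairs
    contain all pairs that [fdiff_exchange] produces from [y] and from vectors of
    size [s]. *)
Definition badset (y : V) (s tau : R) : set V :=
  [set u | cube 0 s u /\ tau < `|fdiff k u f y|].
Definition badpairs (y : V) (s tau : R) : set (V * V) :=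
  [set xh | [/\ cube y (k.+1%:R * s) xh.1, cube 0 (k.+1%:R * s) xh.2 &
    tau < `|fdiff k xh.2 f xh.1|]].

(** Goodness concerns the single base point [y], heaviness the average base point
    around it; a point can be both or neither. *)
Definition good y s tau := (mu (badset y s tau) <= (eps_good * (2 * s) ^+ n)%:E)%E.
Definition heavy y s tau := ((eps_light * s ^+ (n + n))%:E <= I2 (ind (badpairs y s tau)))%E.

Lemma measurable_badset y s tau : measurable (badset y s tau).
Proof.
rewrite /badset (_ : [set u | _] = cube 0 s `&` (fun u => `|fdiff k u f y|) @^-1` `]tau, +oo[).
  apply: measurableI; first exact: measurable_cube.
  rewrite -[X in measurable X]setTI.
  have : measurable_fun setT (fun u : V => `|fdiff k u f y|).
    apply: measurableT_comp => //; apply: measurable_fdiff => //; exact: measurable_cst.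
  by apply => //; exact: measurable_itv.
by apply/seteqP; split => u /=; rewrite in_itv/= andbT.
Qed.

Lemma measurable_badpairs y s tau : measurable (badpairs y s tau).
Proof.
rewrite /badpairs (_ : [set xh | _] = (cube y (k.+1%:R * s) `*` cube 0 (k.+1%:R * s)) `&`
   (fun xh : V * V => `|fdiff k xh.2 f xh.1|) @^-1` `]tau, +oo[).
  apply: measurableI; first by apply: measurableX; exact: measurable_cube.
  rewrite -[X in measurable X]setTI.
  have : measurable_fun setT (fun xh : V * V => `|fdiff k xh.2 f xh.1|).
    apply: measurableT_comp => //; apply: measurable_fdiff; [exact: measurable_snd|exact: measurable_fst].
  by apply => //; exact: measurable_itv.
by apply/seteqP; split => -[x h] /=; rewrite in_itv/= andbT => -[] // [].
Qed.

End Differences.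

(** * From large differences to heavy points *)

Section GoodPoints.
Context {R : realType} {n : nat}.
Local Notation V := 'rV[R]_n.
Local Notation mu := (@borel_rV R n).
Variables (k : nat) (f : V -> R).
Hypotheses (k0 : (0 < k)%N) (mf : measurable_fun setT f).
Local Notation badset := (badset k f).
Local Notation badpairs := (badpairs k f).
Local Notation good := (good k f).
Local Notation heavy := (heavy k f).
Local Notation eps_good := (@eps_good R n k).
Local Notation eps_light := (@eps_light R n k).

Lemma integral_indV (A : set V) : measurable A -> (\int[mu]_x ind A x)%E = mu A.
Proof. by move=> mA; rewrite (integral_ind mu mA). Qed.

Lemma eps_good_gt0 : 0 < eps_good.
Proof. by rewrite invr_gt0 !mulr_gt0// ?exprn_gt0. Qed.

Lemma eps_light_gt0 : 0 < eps_light.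
Proof. by rewrite invr_gt0 mulr_gt0// exprn_gt0. Qed.

(** The two terms of index zero of [fdiff_exchange] are the differences at [h] and
    at [u]; all other terms are small by assumption. *)
Lemma fdiff_exchange_isolate (x h u w : V) (tau' tau : R) :
  `|fdiff k u f x| <= tau' ->
  (forall j, (0 < j < k.+1)%N -> `|fdiff k (u + j%:R *: w) f (x + j%:R *: h)| <= tau) ->
  (forall i, (0 < i < k.+1)%N -> `|fdiff k (h + i%:R *: w) f (x + i%:R *: u)| <= tau) ->
  `|fdiff k h f x| <= tau' + 2 * 2 ^+ k * tau.
Proof.
move=> H0 H1 H2.
have tau0 : 0 <= tau by apply: le_trans (H1 1%N _) => //; rewrite ltnS k0.
have Hsum (F : nat -> R) : (forall j, (0 < j < k.+1)%N -> `|F j| <= tau) ->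
    `|\sum_(j < k) dcoef k (lift ord0 j) * F (lift ord0 j)| <= 2 ^+ k * tau.
  move=> HF; apply: le_trans (ler_norm_sum _ _ _) _.
  apply: (@le_trans _ _ (\sum_(j < k) `|dcoef k (lift ord0 j)| * tau)).
    apply: ler_sum => j _; rewrite normrM ler_wpM2l// HF//.
    by rewrite /= /bump/= add1n ltnS ltn_ord.
  rewrite -mulr_suml ler_wpM2r// -(sum_norm_dcoef k) [leRHS]big_ord_recl lerDr.
  exact: normr_ge0.
have := fdiff_exchange k f x h u w; rewrite !big_ord_recl/= !scale0r !addr0 => E.
have -> : `|fdiff k h f x| = `|dcoef k 0 * fdiff k h f x| by rewrite normrM norm_dcoef0 mul1r.
rewrite (_ : dcoef k 0 * fdiff k h f x = dcoef k 0 * fdiff k u f x +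
  \sum_(j < k) dcoef k (lift ord0 j) * fdiff k (u + (lift ord0 j)%:R *: w) f (x + (lift ord0 j)%:R *: h)
  - \sum_(j < k) dcoef k (lift ord0 j) * fdiff k (h + (lift ord0 j)%:R *: w) f (x + (lift ord0 j)%:R *: u));
  last by rewrite E addrK.
apply: le_trans (ler_normB _ _) _.
apply: le_trans (lerD (ler_normD _ _) (lexx _)) _.
rewrite normrM norm_dcoef0 mul1r.
have := Hsum (fun j => fdiff k (u + j%:R *: w) f (x + j%:R *: h)) H1.
have := Hsum (fun i => fdiff k (h + i%:R *: w) f (x + i%:R *: u)) H2.
by move: H0; lra.
Qed.

Lemma cube_addZ (x u : V) (s t : R) (j : nat) : cube 0 s u -> j%:R * s <= t ->
  cube x t (x + j%:R *: u).
Proof.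
move=> us jst i; rewrite !mxE addrAC subrr add0r normrM normr_nat.
apply: le_trans jst; rewrite ler_wpM2l//; have := us i; by rewrite mxE subr0.
Qed.

Lemma cube0D (u w : V) (s t r : R) : cube 0 s u -> cube 0 t w -> s + t <= r ->
  cube 0 r (u + w).
Proof.
move=> us wt str i; rewrite !mxE subr0; apply: le_trans str.
have := us i; have := wt i; rewrite !mxE !subr0 => h1 h2.
by apply: le_trans (ler_normD _ _) _; rewrite lerD.
Qed.

Lemma cube0Z (w : V) (t : R) (j : nat) : cube 0 t w -> cube 0 (j%:R * t) (j%:R *: w).
Proof.
move=> wt i; rewrite !mxE subr0 normrM normr_nat ler_wpM2l//.
by have := wt i; rewrite mxE subr0.
Qed.

Lemma measurable_ind_comp d (T : measurableType d) d' (T' : measurableType d')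
   (A : set T) (p : T' -> T) : measurable A -> measurable_fun setT p ->
  measurable_fun setT (fun z => ind A (p z) : \bar R).
Proof.
move=> mA mp; apply: (@measurableT_comp _ _ _ _ _ _ (ind A : T -> \bar R) _ p) => //.
exact: measurable_ind.
Qed.

Lemma mem_fail_badset y s tau u : cube 0 s u -> ~ badset y s tau u ->
  `|fdiff k u f y| <= tau.
Proof. by move=> us; rewrite leNgt => h; apply/negP => hu; apply: h. Qed.

Lemma mem_fail_badpairs y s tau x h : cube y (k.+1%:R * s) x ->
  cube 0 (k.+1%:R * s) h -> ~ badpairs y s tau (x, h) -> `|fdiff k h f x| <= tau.
Proof. by move=> ? ?; rewrite leNgt => nb; apply/negP => hu; apply: nb. Qed.

(** If every point of the progression [x + j h] is good and the pairs around [x]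
    are mostly small, a generic auxiliary pair [(u, w)] makes all the other terms
    of [fdiff_exchange] small. *)
Lemma fdiff_le_of_good x h r tau : 0 < r -> cube 0 r h ->
  (forall j, (j < k.+1)%N -> good (x + j%:R *: h) r tau) -> ~ heavy x r tau ->
  `|fdiff k h f x| <= tau + 2 * 2 ^+ k * tau.
Proof.
move=> r0 hr hgood /negP; rewrite -ltNge => hlight.
have kR0 : 0 < k%:R :> R by rewrite ltr0n.
pose Cu : set V := cube 0 (r / 2); pose Cw : set V := cube 0 (r / (2 * k%:R)).
have mCu : measurable Cu by exact: measurable_cube.
have mCw : measurable Cw by exact: measurable_cube.
have rw0 : 0 <= r / (2 * k%:R) by rewrite divr_ge0 ?mulr_ge0// ltW.
have muCw : mu Cw = ((r / k%:R) ^+ n)%:E.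
  by rewrite mu_cube//; congr ((_ ^+ n)%:E); field; rewrite gt_eqF.
have muCu : mu Cu = (r ^+ n)%:E.
  by rewrite mu_cube ?divr_ge0 ?ltW//; congr ((_ ^+ n)%:E); field.
suff [u [w [Cuu Cww H1 H2]]] : exists u w, [/\ Cu u, Cw w,
   forall j, (j < k.+1)%N -> ~ badset (x + j%:R *: h) r tau (u + j%:R *: w) &
   forall i, (i < k)%N -> ~ badpairs x r tau (x + i.+1%:R *: u, h + i.+1%:R *: w)].
  have jw j : (j < k.+1)%N -> cube 0 (r / 2) (j%:R *: w).
    move=> jk; apply: cube_subset (cube0Z j Cww).
    rewrite mulrA ler_pdivrMr ?mulr_gt0// (_ : r / 2 * (2 * k%:R) = k%:R * r); last by field.
    by rewrite ler_pM2r// ler_nat.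
  have uw j : (j < k.+1)%N -> cube 0 r (u + j%:R *: w).
    by move=> jk; apply: cube0D Cuu (jw j jk) _; lra.
  apply: (@fdiff_exchange_isolate x h u w).
  - have := mem_fail_badset (uw 0%N isT) (H1 0%N isT).
    by rewrite !scale0r !addr0.
  - by move=> j /andP[_ jk]; exact: mem_fail_badset (uw j jk) (H1 j jk).
  - case=> // i ik; apply: mem_fail_badpairs (H2 i ik).
      apply: cube_addZ Cuu _; apply: ler_pM => //; last by lra.
        by rewrite divr_ge0// ltW.
      by rewrite ler_nat ltnW.
    apply: cube0D hr (jw _ ik) _.
    have : 2 * r <= k.+1%:R * r by rewrite ler_pM2r// ler_nat ltnS.
    by move: r0; lra.
(* Otherwise each (u, w) of Cu x Cw meets one of 2 k + 1 exceptional sets, whose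
   measures add up to less than that of Cu x Cw. *)
apply: contrapT => H.
have key (z : V * V) : ((ind (Cu `*` Cw) z : \bar R) <=
   \sum_(j < k.+1) (ind (badset (x + j%:R *: h) r tau) (z.1 + j%:R *: z.2)%R * ind Cw z.2) +
   \sum_(i < k) ind (badpairs x r tau) (x + i.+1%:R *: z.1, h + i.+1%:R *: z.2)%R)%E.
  have S0 : (0 <= \sum_(j < k.+1) (ind (badset (x + j%:R *: h) r tau) (z.1 + j%:R *: z.2)%R * ind Cw z.2) :> \bar R)%E.
    by apply: sume_ge0 => j _; rewrite mule_ge0 ?ind_ge0.
  have S1 : (0 <= \sum_(i < k) ind (badpairs x r tau) (x + i.+1%:R *: z.1, h + i.+1%:R *: z.2)%R :> \bar R)%E.
    by apply: sume_ge0 => j _; exact: ind_ge0.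
  have [[zu zw]|nz] := pselect ((Cu `*` Cw) z); last by rewrite ind_out// adde_ge0.
  rewrite ind_in//.
  have [[j jb]|nj] := pselect (exists j : 'I_k.+1, badset (x + j%:R *: h) r tau (z.1 + j%:R *: z.2)).
    rewrite (bigD1 j)//= (ind_in _ jb) (ind_in _ zw) mule1 -addeA leeDl// adde_ge0//.
    by apply: sume_ge0 => i _; rewrite mule_ge0 ?ind_ge0.
  have [[i ib]|ni] := pselect (exists i : 'I_k, badpairs x r tau (x + i.+1%:R *: z.1, h + i.+1%:R *: z.2)).
    rewrite [X in (_ + X)%E](bigD1 i)//= (ind_in _ ib) addeCA leeDl// adde_ge0//.
    by apply: sume_ge0 => ? _; exact: ind_ge0.
  exfalso; apply: H; exists z.1, z.2; split => //.
    by move=> j jk jb; apply: nj; exists (Ordinal jk).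
  by move=> i ik ib; apply: ni; exists (Ordinal ik).
have mbs j : measurable_fun setT (fun z : V * V =>
    ind (badset (x + j%:R *: h) r tau) (z.1 + j%:R *: z.2)%R * ind Cw z.2 : \bar R)%E.
  apply: emeasurable_funM; last by apply: measurable_ind_comp => //; exact: measurable_snd.
  apply: measurable_ind_comp; first exact: measurable_badset.
  apply: measurable_rV_add; first exact: measurable_fst.
  by apply: measurable_rV_scale; [exact: measurable_cst|exact: measurable_snd].
have mbp i : measurable_fun setT (fun z : V * V =>
    ind (badpairs x r tau) (x + i.+1%:R *: z.1, h + i.+1%:R *: z.2)%R : \bar R).
  by apply: measurable_ind_comp; [exact: measurable_badpairs|exact: measurable_affine2].
have := le_I2 (fun z => ind_ge0 R _ z) key.
rewrite I2_add; last 4 first.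
- by apply: emeasurable_sum => j.
- by apply: emeasurable_sum => j.
- by move=> z; apply: sume_ge0 => j _; rewrite mule_ge0 ?ind_ge0.
- by move=> z; apply: sume_ge0 => j _; exact: ind_ge0.
rewrite !I2_sum//; [|by move=> i z; exact: ind_ge0|by move=> i z; rewrite mule_ge0 ?ind_ge0].
have -> : I2 (ind (Cu `*` Cw)) = (r ^+ n * (r / k%:R) ^+ n)%:E.
  transitivity (I2 (fun z => ind Cu z.1 * ind Cw z.2 : \bar R)%E).
    congr I2; apply/funext => -[u w]; rewrite /ind -EFinM !indicE/=.
    by rewrite in_setX/= -natrM mulnb.
  rewrite I2_prod//; try exact: measurable_ind; try by move=> z; exact: ind_ge0.
  by rewrite (integral_indV mCu) (integral_indV mCw) muCu muCw EFinM.
have bs j : (j < k.+1)%N -> (I2 (fun z : V * V =>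
    ind (badset (x + j%:R *: h) r tau) (z.1 + j%:R *: z.2)%R * ind Cw z.2) <=
    (eps_good * (2 * r) ^+ n * (r / k%:R) ^+ n)%:E)%E.
  move=> jk; rewrite I2_swap//; last by move=> z; rewrite mule_ge0 ?ind_ge0.
  have mb : measurable_fun setT (ind (badset (x + j%:R *: h) r tau) : V -> \bar R).
    by apply: measurable_ind; exact: measurable_badset.
  rewrite /I2/= (_ : (\int[mu]_x _)%E = \int[mu]_w (mu (badset (x + j%:R *: h) r tau) * ind Cw w))%E; last first.
    apply: eq_integral => w _; rewrite ge0_integralZr//; last 3 first.
    - by apply: (measurableT_comp mb); apply: measurable_rV_add => //; exact: measurable_cst.
    - by move=> u _; exact: ind_ge0.
    - exact: ind_ge0.
    congr (_ * _)%E; rewrite -(integral_indV (measurable_badset k mf _ _ _)).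
    rewrite -(integral_translate (j%:R *: w) mb); last by move=> u; exact: ind_ge0.
    by apply: eq_integral => u _; congr (ind _ _); exact: addrC.
  rewrite ge0_integralZl//; last 2 first.
  - exact: measurable_ind.
  - by move=> u _; exact: ind_ge0.
  rewrite (integral_indV mCw) muCw [leRHS]EFinM lee_wpmul2r//.
    by rewrite lee_fin exprn_ge0// divr_ge0// ltW.
  exact: hgood.
have bp i : (i < k)%N -> (I2 (fun z : V * V => ind (badpairs x r tau)
    (x + i.+1%:R *: z.1, h + i.+1%:R *: z.2)%R) <= (eps_light * r ^+ (n + n))%:E)%E.
  move=> ik; apply: le_trans (ltW hlight).
  apply: I2_affine; rewrite ?ler1n//; last by move=> z; exact: ind_ge0.
  by apply: measurable_ind; exact: measurable_badpairs.
apply/negP; rewrite -ltNge.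
apply: (@le_lt_trans _ _ ((k.+1%:R * (eps_good * (2 * r) ^+ n * (r / k%:R) ^+ n) + k%:R * (eps_light * r ^+ (n + n)))%:E)).
  rewrite EFinD; apply: leeD.
    apply: (@le_trans _ _ (\sum_(j < k.+1) (eps_good * (2 * r) ^+ n * (r / k%:R) ^+ n)%:E)%E).
      by apply: lee_sum => j _; exact: bs.
    by rewrite sumEFin lee_fin sumr_const card_ord -[leLHS]mulr_natl.
  apply: (@le_trans _ _ (\sum_(j < k) (eps_light * r ^+ (n + n))%:E)%E).
    by apply: lee_sum => j _; exact: bp.
  by rewrite sumEFin lee_fin sumr_const card_ord -[leLHS]mulr_natl.
rewrite lte_fin.
have -> : k.+1%:R * (eps_good * (2 * r) ^+ n * (r / k%:R) ^+ n) = 4^-1 * (r ^+ n * (r / k%:R) ^+ n).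
  rewrite /eps_good [(2 * r) ^+ n]exprMn_comm; last exact: mulrC.
  field; rewrite gt_eqF ?exprn_gt0//=; by rewrite pnatr_eq0.
have kn : k%:R * (eps_light * r ^+ (n + n)) <= 16^-1 * (r ^+ n * (r / k%:R) ^+ n).
  rewrite exprD [(r / _) ^+ n]exprMn_comm; last exact: mulrC.
  rewrite exprVn /eps_light exprD invfM.
  have K1 : (k.+1%:R ^+ n)^-1 <= (k%:R ^+ n)^-1 :> R.
    by rewrite lef_pV2 ?posrE ?exprn_gt0 ?ltr0n// lerXn2r ?nnegrE// ler_nat.
  have K2 : k%:R * (k.+1%:R ^+ 2)^-1 <= 1 :> R.
    rewrite ler_pdivrMr ?exprn_gt0// mul1r expr2 -natrM ler_nat; nia.
  have a0 : 0 < r ^+ n by rewrite exprn_gt0.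
  have b0 : 0 < (k%:R ^+ n)^-1 :> R by rewrite invr_gt0 exprn_gt0.
  have c0 : 0 < (k.+1%:R ^+ n)^-1 :> R by rewrite invr_gt0 exprn_gt0.
  have d0 : 0 <= k%:R * (k.+1%:R ^+ 2)^-1 :> R by rewrite mulr_ge0// invr_ge0 exprn_ge0.
  rewrite invfM.
  have := ler_pM d0 (ltW c0) K2 K1; rewrite mul1r => K3.
  have := ler_wpM2r (ltW (mulr_gt0 a0 a0)) K3.
  move: (k.+1%:R ^+ 2)^-1 (k.+1%:R ^+ n)^-1 (k%:R ^+ n)^-1 (r ^+ n) => A2 An Bn rn E.
  rewrite [leLHS](_ : _ = 16^-1 * (k%:R * A2 * An * (rn * rn))); last by ring.
  rewrite [leRHS](_ : _ = 16^-1 * (Bn * (rn * rn))); last by ring.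
  by rewrite ler_pM2l.
have : 0 < r ^+ n * (r / k%:R) ^+ n by rewrite mulr_gt0// exprn_gt0// divr_gt0.
by move: kn; lra.
Qed.

End GoodPoints.

Section NullDilates.
Context {R : realType} {n : nat}.
Local Notation V := 'rV[R]_n.
Local Notation mu := (@borel_rV R n).

Lemma null_dilates (N : set V) (x : V) : measurable N -> mu N = 0%E -> exists M, [/\ measurable M, mu M = 0%E &
  forall h, ~ M h -> forall j, ~ N (x + j.+1%:R *: h)].
Proof.
move=> mN N0; have mA (j : nat) : measurable_fun setT (fun h : V => x + j.+1%:R *: h).
  apply: measurable_rV_add; first exact: measurable_cst.
  by apply: measurable_rV_scale; [exact: measurable_cst|exact: measurable_id].
have mM j : measurable ((fun h : V => x + j.+1%:R *: h) @^-1` N).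
  by rewrite -[X in measurable X]setTI; exact: mA.
have : mu.-negligible (\bigcup_j ((fun h : V => x + j.+1%:R *: h) @^-1` N)).
  apply: negligible_bigcup => j; exists ((fun h : V => x + j.+1%:R *: h) @^-1` N); split => //.
  rewrite -integral_ind//; transitivity (\int[mu]_h ind N (x + j.+1%:R *: h)%R)%E; first by [].
  rewrite (integral_affine x (G := ind N)) ?ltr0n//; last first.
  - by move=> y; exact: ind_ge0.
  - exact: measurable_ind.
  by rewrite integral_ind// [X in (_ * X)%E]N0 mule0.
move=> [M [mM' M0 HM]]; exists M; split => // h nh j Nj; apply: nh; apply: HM; exists j => //.
Qed.

End NullDilates.

Section GoodUp.
Context {R : realType} {n : nat}.
Local Notation V := 'rV[R]_n.
Local Notation mu := (@borel_rV R n).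
Variables (k : nat) (f : V -> R).
Hypotheses (k0 : (0 < k)%N) (mf : measurable_fun setT f).
Local Notation badset := (badset k f).
Local Notation badpairs := (badpairs k f).
Local Notation good := (good k f).
Local Notation heavy := (heavy k f).
Local Notation eps_good := (@eps_good R n k).
Local Notation eps_light := (@eps_light R n k).

Let swap3 (F : V * (V * V) -> \bar R) : measurable_fun setT F -> (forall z, 0 <= F z)%E ->
  (\int[mu]_v I2 (fun z => F (v, z)) = \int[mu]_u I2 (fun z => F (z.1, (u, z.2))))%E.
Proof.
move=> mF F0; rewrite /I2 /=.
pose G (vu : V * V) := (\int[mu]_w F (vu.1, (vu.2, w)))%E.
rewrite -[LHS]/(\int[mu]_v \int[mu]_u G (v, u))%E (fubini_tonelli G) => [//||]; last first.
  by move=> z; exact: integral_ge0.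
  pose F' (z : (V * V) * V) := F (z.1.1, (z.1.2, z.2)).
  apply: (@measurable_fun_fubini_tonelli_F _ _ (V * V)%type V R mu F'); last by move=> z; exact: F0.
  apply: (measurableT_comp mF); apply: measurable_fun_pair.
    by apply: (measurableT_comp measurable_fst); exact: measurable_fst.
  apply: measurable_fun_pair; last exact: measurable_snd.
  by apply: (measurableT_comp measurable_snd); exact: measurable_fst.
Qed.

Lemma measurable_I2_section (F : V * (V * V) -> \bar R) : measurable_fun setT F ->
  (forall z, 0 <= F z)%E -> measurable_fun setT (fun v => I2 (fun z => F (v, z))).
Proof.
move=> mF F0; rewrite /I2 /=.
pose G (vu : V * V) := (\int[mu]_w F (vu.1, (vu.2, w)))%E.
apply: (@measurable_fun_fubini_tonelli_F _ _ V V R mu G) => //; last first.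
  by move=> z; exact: integral_ge0.
pose F' (z : (V * V) * V) := F (z.1.1, (z.1.2, z.2)).
apply: (@measurable_fun_fubini_tonelli_F _ _ (V * V)%type V R mu F'); last by move=> z; exact: F0.
apply: (measurableT_comp mF); apply: measurable_fun_pair.
  by apply: (measurableT_comp measurable_fst); exact: measurable_fst.
apply: measurable_fun_pair; last exact: measurable_snd.
by apply: (measurableT_comp measurable_snd); exact: measurable_fst.
Qed.

(** The inequality between the two shares that closes the count in [good_up]. *)
Lemma eps_ratio : k%:R * eps_light * 8 / 3 <= eps_good * 2 ^+ n.
Proof.
  have n0 : 0 < 2 ^+ n :> R by rewrite exprn_gt0.
  rewrite /eps_good invfM mulfVK ?gt_eqF// invfM.
  rewrite /eps_light exprD (_ : (16 * _)^-1 = 16^-1 * ((k.+1%:R ^+ n)^-1 * (k.+1%:R ^+ 2)^-1));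
    last by rewrite !invfM.
  have K1 : (k.+1%:R ^+ n)^-1 <= 1 :> R.
    by rewrite invf_le1 ?exprn_gt0// exprn_ege1// ler1n.
  have K2 : k%:R * (k.+1%:R ^+ 2)^-1 <= k.+1%:R^-1 :> R.
    by rewrite ler_pdivrMr ?exprn_gt0// expr2 mulrA mulVf ?pnatr_eq0// mul1r ler_nat.
  have d0 : 0 <= k%:R * (k.+1%:R ^+ 2)^-1 :> R by rewrite mulr_ge0// invr_ge0 exprn_ge0.
  have c0 : 0 <= (k.+1%:R ^+ n)^-1 :> R by rewrite invr_ge0 exprn_ge0.
  have := ler_pM d0 c0 K2 K1.
  have : 0 < k.+1%:R^-1 :> R by rewrite invr_gt0.
  move: (k.+1%:R ^+ 2)^-1 (k.+1%:R ^+ n)^-1 (k.+1%:R^-1) => A2 An B B0 E.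
  rewrite [leLHS](_ : _ = 6^-1 * (k%:R * A2 * An)); last by field.
  lra.
Qed.

(** Doubling the scale: goodness at [y] passes from scale [s / 2] to [s] with an
    additive loss, as long as the pairs around [y] are mostly small. The
    threshold of the smaller scale enters with coefficient one, so the losses
    of successive scales only add up. *)
Lemma good_up y s tau' tau : 0 < s -> good y (s / 2) tau' -> ~ heavy y s tau ->
  good y s (tau' + 2 * 2 ^+ k * tau).
Proof.
move=> s0 hgood /negP; rewrite -ltNge => hlight.
pose Vb : set V := badset y s (tau' + 2 * 2 ^+ k * tau).
have mVb : measurable Vb by exact: measurable_badset.
pose C : set V := cube 0 s; pose C' : set V := cube 0 (s / 2).
have mC : measurable C by exact: measurable_cube.
have mC' : measurable C' by exact: measurable_cube.
have muC : mu C = ((2 * s) ^+ n)%:E by rewrite mu_cube// ltW.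
have muC' : mu C' = (s ^+ n)%:E.
  by rewrite mu_cube ?divr_ge0 ?ltW//; congr ((_ ^+ n)%:E); field.
pose BP := badpairs y s tau.
have mBP : measurable BP by exact: measurable_badpairs.
pose BS := badset y (s / 2) tau'.
have mBS : measurable BS by exact: measurable_badset.
pose P1 j (z : V * (V * V)) : \bar R :=
  (ind C' z.2.1 * ind BP (y + j.+1%:R *: z.1, z.2.1 + j.+1%:R *: z.2.2)%R)%E.
pose P2 j (z : V * (V * V)) : \bar R :=
  (ind C z.1 * ind BP (y + j.+1%:R *: z.2.1, z.1 + j.+1%:R *: z.2.2)%R)%E.
have P10 j z : (0 <= P1 j z)%E by rewrite mule_ge0 ?ind_ge0.
have P20 j z : (0 <= P2 j z)%E by rewrite mule_ge0 ?ind_ge0.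
have m21 : measurable_fun setT (fun z : V * (V * V) => z.2.1).
  by apply: (measurableT_comp measurable_fst); exact: measurable_snd.
have m22 : measurable_fun setT (fun z : V * (V * V) => z.2.2).
  by apply: (measurableT_comp measurable_snd); exact: measurable_snd.
have mP1 j : measurable_fun setT (P1 j).
  apply: emeasurable_funM; apply: measurable_ind_comp => //.
  apply: measurable_fun_pair; apply: measurable_rV_add => //;
    by apply: measurable_rV_scale.
have mP2 j : measurable_fun setT (P2 j).
  apply: emeasurable_funM; apply: measurable_ind_comp => //.
  apply: measurable_fun_pair; apply: measurable_rV_add => //;
    by apply: measurable_rV_scale.
pose S (v : V) := (\sum_(j < k) I2 (fun z => P1 j (v, z)) + \sum_(j < k) I2 (fun z => P2 j (v, z)))%E.
(* For a step v that is bad at scale s, each pair (u, w) with u not bad at scale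
   s / 2 leads to a bad pair of one of the two families P1 and P2. *)
have key (v : V) (z : V * V) : Vb v -> ((ind (C' `*` C) z : \bar R) <= ind BS z.1 * ind C z.2 +
    (\sum_(j < k) P1 j (v, z) + \sum_(j < k) P2 j (v, z)))%E.
  move=> [Cv Vbv].
  have S1 : (0 <= \sum_(j < k) P1 j (v, z))%E by exact: sume_ge0.
  have S2 : (0 <= \sum_(j < k) P2 j (v, z))%E by exact: sume_ge0.
  have [[zu zw]|nz] := pselect ((C' `*` C) z); last first.
    by rewrite ind_out// !adde_ge0// mule_ge0 ?ind_ge0.
  rewrite ind_in//.
  have [bu|nu] := pselect (BS z.1).
    by rewrite (ind_in _ bu) (ind_in _ zw) mule1 leeDl// adde_ge0.
  rewrite (ind_out _ nu) mul0e add0e.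
  have [[j jb]|nj] := pselect (exists j : 'I_k, BP (y + j.+1%:R *: v, z.1 + j.+1%:R *: z.2)).
    have P1j : P1 j (v, z) = 1%E by rewrite /P1/= (ind_in _ zu) (ind_in _ jb) mule1.
    rewrite (bigD1 j)//= P1j -addeA leeDl// adde_ge0//.
    by apply: sume_ge0 => i _; rewrite mule_ge0 ?ind_ge0.
  have [[i ib]|ni] := pselect (exists j : 'I_k, BP (y + j.+1%:R *: z.1, v + j.+1%:R *: z.2)).
    have P2i : P2 i (v, z) = 1%E by rewrite /P2/= (ind_in _ Cv) (ind_in _ ib) mule1.
    rewrite [X in (_ + X)%E](bigD1 i)//= P2i addeCA leeDl// adde_ge0//.
    by apply: sume_ge0 => ? _.
  exfalso; move: Vbv; apply/negP; rewrite -leNgt.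
  have js j : (j < k.+1)%N -> j%:R * s <= k.+1%:R * s.
    by move=> jk; rewrite ler_pM2r// ler_nat ltnW.
  have js' j : (j < k.+1)%N -> s + j%:R * s <= k.+1%:R * s.
    move=> jk; rewrite -[X in X + _]mul1r -mulrDl ler_pM2r//.
    by rewrite addrC natr1 ler_nat.
  apply: (@fdiff_exchange_isolate _ _ _ _ k0 y v z.1 z.2).
  - exact: mem_fail_badset zu nu.
  - case=> // j /andP[_ jk].
    apply: (@mem_fail_badpairs _ _ _ _ y s).
    + exact: cube_addZ Cv (js _ jk).
    + apply: cube0D (cube_subset _ zu) (cube0Z _ zw) (js' _ jk).
      by rewrite ler_pdivrMr// ler_peMr// ?ler1n// ltW.
    + by move=> h; apply: nj; exists (Ordinal (jk : (j < k)%N)).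
  - case=> // j /andP[_ jk].
    apply: (@mem_fail_badpairs _ _ _ _ y s).
    + apply: (cube_addZ y (s := s) (cube_subset _ zu)); last exact: js.
      by rewrite ler_pdivrMr// ler_peMr// ?ler1n// ltW.
    + exact: cube0D Cv (cube0Z _ zw) (js' _ jk).
    + by move=> h; apply: ni; exists (Ordinal (jk : (j < k)%N)).
have a0 : 0 < s ^+ n by rewrite exprn_gt0.
have b0 : 0 < 2 ^+ n :> R by rewrite exprn_gt0.
have e0 := eps_good_gt0 k (R := R) (n := n).
have e'0 := eps_light_gt0 k (R := R) (n := n).
pose a := s ^+ n * (2 * s) ^+ n.
have mbs : measurable_fun setT (fun z : V * V => ind BS z.1 * ind C z.2 : \bar R)%E.
  by apply: emeasurable_funM; apply: measurable_ind_comp.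
have mse (F : V * (V * V) -> \bar R) (v : V) : measurable_fun setT F ->
    measurable_fun setT (fun z => F (v, z)).
  by move=> mF; apply: (measurableT_comp mF); exact: pair1_measurable.
have I2C (A B : set V) : measurable A -> measurable B ->
    I2 (fun z => ind A z.1 * ind B z.2 : \bar R)%E = (mu A * mu B)%E.
  move=> mA mB; rewrite I2_prod ?integral_indV//.
  - exact: measurable_ind.
  - exact: measurable_ind.
  - by move=> z; exact: ind_ge0.
  - by move=> z; exact: ind_ge0.
have key2 v : Vb v -> ((a * (1 - eps_good))%:E <= S v)%E.
  move=> Vbv; have := le_I2 (fun z => ind_ge0 R _ z) (fun z => key v z Vbv).
  rewrite I2_add//; last 3 first.
  - by apply: emeasurable_funD; apply: emeasurable_sum => j; exact: mse.
  - by move=> z; rewrite mule_ge0 ?ind_ge0.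
  - by move=> z; rewrite adde_ge0// sume_ge0.
  rewrite I2_add//; last 4 first.
  - by apply: emeasurable_sum => j; exact: mse.
  - by apply: emeasurable_sum => j; exact: mse.
  - by move=> z; rewrite sume_ge0.
  - by move=> z; rewrite sume_ge0.
  rewrite !I2_sum//; try (by move=> j; exact: mse).
  rewrite I2C//.
  have -> : I2 (ind (C' `*` C)) = a%:E.
    transitivity (I2 (fun z => ind C' z.1 * ind C z.2 : \bar R)%E).
      congr I2; apply/funext => -[u w]; rewrite /ind -EFinM !indicE/=.
      by rewrite in_setX/= -natrM mulnb.
    by rewrite I2C// muC muC' EFinM.
  rewrite -/(S v) => H.
  have H2 : (mu BS * mu C <= (a * eps_good)%:E)%E.
    rewrite (_ : a * eps_good = (eps_good * (2 * (s / 2)) ^+ n) * (2 * s) ^+ n); last first.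
      by rewrite /a (_ : 2 * (s / 2) = s); [ring|field].
    by rewrite EFinM muC; apply: lee_wpmul2r => //; rewrite lee_fin exprn_ge0// mulr_ge0// ltW.
  rewrite mulrBr mulr1 EFinB leeBlDr//; apply: le_trans H _.
  by rewrite addeC leeD2l.
have S0 v : (0 <= S v)%E.
  by rewrite adde_ge0// sume_ge0// => j _; apply: I2_ge0.
(* Integrating over v turns both families into dilated copies of BP. *)
have hI1 j : (j < k)%N -> (\int[mu]_v I2 (fun z => P1 j (v, z)) <= (s ^+ n)%:E * I2 (ind BP))%E.
  move=> jk; rewrite swap3//.
  apply: (@le_trans _ _ (\int[mu]_u (ind C' u * I2 (ind BP)))%E); last first.
    rewrite ge0_integralZr//; last 3 first.
    - exact: measurable_ind.
    - by move=> u _; exact: ind_ge0.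
    - by apply: I2_ge0 => z; exact: ind_ge0.
    by rewrite integral_indV// muC'.
  apply: le_integral_ge0 => u; first exact: I2_ge0.
  have [Cu|nCu] := pselect (C' u).
    rewrite /P1/= (ind_in _ Cu) mul1e.
    rewrite (_ : (fun z => _) = (fun z => ind BP (y + j.+1%:R *: z.1, u + j.+1%:R *: z.2)%R : \bar R)); last first.
      by apply/funext => z; rewrite mul1e.
    apply: I2_affine; rewrite ?ler1n//; first exact: measurable_ind.
    by move=> z; exact: ind_ge0.
  rewrite /P1/= (ind_out _ nCu) mul0e.
  rewrite (_ : (fun z => _) = (fun=> 0%E)); last by apply/funext => z; rewrite mul0e.
  by rewrite /I2 integral0_eq// => x _; rewrite integral0_eq.
have hI2 j : (j < k)%N -> (\int[mu]_v I2 (fun z => P2 j (v, z)) <= ((2 * s) ^+ n)%:E * I2 (ind BP))%E.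
  move=> jk.
  apply: (@le_trans _ _ (\int[mu]_u (ind C u * I2 (ind BP)))%E); last first.
    rewrite ge0_integralZr//; last 3 first.
    - exact: measurable_ind.
    - by move=> u _; exact: ind_ge0.
    - by apply: I2_ge0 => z; exact: ind_ge0.
    by rewrite integral_indV// muC.
  apply: le_integral_ge0 => u; first exact: I2_ge0.
  have [Cu|nCu] := pselect (C u).
    rewrite /P2/= (ind_in _ Cu) mul1e.
    rewrite (_ : (fun z => _) = (fun z => ind BP (y + j.+1%:R *: z.1, u + j.+1%:R *: z.2)%R : \bar R)); last first.
      by apply/funext => z; rewrite mul1e.
    apply: I2_affine; rewrite ?ler1n//; first exact: measurable_ind.
    by move=> z; exact: ind_ge0.
  rewrite /P2/= (ind_out _ nCu) mul0e.
  rewrite (_ : (fun z => _) = (fun=> 0%E)); last by apply/funext => z; rewrite mul0e.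
  by rewrite /I2 integral0_eq// => x _; rewrite integral0_eq.
have hS : (\int[mu]_v S v <= (k%:R * (s ^+ n + (2 * s) ^+ n) * (eps_light * s ^+ (n + n)))%:E)%E.
  have mI1 j : measurable_fun setT (fun v => I2 (fun z => P1 j (v, z))).
    exact: measurable_I2_section.
  have mI2 j : measurable_fun setT (fun v => I2 (fun z => P2 j (v, z))).
    exact: measurable_I2_section.
  have hS0 : (\int[mu]_v S v = \sum_(j < k) \int[mu]_v I2 (fun z => P1 j (v, z)) +
      \sum_(j < k) \int[mu]_v I2 (fun z => P2 j (v, z)))%E.
    rewrite /S ge0_integralD; [congr (_ + _)%E|by []| | | |].
    - by apply: ge0_integral_sum => // j v _; exact: I2_ge0.
    - by apply: ge0_integral_sum => // j v _; exact: I2_ge0.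
    - by move=> v _; apply: sume_ge0 => j _; exact: I2_ge0.
    - by apply: emeasurable_sum => j.
    - by move=> v _; apply: sume_ge0 => j _; exact: I2_ge0.
    - by apply: emeasurable_sum => j.
  rewrite hS0.
  rewrite mulrDr mulrDl EFinD; apply: leeD.
    apply: (@le_trans _ _ (\sum_(j < k) (s ^+ n * (eps_light * s ^+ (n + n)))%:E)%E).
      apply: lee_sum => j _; apply: le_trans (hI1 _ _) _ => //.
      by rewrite [leRHS]EFinM lee_wpmul2l ?lee_fin ?ltW.
    by rewrite sumEFin lee_fin sumr_const card_ord -[leLHS]mulr_natl mulrA.
  apply: (@le_trans _ _ (\sum_(j < k) ((2 * s) ^+ n * (eps_light * s ^+ (n + n)))%:E)%E).
    apply: lee_sum => j _; apply: le_trans (hI2 _ _) _ => //.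
    by rewrite [leRHS]EFinM lee_wpmul2l ?lee_fin ?ltW// exprn_gt0// mulr_gt0.
  by rewrite sumEFin lee_fin sumr_const card_ord -[leLHS]mulr_natl mulrA.
have eg : 1 - eps_good >= 3 / 4.
  have : eps_good <= 4^-1.
    rewrite /eps_good -mulrA invfM ler_piMr// invf_le1 ?mulr_gt0//.
    by rewrite mulr_ege1 ?ler1n// exprn_ege1// ler1n.
  lra.
have a1 : 0 < a * (1 - eps_good).
  by rewrite !mulr_gt0// ?exprn_gt0 ?mulr_gt0//; apply: lt_le_trans eg.
have : ((a * (1 - eps_good))%:E * mu Vb <= \int[mu]_v S v)%E.
  rewrite -integral_indV// -ge0_integralZl//; last 3 first.
  - exact: measurable_ind.
  - by move=> v _; exact: ind_ge0.
  - by rewrite lee_fin ltW.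
  apply: le_integral_ge0 => v; first by rewrite mule_ge0 ?ind_ge0// lee_fin ltW.
  have [Vv|nVv] := pselect (Vb v); first by rewrite (ind_in _ Vv) mule1; exact: key2.
  by rewrite (ind_out _ nVv) mule0.
move=> /le_trans/(_ hS); rewrite muleC -lee_pdivlMr// -EFinM => /le_trans; apply.
rewrite lee_fin ler_pdivrMr//.
rewrite /a [(2 * s) ^+ n]exprMn_comm; last exact: mulrC.
rewrite exprD.
have E := eps_ratio.
have b1 : 1 <= 2 ^+ n :> R by rewrite exprn_ege1// ler1n.
move: (s ^+ n) (2 ^+ n) a0 b0 b1 E => sn tn a0 b0 b1 E.
rewrite (_ : k%:R * (sn + tn * sn) * (eps_light * (sn * sn)) =
  (k%:R * eps_light) * (1 + tn) * sn ^+ 3); last by ring.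
rewrite (_ : eps_good * (tn * sn) * (sn * (tn * sn) * (1 - eps_good)) =
  ((eps_good * tn) * (tn * (1 - eps_good))) * sn ^+ 3); last by ring.
rewrite ler_pM2r ?exprn_gt0//.
have K0 : 0 <= k%:R * eps_light by rewrite mulr_ge0// ltW.
apply: (@le_trans _ _ (k%:R * eps_light * (2 * tn))); first by apply: ler_wpM2l => //; lra.
apply: (@le_trans _ _ ((k%:R * eps_light * 8 / 3) * (tn * (3 / 4)))).
  by rewrite le_eqVlt; apply/orP; left; apply/eqP; field.
apply: ler_pM => //; first by rewrite !mulr_ge0// ltW.
- by rewrite mulr_ge0// ltW.
- by rewrite ler_wpM2l// ltW.
Qed.

Lemma good_chain y r tau0 (tau : nat -> R) M : 0 < r ->
  good y (r / 2 ^+ M) tau0 -> (forall i, (i < M)%N -> ~ heavy y (r / 2 ^+ i) (tau i)) ->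
  good y r (tau0 + \sum_(i < M) 2 * 2 ^+ k * tau i).
Proof.
elim: M r tau0 tau => [|M IH] r tau0 tau r0.
  by rewrite expr0 divr1 big_ord0 addr0.
move=> hg hh; rewrite big_ord_recl/= [X in tau0 + X]addrC addrA.
apply: good_up => //; last by have := hh 0%N isT; rewrite expr0 divr1.
apply: (IH (r / 2) tau0 (fun i => tau i.+1)).
- by rewrite divr_gt0.
- by move: hg; rewrite exprS invfM mulrA.
- by move=> i iM; have := hh i.+1 iM; rewrite exprS invfM mulrA.
Qed.

End GoodUp.

Section BadToHeavy.
Context {R : realType} {n : nat}.
Local Notation V := 'rV[R]_n.
Local Notation mu := (@borel_rV R n).
Variables (k : nat) (f : V -> R).
Hypotheses (k0 : (0 < k)%N) (mf : measurable_fun setT f).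

Lemma good_mono y s tau tau' : tau <= tau' -> good k f y s tau -> good k f y s tau'.
Proof.
move=> tt; apply: le_trans; apply: le_measure; rewrite ?inE.
- exact: measurable_badset.
- exact: measurable_badset.
- by move=> u [us ut]; split => //; apply: le_lt_trans ut.
Qed.

Lemma heavy_anti y s tau tau' : tau <= tau' -> heavy k f y s tau' -> heavy k f y s tau.
Proof.
move=> tt /le_trans; apply; apply: le_I2 => z; first exact: ind_ge0.
by apply: le_ind => -[h1 h2 h3]; split => //; apply: le_lt_trans h3.
Qed.

(** Differences tend to zero in measure along arbitrarily fine dyadic scales; this
    is where the iteration of [good_up] starts. *)
Definition regular (y : V) := forall d, 0 < d -> forall M0, exists2 M,
  (M0 <= M)%N & good k f y (2 ^- M) d.

(** Constant of the multiscale argument, for thresholds decaying like [th ^ i]. *)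
Definition chain_cst (th : R) : R :=
  ((1 + 2 * 2 ^+ k) * (1 + 2 * 2 ^+ k / (1 - th)))^-1.

Lemma chain_cst_gt0 th : 0 < th < 1 -> 0 < chain_cst th.
Proof.
move=> /andP[th0 th1]; have k2 : 0 < 2 ^+ k :> R by rewrite exprn_gt0.
rewrite invr_gt0 mulr_gt0// addr_gt0// ?mulr_gt0// ?invr_gt0 ?subr_gt0//.
Qed.

Lemma sum_geo_le (th : R) M : 0 < th < 1 -> \sum_(i < M) th ^+ i <= (1 - th)^-1.
Proof.
move=> /andP[th0 th1]; have t1 : 0 < 1 - th by rewrite subr_gt0.
rewrite -[leRHS]mul1r ler_pdivlMr// mulrC.
have -> : (1 - th) * (\sum_(i < M) th ^+ i) = 1 - th ^+ M.
  by rewrite -opprB mulNr -subrX1 opprB.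
by rewrite gerBl exprn_ge0// ltW.
Qed.

(** A large difference at [(x, h)] is caused by one of the points [x + j h]
    lying, at some scale not larger than [r], in a region where most pairs
    have a large difference. *)
Lemma bad_heavy (th : R) x h r (T : R) : 0 < th < 1 -> 0 < r -> 0 < T ->
  cube 0 r h -> T < `|fdiff k h f x| ->
  (forall j, (j < k.+1)%N -> forall d, 0 < d -> exists M, good k f (x + j%:R *: h) (r / 2 ^+ M) d) ->
  exists j i, (j < k.+1)%N /\
    heavy k f (x + j%:R *: h) (r / 2 ^+ i) (chain_cst th * T * th ^+ i).
Proof.
move=> th01 r0 T0 hr hT hreg; apply: contrapT => H.
have c0 := chain_cst_gt0 th01; have cT : 0 < chain_cst th * T by rewrite mulr_gt0.
have k2 : 0 < 2 ^+ k :> R by rewrite exprn_gt0.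
have t1 : 0 < 1 - th by rewrite subr_gt0; case/andP: th01.
pose L := chain_cst th * T * (1 + 2 * 2 ^+ k / (1 - th)).
have cL : chain_cst th * T <= L.
  by rewrite ler_peMr ?lerDl ?divr_ge0 ?mulr_ge0// ltW.
have hgood j : (j < k.+1)%N -> good k f (x + j%:R *: h) r L.
  move=> jk; have [M hM] := hreg j jk _ cT.
  have hh i : (i < M)%N -> ~ heavy k f (x + j%:R *: h) (r / 2 ^+ i) (chain_cst th * T * th ^+ i).
    by move=> _ hv; apply: H; exists j, i.
  apply: good_mono (good_chain k0 mf r0 hM hh).
  rewrite -mulr_sumr -mulr_sumr /L mulrDr mulr1 lerD2l.
  rewrite mulrCA ler_pM2l// ler_pM2l ?mulr_gt0//; exact: sum_geo_le.
have hl : ~ heavy k f x r L.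
  move=> hv; apply: H; exists 0%N, 0%N; split; first by [].
  rewrite scale0r addr0 !expr0 divr1 mulr1; exact: heavy_anti hv.
have := fdiff_le_of_good k0 mf r0 hr hgood hl.
have -> : L + 2 * 2 ^+ k * L = T.
  rewrite -[X in X + _]mul1r -mulrDl /L /chain_cst invfM; field.
  by apply/and3P; split; rewrite gt_eqF//; move: k2 t1; nra.
by rewrite leNgt hT.
Qed.

End BadToHeavy.

(** * The line estimate and the charge of a heavy point *)

Definition tseg {R : realType} (k : nat) : set (measurableTypeR R) := `[0, k%:R]%classic.

Lemma integral_tseg {R : realType} (k : nat) :
  (\int[@lebesgue_measure R]_t ind (tseg k) t)%E = k%:R%:E.
Proof.
rewrite integral_ind; last exact: measurable_itv.
transitivity (@lebesgue_measure R `[0, k%:R]%classic); first by [].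
rewrite lebesgue_measure_itv/= lte_fin oppr0 adde0; case: ltP => // k0.
by congr (_%:E); apply/eqP; rewrite eq_le k0 ler0n.
Qed.

Section LineIntegrals.
Context {R : realType} {n : nat}.
Local Notation V := 'rV[R]_n.
Local Notation mu := (@borel_rV R n).
Local Notation leb := (@lebesgue_measure R).

(** For each [t] the inner integral is a translate. *)
Lemma line_integral_le (k : nat) (G : V -> \bar R) y r1 r h : 0 <= r ->
  measurable_fun setT G -> (forall z, 0 <= G z)%E -> cube 0 r h ->
  (\int[mu]_x (ind (cube y r1) x * \int[leb]_t (ind (tseg k) t * G (x + t *: h)%R)) <=
   k%:R%:E * \int[mu]_z (ind (cube y (r1 + k%:R * r)) z * G z))%E.
Proof.
move=> r0 mG G0 hr.
pose G' z : \bar R := (ind (cube y (r1 + k%:R * r)) z * G z)%E.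
have mG' : measurable_fun setT G'.
  by apply: emeasurable_funM => //; apply: measurable_ind; exact: measurable_cube.
have G'0 z : (0 <= G' z)%E by rewrite mule_ge0 ?ind_ge0.
have mItv : measurable (@tseg R k) by exact: measurable_itv.
have mtxh : measurable_fun setT (fun xt : V * measurableTypeR R => xt.1 + xt.2 *: h : V).
  apply: measurable_rV_add; first exact: measurable_fst.
  by apply: measurable_rV_scale; [exact: measurable_snd|exact: measurable_cst].
pose F (xt : V * measurableTypeR R) : \bar R := (ind (tseg k) xt.2 * G' (xt.1 + xt.2 *: h)%R)%E.
have mF : measurable_fun setT F.
  apply: emeasurable_funM.
    by apply: measurable_ind_comp => //; exact: measurable_snd.
  by apply: (measurableT_comp mG').
have F0 z : (0 <= F z)%E by rewrite mule_ge0 ?ind_ge0.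
apply: (@le_trans _ _ (\int[mu]_x \int[leb]_t F (x, t))%E).
  apply: le_integral_ge0 => x.
    by rewrite mule_ge0 ?ind_ge0//; apply: integral_ge0 => t _; rewrite mule_ge0 ?ind_ge0.
  have [yx|nx] := pselect (cube y r1 x); last first.
    by rewrite ind_out// mul0e; apply: integral_ge0.
  rewrite ind_in// mul1e; apply: le_integral_ge0 => t; first by rewrite mule_ge0 ?ind_ge0.
  rewrite /F/=; have [tk|ntk] := pselect (tseg k t); last first.
    by rewrite !(ind_out _ ntk) !mul0e.
  rewrite !(ind_in _ tk) !mul1e /G' ind_in ?mul1e//.
  move: tk; rewrite /tseg/= in_itv/= => tk i; rewrite !mxE.
  have := yx i; have := hr i; rewrite mxE subr0 => hi xi.
  rewrite addrAC; apply: le_trans (ler_normD _ _) _; rewrite lerD//.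
  rewrite normrM; case/andP: tk => t0 tk; rewrite ger0_norm//.
  by apply: ler_pM.
rewrite (fubini_tonelli F)//.
rewrite (_ : (\int[leb]_t _)%E = \int[leb]_t (ind (tseg k) t * \int[mu]_z G' z))%E; last first.
  apply: eq_integral => t _; rewrite /F/= ge0_integralZl//; last 2 first.
  - by apply: (measurableT_comp mG'); apply: measurable_rV_add => //; exact: measurable_cst.
  - exact: ind_ge0.
  congr (_ * _)%E; rewrite -(integral_translate (t *: h) mG' G'0).
  by apply: eq_integral => x _; congr G'; exact: addrC.
rewrite ge0_integralZr//; last 3 first.
- exact: measurable_ind.
- by move=> t _; exact: ind_ge0.
- by apply: integral_ge0 => z _.
by rewrite integral_tseg.
Qed.

End LineIntegrals.

Section LineEstimate.
Context {R : realType} {n : nat}.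
Local Notation V := 'rV[R]_n.
Local Notation mu := (@borel_rV R n).
Local Notation leb := (@lebesgue_measure R).
Variables (k l : nat) (f g : V -> R) (CL : R).

(** The only information on [f] that the main argument uses. *)
Definition line_estimate := forall rho h, 0 < rho -> cube 0 rho h ->
  {ae mu, forall x, (`|fdiff k h f x|%:E <= (CL * rho ^+ l)%:E *
    \int[leb]_t (ind (tseg k) t * (g (x + t *: h)%R)%:E))%E}.

Hypotheses (k0 : (0 < k)%N) (mf : measurable_fun setT f) (mg : measurable_fun setT g).
Hypotheses (g0 : forall x, 0 <= g x) (CL0 : 0 <= CL) (Lfg : line_estimate).

(** The line estimate integrated over [S]; the mass on [D] can be dropped, since no
    segment of [S] meets [D]. *)
Lemma integral_line_estimate (S : set (V * V)) (D : set V) y r1 r :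
  measurable S -> measurable D -> 0 < r ->
  (forall x h, S (x, h) -> cube y r1 x /\ cube 0 r h) ->
  (forall x h t, S (x, h) -> 0 <= t <= k%:R -> ~ D (x + t *: h)) ->
  (I2 (fun z => ind S z * `|fdiff k z.2 f z.1|%:E) <=
   (CL * r ^+ l * k%:R * (2 * r) ^+ n)%:E *
   \int[mu]_z (ind (cube y (r1 + k%:R * r) `\` D) z * (g z)%:E))%E.
Proof.
move=> mS mD r0 Sc SD.
pose Q := cube y (r1 + k%:R * r) `\` D.
have mQ : measurable Q by apply: measurableD => //; exact: measurable_cube.
pose G z : \bar R := (ind Q z * (g z)%:E)%E.
have mG : measurable_fun setT G.
  by apply: emeasurable_funM; [exact: measurable_ind|exact/measurable_EFinP].
have G0 z : (0 <= G z)%E by rewrite mule_ge0 ?ind_ge0// lee_fin.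
have mfd : measurable_fun setT (fun z : V * V => `|fdiff k z.2 f z.1|%:E).
  apply/measurable_EFinP; apply: measurableT_comp => //.
  by apply: measurable_fdiff; [exact: mf|exact: measurable_snd|exact: measurable_fst].
have mI : measurable_fun setT (fun z => ind S z * `|fdiff k z.2 f z.1|%:E : \bar R)%E.
  by apply: emeasurable_funM => //; exact: measurable_ind.
have I0 z : (0 <= ind S z * `|fdiff k z.2 f z.1|%:E)%E by rewrite mule_ge0 ?ind_ge0.
have kR : (0 <= k%:R :> R) by [].
have mItv : measurable (@tseg R k) by exact: measurable_itv.
have CLr0 : (0 <= (CL * r ^+ l)%:E)%E by rewrite lee_fin mulr_ge0// exprn_ge0// ltW.
have mtxh h : measurable_fun setT (fun xt : V * measurableTypeR R => xt.1 + xt.2 *: h : V).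
  apply: measurable_rV_add; first exact: measurable_fst.
  by apply: measurable_rV_scale; [exact: measurable_snd|exact: measurable_cst].
rewrite I2_swap// /I2 /=.
apply: (@le_trans _ _ (\int[mu]_h (ind (cube 0 r) h * ((CL * r ^+ l * k%:R)%:E * \int[mu]_z G z)))%E); last first.
  rewrite ge0_integralZr//; last 3 first.
  - by apply: measurable_ind; exact: measurable_cube.
  - by move=> h _; exact: ind_ge0.
  - by rewrite mule_ge0 ?lee_fin ?mulr_ge0 ?exprn_ge0 ?(ltW r0)//; apply: integral_ge0 => z _.
  rewrite integral_indV; last exact: measurable_cube.
  by rewrite mu_cube ?(ltW r0)// muleA -EFinM [X in (X%:E * _)%E]mulrC.
apply: le_integral_ge0 => h; first by apply: integral_ge0 => x _.
have [hr|nhr] := pselect (cube 0 r h); last first.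
  rewrite ind_out// mul0e integral0_eq// => x _; rewrite ind_out ?mul0e//.
  by move=> /Sc[].
rewrite ind_in// mul1e.
pose F (xt : V * measurableTypeR R) : \bar R := (ind (tseg k) xt.2 * G (xt.1 + xt.2 *: h)%R)%E.
have mF : measurable_fun setT F.
  apply: emeasurable_funM; last exact: (measurableT_comp mG (mtxh h)).
  by apply: measurable_ind_comp => //; exact: measurable_snd.
pose P x : \bar R := (ind (cube y r1) x * \int[leb]_t (ind (tseg k) t * G (x + t *: h)%R))%E.
have P0 x : (0 <= P x)%E.
  by rewrite mule_ge0 ?ind_ge0//; apply: integral_ge0 => t _; rewrite mule_ge0 ?ind_ge0.
have mP : measurable_fun setT P.
  apply: emeasurable_funM; first by apply: measurable_ind; exact: measurable_cube.
  by apply: (@measurable_fun_fubini_tonelli_F _ _ V (measurableTypeR R) R leb F) => // z; rewrite mule_ge0 ?ind_ge0.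
apply: (@le_trans _ _ (\int[mu]_x ((CL * r ^+ l)%:E * P x))%E).
  apply: ae_ge0_le_integral => //.
  - by apply: (measurableT_comp mI); exact: pair2_measurable.
  - by move=> x _; rewrite mule_ge0.
  - exact: measurable_funeM.
  apply: filterS (Lfg r0 hr) => x hx _.
  have [xS|nxS] := pselect (S (x, h)); last by rewrite ind_out// mul0e mule_ge0.
  have [yx _] := Sc _ _ xS; rewrite ind_in// mul1e; apply: le_trans hx _; apply: lee_wpmul2l => //.
  rewrite /P (ind_in _ yx) mul1e.
  apply: le_integral_ge0 => t; first by rewrite mule_ge0 ?ind_ge0// lee_fin.
  have [tk|ntk] := pselect (tseg k t); last by rewrite !(ind_out _ ntk) !mul0e.
  rewrite !(ind_in _ tk) !mul1e /G ind_in ?mul1e//.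
  move: tk; rewrite /tseg/= in_itv/= => tk; split; last exact: SD xS tk.
  move=> i; rewrite !mxE; have := yx i; have := hr i; rewrite mxE subr0 => hi xi.
  rewrite addrAC; apply: le_trans (ler_normD _ _) _; rewrite lerD//.
  rewrite normrM; case/andP: tk => t0 tk; rewrite ger0_norm//.
  by apply: ler_pM.
rewrite ge0_integralZl// [in leRHS]EFinM -muleA; apply: lee_wpmul2l => //.
apply: le_trans (line_integral_le k y r1 (ltW r0) mG G0 hr) _.
apply: lee_wpmul2l; first by rewrite lee_fin.
apply: le_integral_ge0 => z; first by rewrite mule_ge0 ?ind_ge0.
by rewrite -[leRHS]mul1e; apply: lee_wpmul2r; rewrite ?ind_le1.
Qed.

Definition charge_cst : R :=
  2 / @eps_light R n k * CL * k.+1%:R ^+ l * k%:R * (2 * k.+1%:R) ^+ n.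

(** A heavy point must be paid for by mass of [g] near it, even after removing
    a set [D] that most segments avoid. *)
Lemma heavy_charge y s tau (Z : set (V * V)) (D : set V) : 0 < s -> 0 <= tau ->
  heavy k f y s tau -> measurable Z -> measurable D ->
  (forall x h t, badpairs k f y s tau (x, h) -> ~ Z (x, h) -> 0 <= t <= k%:R -> ~ D (x + t *: h)) ->
  (I2 (ind (badpairs k f y s tau `&` Z)) <= (@eps_light R n k / 2 * s ^+ (n + n))%:E)%E ->
  ((tau * s ^+ n)%:E <= (charge_cst * s ^+ l)%:E *
    \int[mu]_z (ind (cube y (k.+1%:R ^+ 2 * s) `\` D) z * (g z)%:E))%E.
Proof.
move=> s0 tau0 hv mZ mD ZD hZ.
have e0 := @eps_light_gt0 R n k.
pose B := badpairs k f y s tau.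
have mB : measurable B by exact: measurable_badpairs.
pose S := B `\` Z.
have mS : measurable S by exact: measurableD.
have hS : ((@eps_light R n k / 2 * s ^+ (n + n))%:E <= I2 (ind S))%E.
  have : (I2 (ind B) <= I2 (ind (B `&` Z)) + I2 (ind S))%E.
    rewrite -I2_add; last 4 first.
    - by apply: measurable_ind; exact: measurableI.
    - exact: measurable_ind.
    - by move=> z; exact: ind_ge0.
    - by move=> z; exact: ind_ge0.
    apply: le_I2 => z; first exact: ind_ge0.
    have [zB|nB] := pselect (B z); last by rewrite ind_out// adde_ge0 ?ind_ge0.
    have [zZ|nZ] := pselect (Z z).
      by rewrite (ind_in _ zB) ind_in// leeDl ?ind_ge0.
    by rewrite (ind_in _ zB) [X in (_ + X)%E]ind_in// leeDr ?ind_ge0.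
  move=> /(le_trans hv) H; have {}H := le_trans H (leeD hZ (lexx (I2 (ind S)))).
  move: (I2 (ind S)) H => J; rewrite -leeBlDl// -EFinB; apply: le_trans.
  by rewrite lee_fin le_eqVlt; apply/orP; left; apply/eqP; field.
have ks : 0 < k.+1%:R * s by rewrite mulr_gt0.
have SC x h : S (x, h) -> cube y (k.+1%:R * s) x /\ cube 0 (k.+1%:R * s) h by move=> [[]].
have SD x h t : S (x, h) -> 0 <= t <= k%:R -> ~ D (x + t *: h).
  by move=> [Bxh Zxh]; exact: ZD.
have := integral_line_estimate mS mD ks SC SD.
rewrite (_ : k.+1%:R * s + k%:R * (k.+1%:R * s) = k.+1%:R ^+ 2 * s); last first.
  by rewrite -natr1; ring.
set I := (\int[mu]_z _)%E => H.
have : (tau%:E * I2 (ind S) <= I2 (fun z => ind S z * `|fdiff k z.2 f z.1|%:E))%E.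
  rewrite (I2_scale tau0 (measurable_ind mS) (fun z => ind_ge0 R _ z)).
  apply: le_I2 => z; first by rewrite mule_ge0 ?ind_ge0// lee_fin.
  have [zS|nS] := pselect (S z); last by rewrite ind_out// mule0 mul0e.
  by rewrite ind_in// mul1e mule1 lee_fin; case: zS => -[_ _ /ltW].
move=> /le_trans/(_ H){}H.
have {H} : ((tau * (@eps_light R n k / 2 * s ^+ (n + n)))%:E <=
   (CL * (k.+1%:R * s) ^+ l * k%:R * (2 * (k.+1%:R * s)) ^+ n)%:E * I)%E.
  by apply: le_trans H; rewrite EFinM; apply: lee_wpmul2l.
have sn : 0 < s ^+ n by rewrite exprn_gt0.
have a0 : 0 < @eps_light R n k / 2 * s ^+ n by rewrite !mulr_gt0.
rewrite (_ : tau * _ = tau * s ^+ n * (@eps_light R n k / 2 * s ^+ n)); last by rewrite exprD; ring.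
rewrite EFinM -lee_pdivlMr// => /le_trans; apply.
rewrite muleAC -EFinM lee_wpmul2r//.
  by apply: integral_ge0 => z _; rewrite mule_ge0 ?ind_ge0// lee_fin.
rewrite lee_fin le_eqVlt; apply/orP; left; apply/eqP.
rewrite /charge_cst ![(_ * _) ^+ _]exprMn_comm; try exact: mulrC.
field; by rewrite !gt_eqF.
Qed.

Hypothesis lg : forall r, (\int[mu]_z (ind (cube 0 r) z * (g z)%:E) < +oo)%E.
Hypothesis l0 : (0 < l)%N.

Lemma measurable_mu_badset s d : measurable_fun setT (fun y => mu (badset k f y s d)).
Proof.
pose S := [set z : V * V | badset k f z.1 s d z.2].
have mS : measurable S.
  rewrite (_ : S = (setT `*` cube 0 s) `&` (fun z : V * V => `|fdiff k z.2 f z.1|) @^-1` `]d, +oo[).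
    apply: measurableI; first by apply: measurableX => //; exact: measurable_cube.
    rewrite -[X in measurable X]setTI.
    have : measurable_fun setT (fun z : V * V => `|fdiff k z.2 f z.1|).
      apply: measurableT_comp => //; apply: measurable_fdiff; [exact: mf|exact: measurable_snd|exact: measurable_fst].
    by apply => //; exact: measurable_itv.
  apply/seteqP; split => -[y u]; rewrite /S/=/badset/= in_itv/= andbT; first by move=> [].
  by move=> [[]].
rewrite (_ : (fun y => _) = (fun y => \int[mu]_u ind S (y, u))%E); last first.
  apply/funext => y; rewrite -integral_indV; last exact: measurable_badset.
  by apply: eq_integral => u _; exact: ind_eq.
apply: measurable_fun_fubini_tonelli_F; first exact: measurable_ind.
by move=> z; exact: ind_ge0.
Qed.

Let Eset (d : R) (N M : nat) : set V := [set y | cube 0 N%:R y /\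
  (@eps_good R n k * (2 * 2 ^- M) ^+ n)%:E < mu (badset k f y (2 ^- M) d)]%E.

Let mEset d N M : measurable (Eset d N M).
Proof.
rewrite (_ : Eset d N M = cube 0 N%:R `&` (fun y => mu (badset k f y (2 ^- M) d)) @^-1`
   `](@eps_good R n k * (2 * 2 ^- M) ^+ n)%:E, +oo[%classic).
  apply: measurableI; first exact: measurable_cube.
  rewrite -[X in measurable X]setTI.
  by have := measurable_mu_badset (2 ^- M) d; apply => //; exact: emeasurable_itv.
by apply/seteqP; split => y; rewrite /Eset/= in_itv/= andbT.
Qed.

(** Chebyshev's inequality: the mean of the differences over steps of size [2 ^- M]
    is at most a multiple of [2 ^- M]. *)
Let muEset d N : 0 < d -> exists2 c, 0 <= c & forall M, (mu (Eset d N M) <= (c * 2 ^- M)%:E)%E.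
Proof.
move=> d0; have eg := @eps_good_gt0 R n k.
pose I := (\int[mu]_z (ind (cube 0 (N%:R + k%:R)) z * (g z)%:E))%E.
have Ifin : I \is a fin_num.
  rewrite ge0_fin_numE ?lg//; apply: integral_ge0 => z _.
  by rewrite mule_ge0 ?ind_ge0// lee_fin.
have I0 : 0 <= fine I.
  by apply: fine_ge0; apply: integral_ge0 => z _; rewrite mule_ge0 ?ind_ge0// lee_fin.
exists (CL * k%:R * fine I / (d * @eps_good R n k)).
  by rewrite divr_ge0 ?mulr_ge0// ltW.
move=> M; pose s : R := 2 ^- M.
have s0 : 0 < s by rewrite invr_gt0 exprn_gt0.
have s1 : s <= 1 by rewrite invf_le1 ?exprn_gt0// exprn_ege1// ler1n.
pose S := [set z : V * V | cube 0 N%:R z.1 /\ badset k f z.1 s d z.2].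
have mS : measurable S.
  rewrite (_ : S = (cube 0 N%:R `*` cube 0 s) `&` (fun z : V * V => `|fdiff k z.2 f z.1|) @^-1` `]d, +oo[).
    apply: measurableI; first by apply: measurableX => //; exact: measurable_cube.
    rewrite -[X in measurable X]setTI.
    have : measurable_fun setT (fun z : V * V => `|fdiff k z.2 f z.1|).
      apply: measurableT_comp => //; apply: measurable_fdiff; [exact: mf|exact: measurable_snd|exact: measurable_fst].
    by apply => //; exact: measurable_itv.
  apply/seteqP; split => -[y u]; rewrite /S/=/badset/= in_itv/= andbT; first by move=> [? []].
  by move=> [[]].
have sn : 0 < (2 * s) ^+ n by rewrite exprn_gt0// mulr_gt0.
have H1 := @integral_line_estimate S set0 0 N%:R s mS measurable0 s0.
have {}H1 : (I2 (fun z => ind S z * `|fdiff k z.2 f z.1|%:E) <= (CL * s ^+ l * k%:R * (2 * s) ^+ n)%:E * I)%E.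
  apply: le_trans (H1 _ _) _; first by move=> x h [Nx []].
    by move=> x h t _ _ [].
  apply: lee_wpmul2l; first by rewrite lee_fin !mulr_ge0 ?exprn_ge0 ?mulr_ge0// ltW.
  apply: le_integral_ge0 => z; first by rewrite mule_ge0 ?ind_ge0// lee_fin.
  rewrite lee_wpmul2r ?lee_fin//; apply: le_ind => -[hz _].
  by apply: cube_subset hz; rewrite lerD2l ler_piMr.
have H2 : (mu (Eset d N M) * (d * (@eps_good R n k * (2 * s) ^+ n))%:E <= I2 (fun z => ind S z * `|fdiff k z.2 f z.1|%:E))%E.
  rewrite -integral_indV; last exact: mEset.
  rewrite -ge0_integralZr//; last 3 first.
  - by apply: measurable_ind; exact: mEset.
  - by move=> y _; exact: ind_ge0.
  - by rewrite lee_fin !mulr_ge0// ltW.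
  apply: le_integral_ge0 => y; first by rewrite mule_ge0 ?ind_ge0// lee_fin !mulr_ge0// ltW.
  have [yE|nE] := pselect (Eset d N M y); last first.
    rewrite ind_out// mul0e; apply: integral_ge0 => u _; by rewrite mule_ge0 ?ind_ge0.
  rewrite ind_in// mul1e EFinM; case: yE => Ny /ltW yE.
  apply: (@le_trans _ _ (d%:E * mu (badset k f y s d))%E).
    by apply: lee_wpmul2l => //; rewrite lee_fin ltW.
  have mb : measurable_fun setT (ind (badset k f y s d) : V -> \bar R).
    by apply: measurable_ind; exact: measurable_badset.
  rewrite -integral_indV; last exact: measurable_badset.
  rewrite -ge0_integralZl//; last 2 first.
  - by move=> u _; exact: ind_ge0.
  - by rewrite lee_fin ltW.
  apply: le_integral_ge0 => u; first by rewrite mule_ge0 ?ind_ge0// lee_fin ltW.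
  have [ub|nb] := pselect (badset k f y s d u); last first.
    by rewrite ind_out// mule0 mule_ge0 ?ind_ge0.
  by rewrite !ind_in// mule1 mul1e lee_fin; case: ub => _ /ltW.
have de : 0 < d * (@eps_good R n k * (2 * s) ^+ n) by rewrite !mulr_gt0.
move: (le_trans H2 H1); rewrite -lee_pdivlMr// -(fineK Ifin) => /le_trans; apply.
rewrite -!EFinM lee_fin.
rewrite (_ : _ / _ = CL * k%:R * fine I / (d * @eps_good R n k) * s ^+ l); last first.
  by field; rewrite !gt_eqF.
rewrite ler_wpM2l//; first by rewrite divr_ge0 ?mulr_ge0// ltW.
by case: (l) l0 => // l' _; rewrite exprS ler_piMr ?exprn_ile1// ltW.
Qed.

Let Eset_null d N M0 : 0 < d -> {ae mu, forall y, ~ (forall M, (M0 <= M)%N -> Eset d N M y)}.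
Proof.
move=> d0; have [c c0 hc] := muEset N d0.
pose E := \bigcap_(M in [set M | (M0 <= M)%N]) Eset d N M.
have mE : measurable E by apply: bigcap_measurable => [|M _]; [exists M0 => /=|exact: mEset].
exists E; split => //; last by move=> y /= /contrapT h M /= hM; exact: h.
apply/eqP; rewrite eq_le measure_ge0 andbT.
apply/lee_addgt0Pr => e e0; rewrite add0e.
pose M := maxn M0 (Num.bound (c / e)).
apply: (@le_trans _ _ (mu (Eset d N M))).
  apply: le_measure; rewrite ?inE; [exact: mE|exact: mEset|].
  by apply: bigcap_inf => /=; exact: leq_maxl.
apply: le_trans (hc M) _; rewrite lee_fin ler_pdivrMr ?exprn_gt0//.
rewrite mulrC -ler_pdivrMr//.
apply: ltW; apply: lt_le_trans (archi_boundP (divr_ge0 c0 (ltW e0))) _.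
rewrite -natrX ler_nat; apply: leq_trans (leq_maxr M0 _) _.
exact/ltnW/ltn_expl.
Qed.

(** At almost every point the differences tend to zero in measure with the
    step; a Borel-Cantelli argument, since their means decay geometrically. *)
Lemma ae_regular : {ae mu, forall y, regular k f y}.
Proof.
have H : {ae mu, forall y, forall j N M0 : nat,
    ~ (forall M, (M0 <= M)%N -> Eset (j.+1%:R^-1) N M y)}.
  apply: ae_foralln => j; apply: ae_foralln => N; apply: ae_foralln => M0.
  by apply: Eset_null; rewrite invr_gt0.
apply: filterS H => y H d d0 M0.
have [N hN] := rV_bounded y 0.
pose j := Num.bound d^-1.
have jd : j.+1%:R^-1 <= d.
  rewrite -[leRHS]invrK lef_pV2 ?posrE ?invr_gt0//.
  apply/ltW; apply: lt_trans (archi_boundP (ltW _)) _; first by rewrite invr_gt0.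
  by rewrite ltr_nat.
have /existsNP[M /not_implyP[MM hM]] := H j N M0.
exists M => //; apply: (good_mono mf jd); rewrite /good leNgt; apply/negP => hb.
apply: hM; split => // i; rewrite mxE subr0; have := hN i; by rewrite addr0.
Qed.

End LineEstimate.

(** * Thick sets and their weighted mass *)

Section RealLemmas.
Context {R : realType}.

Lemma powR_lt1 (x a : R) : 0 < x < 1 -> 0 < a -> 0 < x `^ a < 1.
Proof.
move=> /andP[x0 x1] a0; rewrite powR_gt0//= (_ : 1 = 1 `^ a :> R); last by rewrite powR1.
by apply: gt0_ltr_powR; rewrite ?nnegrE// ltW.
Qed.

Lemma powRX (x a : R) i : 0 <= x -> (x ^+ i) `^ a = (x `^ a) ^+ i.
Proof.
move=> x0; elim: i => [|i IH]; first by rewrite !expr0 powR1.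
by rewrite !exprS powRM ?exprn_ge0// IH.
Qed.

Lemma geo_sum_le_lt1 (a0 rho kap X : R) L : 0 < a0 -> 0 < rho < 1 -> 0 < kap -> 0 <= X ->
  \sum_(i < L) (if a0 * rho ^+ i <= X then (a0 * rho ^+ i) `^ kap else 0) <=
  (1 - rho `^ kap)^-1 * X `^ kap.
Proof.
move=> a00 r01 k0 X0; have /andP[r0 r1] := r01.
have /andP[th0 th1] := powR_lt1 r01 k0.
elim: L a0 a00 => [|L IH] a0 a00.
  by rewrite big_ord0 mulr_ge0 ?powR_ge0// invr_ge0 subr_ge0 ltW.
have [aX|aX] := leP a0 X; last first.
  rewrite big_ord_recl/= expr0 mulr1 (lt_geF aX) add0r.
  have := IH (a0 * rho) (mulr_gt0 a00 r0); apply: le_trans.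
  by rewrite le_eqVlt; apply/orP; left; apply/eqP; apply: eq_bigr => i _; rewrite /bump/= add1n exprS mulrA.
apply: (@le_trans _ _ (\sum_(i < L.+1) a0 `^ kap * (rho `^ kap) ^+ i)).
  apply: ler_sum => i _; case: ifP => _; last by rewrite mulr_ge0 ?powR_ge0// exprn_ge0// powR_ge0.
  by rewrite powRM ?(ltW a00) ?exprn_ge0 ?(ltW r0)// powRX// ltW.
rewrite -mulr_sumr mulrC; apply: ler_pM.
- by apply: sumr_ge0 => i _; rewrite exprn_ge0// ltW.
- exact: powR_ge0.
- by apply: sum_geo_le; rewrite th0.
- by apply: ge0_ler_powR; rewrite ?nnegrE// ltW.
Qed.

(** The terms of a geometric sequence below a threshold sum to a multiple of the
    threshold, whichever way the sequence goes. *)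
Lemma geo_sum_le (rho kap : R) : 0 < rho -> rho != 1 -> 0 < kap ->
  exists2 C, 0 <= C & forall a0 X L, 0 < a0 -> 0 <= X ->
  \sum_(i < L) (if a0 * rho ^+ i <= X then (a0 * rho ^+ i) `^ kap else 0) <= C * X `^ kap.
Proof.
move=> r0 r1 k0.
have main (r : R) : 0 < r < 1 -> 0 <= (1 - r `^ kap)^-1.
  by move=> r01; have /andP[_ /ltW] := powR_lt1 r01 k0; rewrite invr_ge0 subr_ge0.
have [rl|rg|re] := ltgtP rho 1; last by rewrite re eqxx in r1.
  exists (1 - rho `^ kap)^-1; first by rewrite main// r0.
  by move=> a0 X L a00 X0; apply: geo_sum_le_lt1; rewrite ?r0.
have rV : 0 < rho^-1 < 1 by rewrite invr_gt0 r0 invf_lt1.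
exists (1 - rho^-1 `^ kap)^-1; first exact: main.
move=> a0 X L a00 X0; rewrite (reindex_inj rev_ord_inj)/=.
case: L => [|L]; first by rewrite big_ord0 mulr_ge0 ?powR_ge0 ?main.
have a1 : 0 < a0 * rho ^+ L by rewrite mulr_gt0// exprn_gt0.
apply: le_trans (geo_sum_le_lt1 L.+1 a1 rV k0 X0).
rewrite le_eqVlt; apply/orP; left; apply/eqP; apply: eq_bigr => i _.
have iL : (i <= L)%N by rewrite -ltnS.
rewrite (_ : a0 * rho ^+ (L.+1 - i.+1) = a0 * rho ^+ L * rho^-1 ^+ i)//.
rewrite subSS -mulrA; congr (_ * _).
have -> : rho ^+ L = rho ^+ (L - i) * rho ^+ i by rewrite -exprD subnK.
by rewrite exprVn mulfK// expf_neq0// gt_eqF.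
Qed.

Lemma count_close (L M : nat) (P : pred nat) :
  (forall i j, (i < L)%N -> (j < L)%N -> P i -> P j -> (i <= j)%N -> (j < i + M)%N) ->
  (\sum_(i < L) P i <= M)%N.
Proof.
move=> H; rewrite -(big_mkord xpredT (fun i => nat_of_bool (P i))).
have -> : (\sum_(0 <= i < L) P i)%N = size (seq.filter P (iota 0 L)).
  by rewrite size_filter -sum1_count [RHS]big_mkcond /index_iota subn0; apply: eq_bigr => i _; case: (P i).
have [/hasP[i0 i0L Pi0]|/hasPn nP] := boolP (has P (iota 0 L)); last first.
  rewrite (_ : seq.filter _ _ = [::])//; apply/eqP; rewrite -size_eq0 size_filter.
  by rewrite eqn0Ngt -has_count; apply/hasPn.
have exP : exists i, (i < L)%N && P i by exists i0; move: i0L; rewrite mem_iota add0n => /= ->.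
case: (ex_minnP exP) => m /andP[mL Pm] mmin.
rewrite -[leqRHS](size_iota m M); apply: uniq_leq_size; first by rewrite filter_uniq// iota_uniq.
move=> i; rewrite mem_filter !mem_iota add0n => /andP[Pi /= iL].
have mi : (m <= i)%N by apply: mmin; rewrite iL.
by rewrite mi; exact: H.
Qed.

(** A number of scales to skip, large enough to beat the constant of the weight
    but only linear in it. *)
Lemma exists_gap (th C : R) : 0 < th < 1 -> 0 <= C -> exists2 D, 0 <= D & forall A, 0 <= A ->
  exists M : nat, C * A * th ^+ M <= 2^-1 /\ M%:R <= D * (1 + A).
Proof.
move=> /andP[t0 t1] C0; pose eta := th^-1 - 1.
have e0 : 0 < eta by rewrite subr_gt0 invf_gt1.
exists (2 * C / eta + 1); first by rewrite addr_ge0// divr_ge0 ?mulr_ge0// ltW.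
move=> A A0; pose x := 2 * C * A / eta.
have x0 : 0 <= x by rewrite divr_ge0 ?mulr_ge0// ltW.
exists (Num.truncn x).+1; split; last first.
  apply: (@le_trans _ _ (x + 1)).
    by rewrite -natr1 lerD2r truncn_le.
  rewrite (_ : x = 2 * C / eta * A); last by rewrite /x; ring.
  have : 0 <= 2 * C / eta by rewrite divr_ge0 ?mulr_ge0// ltW.
  by move: A0; nra.
have xM : x < (Num.truncn x).+1%:R by rewrite truncnS_gt.
set M := (Num.truncn x).+1 in xM *.
have bern : M%:R * eta <= th^-1 ^+ M.
  have -> : th^-1 = 1 + eta by rewrite /eta; lra.
  elim: M {xM} => [|M IH]; first by rewrite mul0r expr0.
  have e1 : 1 <= (1 + eta) ^+ M by rewrite exprn_ege1// lerDl ltW.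
  rewrite exprS mulrDl mul1r -natr1 mulrDl mul1r; nra.
have H : 2 * C * A <= th^-1 ^+ M.
  by apply: le_trans bern; rewrite -ler_pdivrMr//; exact: ltW.
have thM : 0 < th ^+ M by rewrite exprn_gt0.
have := ler_wpM2r (ltW thM) H; rewrite exprVn mulVf ?gt_eqF// => ?; lra.
Qed.

End RealLemmas.

Section Thick.
Context {R : realType} {n : nat}.
Local Notation V := 'rV[R]_n.
Local Notation mu := (@borel_rV R n).

Lemma measurable_subcube_ind r : measurable_fun setT
  (fun z : V * V => ind (cube z.1 r) z.2 : \bar R).
Proof.
rewrite (_ : (fun z => _) = ind [set wz : V * V | cube wz.1 r wz.2]); last first.
  by apply/funext => z; exact: ind_eq.
by apply: measurable_ind; exact: measurable_subcube.
Qed.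

Lemma cube_mass (E : set V) x y r s : measurable E -> 0 <= s ->
  cube y s `<=` E -> cube y s `<=` cube x r ->
  (((2 * s) ^+ n)%:E <= \int[mu]_z (ind (cube x r) z * ind E z))%E.
Proof.
move=> mE s0 yE yx; rewrite -(mu_cube y s0) -integral_indV; last exact: measurable_cube.
apply: le_integral_ge0 => z; first exact: ind_ge0.
have [yz|nz] := pselect (cube y s z); last by rewrite ind_out ?mule_ge0 ?ind_ge0.
by rewrite (ind_in _ yz) (ind_in _ (yE _ yz)) (ind_in _ (yx _ yz)) mule1.
Qed.

(** Near a point of [nb (nb H s) (c * s)] there is a whole cube of radius [s / 2]
    inside [nb H s]. *)
Lemma nb_mass (H : set V) (s c : R) x : 0 < s -> nb (nb H s) (c * s) x ->
  ((s ^+ n)%:E <= \int[mu]_z (ind (cube x ((c + 2) * s)) z * ind (nb H s) z))%E.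
Proof.
move=> s0 /nb_near[w /nb_near[y Hy yw] wx].
have := @cube_mass (nb H s) x y ((c + 2) * s) (s / 2) (measurable_nb H s).
rewrite (_ : 2 * (s / 2) = s); last by field.
apply; first by rewrite divr_ge0// ltW.
  by apply: nb_cube => //; rewrite ltr_pdivrMr// ltr_pMr// ltr1n.
move=> z yz; have xw : cube x (c * s) w by exact/cubeC.
have wy : cube w s y by exact/cubeC.
apply: cube_trans (cube_trans (lexx _) xw wy) yz.
by rewrite mulrDl; move: s0; lra.
Qed.

Section WithWeight.
Context (v : V -> R) (A : R).
Hypotheses (v0 : forall x, 0 <= v x) (mv : measurable_fun setT v) (A0 : 0 <= A).
Hypothesis Av : A1_at v A.

Definition vmass (E : set V) : \bar R := (\int[mu]_x (ind E x * (v x)%:E))%E.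

Lemma vmass_ge0 E : (0 <= vmass E)%E.
Proof. by apply: integral_ge0 => x _; rewrite mule_ge0 ?ind_ge0// lee_fin. Qed.

(** Neighbourhoods of a set that is thick at scale [s] have comparable mass. *)
Lemma vmass_nb (H : set V) (s c : R) : 0 < s -> 0 <= c ->
  (vmass (nb (nb H s) (c * s)) <= ((4 * (c + 2)) ^+ n * A)%:E * vmass (nb H s))%E.
Proof.
move=> s0 c0; have sn : 0 < s ^+ n by rewrite exprn_gt0.
have mE : measurable (nb H s) by exact: measurable_nb.
have mev : measurable_fun setT (fun x => (v x)%:E) by exact/measurable_EFinP.
have cs : 0 < (c + 2) * s by rewrite mulr_gt0// ltr_wpDl.
have := A1_average v0 mv A0 Av cs (measurable_ind mE) (fun x => ind_ge0 R _ x).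
rewrite (_ : 4 * ((c + 2) * s) = s * (4 * (c + 2))); last by ring.
rewrite [(s * _) ^+ n]exprMn_comm; last exact: mulrC.
rewrite -/(vmass (nb H s)) -mulrA EFinM -muleA => H1.
rewrite -(lee_pmul2l (x := (s ^+ n)%:E))//; apply: le_trans H1.
rewrite /vmass -ge0_integralZl//; last 3 first.
- by apply: emeasurable_funM => //; apply: measurable_ind; exact: measurable_nb.
- by move=> x _; rewrite mule_ge0 ?ind_ge0// lee_fin.
- by rewrite lee_fin ltW.
apply: le_integral_ge0 => x.
  by rewrite !mule_ge0 ?ind_ge0// lee_fin// ltW.
have [xN|nN] := pselect (nb (nb H s) (c * s) x); last first.
  rewrite ind_out// mul0e mule0 mule_ge0 ?lee_fin//.
  by apply: integral_ge0 => z _; rewrite mule_ge0 ?ind_ge0.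
rewrite ind_in// mul1e muleC; apply: lee_wpmul2l; first by rewrite lee_fin.
exact: nb_mass.
Qed.

End WithWeight.

End Thick.

(** * Segments that hit a thick set *)

Section Hitting.
Context {R : realType} {n : nat}.
Local Notation V := 'rV[R]_n.
Local Notation mu := (@borel_rV R n).
Local Notation leb := (@lebesgue_measure R).

Lemma A1_at1 : A1_at (fun=> 1 : R) 1 (n := n).
Proof.
move=> c r r0; apply: aeW => z _; under eq_integral do rewrite mule1.
by rewrite integral_indV ?mu_cube ?mulr1 ?(ltW r0)//; exact: measurable_cube.
Qed.

(** [A1_average] for the constant weight. *)
Lemma average_cube_le (y : V) rho r (G : V -> \bar R) : 0 < r ->
  measurable_fun setT G -> (forall z, 0 <= G z)%E ->
  (\int[mu]_x (ind (cube y rho) x * \int[mu]_z (ind (cube x r) z * G z)) <=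
   ((4 * r) ^+ n)%:E * \int[mu]_z (ind (cube y (rho + r)) z * G z))%E.
Proof.
move=> r0 mG G0.
have mG' : measurable_fun setT (fun z => ind (cube y (rho + r)) z * G z)%E.
  by apply: emeasurable_funM => //; apply: measurable_ind; exact: measurable_cube.
have := A1_average (fun=> ler01) (measurable_cst _) ler01 A1_at1 r0 mG'.
rewrite mulr1 => H.
have {}H := H (fun z => mule_ge0 (ind_ge0 R _ z) (G0 z)).
rewrite [X in (_ <= _ * X)%E](_ : _ = \int[mu]_z (ind (cube y (rho + r)) z * G z))%E in H; last first.
  by apply: eq_integral => z _; rewrite mule1.
apply: le_trans H; apply: le_integral_ge0 => x.
  by rewrite mule_ge0 ?ind_ge0//; apply: integral_ge0 => z _; rewrite mule_ge0 ?ind_ge0.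
rewrite mul1e; have [yx|nx] := pselect (cube y rho x); last first.
  by rewrite ind_out// mul0e; apply: integral_ge0 => z _; rewrite !mule_ge0 ?ind_ge0.
rewrite ind_in// mul1e; apply: le_integral_ge0 => z; first by rewrite mule_ge0 ?ind_ge0.
have [xz|nz] := pselect (cube x r z); last by rewrite ind_out// !mul0e.
rewrite ind_in// !mul1e ind_in ?mul1e//; exact: cube_trans (lexx _) yx xz.
Qed.

Variables (k : nat) (s s' c : R) (H : set V).
Hypotheses (k0 : (0 < k)%N) (s'0 : 0 < s') (ss' : s' <= s) (c0 : 0 <= c).
Let E := nb H s'.
Let kap : R := k.+1%:R.
Let phi (x : V) : \bar R := (\int[mu]_z (ind (cube x ((c + 3) * s')) z * ind E z))%E.
Let psi (z : V * V) : \bar R := (\int[leb]_t (ind (tseg k) t * phi (z.1 + t *: z.2)%R))%E.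

(** Pairs [(x, h)] whose segment stays long enough near the thick set [nb H s'];
    they include all pairs whose segment meets a neighbourhood of that set. *)
Definition hits : set (V * V) := [set z | ((s' / (kap * s) * s' ^+ n)%:E <= psi z)%E].

Let s0 : 0 < s. Proof. exact: lt_le_trans ss'. Qed.
Let kap0 : 0 < kap. Proof. by rewrite ltr0n. Qed.
Let phi0 x : (0 <= phi x)%E.
Proof. by apply: integral_ge0 => z _; rewrite mule_ge0 ?ind_ge0. Qed.
Let mE : measurable E. Proof. exact: measurable_nb. Qed.
Let mphi : measurable_fun setT phi.
Proof.
pose F (z : V * V) : \bar R := (ind (cube z.1 ((c + 3) * s')) z.2 * ind E z.2)%E.
apply: (@measurable_fun_fubini_tonelli_F _ _ V V R mu F).
  apply: emeasurable_funM; first exact: measurable_subcube_ind.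
  by apply: measurable_ind_comp => //; exact: measurable_snd.
by move=> z; rewrite mule_ge0 ?ind_ge0.
Qed.
Let psi0 z : (0 <= psi z)%E.
Proof. by apply: integral_ge0 => t _; rewrite mule_ge0 ?ind_ge0. Qed.
Let mpsi : measurable_fun setT psi.
Proof.
pose F (zt : (V * V) * measurableTypeR R) : \bar R :=
  (ind (tseg k) zt.2 * phi (zt.1.1 + zt.2 *: zt.1.2)%R)%E.
have mF : measurable_fun setT F.
  apply: emeasurable_funM.
    by apply: measurable_ind_comp; [exact: measurable_itv|exact: measurable_snd].
  apply: (measurableT_comp mphi); apply: measurable_rV_add.
    by apply: (measurableT_comp measurable_fst); exact: measurable_fst.
  apply: measurable_rV_scale; first exact: measurable_snd.
  by apply: (measurableT_comp measurable_snd); exact: measurable_fst.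
apply: (@measurable_fun_fubini_tonelli_F _ _ (V * V)%type (measurableTypeR R) R leb F) => // z.
by rewrite mule_ge0 ?ind_ge0.
Qed.

Lemma measurable_hits : measurable hits.
Proof.
rewrite (_ : hits = psi @^-1` `[(s' / (kap * s) * s' ^+ n)%:E, +oo[%classic); last first.
  by apply/seteqP; split => z; rewrite /hits/= in_itv/= andbT.
by rewrite -[X in measurable X]setTI; apply: mpsi => //; exact: emeasurable_itv.
Qed.

(** A step of size [kap * s] moves by at most [s'] during a time [s' / (kap * s)], so
    a segment that comes near the thick set stays near it for that long. *)
Lemma hits_segment x h t0 : cube 0 (kap * s) h -> 0 <= t0 <= k%:R ->
  nb E (c * s') (x + t0 *: h) -> hits (x, h).
Proof.
move=> hs /andP[t00 t0k] /nb_near[w /nb_near[y Hy yw] wx].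
have k1 : 1 <= k%:R :> R by rewrite ler1n.
have k2 : 2 <= kap by rewrite /kap ler_nat.
pose eta := s' / (kap * s).
have ks0 : 0 < kap * s by rewrite mulr_gt0.
have eta0 : 0 < eta by rewrite divr_gt0.
have eta1 : eta <= 2^-1.
  rewrite ler_pdivrMr// mulrC ler_pdivlMr//.
  by rewrite [leRHS]mulrC; apply: ler_pM => //; exact: ltW.
have etah t i : `|t - t0| <= eta -> `|(t *: h) ord0 i - (t0 *: h) ord0 i| <= s'.
  move=> tt; rewrite !mxE -mulrBl normrM.
  have := hs i; rewrite mxE subr0 => hi.
  apply: le_trans (ler_pM _ _ tt hi) _ => //.
  by rewrite /eta -mulrA mulVf ?mulr1// gt_eqF.
have near t : `|t - t0| <= eta -> ((s' ^+ n)%:E <= phi (x + t *: h))%E.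
  move=> tt.
  have := @cube_mass R n E (x + t *: h) y ((c + 3) * s') (s' / 2) mE.
  rewrite (_ : 2 * (s' / 2) = s'); last by field.
  apply; first by rewrite divr_ge0// ltW.
    by apply: nb_cube => //; rewrite ltr_pdivrMr// ltr_pMr// ltr1n.
  move=> z yz; have xx : cube (x + t *: h) s' (x + t0 *: h).
    move=> i; have := etah t i tt; rewrite !mxE distrC => hh.
    by apply: le_trans hh; rewrite le_eqVlt; apply/orP; left; apply/eqP; congr (`|_|); ring.
  have xw : cube (x + t0 *: h) (c * s') w by exact/cubeC.
  have wy : cube w s' y by exact/cubeC.
  apply: (cube_trans _ (cube_trans (lexx _) (cube_trans (lexx _) xx xw) wy) yz).
  by rewrite mulrDl; move: s'0; lra.
pose a := if t0 + eta <= k%:R then t0 else t0 - eta.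
have a0 : 0 <= a by rewrite /a; case: ifPn => //; rewrite -ltNge => ?; lra.
have ak : a + eta <= k%:R by rewrite /a; case: ifPn => //; rewrite -ltNge => ?; lra.
have at0 t : a <= t <= a + eta -> `|t - t0| <= eta.
  by rewrite /a ler_norml; case: ifPn => _ /andP[h1 h2]; apply/andP; split; lra.
pose J : set (measurableTypeR R) := `[a, a + eta]%classic.
have mJ : measurable J by exact: measurable_itv.
have muJ : leb J = eta%:E.
  transitivity (@lebesgue_measure R `[a, a + eta]%classic); first by [].
  by rewrite lebesgue_measure_itv/= lte_fin ltrDl eta0 -EFinB addrAC subrr add0r.
rewrite /hits/= -/eta EFinM muleC -muJ -(integral_ind leb mJ).
rewrite -ge0_integralZl//; last 3 first.
- exact: measurable_ind.
- by move=> t _; exact: ind_ge0.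
- by rewrite lee_fin exprn_ge0// ltW.
apply: le_integral_ge0 => t; first by rewrite mule_ge0 ?ind_ge0// lee_fin exprn_ge0// ltW.
have [tJ|nJ] := pselect (J t); last by rewrite ind_out// mule0 mule_ge0 ?ind_ge0.
rewrite ind_in// mule1; move: tJ; rewrite /J/= in_itv/= => ta.
rewrite ind_in ?mul1e; last first.
  by rewrite /tseg/= in_itv/=; case/andP: ta => h1 h2; apply/andP; split; lra.
by apply: near; exact: at0.
Qed.

Definition hit_cst : R := kap * (2 * kap) ^+ n * k%:R * (4 * (c + 3)) ^+ n.

(** The factor [s / s'] is the price of one dimension: a segment of length [s] is hit
    by a set of width [s'] much more often than the measure of the set suggests. *)
Lemma I2_hits_le (y : V) :
  (I2 (ind ((cube y (kap * s) `*` cube 0 (kap * s)) `&` hits)) <=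
   (hit_cst * s ^+ n * (s / s'))%:E *
   \int[mu]_z (ind (cube y ((kap ^+ 2 + c + 3) * s)) z * ind E z))%E.
Proof.
have ks0 : 0 < kap * s by rewrite mulr_gt0.
pose eta := s' / (kap * s) * s' ^+ n.
have eta0 : 0 < eta by rewrite mulr_gt0 ?divr_gt0// exprn_gt0.
set B := _ `&` hits; set I := (\int[mu]_z _)%E.
have mB : measurable B.
  apply: measurableI; last exact: measurable_hits.
  by apply: measurableX; exact: measurable_cube.
have I0 : (0 <= I)%E by apply: integral_ge0 => z _; rewrite mule_ge0 ?ind_ge0.
have r30 : 0 < (c + 3) * s' by rewrite mulr_gt0// ltr_wpDl.
pose F (z : V * V) : \bar R := (ind (cube 0 (kap * s)) z.2 * (ind (cube y (kap * s)) z.1 * psi z))%E.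
have F0 z : (0 <= F z)%E by rewrite !mule_ge0 ?ind_ge0.
have mF : measurable_fun setT F.
  apply: emeasurable_funM.
    by apply: measurable_ind_comp; [exact: measurable_cube|exact: measurable_snd].
  apply: emeasurable_funM => //.
  by apply: measurable_ind_comp; [exact: measurable_cube|exact: measurable_fst].
have H1 : (eta%:E * I2 (ind B) <= I2 F)%E.
  have mBi : measurable_fun setT (ind B : V * V -> \bar R) by exact: measurable_ind.
  rewrite (I2_scale (ltW eta0) mBi (fun z => ind_ge0 R _ z)).
  apply: le_I2 => z; first by rewrite mule_ge0 ?ind_ge0// lee_fin ltW.
  have [[[h1 h2] h3]|nB] := pselect (B z); last by rewrite ind_out// mule0.
  by rewrite ind_in// mule1 /F !ind_in// !mul1e.
have H2 : (I2 F <= ((2 * (kap * s)) ^+ n * k%:R * (4 * ((c + 3) * s')) ^+ n)%:E * I)%E.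
  rewrite I2_swap// /I2 /=.
  apply: (@le_trans _ _ (\int[mu]_h (ind (cube 0 (kap * s)) h * ((k%:R * (4 * ((c + 3) * s')) ^+ n)%:E * I)))%E); last first.
    rewrite ge0_integralZr//; last 3 first.
    - by apply: measurable_ind; exact: measurable_cube.
    - by move=> h _; exact: ind_ge0.
    - by rewrite mule_ge0// lee_fin mulr_ge0// exprn_ge0// mulr_ge0// ltW.
    rewrite integral_indV; last exact: measurable_cube.
    rewrite mu_cube ?(ltW ks0)// muleA -EFinM.
    by rewrite -[X in (_ <= X%:E * _)%E]mulrA.
  apply: le_integral_ge0 => h; first exact: integral_ge0.
  have [hs|nh] := pselect (cube 0 (kap * s) h); last first.
    rewrite ind_out// mul0e integral0_eq// => x _; by rewrite /F/= ind_out// mul0e.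
  rewrite ind_in// mul1e (_ : (fun x => F (x, h)) = (fun x => ind (cube y (kap * s)) x *
    \int[leb]_t (ind (tseg k) t * phi (x + t *: h)%R))%E); last first.
    by apply/funext => x; rewrite /F/= ind_in// mul1e.
  apply: le_trans (line_integral_le k y (kap * s) (ltW ks0) mphi phi0 hs) _.
  rewrite EFinM -muleA; apply: lee_wpmul2l; first by rewrite lee_fin.
  rewrite (_ : kap * s + k%:R * (kap * s) = kap ^+ 2 * s); last by rewrite /kap -natr1; ring.
  apply: le_trans (average_cube_le y (kap ^+ 2 * s) r30 (measurable_ind mE) (fun z => ind_ge0 R _ z)) _.
  apply: lee_wpmul2l; first by rewrite lee_fin exprn_ge0// mulr_ge0// ltW.
  apply: le_integral_ge0 => z; first by rewrite mule_ge0 ?ind_ge0.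
  apply: lee_wpmul2r; first exact: ind_ge0.
  apply: le_ind => zz; apply: cube_subset zz.
  rewrite -addrA [leRHS]mulrDl lerD2l ler_wpM2l//; first by rewrite addr_ge0.
have := le_trans H1 H2; rewrite muleC -lee_pdivlMr// => /le_trans; apply.
rewrite muleAC -EFinM lee_wpmul2r// lee_fin le_eqVlt; apply/orP; left; apply/eqP.
rewrite /hit_cst /eta ![(_ * _) ^+ _]exprMn_comm; try exact: mulrC.
field; rewrite !gt_eqF ?exprn_gt0//.
Qed.

End Hitting.

(** * Absorption between scales *)

Section Absorption.
Context {R : realType}.

(** A family of finite quantities, each bounded by a small share of the others
    plus a remainder, is bounded by the remainders. *)
Lemma absorb (L : nat) (W X : 'I_L -> \bar R) (c : 'I_L -> 'I_L -> R) :
  (forall i j, 0 <= c i j) -> (forall i, 0 <= W i)%E -> (forall i, W i \is a fin_num) ->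
  (forall i, 0 <= X i)%E ->
  (forall i, W i <= \sum_(j < L) (c i j)%:E * W j + X i)%E ->
  (forall j, \sum_(i < L) c i j <= 2^-1) ->
  (\sum_(i < L) W i <= 2%:E * \sum_(i < L) X i)%E.
Proof.
move=> c0 W0 Wf X0 WX c1.
have H : (\sum_(i < L) W i <= 2^-1%:E * \sum_(i < L) W i + \sum_(i < L) X i)%E.
  apply: (@le_trans _ _ (\sum_(i < L) (\sum_(j < L) (c i j)%:E * W j + X i))%E).
    by apply: lee_sum.
  rewrite big_split/=; apply: leeD => //; rewrite exchange_big/= ge0_sume_distrr//.
  apply: lee_sum => j _; rewrite -ge0_sume_distrl; last by move=> i _; rewrite lee_fin.
  by rewrite sumEFin lee_wpmul2r// lee_fin.
have Sf : (\sum_(i < L) W i)%E \is a fin_num by apply/sum_fin_numP => i _ _; exact: Wf.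
move: H; set S := (\sum_(i < L) W i)%E in Sf *; set T := (\sum_(i < L) X i)%E.
rewrite -(fineK Sf) -EFinM; case: T => [t| |] //; last by rewrite mulry gtr0_sg// mul1e leey.
  by rewrite -EFinD -EFinM !lee_fin; lra.
Qed.

Lemma gap_sum_up (th : R) (M L j : nat) : 0 < th < 1 ->
  \sum_(i < L) (if (j + M <= i)%N then th ^+ (i - j) else 0) <= th ^+ M / (1 - th).
Proof.
move=> th01; have /andP[t0 t1] := th01.
have main (m : nat) : \sum_(i < L) (if (m <= i)%N then th ^+ (i - m) else 0) <= (1 - th)^-1.
  elim: L m => [|L IH] m; first by rewrite big_ord0 invr_ge0 subr_ge0 ltW.
  case: m => [|m].
    apply: le_trans (sum_geo_le L.+1 th01).
    by apply: ler_sum => i _; rewrite subn0.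
  rewrite big_ord_recl/= add0r; apply: le_trans (IH m).
  by apply: ler_sum => i _; rewrite /bump/= add1n ltnS subSS.
apply: (@le_trans _ _ (th ^+ M * \sum_(i < L) (if (j + M <= i)%N then th ^+ (i - (j + M)) else 0))).
  rewrite mulr_sumr; apply: ler_sum => i _; case: ifPn => h; last by rewrite mulr0.
  by rewrite -exprD subnDA subnKC// leq_subRL ?(leq_trans (leq_addr _ _) h).
by rewrite ler_wpM2l// exprn_ge0// ltW.
Qed.

Lemma gap_sum_down (th : R) (M L j : nat) : 0 < th < 1 ->
  \sum_(i < L) (if (i + M <= j)%N then th ^+ (j - i) else 0) <= th ^+ M / (1 - th).
Proof.
move=> th01; have /andP[t0 t1] := th01.
have main (m : nat) : \sum_(i < L) (if (i <= m)%N then th ^+ (m - i) else 0) <= (1 - th)^-1.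
  apply: le_trans (sum_geo_le m.+1 th01).
  elim: L m => [|L IH] m; first by rewrite big_ord0 sumr_ge0// => i _; rewrite exprn_ge0// ltW.
  rewrite big_ord_recl/= subn0 addrC [leRHS]big_ord_recr/= lerD2r.
  case: m => [|m]; first by rewrite big1 ?big_ord0.
  apply: le_trans (IH m).
  by apply: ler_sum => i _; rewrite /bump/= add1n ltnS subSS.
have [Mj|jM] := leqP M j; last first.
  rewrite big1 ?divr_ge0 ?exprn_ge0 ?subr_ge0 ?ltW// => i _.
  by rewrite leqNgt (leq_trans jM) ?leq_addl.
apply: (@le_trans _ _ (th ^+ M * \sum_(i < L) (if (i <= j - M)%N then th ^+ (j - M - i) else 0))).
  rewrite mulr_sumr; apply: ler_sum => i _.
  rewrite leq_subRL// [(M + i)%N]addnC; case: ifPn => h; last by rewrite mulr0.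
  rewrite -exprD subnAC subnKC// leq_subRL ?(leq_trans (leq_addr _ _) h)//.
by rewrite ler_wpM2l// exprn_ge0// ltW.
Qed.

End Absorption.

Section WeightedStep.
Context {R : realType} {n : nat}.
Local Notation V := 'rV[R]_n.
Local Notation mu := (@borel_rV R n).
Context (v : V -> R) (A : R).
Hypotheses (v0 : forall x, 0 <= v x) (mv : measurable_fun setT v) (A0 : 0 <= A).
Hypothesis Av : A1_at v A.

Let mev : measurable_fun setT (fun x => (v x)%:E). Proof. exact/measurable_EFinP. Qed.

Lemma measurable_average r (G : V -> \bar R) : measurable_fun setT G ->
  (forall z, 0 <= G z)%E ->
  measurable_fun setT (fun w => \int[mu]_z (ind (cube w r) z * G z))%E.
Proof.
move=> mG G0.
pose F (z : V * V) : \bar R := (ind (cube z.1 r) z.2 * G z.2)%E.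
apply: (@measurable_fun_fubini_tonelli_F _ _ V V R mu F).
  apply: emeasurable_funM; first exact: measurable_subcube_ind.
  by apply: (measurableT_comp mG); exact: measurable_snd.
by move=> z; rewrite mule_ge0 ?ind_ge0.
Qed.

(** A pointwise bound on [E] by averages, integrated against the weight: the average
    of [G] over cubes of radius [r] costs a factor [A]. *)
Lemma weighted_step (L : nat) (E : set V) (al c r : R) (be : 'I_L -> R) (P : 'I_L -> V -> \bar R)
    (G : V -> \bar R) : 0 < r -> 0 <= al -> 0 <= c -> (forall j, 0 <= be j) ->
  (forall j, measurable_fun setT (P j)) -> (forall j w, 0 <= P j w)%E ->
  measurable_fun setT G -> (forall z, 0 <= G z)%E -> measurable E ->
  (forall w, E w -> al%:E <= \sum_(j < L) (be j)%:E * P j w +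
     c%:E * \int[mu]_z (ind (cube w r) z * G z))%E ->
  (al%:E * vmass v E <= \sum_(j < L) (be j)%:E * \int[mu]_w (P j w * (v w)%:E) +
     (c * ((4 * r) ^+ n * A))%:E * \int[mu]_z (G z * (v z)%:E))%E.
Proof.
move=> r0 al0 c0 be0 mP P0 mG G0 mE H.
pose Q w : \bar R := (\int[mu]_z (ind (cube w r) z * G z))%E.
have Q0 w : (0 <= Q w)%E by apply: integral_ge0 => z _; rewrite mule_ge0 ?ind_ge0.
have mQ : measurable_fun setT Q by exact: measurable_average.
have mPv j : measurable_fun setT (fun w => P j w * (v w)%:E)%E by exact: emeasurable_funM.
have Pv0 j w : (0 <= P j w * (v w)%:E)%E by rewrite mule_ge0// lee_fin.
have Qv0 w : (0 <= (v w)%:E * Q w)%E by rewrite mule_ge0// lee_fin.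
have mQv : measurable_fun setT (fun w => (v w)%:E * Q w)%E by exact: emeasurable_funM.
apply: (@le_trans _ _ (\int[mu]_w (\sum_(j < L) (be j)%:E * (P j w * (v w)%:E) +
    c%:E * ((v w)%:E * Q w)))%E).
  rewrite /vmass -ge0_integralZl//; last 2 first.
  - by apply: emeasurable_funM => //; exact: measurable_ind.
  - by move=> w _; rewrite mule_ge0 ?ind_ge0// lee_fin.
  apply: le_integral_ge0 => w; first by rewrite !mule_ge0 ?ind_ge0// lee_fin.
  have S0 : (0 <= \sum_(j < L) (be j)%:E * (P j w * (v w)%:E))%E.
    by apply: sume_ge0 => j _; rewrite mule_ge0// lee_fin.
  have [Ew|nE] := pselect (E w); last first.
    by rewrite ind_out// mul0e mule0 adde_ge0// mule_ge0// lee_fin.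
  rewrite ind_in// mul1e.
  apply: (@le_trans _ _ ((\sum_(j < L) (be j)%:E * P j w + c%:E * Q w) * (v w)%:E)%E).
    by apply: lee_wpmul2r; [rewrite lee_fin|exact: H].
  rewrite ge0_muleDl; last 2 first.
  - by apply: sume_ge0 => j _; rewrite mule_ge0// lee_fin.
  - by rewrite mule_ge0// lee_fin.
  apply: leeD; last by rewrite -muleA [X in (_ * X)%E]muleC.
  rewrite ge0_sume_distrl; last by move=> j _; rewrite mule_ge0// lee_fin.
  by apply: lee_sum => j _; rewrite muleA.
rewrite ge0_integralD//; last 4 first.
- by move=> w _; apply: sume_ge0 => j _; rewrite mule_ge0// lee_fin.
- by apply: emeasurable_sum => j; exact: measurable_funeM.
- by move=> w _; rewrite mule_ge0// lee_fin.
- exact: measurable_funeM.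
apply: leeD.
  rewrite ge0_integral_sum//; last 2 first.
  - by move=> j; exact: measurable_funeM.
  - by move=> j w _; rewrite mule_ge0// lee_fin.
  by apply: lee_sum => j _; rewrite ge0_integralZl// lee_fin.
rewrite ge0_integralZl// ?lee_fin// EFinM -muleA; apply: lee_wpmul2l; first by rewrite lee_fin.
exact: A1_average.
Qed.

End WeightedStep.

(** * The sum over all scales of the masses of thick sets *)

Lemma powR_pred {R : realType} (x p : R) : 0 <= x -> 0 < p -> x `^ p = x `^ (p - 1) * x.
Proof.
move=> x0 p0; have := @powRD R x (p - 1) 1; rewrite subrK powRr1// => -> //.
by rewrite gt_eqF.
Qed.

Section Claims.
Context {R : realType} {n : nat}.
Local Notation V := 'rV[R]_n.
Local Notation mu := (@borel_rV R n).
Variables (k l : nat) (CL b : R).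
Hypotheses (k0 : (0 < k)%N) (CL0 : 0 <= CL).

Definition chg : R := @charge_cst R n k l CL + 1.

Lemma chg_gt0 : 0 < chg.
Proof.
rewrite ltr_wpDl// /charge_cst !mulr_ge0 ?exprn_ge0 ?mulr_ge0//.
by rewrite invr_ge0 ltW// eps_light_gt0.
Qed.

Let kap : R := k.+1%:R.
Let c1 : R := kap ^+ 2 + 1.
Let kap0 : 0 < kap. Proof. by rewrite ltr0n. Qed.
Let c10 : 0 < c1. Proof. by rewrite ltr_wpDl// exprn_ge0// ltW. Qed.

(** Where [g] is below this multiple of the level, it contributes at most half of the
    mass in [thick_mass]. *)
Definition thr_cst : R := (2 * chg * (2 * c1) ^+ n)^-1.

Section Fixed.
Variables (f g v : V -> R) (A lam sig rho : R) (L : nat).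
Hypotheses (mf : measurable_fun setT f) (mg : measurable_fun setT g).
Hypotheses (g0 : forall x, 0 <= g x) (Lfg : line_estimate k l f g CL).
Hypotheses (v0 : forall x, 0 <= v x) (mv : measurable_fun setT v) (A0 : 0 <= A).
Hypotheses (Av : A1_at v A).
Hypothesis lv : forall r, (\int[mu]_z (ind (cube 0 r) z * (v z)%:E) < +oo)%E.
Hypotheses (lam0 : 0 < lam) (sig0 : 0 < sig).

Definition sc (i : nat) : R := sig * 2 ^+ i.
Definition lev (i : nat) : R := lam * sc i `^ b.
(** The cube of radius [rho] makes the masses finite, as absorption requires; the
    bounds do not depend on [rho]. *)
Definition hset (i : nat) : set V :=
  [set y | cube 0 rho y /\ heavy k f y (sc i) (lev i * sc i ^+ l)].
Definition thick (i : nat) : set V := nb (hset i) (sc i).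

Lemma sc_gt0 i : 0 < sc i. Proof. by rewrite mulr_gt0// exprn_gt0. Qed.
Lemma lev_gt0 i : 0 < lev i. Proof. by rewrite mulr_gt0// powR_gt0// sc_gt0. Qed.

Lemma levE i : lev i = lam * sig `^ b * (2 `^ b) ^+ i.
Proof.
by rewrite /lev /sc powRM ?(ltW sig0) ?exprn_ge0// powRX// mulrA.
Qed.

Lemma measurable_thick i : measurable (thick i).
Proof. exact: measurable_nb. Qed.

Let mgE : measurable_fun setT (fun x => (g x)%:E). Proof. exact/measurable_EFinP. Qed.
Let mvE : measurable_fun setT (fun x => (v x)%:E). Proof. exact/measurable_EFinP. Qed.
Let gE0 x : (0 <= (g x)%:E)%E. Proof. by rewrite lee_fin. Qed.

Lemma thick_vmass_fin i : vmass v (thick i) \is a fin_num.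
Proof.
rewrite ge0_fin_numE ?vmass_ge0//; apply: le_lt_trans (lv (rho + sc i)).
apply: le_integral_ge0 => x; first by rewrite mule_ge0 ?ind_ge0// lee_fin.
rewrite lee_wpmul2r ?lee_fin//; apply: le_ind => /nb_near[y [y0 _] yx].
exact: cube_trans y0 yx.
Qed.

(** [heavy_charge] at the level of scale [i], with the powers of the scale that
    come from the order of the derivative cancelled. *)
Lemma level_charge y i (Z : set (V * V)) (D : set V) :
  heavy k f y (sc i) (lev i * sc i ^+ l) -> measurable Z -> measurable D ->
  (forall x h t, cube 0 (kap * sc i) h -> ~ Z (x, h) -> 0 <= t <= k%:R -> ~ D (x + t *: h)) ->
  (I2 (ind ((cube y (kap * sc i) `*` cube 0 (kap * sc i)) `&` Z)) <=
     (@eps_light R n k / 2 * sc i ^+ (n + n))%:E)%E ->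
  ((lev i * sc i ^+ n)%:E <= chg%:E *
    \int[mu]_z (ind (cube y (kap ^+ 2 * sc i) `\` D) z * (g z)%:E))%E.
Proof.
move=> hv mZ mD ZD IZ.
have sl : 0 < sc i ^+ l by rewrite exprn_gt0 ?sc_gt0.
have t0 : 0 <= lev i * sc i ^+ l by rewrite mulr_ge0// ltW// lev_gt0.
have := heavy_charge mf mg g0 CL0 Lfg (sc_gt0 i) t0 hv mZ mD.
set I := (\int[mu]_z _)%E => H.
have I0 : (0 <= I)%E by apply: integral_ge0 => z _; rewrite mule_ge0 ?ind_ge0.
have {}H : ((lev i * sc i ^+ l * sc i ^+ n)%:E <= (@charge_cst R n k l CL * sc i ^+ l)%:E * I)%E.
  apply: H => [x h t [_ hs _] nZ ht|]; first exact: ZD hs nZ ht.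
  apply: le_trans IZ; apply: le_I2 => z; first exact: ind_ge0.
  by apply: le_ind => -[[]].
rewrite -(@lee_pmul2l _ (sc i ^+ l)%:E)// -EFinM mulrCA mulrA; apply: le_trans H _.
rewrite muleA -EFinM; apply: lee_wpmul2r => //.
by rewrite lee_fin mulrC ler_wpM2l ?(ltW sl)// /chg lerDl.
Qed.

Lemma thick_mass i w : thick i w ->
  ((lev i * sc i ^+ n)%:E <= chg%:E * \int[mu]_z (ind (cube w (c1 * sc i)) z * (g z)%:E))%E.
Proof.
move=> /nb_near[y [_ hv] yw].
have := @level_charge y i set0 set0 hv measurable0 measurable0.
rewrite setI0 setD0 (_ : I2 _ = 0%E); last first.
  by rewrite /I2 integral0_eq// => x _; rewrite integral0_eq// => z _; rewrite ind_out.
move=> H; apply: le_trans (H _ _) _.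
- by move=> ? ? ? _ _ _ [].
- by rewrite lee_fin mulr_ge0 ?exprn_ge0 ?(ltW (sc_gt0 i))// divr_ge0// ltW// eps_light_gt0.
apply: lee_wpmul2l; first by rewrite lee_fin ltW// chg_gt0.
apply: le_integral_ge0 => z; first by rewrite mule_ge0 ?ind_ge0.
apply: lee_wpmul2r => //; apply: le_ind => yz.
have wy : cube w (sc i) y by exact/cubeC.
by apply: cube_trans wy yz; rewrite /c1 mulrDl mul1r addrC.
Qed.

(** The exponents above one: only the part of [g] exceeding a multiple of the level
    matters, and each value of [g] exceeds only geometrically many levels. *)
Lemma thick_sum_gt1 (p Cg : R) : 1 < p -> 0 <= Cg ->
  (forall a0 X L, 0 < a0 -> 0 <= X ->
    \sum_(i < L) (if a0 * (2 `^ b) ^+ i <= X then (a0 * (2 `^ b) ^+ i) `^ (p - 1) else 0)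
      <= Cg * X `^ (p - 1)) ->
  (\sum_(i < L) (lev i `^ p)%:E * vmass v (thick i) <=
    (2 * chg * (4 * c1) ^+ n * Cg * thr_cst `^ (1 - p) * A)%:E *
    \int[mu]_x (g x `^ p * v x)%:E)%E.
Proof.
move=> p1 Cg0 hCg.
have ch0 := chg_gt0; pose del := thr_cst; rewrite -/del.
have d0 : 0 < del by rewrite /del /thr_cst invr_gt0 !mulr_gt0// exprn_gt0// mulr_gt0.
pose G i (z : V) : R := if del * lev i < g z then g z else 0.
have G0 i z : 0 <= G i z by rewrite /G; case: ifP.
have mG i : measurable_fun setT (G i).
  apply: measurable_fun_ifT => //.
  by apply: measurable_fun_ltr.
have step i : (i < L)%N -> ((lev i)%:E * vmass v (thick i) <=
    (2 * chg * (4 * c1) ^+ n * A)%:E * \int[mu]_z ((G i z)%:E * (v z)%:E))%E.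
  move=> iL; have s0 := sc_gt0 i; have sn : 0 < sc i ^+ n by rewrite exprn_gt0.
  have cs : 0 < c1 * sc i by rewrite mulr_gt0.
  have key w : thick i w -> ((lev i)%:E <= \sum_(j < 0) 0%:E * cst 0 w +
      (2 * chg / sc i ^+ n)%:E * \int[mu]_z (ind (cube w (c1 * sc i)) z * (G i z)%:E))%E.
    move=> /thick_mass Hw; rewrite big_ord0 add0e.
    set J := (\int[mu]_z _)%E.
    have mJ : measurable_fun setT (fun z => ind (cube w (c1 * sc i)) z * (G i z)%:E)%E.
      by apply: emeasurable_funM; [apply: measurable_ind; exact: measurable_cube|exact/measurable_EFinP].
    have J0 z : (0 <= ind (cube w (c1 * sc i)) z * (G i z)%:E)%E by rewrite mule_ge0 ?ind_ge0// lee_fin.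
    have le1 : (\int[mu]_z (ind (cube w (c1 * sc i)) z * (g z)%:E) <=
        J + (del * lev i * (2 * (c1 * sc i)) ^+ n)%:E)%E.
      apply: (@le_trans _ _ (\int[mu]_z (ind (cube w (c1 * sc i)) z * (G i z)%:E + (del * lev i)%:E * ind (cube w (c1 * sc i)) z))%E).
        apply: le_integral_ge0 => z; first by rewrite mule_ge0 ?ind_ge0.
        rewrite [X in (_ + X)%E]muleC -ge0_muleDr; last 2 first.
        - by rewrite lee_fin.
        - by rewrite lee_fin mulr_ge0 ?ltW// lev_gt0.
        rewrite lee_wpmul2l ?ind_ge0// -EFinD lee_fin /G; case: ltP => h; last by rewrite add0r.
        by rewrite lerDl mulr_ge0 ?ltW// lev_gt0.
      rewrite ge0_integralD//; last 2 first.
      - by move=> z _; rewrite mule_ge0 ?ind_ge0// lee_fin mulr_ge0 ?ltW// lev_gt0.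
      - by apply: measurable_funeM; apply: measurable_ind; exact: measurable_cube.
      rewrite leeD2l// ge0_integralZl//; last 3 first.
      - by apply: measurable_ind; exact: measurable_cube.
      - by move=> z _; exact: ind_ge0.
      - by rewrite lee_fin mulr_ge0 ?ltW// lev_gt0.
      rewrite integral_indV; last exact: measurable_cube.
      by rewrite mu_cube ?(ltW cs)// -EFinM.
    have J1 : (0 <= J)%E by exact: integral_ge0.
    have := le_trans Hw (lee_wpmul2l _ le1); rewrite lee_fin (ltW ch0) => /(_ isT).
    case: J J1 {le1} => [j| |] //.
      rewrite lee_fin => j0; rewrite -!EFinD -!EFinM !lee_fin mulrDr.
      rewrite (_ : chg * (del * lev i * (2 * (c1 * sc i)) ^+ n) = lev i * sc i ^+ n / 2); last first.
        rewrite /del /thr_cst mulrA [(2 * (c1 * sc i)) ^+ n]exprMn_comm; last exact: mulrC.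
        rewrite [(c1 * sc i) ^+ n]exprMn_comm; last exact: mulrC.
        rewrite [(2 * c1) ^+ n]exprMn_comm; last exact: mulrC.
        by field; rewrite !gt_eqF ?exprn_gt0//.
      by move=> h; rewrite mulrAC ler_pdivlMr//; lra.
    by move=> _ _; rewrite gt0_muley ?leey// lte_fin divr_gt0// mulr_gt0.
  have := @weighted_step R n v A v0 mv A0 Av 0 (thick i) (lev i) (2 * chg / sc i ^+ n) (c1 * sc i)
    (fun=> 0) (fun=> cst 0%E) (fun z => (G i z)%:E) cs (ltW (lev_gt0 i)).
  rewrite big_ord0 add0e (_ : 2 * chg / sc i ^+ n * _ = 2 * chg * (4 * c1) ^+ n * A); last first.
    have -> : (4 * (c1 * sc i)) ^+ n = (4 * c1) ^+ n * sc i ^+ n by rewrite mulrA exprMn.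
    by field; rewrite gt_eqF.
  apply => //.
  - by rewrite divr_ge0// ?mulr_ge0// ltW.
  - exact/measurable_EFinP.
  - by move=> z; rewrite lee_fin.
  - exact: measurable_thick.
pose K := 2 * chg * (4 * c1) ^+ n * A.
have K0 : 0 <= K by rewrite !mulr_ge0 ?exprn_ge0 ?mulr_ge0// ltW.
have mGv i : measurable_fun setT (fun z => (G i z)%:E * (v z)%:E)%E.
  by apply: emeasurable_funM => //; exact/measurable_EFinP.
have Gv0 i z : (0 <= (G i z)%:E * (v z)%:E)%E by rewrite mule_ge0// lee_fin.
apply: (@le_trans _ _ (\sum_(i < L) K%:E * \int[mu]_z ((lev i `^ (p - 1))%:E * ((G i z)%:E * (v z)%:E)))%E).
  apply: lee_sum => i _.
  rewrite (powR_pred (ltW (lev_gt0 i)) (lt_trans ltr01 p1)).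
  rewrite ge0_integralZl// ?lee_fin ?powR_ge0// muleCA EFinM -muleA.
  by apply: lee_wpmul2l; [rewrite lee_fin powR_ge0|exact: step].
rewrite -ge0_sume_distrr; last first.
  by move=> i _; apply: integral_ge0 => z _; rewrite mule_ge0// lee_fin powR_ge0.
rewrite (_ : 2 * chg * (4 * c1) ^+ n * Cg * del `^ (1 - p) * A = K * (Cg * del `^ (1 - p))); last by rewrite /K; ring.
rewrite [X in (_ <= X * _)%E]EFinM -[leRHS]muleA; apply: lee_wpmul2l; first by rewrite lee_fin.
rewrite -ge0_integral_sum//; last 2 first.
- by move=> i; exact: measurable_funeM.
- by move=> i z _; rewrite mule_ge0// lee_fin powR_ge0.
have C0 : 0 <= Cg * del `^ (1 - p) by rewrite mulr_ge0// powR_ge0.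
have mgp : measurable_fun setT (fun x => (g x `^ p * v x)%:E).
  apply/measurable_EFinP; apply: measurable_funM => //.
  by apply: (measurableT_comp (measurable_powR p)).
rewrite -ge0_integralZl//; last by move=> x _; rewrite lee_fin mulr_ge0// powR_ge0.
apply: le_integral_ge0 => z.
  by apply: sume_ge0 => i _; rewrite mule_ge0// lee_fin powR_ge0.
rewrite (eq_bigr (fun i : 'I_L => (lev i `^ (p - 1) * (G i z * v z))%:E)); last first.
  by [].
rewrite sumEFin -EFinM lee_fin.
apply: (@le_trans _ _ ((\sum_(i < L) (if lam * sig `^ b * (2 `^ b) ^+ i <= g z / del then
    (lam * sig `^ b * (2 `^ b) ^+ i) `^ (p - 1) else 0)) * (g z * v z))).
  rewrite mulr_suml; apply: ler_sum => i _; rewrite -levE /G.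
  have [h|h] := ltP (del * lev i) (g z).
    by rewrite ifT// ler_pdivlMr// mulrC ltW.
  by rewrite mul0r mulr0 mulr_ge0 ?mulr_ge0//; case: ifP => // _; exact: powR_ge0.
have h := hCg (lam * sig `^ b) (g z / del) L _ _.
apply: le_trans (ler_wpM2r (mulr_ge0 (g0 z) (v0 z)) (h _ _)) _.
- by rewrite mulr_gt0// powR_gt0.
- by rewrite divr_ge0// ltW.
have dV0 : 0 <= del^-1 by rewrite invr_ge0 ltW.
rewrite (powRM _ (g0 z) dV0).
have -> : del^-1 `^ (p - 1) = del `^ (1 - p).
  by rewrite -powR_inv1 ?(ltW d0)// -powRrM mulN1r opprB.
rewrite (powR_pred (g0 z) (lt_trans ltr01 p1)).
by rewrite le_eqVlt; apply/orP; left; apply/eqP; ring.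
Qed.

(** The common end of the two cases of exponent one. [Lam i] is the part of the
    space that scale [i] may charge, [beta i j] the share of scale [j] that is
    moved to scale [i]. *)
Lemma thick_sum_absorb (M : nat) (Lam : nat -> set V) (bet : 'I_L -> 'I_L -> R)
    (P : 'I_L -> 'I_L -> V -> \bar R) (c : 'I_L -> 'I_L -> R) :
  (forall i, measurable (Lam i)) ->
  (forall z, (\sum_(i < L) (z \in Lam i) <= M)%N) ->
  (forall i j, 0 <= bet i j) -> (forall i j, measurable_fun setT (P i j)) ->
  (forall i j w, 0 <= P i j w)%E -> (forall i j, 0 <= c i j) ->
  (forall (i : 'I_L) w, thick i w -> (lev i * sc i ^+ n)%:E <=
     \sum_(j < L) (bet i j)%:E * P i j w +
     chg%:E * \int[mu]_z (ind (cube w (c1 * sc i)) z * (ind (Lam i) z * (g z)%:E)))%E ->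
  (forall i j : 'I_L, (bet i j)%:E * \int[mu]_w (P i j w * (v w)%:E) <=
     (c i j * (lev j * sc i ^+ n))%:E * vmass v (thick j))%E ->
  (forall j, \sum_(i < L) c i j <= 2^-1) ->
  (\sum_(i < L) (lev i)%:E * vmass v (thick i) <=
    (2 * (chg * (4 * c1) ^+ n * A * M%:R))%:E * \int[mu]_x (g x * v x)%:E)%E.
Proof.
move=> mLam LamM bet0 mP P0 cc0 Hw HP Hc.
have ch0 := chg_gt0.
have mG i : measurable_fun setT (fun z => ind (Lam i) z * (g z)%:E)%E.
  by apply: emeasurable_funM => //; exact: measurable_ind.
have G0 i z : (0 <= ind (Lam i) z * (g z)%:E)%E by rewrite mule_ge0 ?ind_ge0.
have mGv i : measurable_fun setT (fun z => ind (Lam i) z * (g z)%:E * (v z)%:E)%E.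
  exact: emeasurable_funM.
have Gv0 i z : (0 <= ind (Lam i) z * (g z)%:E * (v z)%:E)%E by rewrite mule_ge0// lee_fin.
pose K := chg * (4 * c1) ^+ n * A.
have K0 : 0 <= K by rewrite !mulr_ge0 ?exprn_ge0 ?mulr_ge0// ltW.
pose X (i : 'I_L) : \bar R := (K%:E * \int[mu]_z (ind (Lam i) z * (g z)%:E * (v z)%:E))%E.
have X0 i : (0 <= X i)%E by rewrite mule_ge0 ?lee_fin//; exact: integral_ge0.
have WX (i : 'I_L) : ((lev i)%:E * vmass v (thick i) <=
    \sum_(j < L) (c i j)%:E * ((lev j)%:E * vmass v (thick j)) + X i)%E.
  have s0 := sc_gt0 i; have sn : 0 < sc i ^+ n by rewrite exprn_gt0.
  have cs : 0 < c1 * sc i by rewrite mulr_gt0.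
  have ls0 : 0 <= lev i * sc i ^+ n by rewrite mulr_ge0 ?ltW// lev_gt0.
  have := weighted_step v0 mv A0 Av cs ls0 (ltW ch0) (bet0 i) (mP i) (P0 i) (mG i) (G0 i) (measurable_thick i) (Hw i).
  move=> H; rewrite -(@lee_pmul2l _ (sc i ^+ n)%:E)//.
  rewrite muleA -EFinM [sc i ^+ n * _]mulrC; apply: le_trans H _.
  have T0 j : (0 <= (c i j)%:E * ((lev j)%:E * vmass v (thick j)))%E.
    apply: mule_ge0; first by rewrite lee_fin.
    by apply: mule_ge0; [rewrite lee_fin ltW// lev_gt0|exact: vmass_ge0].
  have S0 : (0 <= \sum_(j < L) (c i j)%:E * ((lev j)%:E * vmass v (thick j)))%E.
    by apply: sume_ge0 => j _; exact: T0.
  rewrite (ge0_muleDr _ S0 (X0 i)).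
  apply: leeD.
    rewrite ge0_sume_distrr; last by move=> j _; exact: T0.
    apply: lee_sum => j _; apply: le_trans (HP i j) _.
    rewrite !muleA -!EFinM lee_wpmul2r ?vmass_ge0// lee_fin.
    by rewrite le_eqVlt; apply/orP; left; apply/eqP; ring.
  rewrite /X muleA -EFinM; apply: lee_wpmul2r; first exact: integral_ge0.
  have -> : (4 * (c1 * sc i)) ^+ n = (4 * c1) ^+ n * sc i ^+ n by rewrite mulrA exprMn.
  by rewrite lee_fin /K le_eqVlt; apply/orP; left; apply/eqP; ring.
apply: le_trans (absorb cc0 _ _ X0 WX Hc) _.
- by move=> i; rewrite mule_ge0 ?vmass_ge0// lee_fin ltW// lev_gt0.
- by move=> i; rewrite fin_numM// thick_vmass_fin.
rewrite [X in (_ <= X * _)%E]EFinM -[leRHS]muleA; apply: lee_wpmul2l => //.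
rewrite /X -ge0_sume_distrr; last by move=> i _; exact: integral_ge0.
rewrite [X in (_ <= X * _)%E]EFinM -[leRHS]muleA; apply: lee_wpmul2l => //.
rewrite -ge0_integral_sum// -ge0_integralZl//; last 2 first.
- by apply/measurable_EFinP; exact: measurable_funM.
- by move=> x _; rewrite lee_fin mulr_ge0.
apply: le_integral_ge0 => z; first exact: sume_ge0.
under eq_bigr do rewrite -muleA.
rewrite -ge0_sume_distrl; last by move=> i _; exact: ind_ge0.
rewrite -EFinM; apply: lee_wpmul2r; first by rewrite lee_fin mulr_ge0.
rewrite /ind sumEFin lee_fin; apply: le_trans (_ : (\sum_(i < L) (z \in Lam i))%N%:R <= _); last first.
  by rewrite ler_nat LamM.
by rewrite natr_sum; apply: ler_sum => i _; rewrite indicE.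
Qed.

Lemma sc_shift i j : (i <= j)%N -> sc j = sc i * 2 ^+ (j - i).
Proof. by move=> ij; rewrite /sc -mulrA -exprD subnKC. Qed.

Lemma sc_le i j : (i <= j)%N -> sc i <= sc j.
Proof. by move=> ij; rewrite /sc ler_pM2l// ler_weXn2l// ler1n. Qed.

Lemma lev_shift i j : (i <= j)%N -> lev j = lev i * (2 `^ b) ^+ (j - i).
Proof. by move=> ij; rewrite (levE i) (levE j) -[RHS]mulrA -exprD subnKC. Qed.

Lemma near_thick i w z (c : R) : 0 <= c -> thick i w -> cube w (c * sc i) z ->
  nb (thick i) ((c + 1) * sc i) z.
Proof.
move=> c0 iw wz; apply: nb_cube iw _ _ wz.
by rewrite mulrDl mul1r ltrDl sc_gt0.
Qed.

Let C1 : R := c1 + 1.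
Let C10 : 0 <= C1. Proof. by rewrite addr_ge0// ltW. Qed.

(** Exponent one, positive [b]: the coarse scales dominate, so the mass near a coarse
    thick set is not charged again by the finer scales, whose thick sets near it are
    a small part of its own mass. *)
Lemma thick_sum_pos (K0 : R) (M : nat) :
  0 < b -> K0 = (4 * (2 * C1 + 2)) ^+ n ->
  K0 / (1 - 2 `^ (- b)) * A * (2 `^ (- b)) ^+ M <= 2^-1 ->
  (\sum_(i < L) (lev i)%:E * vmass v (thick i) <=
    (2 * (chg * (4 * c1) ^+ n * A * M%:R))%:E * \int[mu]_x (g x * v x)%:E)%E.
Proof.
move=> b0 K0E HM.
pose th : R := 2 `^ (- b).
have th01 : 0 < th < 1 by rewrite /th -mulN1r powRrM powR_inv1//; apply: powR_lt1 => //; lra.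
pose Lam i : set V := nb (thick i) (C1 * sc i) `&`
  ~` \bigcup_(j in [set j | (j < L)%N /\ (i + M <= j)%N]) nb (thick j) (C1 * sc j).
pose bet (i j : 'I_L) := if (i + M <= j)%N then lev i * sc i ^+ n else 0.
pose P (i j : 'I_L) : V -> \bar R := ind (nb (thick j) (2 * C1 * sc j)).
pose c (i j : 'I_L) := if (i + M <= j)%N then K0 * A * th ^+ (j - i) else 0.
have K00 : 0 <= K0 by rewrite K0E exprn_ge0// mulr_ge0// addr_ge0// mulr_ge0.
apply: (@thick_sum_absorb M Lam bet P c).
- move=> i; apply: measurableI; first exact: measurable_nb.
  by apply: measurableC; apply: bigcup_measurable => j _; exact: measurable_nb.
- move=> z; apply: (@count_close _ _ (fun i => z \in Lam i)) => i j iL jL /set_mem[_ zi] /set_mem[zj _] ij.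
  by rewrite ltnNge; apply/negP => iMj; apply: zi; exists j.
- by move=> i j; rewrite /bet; case: ifP => // _; rewrite mulr_ge0 ?exprn_ge0// ltW// ?lev_gt0 ?sc_gt0.
- by move=> i j; apply: measurable_ind; exact: measurable_nb.
- by move=> i j w; exact: ind_ge0.
- by move=> i j; rewrite /c; case: ifP => // _; rewrite !mulr_ge0// exprn_ge0// powR_ge0.
- move=> i w iw.
  have [[j [iMj jw]]|nj] := pselect (exists j : 'I_L, (i + M <= j)%N /\ nb (thick j) (2 * C1 * sc j) w).
    rewrite (bigD1 j)//= {1}/bet iMj /P ind_in// mule1 -addeA leeDl//.
    apply: adde_ge0.
      apply: sume_ge0 => j' _; rewrite mule_ge0 ?ind_ge0// lee_fin /bet; case: ifP => // _.
      by rewrite mulr_ge0 ?exprn_ge0// ltW// ?lev_gt0 ?sc_gt0.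
    rewrite mule_ge0 ?lee_fin ?(ltW chg_gt0)//; apply: integral_ge0 => z _.
    by rewrite !mule_ge0 ?ind_ge0.
  apply: le_trans (thick_mass iw) _.
  rewrite -[leLHS]add0e; apply: leeD.
    apply: sume_ge0 => j' _; rewrite mule_ge0 ?ind_ge0// lee_fin /bet; case: ifP => // _.
    by rewrite mulr_ge0 ?exprn_ge0// ltW// ?lev_gt0 ?sc_gt0.
  apply: lee_wpmul2l; first by rewrite lee_fin ltW// chg_gt0.
  apply: le_integral_ge0 => z; first by rewrite mule_ge0 ?ind_ge0.
  have [wz|nwz] := pselect (cube w (c1 * sc i) z); last by rewrite ind_out// !mul0e.
  rewrite ind_in// [X in (_ <= 1 * (X * _))%E]ind_in ?mul1e//; split.
    by apply: near_thick iw wz; exact: ltW.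
  move=> [j [jL iMj] jz]; apply: nj; exists (Ordinal jL); split => //=.
  have [y [t [jy ts yz]]] := jz.
  exists y, (t + c1 * sc i); split => //; last first.
    by apply: cube_trans (lexx _) yz _; exact/cubeC.
  have h : c1 * sc i <= c1 * sc j.
    by rewrite ler_pM2l// sc_le//; exact: leq_trans (leq_addr _ _) iMj.
  have := sc_gt0 j; rewrite /C1 in ts *; lra.
- move=> i j; rewrite /bet /c; case: ifPn => iMj; last by rewrite !mul0r !mul0e.
  have ij : (i <= j)%N by exact: leq_trans (leq_addr _ _) iMj.
  have := @vmass_nb _ _ v A v0 mv A0 Av (hset j) (sc j) (2 * C1) (sc_gt0 j).
  rewrite -/(thick j) -K0E mulr_ge0// => /(_ isT) h.
  apply: (@le_trans _ _ ((lev i * sc i ^+ n)%:E * ((K0 * A)%:E * vmass v (thick j)))%E).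
    apply: lee_wpmul2l h; rewrite lee_fin mulr_ge0 ?exprn_ge0// ltW// ?lev_gt0 ?sc_gt0//.
  rewrite muleA -EFinM; apply: lee_wpmul2r; first exact: vmass_ge0.
  rewrite lee_fin (lev_shift ij) le_eqVlt; apply/orP; left; apply/eqP.
  rewrite /th powRN exprVn; field.
  by rewrite expf_neq0// gt_eqF// powR_gt0.
- move=> j; apply: le_trans HM.
  rewrite (_ : _ / _ * _ * _ = K0 * A * (th ^+ M / (1 - th))); last by rewrite /th; ring.
  apply: le_trans (ler_wpM2l _ (gap_sum_down M L j th01)); last exact: mulr_ge0.
  rewrite mulr_sumr; apply: ler_sum => i _; rewrite /c; case: ifP => // _.
  by rewrite mulr0.
Qed.

Let c4 : R := kap ^+ 2 + C1 + 4.
(** Turns the bound of [I2_hits_le] into half of the share of pairs that defines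
    heaviness. *)
Definition hit_share : R := 2 * @hit_cst R n k C1 / @eps_light R n k.

(** Exponent one, [b < -1]: the fine scales dominate. A cube of scale [i] is charged
    off the fine thick sets, unless segments hit those so often that they fill a
    large part of a comparable cube. *)
Lemma thick_sum_neg (K0 : R) (M : nat) :
  b < -1 -> K0 = hit_share * (4 * c4) ^+ n ->
  K0 / (1 - 2 `^ (b + 1)) * A * (2 `^ (b + 1)) ^+ M <= 2^-1 ->
  (\sum_(i < L) (lev i)%:E * vmass v (thick i) <=
    (2 * (chg * (4 * c1) ^+ n * A * M%:R))%:E * \int[mu]_x (g x * v x)%:E)%E.
Proof.
move=> b0 K0E HM.
have e0 := @eps_light_gt0 R n k.
pose th : R := 2 `^ (b + 1).
have th01 : 0 < th < 1.
  rewrite /th (_ : b + 1 = -1 * (- (b + 1))); last by rewrite mulN1r opprK.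
  by rewrite powRrM powR_inv1//; apply: powR_lt1 => //; lra.
have c40 : 0 < c4 by rewrite /c4 ltr_wpDl// addr_ge0// exprn_ge0// ltW.
have hc0 : 0 <= @hit_cst R n k C1.
  by rewrite /hit_cst !mulr_ge0// exprn_ge0// mulr_ge0// addr_ge0.
have hs0 : 0 <= hit_share by apply: divr_ge0; [exact: mulr_ge0|exact: ltW].
pose fine i := [set j | (j < L)%N /\ (j + M <= i)%N].
pose DD i : set V := \bigcup_(j in fine i) nb (thick j) (C1 * sc j).
pose ZZ i : set (V * V) := \bigcup_(j in fine i) hits k (sc i) (sc j) C1 (hset j).
have mDD i : measurable (DD i) by apply: bigcup_measurable => j _; exact: measurable_nb.
pose Lam i : set V := nb (thick i) (C1 * sc i) `&` ~` DD i.
pose bet (i j : 'I_L) := if (j + M <= i)%N then hit_share * lev i * (sc i / sc j) else 0.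
pose P (i j : 'I_L) (w : V) : \bar R := (\int[mu]_z (ind (cube w (c4 * sc i)) z * ind (thick j) z))%E.
pose c (i j : 'I_L) := if (j + M <= i)%N then K0 * A * th ^+ (i - j) else 0.
have K00 : 0 <= K0 by rewrite K0E mulr_ge0// exprn_ge0// mulr_ge0// ltW.
have hls i j : 0 <= hit_share * lev i * (sc i / sc j).
  apply: mulr_ge0; first by apply: mulr_ge0 => //; exact: ltW (lev_gt0 i).
  by apply: divr_ge0; exact: ltW (sc_gt0 _).
have bet0 i j : 0 <= bet i j by rewrite /bet; case: ifP => // _; exact: hls.
have P0 i j w : (0 <= P i j w)%E by apply: integral_ge0 => z _; rewrite mule_ge0 ?ind_ge0.
have mth j : measurable (thick j) by exact: measurable_nb.
apply: (@thick_sum_absorb M Lam bet P c) => //.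
- by move=> i; apply: measurableI; [exact: measurable_nb|exact: measurableC].
- move=> z; apply: (@count_close _ _ (fun i => z \in Lam i)) => i j iL jL /set_mem[zi _] /set_mem[_ zj] ij.
  by rewrite ltnNge; apply/negP => iMj; apply: zj; exists i.
- by move=> i j; apply: measurable_average; [exact: measurable_ind|move=> z; exact: ind_ge0].
- by move=> i j; rewrite /c; case: ifP => // _; rewrite !mulr_ge0// exprn_ge0// powR_ge0.
- move=> i w iw.
  have s0 := sc_gt0 i; have sn0 : 0 < sc i ^+ n by rewrite exprn_gt0.
  have lv0 := lev_gt0 i.
  have S0 : (0 <= \sum_(j < L) (bet i j)%:E * P i j w)%E.
    by apply: sume_ge0 => j _; apply: mule_ge0; rewrite ?lee_fin.
  have J0 : (0 <= chg%:E * \int[mu]_z (ind (cube w (c1 * sc i)) z * (ind (Lam i) z * (g z)%:E)))%E.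
    rewrite mule_ge0 ?lee_fin ?(ltW chg_gt0)//; apply: integral_ge0 => z _.
    by rewrite !mule_ge0 ?ind_ge0.
  have [big|small] := leP (lev i * sc i ^+ n)%:E (\sum_(j < L) (bet i j)%:E * P i j w)%E.
    by rewrite -[leLHS]adde0; apply: leeD.
  have [y [_ hv] yw] := nb_near iw.
  rewrite -[leLHS]add0e; apply: leeD => //.
  have wy : cube w (sc i) y by exact/cubeC.
  have mZZ : measurable (ZZ i) by apply: bigcup_measurable => j _; exact: measurable_hits.
  apply: le_trans (@level_charge y i (ZZ i) (DD i) hv mZZ (mDD i) _ _) _.
  + move=> x h t hs nZ ht [j [jL jMi] jx]; apply: nZ; exists j => //.
    apply: hits_segment hs ht jx => //; first exact: sc_gt0.
    by apply: sc_le; exact: leq_trans (leq_addr _ _) jMi.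
  + set Bx := (_ `*` _).
    apply: (@le_trans _ _ (\sum_(j < L | (j + M <= i)%N) I2 (ind (Bx `&` hits k (sc i) (sc j) C1 (hset j))))%E).
      rewrite -big_filter -I2_sum; last 2 first.
      * move=> j; apply: measurable_ind; apply: measurableI; last exact: measurable_hits.
        by apply: measurableX; exact: measurable_cube.
      * by move=> j z; exact: ind_ge0.
      apply: le_I2 => z; first exact: ind_ge0.
      rewrite big_filter; have [[Bz [j [jL jMi] jz]]|nz] := pselect ((Bx `&` ZZ i) z); last first.
        by rewrite ind_out//; apply: sume_ge0 => j _; exact: ind_ge0.
      rewrite (bigD1 (Ordinal jL))//= [X in (_ <= X + _)%E]ind_in//.
      rewrite -[leLHS]adde0; apply: leeD; first exact: ind_le1.
      by apply: sume_ge0 => j' _; exact: ind_ge0.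
    apply: (@le_trans _ _ ((@eps_light R n k / 2 * sc i ^+ n / lev i)%:E * \sum_(j < L) (bet i j)%:E * P i j w)%E).
      rewrite ge0_sume_distrr; last by move=> j _; apply: mule_ge0; rewrite ?lee_fin.
      rewrite big_mkcond/=; apply: lee_sum => j _; rewrite /bet; case: ifPn => jMi; last first.
        by rewrite mul0e mule0.
      have ji : (j <= i)%N by exact: leq_trans (leq_addr _ _) jMi.
      apply: le_trans (I2_hits_le k (hset j) (sc_gt0 j) (sc_le ji) C10 y) _.
      rewrite muleA -EFinM.
      rewrite (_ : @eps_light R n k / 2 * sc i ^+ n / lev i * (hit_share * lev i * (sc i / sc j)) =
        @hit_cst R n k C1 * sc i ^+ n * (sc i / sc j)); last first.
        by rewrite /hit_share; field; rewrite !gt_eqF// sc_gt0.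
      apply: lee_wpmul2l.
        rewrite lee_fin; apply: mulr_ge0; first by apply: mulr_ge0 => //; exact: ltW.
        by apply: divr_ge0; exact: ltW (sc_gt0 _).
      apply: le_integral_ge0 => z; first by rewrite mule_ge0 ?ind_ge0.
      apply: lee_wpmul2r; first exact: ind_ge0.
      apply: le_ind => yz; apply: cube_trans wy yz.
      by rewrite /c4 le_eqVlt; apply/orP; left; apply/eqP; rewrite /kap; ring.
    apply: le_trans (lee_wpmul2l _ (ltW small)) _.
      rewrite lee_fin; apply: divr_ge0; last exact: ltW.
      by apply: mulr_ge0; [apply: divr_ge0 => //; exact: ltW|exact: ltW].
    rewrite -EFinM lee_fin exprD le_eqVlt; apply/orP; left; apply/eqP.
    by field; rewrite gt_eqF.
  apply: lee_wpmul2l; first by rewrite lee_fin ltW// chg_gt0.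
  apply: le_integral_ge0 => z; first by rewrite mule_ge0 ?ind_ge0.
  rewrite muleA; apply: lee_wpmul2r => //.
  have [[yz nD]|nz] := pselect ((cube y (kap ^+ 2 * sc i) `\` DD i) z); last first.
    by rewrite ind_out// mule_ge0 ?ind_ge0.
  have wz : cube w (c1 * sc i) z by apply: cube_trans wy yz; rewrite /c1 mulrDl mul1r addrC.
  rewrite [X in (_ <= X * _)%E]ind_in// mul1e; apply: le_ind => _; split => //.
  by apply: near_thick iw wz; exact: ltW.
- move=> i j; rewrite /bet /c; case: ifPn => jMi; last by rewrite !mul0r !mul0e.
  have ji : (j <= i)%N by exact: leq_trans (leq_addr _ _) jMi.
  have cs : 0 < c4 * sc i by rewrite mulr_gt0// sc_gt0.
  have mi : measurable_fun setT (fun z : V => ind (thick j) z : \bar R) by exact: measurable_ind.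
  have := A1_average v0 mv A0 Av cs mi (fun z => ind_ge0 R (thick j) z).
  under eq_integral do rewrite muleC.
  move=> h; apply: (@le_trans _ _ ((hit_share * lev i * (sc i / sc j))%:E * (((4 * (c4 * sc i)) ^+ n * A)%:E * vmass v (thick j)))%E).
    by apply: lee_wpmul2l h; rewrite lee_fin.
  rewrite muleA -EFinM; apply: lee_wpmul2r; first exact: vmass_ge0.
  rewrite lee_fin (lev_shift ji) [in sc i / _](sc_shift ji) le_eqVlt; apply/orP; left; apply/eqP.
  rewrite /th K0E powRD; last by rewrite pnatr_eq0 implybT.
  rewrite powRr1// [(2 `^ b * 2) ^+ _]exprMn.
  have -> : (4 * (c4 * sc i)) ^+ n = (4 * c4) ^+ n * sc i ^+ n by rewrite mulrA exprMn.
  by field; rewrite gt_eqF// sc_gt0.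
- move=> j; apply: le_trans HM.
  rewrite (_ : _ / _ * _ * _ = K0 * A * (th ^+ M / (1 - th))); last by rewrite /th; ring.
  apply: le_trans (ler_wpM2l _ (gap_sum_up M L j th01)); last exact: mulr_ge0.
  rewrite mulr_sumr; apply: ler_sum => i _; rewrite /c; case: ifP => // _.
  by rewrite mulr0.
Qed.

End Fixed.

Definition thick_bound (p C : R) := forall (f g v : V -> R) (A lam sig rho : R) (L : nat),
  measurable_fun setT f -> measurable_fun setT g -> (forall x, 0 <= g x) ->
  line_estimate k l f g CL ->
  (forall x, 0 <= v x) -> measurable_fun setT v -> 0 <= A -> A1_at v A ->
  (forall r, (\int[mu]_z (ind (cube 0 r) z * (v z)%:E) < +oo)%E) ->
  0 < lam -> 0 < sig ->
  (\sum_(i < L) (lev lam sig i `^ p)%:E * vmass v (thick f lam sig rho i) <=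
    (C * (1 + A) ^+ 2)%:E * \int[mu]_x (g x `^ p * v x)%:E)%E.

(** At exponent one the number of skipped scales is linear in [A] by [exists_gap];
    this and the factor [A] of [A1_average] give the square. *)
Lemma thick_sum_le (p : R) : 1 <= p -> b != 0 -> (p = 1 -> 0 < b \/ b < -1) ->
  exists2 C, 0 <= C & thick_bound p C.
Proof.
move=> p1 b0 pb; have ch0 := chg_gt0; have c40 : 0 < (4 * c1) ^+ n by rewrite exprn_gt0// mulr_gt0.
have thr0 : 0 <= thr_cst.
  by rewrite /thr_cst invr_ge0 !mulr_ge0// ?exprn_ge0 ?mulr_ge0// ltW.
have fin1 (D : R) : 0 <= D ->
    (forall (f g v : V -> R) (A lam sig rho : R) (L : nat),
  measurable_fun setT f -> measurable_fun setT g -> (forall x, 0 <= g x) ->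
  line_estimate k l f g CL ->
  (forall x, 0 <= v x) -> measurable_fun setT v -> 0 <= A -> A1_at v A ->
  (forall r, (\int[mu]_z (ind (cube 0 r) z * (v z)%:E) < +oo)%E) ->
  0 < lam -> 0 < sig -> exists2 M : nat, M%:R <= D * (1 + A) &
  (\sum_(i < L) (lev lam sig i)%:E * vmass v (thick f lam sig rho i) <=
    (2 * (chg * (4 * c1) ^+ n * A * M%:R))%:E * \int[mu]_x (g x * v x)%:E)%E) ->
  p = 1 -> exists2 C, 0 <= C & thick_bound p C.
  move=> D0 H pE; exists (2 * (chg * (4 * c1) ^+ n * D)).
    by apply: mulr_ge0 => //; apply: mulr_ge0 => //; apply: mulr_ge0; exact: ltW.
  move=> f g v A lam sig rho L mf mg g0 Lfg v0 mv A0 Av lv lam0 sig0.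
  have [M MD {}H] := H f g v A lam sig rho L mf mg g0 Lfg v0 mv A0 Av lv lam0 sig0.
  rewrite pE; under eq_bigr => i _ do rewrite (powRr1 (ltW (lev_gt0 lam0 sig0 i))).
  under eq_integral do rewrite powRr1//.
  apply: le_trans H _; apply: lee_wpmul2r.
    by apply: integral_ge0 => z _; rewrite lee_fin mulr_ge0.
  rewrite lee_fin -[leRHS]mulrA ler_pM2l// -2!mulrA -[leRHS]mulrA -[in leRHS]mulrA.
  rewrite ler_pM2l// ler_pM2l//.
  apply: le_trans (ler_wpM2l A0 MD) _.
  by rewrite mulrCA ler_wpM2l// expr2 ler_wpM2r// ?addr_ge0// lerDr.
move: p1; rewrite le_eqVlt => /orP[/eqP pE|p1].
  have [bp|bn] := pb (esym pE).
    pose K0 : R := (4 * (2 * (c1 + 1) + 2)) ^+ n.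
    have K00 : 0 <= K0 by rewrite exprn_ge0// mulr_ge0// addr_ge0// mulr_ge0// addr_ge0// ltW.
    have th01 : 0 < 2 `^ (- b) < 1 by rewrite -mulN1r powRrM powR_inv1//; apply: powR_lt1 => //; lra.
    have [D D0 HD] : exists2 D, 0 <= D & forall A, 0 <= A -> exists M : nat,
        K0 / (1 - 2 `^ (- b)) * A * (2 `^ (- b)) ^+ M <= 2^-1 /\ M%:R <= D * (1 + A).
      apply: exists_gap => //; rewrite divr_ge0// subr_ge0 ltW//; by case/andP: th01.
    apply: (fin1 D) => // f g v A lam sig rho L mf mg g0 Lfg v0 mv A0 Av lv lam0 sig0.
    have [M [HM MD]] := HD A A0; exists M => //.
    exact: (thick_sum_pos rho L mf mg g0 Lfg v0 mv A0 Av lv lam0 sig0 bp erefl HM).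
  pose K0 : R := hit_share * (4 * (kap ^+ 2 + (c1 + 1) + 4)) ^+ n.
  have hs0 : 0 <= hit_share.
    have e0 := @eps_light_gt0 R n k.
    rewrite /hit_share; apply: divr_ge0; last exact: ltW.
    apply: mulr_ge0 => //; rewrite /hit_cst !mulr_ge0// exprn_ge0// mulr_ge0//.
    by rewrite addr_ge0// addr_ge0// ltW.
  have K00 : 0 <= K0.
    apply: mulr_ge0 => //; apply: exprn_ge0; apply: mulr_ge0 => //.
    by apply: addr_ge0 => //; apply: addr_ge0; [exact: sqr_ge0|apply: addr_ge0 => //; exact: ltW].
  have th01 : 0 < 2 `^ (b + 1) < 1.
    rewrite (_ : b + 1 = -1 * (- (b + 1))); last by rewrite mulN1r opprK.
    by rewrite powRrM powR_inv1//; apply: powR_lt1 => //; lra.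
  have [D D0 HD] : exists2 D, 0 <= D & forall A, 0 <= A -> exists M : nat,
      K0 / (1 - 2 `^ (b + 1)) * A * (2 `^ (b + 1)) ^+ M <= 2^-1 /\ M%:R <= D * (1 + A).
    apply: exists_gap => //; rewrite divr_ge0// subr_ge0 ltW//; by case/andP: th01.
  apply: (fin1 D) => // f g v A lam sig rho L mf mg g0 Lfg v0 mv A0 Av lv lam0 sig0.
  have [M [HM MD]] := HD A A0; exists M => //.
  exact: (thick_sum_neg rho L mf mg g0 Lfg v0 mv A0 Av lv lam0 sig0 bn erefl HM).
have rb : 2 `^ b != 1 :> R by rewrite powR_eq1 (negbTE b0) orbF; apply/norP; split; lra.
have [Cg Cg0 HCg] := @geo_sum_le R (2 `^ b) (p - 1) (powR_gt0 b (ltr0n R 2)) rb (ltac:(by rewrite subr_gt0)).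
exists (2 * chg * (4 * c1) ^+ n * Cg * thr_cst `^ (1 - p)).
  by rewrite !mulr_ge0// ?powR_ge0// ltW.
move=> f g v A lam sig rho L mf mg g0 Lfg v0 mv A0 Av lv lam0 sig0.
apply: le_trans (thick_sum_gt1 rho L mf mg g0 Lfg v0 mv A0 Av lam0 sig0 p1 Cg0 HCg) _.
apply: lee_wpmul2r.
  by apply: integral_ge0 => z _; rewrite lee_fin mulr_ge0// powR_ge0.
rewrite lee_fin ler_wpM2l//; first by rewrite !mulr_ge0// ?powR_ge0// ltW.
rewrite -subr_ge0 (_ : _ - A = 1 + A + A ^+ 2); last by ring.
by rewrite !addr_ge0// exprn_ge0.
Qed.

End Claims.

(** * Powers of the norm on annuli *)

Section Annuli.
Context {R : realType} {n : nat}.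
Hypothesis n0 : (0 < n)%N.
Local Notation V := 'rV[R]_n.
Local Notation mu := (@borel_rV R n).

Lemma measurable_enorm : measurable_fun setT (@enorm R n).
Proof.
apply: measurableT_comp; first by apply: continuous_measurable_fun; exact: sqrt_continuous.
apply: measurable_sum => i; apply: measurable_funX.
exact: measurable_coord.
Qed.

Definition annulus (r : R) : set V := cube 0 r `\` cube 0 (r / 2).

Lemma measurable_annulus r : measurable (annulus r).
Proof. by apply: measurableD; exact: measurable_cube. Qed.

Lemma enorm_annulus r h : 0 < r -> annulus r h -> r / 2 <= enorm h <= n%:R * r.
Proof.
move=> r0 [hr nh]; apply/andP; split.
  have [i hi] : exists i, r / 2 < `|h ord0 i|.
    apply: contrapT => H; apply: nh => i; rewrite mxE subr0 leNgt; apply/negP => hi.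
    by apply: H; exists i.
  apply/ltW/(lt_le_trans hi); rewrite /enorm -sqrtr_sqr ler_wsqrtr//.
  by rewrite (bigD1 i)//= lerDl sumr_ge0// => j _; exact: sqr_ge0.
have n1 : 1 <= n%:R :> R by rewrite ler1n.
have nr : 0 <= n%:R * r by rewrite mulr_ge0// ltW.
rewrite -(ger0_norm nr) -sqrtr_sqr /enorm ler_wsqrtr//.
apply: (@le_trans _ _ (\sum_(i < n) r ^+ 2)).
  apply: ler_sum => i _; have := hr i; rewrite mxE subr0 => hi.
  by rewrite -(ger0_norm (sqr_ge0 _)) normrX lerXn2r// nnegrE// ltW.
rewrite sumr_const card_ord -[_ ^+ 2 *+ n]mulr_natl exprMn ler_wpM2r ?sqr_ge0//.
by rewrite expr2 ler_peMl.
Qed.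

(** The distortion of the power [a] over an annulus. *)
Definition dist (a : R) : R := (2 * n%:R) `^ `|a|.

Lemma dist_gt0 a : 0 < dist a.
Proof. by rewrite powR_gt0// mulr_gt0// ltr0n. Qed.

Lemma powR_dist (a y : R) : 2^-1 <= y <= n%:R -> y `^ a <= dist a.
Proof.
move=> /andP[y2 yn]; have n1 : 1 <= n%:R :> R by rewrite ler1n.
have y0 : 0 < y by lra.
have [a0|a0] := leP 0 a.
  by rewrite /dist ger0_norm// ge0_ler_powR// ?nnegrE//; lra.
rewrite /dist ltr0_norm// -[in leLHS](opprK a) powRN -powR_inv1 ?powR_ge0// -powRrM mulrC powRrM.
rewrite powR_inv1; last lra.
apply: ge0_ler_powR; rewrite ?nnegrE ?invr_ge0; [lra|lra|lra|].
rewrite -[leRHS]invrK lef_pV2 ?posrE ?invr_gt0//; last lra.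
apply: le_trans y2; rewrite lef_pV2 ?posrE//; lra.
Qed.

Lemma powR_annulus a r h : 0 < r -> annulus r h ->
  (dist a)^-1 * r `^ a <= enorm h `^ a <= dist a * r `^ a.
Proof.
move=> r0 rh; have /andP[h1 h2] := enorm_annulus r0 rh.
have h0 : 0 < enorm h by apply: lt_le_trans h1; rewrite divr_gt0.
have hE : enorm h = (enorm h / r) * r by rewrite divfK// gt_eqF.
have yr : 2^-1 <= enorm h / r <= n%:R.
  by rewrite ler_pdivlMr// ler_pdivrMr// h2 mulrC h1.
have y0 : 0 < enorm h / r by rewrite divr_gt0.
have pr : 0 < r `^ a by rewrite powR_gt0.
rewrite hE powRM ?(ltW y0) ?(ltW r0)//; apply/andP; split; rewrite ler_pM2r//.
  have := powR_dist (- a) yr; rewrite powRN /dist normrN.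
  by rewrite -[X in _ -> _ <= X]invrK => e; rewrite lef_pV2 ?posrE ?invr_gt0 ?powR_gt0// mulr_gt0// ltr0n.
exact: powR_dist.
Qed.

End Annuli.

Section Powers.
Context {R : realType}.

Lemma powR_subadd (a c th : R) : 0 <= a -> 0 <= c -> 0 < th <= 1 ->
  (a + c) `^ th <= a `^ th + c `^ th.
Proof.
move=> a0 c0 /andP[t0 t1].
have [s0|s0] := ltP 0 (a + c); last first.
  have -> : a = 0 by lra.
  have -> : c = 0 by lra.
  by rewrite addr0 lerDl powR_ge0.
have sub1 x : 0 <= x -> x <= a + c -> x / (a + c) * (a + c) `^ th <= x `^ th.
  move=> x0 xs; have [->|xn] := eqVneq x 0; first by rewrite mul0r mul0r powR_ge0.
  have xp : 0 < x by rewrite lt_neqAle eq_sym xn.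
  have sn : a + c != 0 by rewrite gt_eqF.
  rewrite -[X in _ <= X `^ _](divfK sn).
  rewrite (powRM _ (divr_ge0 x0 (ltW s0)) (ltW s0)) ler_wpM2r ?powR_ge0//.
  by apply: ger1_powR => //; rewrite divr_gt0//= ler_pdivrMr// mul1r.
have := lerD (sub1 a a0 (ltac:(lra))) (sub1 c c0 (ltac:(lra))).
by rewrite -mulrDl -mulrDl divff ?gt_eqF// mul1r.
Qed.

Lemma poweR_subadd (a c : \bar R) (th : R) : (0 <= a)%E -> (0 <= c)%E -> 0 < th <= 1 ->
  ((a + c) `^ th <= a `^ th + c `^ th)%E.
Proof.
move=> a0 c0 t01; have /andP[t0 _] := t01; have tn : th != 0 by rewrite gt_eqF.
case: a a0 => [a| |]//; case: c c0 => [c| |]//.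
- move=> c0 a0; rewrite -EFinD !poweR_EFin -EFinD lee_fin.
  by apply: powR_subadd; rewrite -?lee_fin.
- by move=> _ a0; rewrite addey// !poweRyr// addey// poweR_EFin.
- by move=> c0 _; rewrite addye// !poweRyr// addye// poweR_EFin.
- by move=> _ _; rewrite addye// !poweRyr.
Qed.

Lemma poweR_sum (I : Type) (s : seq I) (F : I -> \bar R) (th : R) : 0 < th <= 1 ->
  (forall i, 0 <= F i)%E -> ((\sum_(i <- s) F i) `^ th <= \sum_(i <- s) F i `^ th)%E.
Proof.
move=> t01 F0; have /andP[t0 _] := t01; elim: s => [|i s IH].
  by rewrite !big_nil poweR0r// gt_eqF.
rewrite !big_cons; apply: le_trans (poweR_subadd _ _ t01) _ => //.
  by apply: sume_ge0.
exact: leeD.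
Qed.

Lemma le_poweR (a c : \bar R) (th : R) : 0 <= th -> (0 <= a)%E -> (a <= c)%E -> (a `^ th <= c `^ th)%E.
Proof.
move=> t0 a0 ac; apply: gt0_ler_poweR => //; rewrite in_itv/= ?leey ?a0//.
by rewrite (le_trans a0 ac).
Qed.

End Powers.

(** * Mixed norms of thick sets *)

Section TwoScales.
Context {R : realType} {n : nat}.
Local Notation V := 'rV[R]_n.
Local Notation mu := (@borel_rV R n).
Variables (k : nat) (H : set V) (r s th : R).
Hypotheses (k0 : (0 < k)%N) (s0 : 0 < s) (sr : s <= r) (th01 : 0 < th <= 1).

Let E : set V := nb H s.
Let r0 : 0 < r. Proof. exact: lt_le_trans sr. Qed.
Let mE : measurable E. Proof. exact: measurable_nb. Qed.
Let mInd2 (x : V) t : measurable_fun setT (fun z : V => ind (cube x t) z * ind E z : \bar R)%E.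
Proof. by apply: emeasurable_funM; apply: measurable_ind => //; exact: measurable_cube. Qed.
Let ind2_ge0 (x : V) t z : (0 <= ind (cube x t) z * ind E z :> \bar R)%E.
Proof. by rewrite mule_ge0 ?ind_ge0. Qed.

(** For [j = 0] the translate does not move; otherwise [h |-> x + j h] expands. *)
Lemma shifted_mass (j : nat) (x : V) : (j <= k)%N ->
  (\int[mu]_h (ind (cube 0 r) h * ind E (x + j%:R *: h)%R) <=
   ((2 * r) ^+ n)%:E * ind E x + \int[mu]_z (ind (cube x (k%:R * r)) z * ind E z))%E.
Proof.
move=> jk; case: j jk => [|j] jk.
  under eq_integral do rewrite scale0r addr0.
  rewrite -[leLHS]adde0; apply: leeD; last exact: integral_ge0.
  under eq_integral do rewrite muleC.
  rewrite ge0_integralZl//; last 3 first.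
  - by apply: measurable_ind; exact: measurable_cube.
  - by move=> h _; exact: ind_ge0.
  - exact: ind_ge0.
  by rewrite integral_indV ?mu_cube ?(ltW r0)//; [rewrite muleC|exact: measurable_cube].
rewrite -[leLHS]add0e; apply: leeD.
  by rewrite mule_ge0 ?ind_ge0// lee_fin exprn_ge0// mulr_ge0// ltW.
have j0 : 0 < j.+1%:R :> R by rewrite ltr0n.
apply: (@le_trans _ _ (\int[mu]_h (fun z => ind (cube x (k%:R * r)) z * ind E z) (x + j.+1%:R *: h)%R)%E).
  apply: le_integral_ge0 => h; first by rewrite mule_ge0 ?ind_ge0.
  apply: lee_wpmul2r; first exact: ind_ge0.
  have [hr|hr] := pselect (cube 0 r h); last by rewrite ind_out// ind_ge0.
  rewrite (ind_in R hr) ind_in// => i; have := hr i; rewrite !mxE subr0 => hi.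
  rewrite addrAC subrr add0r normrM ger0_norm ?ler0n//.
  by apply: ler_pM => //; rewrite ler_nat.
rewrite (integral_affine x j0 (mInd2 x (k%:R * r)) (ind2_ge0 x (k%:R * r))) -[leRHS]mul1e; apply: lee_wpmul2r; first exact: integral_ge0.
by rewrite lee_fin invf_le1 ?exprn_gt0// exprn_ege1// ler1n.
Qed.

(** The set [E] is a union of cubes of radius comparable to [s], so that a nonempty
    piece of it has mass at least [s ^ n], up to enlarging the cube. *)
Lemma small_mass (x : V) : ((\int[mu]_z (ind (cube x (k%:R * r)) z * ind E z)) `^ th <=
  (s `^ (n%:R * (th - 1)))%:E * \int[mu]_z (ind (cube x ((k%:R + 3) * r)) z * ind E z))%E.
Proof.
have /andP[t0 t1] := th01; have tn : th != 0 by rewrite gt_eqF.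
have [[z [xz Ez]]|nz] := pselect (exists z, cube x (k%:R * r) z /\ E z); last first.
  rewrite integral0_eq ?poweR0r//; first by rewrite mule_ge0 ?lee_fin ?powR_ge0//; exact: integral_ge0.
  move=> z _; have [xz|xz] := pselect (cube x (k%:R * r) z); last by rewrite ind_out// mul0e.
  by rewrite [X in (_ * X)%E]ind_out ?mule0// => Ez; apply: nz; exists z.
set M := (X in (_ <= _ * X)%E).
have ks : 0 <= (k%:R + 3) * r by rewrite mulr_ge0// ?addr_ge0// ltW.
have Ms : ((s ^+ n)%:E <= M)%E.
  have zE : nb (nb H s) (1 * s) z.
    by apply: nb_cube Ez _ _ (cube_refl z (lexx 0)); rewrite mul1r.
  apply: le_trans (nb_mass s0 zE) _.
  apply: le_integral_ge0 => w; first exact: ind2_ge0.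
  apply: lee_wpmul2r; first exact: ind_ge0.
  apply: le_ind => zw; apply: cube_trans xz zw.
  by rewrite [leRHS]mulrDl lerD2l (_ : 1 + 2 = 3) ?ler_pM2l// -natr1 addrC.
have Mfin : M \is a fin_num.
  rewrite ge0_fin_numE; last exact: integral_ge0.
  apply: (@le_lt_trans _ _ (\int[mu]_z (ind (cube x ((k%:R + 3) * r)) z))%E).
    apply: le_integral_ge0 => w; first exact: ind2_ge0.
    by rewrite -[leRHS]mule1 lee_wpmul2l ?ind_ge0 ?ind_le1.
  by rewrite integral_indV ?mu_cube ?ltry//; exact: measurable_cube.
apply: (@le_trans _ _ (M `^ th)%E).
  apply: le_poweR; [exact: ltW|exact: integral_ge0|].
  apply: le_integral_ge0 => w; first exact: ind2_ge0.
  apply: lee_wpmul2r; first exact: ind_ge0.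
  by apply: le_ind; apply: cube_subset; rewrite ler_pM2r// lerDl.
have sn : 0 < s ^+ n by rewrite exprn_gt0.
rewrite -(fineK Mfin) in Ms *; move: (fine M) Ms => m; rewrite lee_fin => ms.
have m0 : 0 < m by exact: lt_le_trans ms.
rewrite poweR_EFin -EFinM lee_fin.
rewrite [in leLHS](_ : th = (th - 1) + 1); last by rewrite subrK.
rewrite powRD; last by rewrite (gt_eqF m0) implybT.
rewrite powRr1 ?(ltW m0)// ler_pM2r// powRrM powR_mulrn ?(ltW s0)//.
rewrite -[th - 1]opprK [leLHS]powRN [leRHS]powRN lef_pV2 ?posrE ?powR_gt0//.
by apply: ge0_ler_powR; rewrite ?nnegrE ?(ltW m0) ?(ltW sn)//; lra.
Qed.

(** The power [(r / s) `^ (n (1 - th))] is the loss that the assumption on [p], [q]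
    and the order of the derivative has to beat. *)
Lemma two_scales (v : V -> R) (A : R) (j : nat) : (forall x, 0 <= v x) ->
  measurable_fun setT v -> 0 <= A -> A1_at v A -> (j <= k)%N ->
  (\int[mu]_x ((\int[mu]_h (ind (cube 0 r) h * ind E (x + j%:R *: h)%R)) `^ th * (v x)%:E) <=
   ((2 ^+ n + (4 * (k%:R + 3)) ^+ n) * (1 + A) * (r `^ (n%:R * th) * (r / s) `^ (n%:R * (1 - th))))%:E
     * vmass v E)%E.
Proof.
move=> v0 mv A0 Av jk; have /andP[t0 t1] := th01; have tn : th != 0 by rewrite gt_eqF.
have kr : 0 < (k%:R + 3) * r by rewrite mulr_gt0// ltr_wpDl.
have mve : measurable_fun setT (fun x => (v x)%:E) by exact/measurable_EFinP.
pose N x : \bar R := (\int[mu]_z (ind (cube x ((k%:R + 3) * r)) z * ind E z))%E.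
have N0 x : (0 <= N x)%E by exact: integral_ge0.
have mN : measurable_fun setT N.
  by apply: measurable_average; [exact: measurable_ind|move=> z; exact: ind_ge0].
pose a : R := ((2 * r) ^+ n) `^ th; pose c : R := s `^ (n%:R * (th - 1)).
have a0 : 0 <= a by exact: powR_ge0.
have c0 : 0 <= c by exact: powR_ge0.
apply: (@le_trans _ _ (\int[mu]_x (a%:E * (ind E x * (v x)%:E) + c%:E * ((v x)%:E * N x)))%E).
  apply: le_integral_ge0 => x; first by rewrite mule_ge0 ?poweR_ge0// lee_fin.
  have I0 : (0 <= \int[mu]_h (ind (cube 0 r) h * ind E (x + j%:R *: h)%R))%E.
    by apply: integral_ge0 => h _; rewrite mule_ge0 ?ind_ge0.
  have J0 : (0 <= ((2 * r) ^+ n)%:E * ind E x)%E.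
    by rewrite mule_ge0 ?ind_ge0// lee_fin exprn_ge0// mulr_ge0// ltW.
  apply: (@le_trans _ _ ((a%:E * ind E x + c%:E * N x) * (v x)%:E)%E).
    apply: lee_wpmul2r; first by rewrite lee_fin.
    apply: le_trans (le_poweR (ltW t0) I0 (shifted_mass x jk)) _.
    apply: le_trans (poweR_subadd J0 _ th01) _; first exact: integral_ge0.
    apply: leeD; last exact: small_mass.
    have [Ex|nE] := pselect (E x); first by rewrite ind_in// !mule1.
    by rewrite ind_out// !mule0 poweR0r.
  rewrite ge0_muleDl; last 2 first.
  - by rewrite mule_ge0 ?ind_ge0.
  - by rewrite mule_ge0.
  by rewrite -!muleA [X in (_ + _ * X <= _)%E]muleC.
have mEv : measurable_fun setT (fun x => ind E x * (v x)%:E)%E by apply: emeasurable_funM => //; exact: measurable_ind.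
have mvN : measurable_fun setT (fun x => (v x)%:E * N x)%E by exact: emeasurable_funM.
have Ev0 x : (0 <= ind E x * (v x)%:E)%E by rewrite mule_ge0 ?ind_ge0// lee_fin.
have vN0 x : (0 <= (v x)%:E * N x)%E by rewrite mule_ge0// lee_fin.
rewrite ge0_integralD//; last 4 first.
- by move=> x _; rewrite mule_ge0.
- exact: measurable_funeM.
- by move=> x _; rewrite mule_ge0.
- exact: measurable_funeM.
rewrite ge0_integralZl// ge0_integralZl//.
apply: (@le_trans _ _ (a%:E * vmass v E + c%:E * (((4 * ((k%:R + 3) * r)) ^+ n * A)%:E * vmass v E))%E).
  rewrite leeD2l//; apply: lee_wpmul2l => //.
  by apply: A1_average => //; [exact: measurable_ind|move=> z; exact: ind_ge0].
rewrite muleA -EFinM -ge0_muleDl; last 2 first.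
- by [].
- by rewrite lee_fin !mulr_ge0// exprn_ge0// mulr_ge0// ltW.
rewrite -EFinD; apply: lee_wpmul2r; first exact: vmass_ge0.
rewrite lee_fin.
have rs1 : 1 <= r / s by rewrite ler_pdivlMr// mul1r.
have pr : 0 < r `^ (n%:R * th) by rewrite powR_gt0.
have prs : 1 <= (r / s) `^ (n%:R * (1 - th)).
  by rewrite -[leLHS](powRr0 (r / s)); apply: ler_powR => //; rewrite mulr_ge0// subr_ge0.
have aE : a <= 2 ^+ n * r `^ (n%:R * th).
  rewrite /a exprMn powRM ?exprn_ge0 ?(ltW r0)// -[r ^+ n]powR_mulrn ?(ltW r0)// -powRrM.
  rewrite ler_pM2r//; apply: (@le_trans _ _ ((2 ^+ n) `^ 1)); last by rewrite powRr1// exprn_ge0.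
  by apply: ler_powR => //; rewrite exprn_ege1// ler1n.
have cE : c * ((4 * ((k%:R + 3) * r)) ^+ n * A) =
    (4 * (k%:R + 3)) ^+ n * A * (r `^ (n%:R * th) * (r / s) `^ (n%:R * (1 - th))).
  have -> : (4 * ((k%:R + 3) * r)) ^+ n = (4 * (k%:R + 3)) ^+ n * r ^+ n by rewrite mulrA exprMn.
  have sV : 0 <= s^-1 by rewrite invr_ge0 ltW.
  rewrite (powRM _ (ltW r0) sV) -powR_inv1 ?(ltW s0)// -powRrM.
  have -> : r ^+ n = r `^ (n%:R * th) * r `^ (n%:R * (1 - th)).
    rewrite -powRD; last by rewrite (gt_eqF r0) implybT.
    by rewrite -mulrDr addrCA subrr addr0 mulr1 powR_mulrn// ltW.
  by rewrite /c (_ : n%:R * (th - 1) = -1 * (n%:R * (1 - th))); ring.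
rewrite cE.
set u := r `^ _ in aE pr *; set w := (_ / _) `^ _ in prs *; set d := (4 * _) ^+ n.
have d0 : 0 <= d by rewrite exprn_ge0// mulr_ge0// addr_ge0.
have e0 : 0 <= 2 ^+ n :> R by rewrite exprn_ge0.
have uw : u <= u * w by rewrite ler_peMr// ltW.
have uw0 : 0 <= u * w by apply: le_trans uw; exact: ltW.
apply: (@le_trans _ _ (2 ^+ n * (u * w) + d * A * (u * w))).
  by rewrite lerD2r; apply: le_trans aE _; rewrite ler_wpM2l.
rewrite -mulrDl ler_wpM2r// mulrDr mulr1 mulrDl.
have : 0 <= 2 ^+ n * A by rewrite mulr_ge0.
lra.
Qed.

End TwoScales.

Lemma sum_shift_le {R : realType} (a : nat -> \bar R) (L c : nat) : (forall m, 0 <= a m)%E ->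
  (\sum_(i < L) (if (c <= i)%N then a (i - c)%N else 0) <= \sum_(m < L) a m)%E.
Proof.
move=> a0; elim: L c => [|L IH] c; first by rewrite !big_ord0.
case: c => [|c].
  by apply: lee_sum => i _; rewrite subn0.
rewrite big_ord_recl/= add0e big_ord_recr/=; apply: le_trans (leeDl _ (a0 L)).
apply: le_trans (IH c).
by apply: lee_sum => i _; rewrite /bump/= add1n ltnS subSS.
Qed.

Section DoubleSum.
Context {R : realType} {n : nat}.
Local Notation V := 'rV[R]_n.
Local Notation mu := (@borel_rV R n).

(** The level used for thick sets [m] scales below the scale of the difference. *)
Definition level_at (l : nat) (b lam eta th : R) (m : nat) : R :=
  lam * eta * (2 `^ (b + l%:R) * th) ^+ m.

(** The factor gained per scale between a difference and the heavy point that causes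
    it. *)
Definition decay (l : nat) (p q th : R) : R :=
  2 `^ (n%:R * (1 - p / q) - l%:R * p) * th `^ (- p).

Lemma level_weight l (b p q lam eta th s : R) (m : nat) :
  0 < lam -> 0 < eta -> 0 < th -> 0 < s -> 0 < q ->
  lam `^ p * ((s * 2 ^+ m) `^ (b * q - n%:R)) `^ (p / q) *
    ((s * 2 ^+ m) `^ (n%:R * (p / q)) * (2 ^+ m) `^ (n%:R * (1 - p / q))) =
  eta `^ (- p) * (level_at l b lam eta th m * s `^ b) `^ p * decay l p q th ^+ m.
Proof.
move=> l0 e0 t0 s0 q0; rewrite /level_at /decay.
have m0 : 0 < (2 : R) ^+ m by rewrite exprn_gt0.
have sm0 : 0 < s * 2 ^+ m by rewrite mulr_gt0.
have b20 : 0 < 2 `^ (b + l%:R) :> R by rewrite powR_gt0.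
have qn : q != 0 by rewrite gt_eqF.
have E (x a : R) : 0 < x -> x `^ a = expR (a * ln x) by move=> x0; rewrite /powR gt_eqF.
have lm : ln ((2 : R) ^+ m) = m%:R * ln 2 by rewrite lnXn// mulr_natl.
have lsm : ln (s * 2 ^+ m) = ln s + m%:R * ln 2 by rewrite lnM ?posrE// lm.
have bt0 : 0 < 2 `^ (b + l%:R) * th by rewrite mulr_gt0.
have btm0 : 0 < (2 `^ (b + l%:R) * th) ^+ m by rewrite exprn_gt0.
have lbt : ln ((2 `^ (b + l%:R) * th) ^+ m) = m%:R * ((b + l%:R) * ln 2 + ln th).
  by rewrite lnXn// -[_ *+ m]mulr_natl lnM ?posrE ?powR_gt0// ln_powR.
have sb0 : 0 < s `^ b by rewrite powR_gt0.
have le0 : 0 < lam * eta by rewrite mulr_gt0.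
have D0 : 0 < 2 `^ (n%:R * (1 - p / q) - l%:R * p) * th `^ (- p) by rewrite mulr_gt0// powR_gt0.
rewrite -[X in _ = _ * X]powR_mulrn ?(ltW D0)//.
rewrite (E _ _ D0) lnM ?posrE ?powR_gt0// !ln_powR.
have b0 : 0 < lam * eta * (2 `^ (b + l%:R) * th) ^+ m * s `^ b by rewrite !mulr_gt0.
rewrite -powRrM !(E _ _ sm0) (E _ _ m0) (E _ _ b0) (E _ _ l0) (E _ _ e0) lsm lm.
rewrite (lnM (mulr_gt0 le0 btm0) sb0) (lnM le0 btm0) (lnM l0 e0) lbt ln_powR -!expRD.
by congr expR; field.
Qed.

(** As [p / q <= 1], the power is subadditive over pairs of scales. For a fixed gap
    between the two scales the sum is an instance of [thick_sum_le], at the level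
    that belongs to this gap; the sum over the gaps is geometric. *)
Lemma double_sum_le (k l : nat) (CL b p q th eta : R) :
  (0 < k)%N -> 0 <= CL -> 1 <= p -> b != 0 -> (p = 1 -> 0 < b \/ b < -1) ->
  p <= q -> 0 < th -> 0 < eta -> decay l p q th < 1 ->
  exists2 C, 0 <= C & forall (f g v : V -> R) (A lam sig rho : R) (L : nat),
  measurable_fun setT f -> measurable_fun setT g -> (forall x, 0 <= g x) ->
  line_estimate k l f g CL ->
  (forall x, 0 <= v x) -> measurable_fun setT v -> 0 <= A -> A1_at v A ->
  (forall r, (\int[mu]_z (ind (cube 0 r) z * (v z)%:E) < +oo)%E) ->
  0 < lam -> 0 < sig ->
  ((lam `^ p)%:E * \int[mu]_x ((\int[mu]_h \sum_(z : 'I_L * 'I_L * 'I_k.+1)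
     (if (z.1.2 <= z.1.1)%N then (sc sig z.1.1 `^ (b * q - n%:R))%:E *
        (ind (cube 0 (sc sig z.1.1)) h *
         ind (thick k l b f (level_at l b lam eta th (z.1.1 - z.1.2)) sig rho z.1.2)
             (x + z.2%:R *: h)%R)
      else 0)) `^ (p / q) * (v x)%:E) <=
   (C * (1 + A) ^+ 3)%:E * \int[mu]_x (g x `^ p * v x)%:E)%E.
Proof.
move=> k0 CL0 p1 b0 pb pq t0 e0 dec1.
have p0 : 0 < p by lra.
have q0 : 0 < q by lra.
have th01 : 0 < p / q <= 1 by rewrite divr_gt0//= ler_pdivrMr// mul1r.
have /andP[pq0 pq1] := th01; have pqn : p / q != 0 by rewrite gt_eqF.
have [C C0 HC] := @thick_sum_le R n k l CL b k0 CL0 p p1 b0 pb.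
pose K : R := 2 ^+ n + (4 * (k%:R + 3)) ^+ n.
have K0 : 0 <= K by rewrite addr_ge0// exprn_ge0// mulr_ge0// addr_ge0.
set dl := decay l p q th in dec1.
have dl0 : 0 < dl by rewrite mulr_gt0// powR_gt0.
have ep0 : 0 <= eta `^ (- p) by exact: powR_ge0.
have dV : 0 <= (1 - dl)^-1 by rewrite invr_ge0 subr_ge0 ltW.
exists (k.+1%:R * (K * eta `^ (- p)) * (1 - dl)^-1 * C).
  by apply: mulr_ge0 => //; apply: mulr_ge0 => //; rewrite !mulr_ge0.
move=> f g v A lam sig rho L mf mg g0 Lfg v0 mv A0 Av lv lam0 sig0.
have lv0 m : 0 < level_at l b lam eta th m.
  by rewrite /level_at !mulr_gt0// exprn_gt0// mulr_gt0// powR_gt0.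
pose Th (m c : nat) := thick k l b f (level_at l b lam eta th m) sig rho c.
have mTh m c : measurable (Th m c) by exact: measurable_nb.
pose W (m c : nat) : \bar R := ((lev b (level_at l b lam eta th m) sig c `^ p)%:E * vmass v (Th m c))%E.
have W0 m c : (0 <= W m c)%E by rewrite mule_ge0 ?vmass_ge0// lee_fin powR_ge0.
pose G (i c j : nat) (x h : V) : \bar R :=
  (ind (cube 0 (sc sig i)) h * ind (Th (i - c)%N c) (x + j%:R *: h)%R)%E.
have G0 i c j x h : (0 <= G i c j x h)%E by rewrite mule_ge0 ?ind_ge0.
have mG2 i c j : measurable_fun setT (fun z : V * V => G i c j z.1 z.2).
  apply: emeasurable_funM.
    by apply: measurable_ind_comp; [exact: measurable_cube|exact: measurable_snd].
  apply: measurable_ind_comp; first exact: mTh.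
  apply: measurable_rV_add; first exact: measurable_fst.
  by apply: measurable_rV_scale; [exact: measurable_cst|exact: measurable_snd].
have mG i c j x : measurable_fun setT (G i c j x) by exact: (measurable_section x (mG2 i c j)).
pose J i c j x : \bar R := (\int[mu]_h G i c j x h)%E.
have J0 i c j x : (0 <= J i c j x)%E by apply: integral_ge0.
have mJ i c j : measurable_fun setT (J i c j).
  by apply: (@measurable_fun_fubini_tonelli_F _ _ V V R mu (fun z => G i c j z.1 z.2)).
have mve : measurable_fun setT (fun x => (v x)%:E) by exact/measurable_EFinP.
have ve0 x : (0 <= (v x)%:E)%E by rewrite lee_fin.
pose cf i : R := sc sig i `^ (b * q - n%:R).
have cf0 i : 0 <= cf i by exact: powR_ge0.
pose F (z : 'I_L * 'I_L * 'I_k.+1) (x : V) : \bar R :=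
  if (z.1.2 <= z.1.1)%N then (((cf z.1.1) `^ (p / q))%:E * (J z.1.1 z.1.2 z.2 x `^ (p / q) * (v x)%:E))%E else 0%E.
have F0 z x : (0 <= F z x)%E.
  by rewrite /F; case: ifP => // _; rewrite !mule_ge0 ?poweR_ge0// lee_fin powR_ge0.
have mJv i c j : measurable_fun setT (fun x => J i c j x `^ (p / q) * (v x)%:E)%E.
  by apply: emeasurable_funM => //; apply: (measurableT_comp (measurable_poweR (p / q))).
have mF z : measurable_fun setT (F z).
  rewrite /F; case: (_ <= _)%N; last exact: measurable_cst.
  exact: measurable_funeM.
apply: (@le_trans _ _ ((lam `^ p)%:E * \sum_(z : 'I_L * 'I_L * 'I_k.+1) \int[mu]_x F z x)%E).
  apply: lee_wpmul2l; first by rewrite lee_fin powR_ge0.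
  rewrite -ge0_integral_sum//.
  apply: le_integral_ge0 => x; first by rewrite mule_ge0 ?poweR_ge0.
  rewrite ge0_integral_sum//; last 2 first.
  - by move=> z; case: (_ <= _)%N; [apply: measurable_funeM; exact: mG|exact: measurable_cst].
  - by move=> z h _; case: ifP => // _; apply: mule_ge0; [rewrite lee_fin powR_ge0|exact: G0].
  apply: (@le_trans _ _ ((\sum_(z : 'I_L * 'I_L * 'I_k.+1) (\int[mu]_h (if (z.1.2 <= z.1.1)%N then (cf z.1.1)%:E * G z.1.1 z.1.2 z.2 x h else 0)) `^ (p / q)) * (v x)%:E)%E).
    apply: lee_wpmul2r => //; apply: poweR_sum => // z.
    by apply: integral_ge0 => h _; case: ifP => // _; apply: mule_ge0; [rewrite lee_fin cf0|exact: G0].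
  rewrite ge0_sume_distrl; last by move=> z _; exact: poweR_ge0.
  apply: lee_sum => z _; rewrite /F; case: ifP => _.
    rewrite ge0_integralZl//; last by rewrite lee_fin cf0.
    rewrite -/(J z.1.1 z.1.2 z.2 x) poweRM//; last by rewrite lee_fin cf0.
    by rewrite poweR_EFin muleA.
  by rewrite integral0 poweR0r// mul0e.
rewrite ge0_sume_distrr; last by move=> z _; apply: integral_ge0.
pose B : R := K * (1 + A) * eta `^ (- p).
have B0 : 0 <= B by rewrite !mulr_ge0// addr_ge0.
pose S := (\sum_(m < L) (dl ^+ m)%:E * \sum_(c < L) W m c)%E.
apply: (@le_trans _ _ (\sum_(z : 'I_L * 'I_L * 'I_k.+1)
   B%:E * (if (z.1.2 <= z.1.1)%N then (dl ^+ (z.1.1 - z.1.2))%:E * W (z.1.1 - z.1.2)%N z.1.2 else 0))%E).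
  apply: lee_sum => -[[i c] j] _ /=; rewrite /F/=; case: ifPn => ci; last first.
    by rewrite integral0 !mule0.
  rewrite ge0_integralZl//; last 2 first.
  - by move=> x _; rewrite mule_ge0 ?poweR_ge0.
  - by rewrite lee_fin powR_ge0.
  have jk : (j <= k)%N by rewrite -ltnS.
  have scc : sc sig c <= sc sig i by rewrite sc_le.
  have H := two_scales (hset k l b f (level_at l b lam eta th (i - c)) sig rho c) (sc_gt0 sig0 c) scc th01 v0 mv A0 Av jk.
  rewrite muleA -EFinM; apply: (@le_trans _ _ (((lam `^ p * cf i `^ (p / q))%:E * _)%E)).
    by apply: lee_wpmul2l; [rewrite lee_fin mulr_ge0 ?powR_ge0|exact: H].
  rewrite muleA -EFinM [X in (_ <= _ * X)%E]muleA -EFinM muleA -EFinM; apply: lee_wpmul2r; first exact: vmass_ge0.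
  have sci : sc sig i = sc sig c * 2 ^+ (i - c) by exact: sc_shift.
  have -> : sc sig i / sc sig c = 2 ^+ (i - c) by rewrite sci mulrC mulKf// gt_eqF// sc_gt0.
  rewrite lee_fin mulrCA [X in _ * X](_ : _ = eta `^ (- p) * (lev b (level_at l b lam eta th (i - c)) sig c) `^ p * dl ^+ (i - c)).
    by rewrite /B /K le_eqVlt; apply/orP; left; apply/eqP; ring.
  by rewrite /cf sci; exact: (level_weight l b p (i - c) lam0 e0 t0 (sc_gt0 sig0 c) q0).
rewrite -ge0_sume_distrr; last first.
  by move=> z _; case: ifP => // _; rewrite mule_ge0// lee_fin exprn_ge0// ltW.
rewrite -(pair_bigA _ (fun (u : 'I_L * 'I_L) (j : 'I_k.+1) =>
  if (u.2 <= u.1)%N then (dl ^+ (u.1 - u.2))%:E * W (u.1 - u.2)%N u.2 else 0)%E)/=.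
apply: (@le_trans _ _ (B%:E * (k.+1%:R%:E * S))%E).
  apply: lee_wpmul2l; first by rewrite lee_fin.
  rewrite (eq_bigr (fun u : 'I_L * 'I_L => k.+1%:R%:E * (if (u.2 <= u.1)%N then (dl ^+ (u.1 - u.2))%:E * W (u.1 - u.2)%N u.2 else 0))%E); last first.
    move=> u _; set X := (if _ then _ else _).
    rewrite (eq_bigr (fun=> 1%:E * X)%E); last by move=> j _; rewrite mul1e.
    by rewrite -ge0_sume_distrl// sumEFin sumr_const card_ord.
  rewrite -ge0_sume_distrr; last first.
    by move=> u _; case: ifP => // _; rewrite mule_ge0// lee_fin exprn_ge0// ltW.
  apply: lee_wpmul2l; first by rewrite lee_fin.
  rewrite -(pair_bigA _ (fun i c : 'I_L => if (c <= i)%N then (dl ^+ (i - c))%:E * W (i - c)%N c else 0)%E)/=.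
  rewrite exchange_big/= /S.
  rewrite [X in (_ <= X)%E](eq_bigr (fun m : 'I_L => \sum_(c < L) (dl ^+ m)%:E * W m c)%E); last first.
    by move=> m _; rewrite ge0_sume_distrr.
  rewrite [X in (_ <= X)%E]exchange_big/=; apply: lee_sum => c _.
  apply: (sum_shift_le L c (a := fun m => (dl ^+ m)%:E * W m c)%E) => m.
  by rewrite mule_ge0// lee_fin exprn_ge0// ltW.
set I := (\int[mu]_x _)%E.
have I0 : (0 <= I)%E by apply: integral_ge0 => x _; rewrite lee_fin mulr_ge0// powR_ge0.
have SI : (S <= ((1 - dl)^-1 * (C * (1 + A) ^+ 2))%:E * I)%E.
  apply: (@le_trans _ _ (\sum_(m < L) (dl ^+ m)%:E * ((C * (1 + A) ^+ 2)%:E * I))%E).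
    apply: lee_sum => m _; apply: lee_wpmul2l; first by rewrite lee_fin exprn_ge0// ltW.
    exact: (HC f g v A (level_at l b lam eta th m) sig rho L mf mg g0 Lfg v0 mv A0 Av lv (lv0 m) sig0).
  have CA0 : 0 <= C * (1 + A) ^+ 2 by rewrite mulr_ge0// exprn_ge0// addr_ge0.
  rewrite -ge0_sume_distrl; last by move=> m _; rewrite lee_fin exprn_ge0// ltW.
  rewrite sumEFin muleA -EFinM; apply: lee_wpmul2r => //; rewrite lee_fin ler_wpM2r//.
  by apply: sum_geo_le; rewrite dl0.
rewrite muleA -EFinM; apply: le_trans (lee_wpmul2l _ SI) _.
  by rewrite lee_fin mulr_ge0.
rewrite muleA -EFinM; apply: lee_wpmul2r => //.
by rewrite lee_fin /B le_eqVlt; apply/orP; left; apply/eqP; ring.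
Qed.

End DoubleSum.

(** * Exhaustion of the superlevel set *)

Section MixedLimit.
Context {R : realType} {n : nat}.
Local Notation V := 'rV[R]_n.
Local Notation mu := (@borel_rV R n).

(** Monotone convergence for both integrals. At a point where the limit is finite,
    the inner integrals are bounded by a constant, which passes to their limit and
    then through the power. *)
Lemma mixed_integral_le (T : nat -> set (V * V)) (S : set (V * V)) (w : V -> \bar R)
    (th : R) (v : V -> R) (B : \bar R) (N : set V) :
  (forall I, measurable (T I)) -> (forall I J, (I <= J)%N -> T I `<=` T J) ->
  measurable_fun setT w -> (forall h, 0 <= w h)%E -> 0 < th ->
  (forall x, 0 <= v x) -> measurable_fun setT v ->
  measurable N -> mu N = 0%E ->
  (forall x, ~ N x -> exists N', [/\ measurable N', mu N' = 0%E &
     forall h, ~ N' h -> S (x, h) -> exists I, T I (x, h)]) ->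
  (forall I, \int[mu]_x ((\int[mu]_h (ind (T I) (x, h) * w h)) `^ th * (v x)%:E) <= B)%E ->
  (\int[mu]_x ((\int[mu]_h (ind S (x, h) * w h)) `^ th * (v x)%:E) <= B)%E.
Proof.
move=> mT ndT mw w0 t0 v0 mv mN N0 HN HB.
pose G I x h : \bar R := (ind (T I) (x, h) * w h)%E.
have G0 I x h : (0 <= G I x h)%E by rewrite mule_ge0 ?ind_ge0.
have mG2 I : measurable_fun setT (fun z : V * V => G I z.1 z.2).
  apply: emeasurable_funM; last by apply: (measurableT_comp mw); exact: measurable_snd.
  by apply: (@measurable_ind_comp R _ _ _ _ (T I) (fun z : V * V => (z.1, z.2))) => //; apply/measurable_fun_pairP; split; [exact: measurable_fst|exact: measurable_snd].
have mG I x : measurable_fun setT (G I x) by exact: (measurable_section x (mG2 I)).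
have ndG x h : {homo (fun I => G I x h) : I J / (I <= J)%N >-> (I <= J)%E}.
  by move=> I J IJ; apply: lee_wpmul2r => //; apply: le_ind; exact: ndT.
pose a I x : \bar R := (\int[mu]_h G I x h)%E.
have a0 I x : (0 <= a I x)%E by apply: integral_ge0.
have ma I : measurable_fun setT (a I).
  by apply: (@measurable_fun_fubini_tonelli_F _ _ V V R mu (fun z => G I z.1 z.2)).
have nda x : {homo (a ^~ x) : I J / (I <= J)%N >-> (I <= J)%E}.
  by move=> I J IJ; apply: le_integral_ge0 => // h; exact: ndG.
pose u I x : \bar R := (a I x `^ th * (v x)%:E)%E.
have u0 I x : (0 <= u I x)%E by rewrite mule_ge0 ?poweR_ge0 ?lee_fin.
have mu_ I : measurable_fun setT (u I).
  apply: emeasurable_funM; last exact/measurable_EFinP.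
  exact: (measurableT_comp (measurable_poweR th)).
have ndu x : {homo (u ^~ x) : I J / (I <= J)%N >-> (I <= J)%E}.
  move=> I J IJ; apply: lee_wpmul2r; first by rewrite lee_fin.
  by apply: le_poweR => //; [exact: ltW|exact: nda].
apply: (@le_trans _ _ (\int[mu]_x limn (fun I => u I x))%E); last first.
  rewrite (monotone_convergence mu measurableT mu_ (fun I x _ => u0 I x) (fun x _ => ndu x)).
  apply: lime_le; last by apply: nearW => I; exact: HB.
  apply: ereal_nondecreasing_is_cvgn => I J IJ; apply: le_integral_ge0 => // x; exact: ndu.
have ucvg x : cvgn (fun I => u I x) by exact: ereal_nondecreasing_is_cvgn (ndu x).
apply: (ae_le_integral_ge0 mN N0) => [x|x|x Nx].
- by rewrite mule_ge0 ?poweR_ge0 ?lee_fin.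
- by apply: lime_ge => //; apply: nearW.
have [N' [mN' N'0 HN']] := HN x Nx.
have S0 : (0 <= \int[mu]_h (ind S (x, h) * w h))%E.
  by apply: integral_ge0 => h _; rewrite mule_ge0 ?ind_ge0.
have Slim : (\int[mu]_h (ind S (x, h) * w h) <= limn (fun I => a I x))%E.
  rewrite -(monotone_convergence mu measurableT (fun I => mG I x) (fun I h _ => G0 I x h) (fun h _ => ndG x h)).
  apply: (ae_le_integral_ge0 mN' N'0) => [h|h|h Nh].
  - by rewrite mule_ge0 ?ind_ge0.
  - by apply: lime_ge; [exact: ereal_nondecreasing_is_cvgn (ndG x h)|apply: nearW => I; exact: G0].
  have [Sx|nS] := pselect (S (x, h)); last first.
    rewrite ind_out// mul0e.
    by apply: lime_ge; [exact: ereal_nondecreasing_is_cvgn (ndG x h)|apply: nearW => I; exact: G0].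
  have [I TI] := HN' h Nh Sx.
  apply: lime_ge; first exact: ereal_nondecreasing_is_cvgn (ndG x h).
  exists I => // J /= IJ; rewrite ind_in// /G ind_in//; exact: (ndT I J IJ).
have [v00|vp] := leP (v x) 0.
  have -> : v x = 0 by apply/eqP; rewrite eq_le v00 v0.
  by rewrite mule0; apply: lime_ge => //; apply: nearW.
set y := limn (fun I => u I x).
have uy I : (u I x <= y)%E.
  by apply: (lime_ge (ucvg x)); exists I => // J /= IJ; exact: ndu.
have [->|yoo] := eqVneq y +oo%E; first by rewrite leey.
have y0 : (0 <= y)%E by apply: lime_ge => //; apply: nearW.
have yf : y \is a fin_num by rewrite ge0_fin_numE// lt_neqAle yoo leey.
pose c := (fine y / v x) `^ th^-1.
have tn : th != 0 by rewrite gt_eqF.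
have ac I : (a I x <= c%:E)%E.
  have := uy I; rewrite /u -{1}(fineK yf).
  have aoo : (a I x `^ th * (v x)%:E <= (fine y)%:E)%E -> a I x \is a fin_num.
    rewrite ge0_fin_numE// => h; apply: lty_poweRy tn _.
    rewrite ltey; apply/eqP => e; move: h; rewrite e gt0_mulye ?lte_fin// leye_eq.
  move=> h; have af := aoo h; move: h; rewrite -(fineK af).
  have f0 : 0 <= fine (a I x) by rewrite fine_ge0.
  rewrite poweR_EFin -EFinM !lee_fin -ler_pdivlMr// => h.
  rewrite /c -[leLHS]powRr1// -(mulfV tn) powRrM; apply: ge0_ler_powR => //.
  - by rewrite invr_ge0 ltW.
  - by rewrite nnegrE powR_ge0.
  - by rewrite nnegrE divr_ge0// fine_ge0.
have Sc : (\int[mu]_h (ind S (x, h) * w h) <= c%:E)%E.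
  apply: le_trans Slim _; apply: lime_le; first exact: ereal_nondecreasing_is_cvgn (nda x).
  by apply: nearW.
have yv0 : 0 <= fine y / v x by rewrite divr_ge0 ?fine_ge0.
apply: (@le_trans _ _ (c%:E `^ th * (v x)%:E)%E).
  by apply: lee_wpmul2r; [rewrite lee_fin|apply: le_poweR => //; exact: ltW].
rewrite poweR_EFin /c -powRrM mulVf// powRr1//.
by rewrite -EFinM divfK ?gt_eqF// fineK.
Qed.

End MixedLimit.

(** * Reduction of small outer exponents *)

Section ExponentReduction.
Context {R : realType} {n : nat}.
Hypothesis n0 : (0 < n)%N.
Local Notation V := 'rV[R]_n.
Local Notation mu := (@borel_rV R n).

Lemma measurable_enorm_pow (a : R) : measurable_fun setT (fun h : V => (enorm h `^ a)%:E).
Proof.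
apply/measurable_EFinP; apply: (measurableT_comp (measurable_powR a)).
exact: measurable_enorm.
Qed.

(** Split at [|h| `^ b = Y]. Below, the integral of [|h| `^ (b q - n)] over the
    annuli is a geometric sum; above, [|h| `^ (b q)] is at most
    [Y `^ (q - p) * |h| `^ (b p)]. *)
Lemma exponent_split (b p q : R) : b != 0 -> 0 < q -> q < p ->
  exists2 C, 0 <= C & forall (B : set V) (sig : R) (L : nat) (Y : R), measurable B -> 0 < sig ->
  (forall h, B h -> exists2 i, (i < L)%N & annulus (sc sig i) h) -> 0 < Y ->
  (\int[mu]_h (ind B h * (enorm h `^ (b * q - n%:R))%:E) <=
   (C * Y `^ q)%:E + (Y `^ (q - p))%:E * \int[mu]_h (ind B h * (enorm h `^ (b * p - n%:R))%:E))%E.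
Proof.
move=> b0 q0 qp.
have rb : 2 `^ b != 1 :> R by rewrite powR_eq1 (negbTE b0) orbF; apply/norP; split; lra.
have [Cg Cg0 HCg] := @geo_sum_le R (2 `^ b) q (powR_gt0 b (ltr0n R 2)) rb q0.
have db := @dist_gt0 R n n0 b; have dq := @dist_gt0 R n n0 (b * q - n%:R).
pose d : R := @dist R n b; pose e : R := @dist R n (b * q - n%:R).
exists (e * 2 ^+ n * Cg * d `^ q).
  by rewrite !mulr_ge0 ?powR_ge0 ?exprn_ge0// ltW.
move=> B sig L Y mB sig0 HB Y0.
pose t i (h : V) : \bar R := if sc sig i `^ b <= d * Y then ((e * sc sig i `^ (b * q - n%:R))%:E * ind (cube 0 (sc sig i)) h)%E else 0%E.
have t0 i h : (0 <= t i h)%E.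
  by rewrite /t; case: ifP => // _; rewrite mule_ge0 ?ind_ge0// lee_fin mulr_ge0 ?powR_ge0// ltW.
have mt i : measurable_fun setT (t i).
  rewrite /t; case: (_ <= _); last exact: measurable_cst.
  by apply: measurable_funeM; apply: measurable_ind; exact: measurable_cube.
have mB2 : measurable_fun setT (fun h : V => ind B h * (enorm h `^ (b * p - n%:R))%:E)%E.
  by apply: emeasurable_funM; [exact: measurable_ind|exact: measurable_enorm_pow].
have B20 (h : V) : (0 <= ind B h * (enorm h `^ (b * p - n%:R))%:E)%E.
  by rewrite mule_ge0 ?ind_ge0// lee_fin powR_ge0.
have Yq0 : (0 <= (Y `^ (q - p))%:E)%E by rewrite lee_fin powR_ge0.
apply: (@le_trans _ _ (\int[mu]_h (\sum_(i < L) t i h + (Y `^ (q - p))%:E * (ind B h * (enorm h `^ (b * p - n%:R))%:E)))%E).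
  apply: le_integral_ge0 => h; first by rewrite mule_ge0 ?ind_ge0// lee_fin powR_ge0.
  have S0 : (0 <= \sum_(i < L) t i h)%E by apply: sume_ge0.
  have [Bh|nB] := pselect (B h); last by rewrite ind_out// mul0e adde_ge0// mule_ge0// mul0e.
  have [i iL hi] := HB h Bh; have si0 := sc_gt0 sig0 i.
  have /andP[h1 _] := enorm_annulus n0 si0 hi.
  have h0 : 0 < enorm h by apply: lt_le_trans h1; rewrite divr_gt0.
  have hb0 : 0 < enorm h `^ b by rewrite powR_gt0.
  rewrite ind_in// !mul1e; have [hY|hY] := leP (enorm h `^ b) Y.
    rewrite -[leLHS]adde0; apply: leeD; last by rewrite mule_ge0// lee_fin powR_ge0.
    rewrite (bigD1 (Ordinal iL))//= -[leLHS]adde0; apply: leeD; last by apply: sume_ge0.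
    rewrite /t ifT; last first.
      have /andP[h2 _] := powR_annulus n0 b si0 hi.
      by have := le_trans h2 hY; rewrite mulrC ler_pdivrMr// mulrC.
    rewrite ind_in ?mule1; last by case: hi.
    by rewrite lee_fin; have /andP[] := powR_annulus n0 (b * q - n%:R) si0 hi.
  rewrite -[leLHS]add0e; apply: leeD => //; rewrite -EFinM lee_fin.
  have -> : b * q - n%:R = b * (q - p) + (b * p - n%:R) by ring.
  rewrite [leLHS]powRD; last by rewrite (gt_eqF h0) implybT.
  rewrite ler_wpM2r ?powR_ge0// powRrM -[q - p]opprK [leLHS]powRN [leRHS]powRN.
  rewrite lef_pV2 ?posrE ?powR_gt0//; apply: ge0_ler_powR; rewrite ?nnegrE ?(ltW hb0) ?(ltW Y0) ?(ltW hY)//.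
  by rewrite oppr_ge0 subr_le0 ltW.
rewrite ge0_integralD//; last 4 first.
- by move=> h _; apply: sume_ge0.
- exact: emeasurable_sum.
- by move=> h _; rewrite mule_ge0.
- exact: measurable_funeM.
rewrite ge0_integralZl//; apply: leeD => //.
rewrite ge0_integral_sum//.
apply: (@le_trans _ _ (\sum_(i < L) (e * 2 ^+ n * (if sig `^ b * (2 `^ b) ^+ i <= d * Y then (sig `^ b * (2 `^ b) ^+ i) `^ q else 0))%:E)%E).
  apply: lee_sum => i _; have si0 := sc_gt0 sig0 i.
  have E : sc sig i `^ b = sig `^ b * (2 `^ b) ^+ i.
    by rewrite /sc powRM ?exprn_ge0 ?(ltW sig0)// powRX.
  rewrite /t -E; case: ifP => _; last by rewrite integral0 mulr0.
  rewrite ge0_integralZl//; last 3 first.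
  - by apply: measurable_ind; exact: measurable_cube.
  - by move=> h _; exact: ind_ge0.
  - by rewrite lee_fin mulr_ge0 ?powR_ge0// ltW.
  rewrite integral_indV ?mu_cube ?(ltW si0)//; last exact: measurable_cube.
  rewrite -EFinM lee_fin -powRrM [(2 * _) ^+ n]exprMn -[sc sig i ^+ n]powR_mulrn ?(ltW si0)//.
  rewrite le_eqVlt; apply/orP; left; apply/eqP.
  rewrite [in RHS](_ : b * q = (b * q - n%:R) + n%:R); last by rewrite subrK.
  rewrite [in RHS]powRD; last by rewrite (gt_eqF si0) implybT.
  by ring.
rewrite sumEFin lee_fin -mulr_sumr.
have dY : 0 <= d * Y by rewrite mulr_ge0 ?ltW.
have eq0 : 0 <= e * 2 ^+ n by rewrite mulr_ge0 ?exprn_ge0// ltW.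
apply: le_trans (ler_wpM2l eq0 (HCg (sig `^ b) (d * Y) L (powR_gt0 _ sig0) dY)) _.
by rewrite (powRM _ (ltW db) (ltW Y0)) !mulrA.
Qed.

(** Optimal choice of [Y] in [exponent_split]: [Y `^ p] is the integral for [q = p]. *)
Lemma exponent_reduction (b p q : R) : b != 0 -> 0 < q -> q < p ->
  exists2 C, 0 < C & forall (B : set V) (sig : R) (L : nat), measurable B -> 0 < sig ->
  (forall h, B h -> exists2 i, (i < L)%N & annulus (sc sig i) h) ->
  ((\int[mu]_h (ind B h * (enorm h `^ (b * q - n%:R))%:E)) `^ (p / q) <=
   C%:E * \int[mu]_h (ind B h * (enorm h `^ (b * p - n%:R))%:E))%E.
Proof.
move=> b0 q0 qp; have p0 : 0 < p by lra.
have [C C0 HC] := exponent_split b0 q0 qp.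
have C1 : 0 < C + 1 by rewrite ltr_wpDl.
exists ((C + 1) `^ (p / q)); first by rewrite powR_gt0.
move=> B sig L mB sig0 HB; have {}HC Y := HC B sig L Y mB sig0 HB.
set F := (\int[mu]_h _)%E in HC *; set X := (\int[mu]_h _)%E in HC *.
have F0 : (0 <= F)%E by apply: integral_ge0 => h _; rewrite mule_ge0 ?ind_ge0// lee_fin powR_ge0.
have X0 : (0 <= X)%E by apply: integral_ge0 => h _; rewrite mule_ge0 ?ind_ge0// lee_fin powR_ge0.
have pq0 : 0 < p / q by rewrite divr_gt0.
case: X X0 HC => [x| |]// X0 HC; last first.
  by rewrite gt0_muley ?leey// lte_fin powR_gt0.
rewrite lee_fin in X0; have [x0|x0] := ltP 0 x; last first.
  have xE : x = 0 by apply/eqP; rewrite eq_le x0 X0.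
  suff -> : F = 0%E by rewrite poweR0r ?gt_eqF// xE mule0.
  apply/eqP; rewrite eq_le F0 andbT; apply/lee_addgt0Pr => e e0; rewrite add0e.
  have Y0 : 0 < (e / (C + 1)) `^ q^-1 by rewrite powR_gt0// divr_gt0.
  apply: le_trans (HC _ Y0) _; rewrite xE mule0 adde0 lee_fin -powRrM mulVf ?gt_eqF//.
  rewrite powRr1; last by rewrite divr_ge0// ltW.
  by rewrite mulrCA ger_pMr// ler_pdivrMr// mul1r lerDl.
have Y0 : 0 < x `^ p^-1 by rewrite powR_gt0.
have pn : p != 0 by rewrite gt_eqF.
have H : (F <= ((C + 1) * x `^ (p^-1 * q))%:E)%E.
  apply: le_trans (HC _ Y0) _; rewrite -EFinM -EFinD lee_fin -!powRrM mulrDl lerD2l mul1r.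
  rewrite -{2}(powRr1 (ltW x0)) -powRD; last by rewrite (gt_eqF x0) implybT.
  by rewrite (_ : p^-1 * (q - p) + 1 = p^-1 * q)//; field.
apply: le_trans (le_poweR (ltW pq0) F0 H) _.
rewrite poweR_EFin -EFinM lee_fin powRM ?powR_ge0 ?(ltW C1)// -powRrM.
rewrite (_ : p^-1 * q * (p / q) = 1); last by field; rewrite pn gt_eqF.
by rewrite powRr1// ltW.
Qed.

End ExponentReduction.

(** * The estimate for Borel functions *)

Section Cover.
Context {R : realType} {n : nat}.
Hypothesis n0 : (0 < n)%N.
Local Notation V := 'rV[R]_n.
Local Notation mu := (@borel_rV R n).
Variables (k l : nat) (b th lam : R) (f : V -> R).
Hypotheses (k0 : (0 < k)%N) (th01 : 0 < th < 1) (lam0 : 0 < lam).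
Hypothesis mf : measurable_fun setT f.

(** The divisor accounts for replacing the norm of [h] by its dyadic radius. *)
Definition cover_cst : R := chain_cst k th / @dist R n (b + l%:R).

Lemma cover_cst_gt0 : 0 < cover_cst.
Proof. by rewrite divr_gt0 ?chain_cst_gt0// dist_gt0. Qed.

Let eta := cover_cst.

Definition heavy_at (s : R) (m : nat) : set V :=
  [set y | heavy k f y s (level_at l b lam eta th m * s `^ b * s ^+ l)].

(** The indices are the dyadic exponent of [h], the number of scales between [h] and
    the heavy point, and the position of this point in the progression. *)
Definition piece (z : int * nat * nat) : set (V * V) :=
  [set u | annulus (2 ^ z.1.1) u.2 /\
     nb (heavy_at (2 ^ z.1.1 / 2 ^+ z.1.2) z.1.2) (2 ^ z.1.1 / 2 ^+ z.1.2) (u.1 + z.2%:R *: u.2)].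

(** The part of the superlevel set that is seen by finitely many scales. *)
Definition trunc (I : nat) : set (V * V) :=
  [set u | [/\ superlevel lam b k l f u, cube 0 I%:R u.1 &
     exists z, [/\ (`|z.1.1| <= I)%N, (z.1.2 <= I)%N, (z.2 < k.+1)%N & piece z u]]].

Lemma trunc_mono I J : (I <= J)%N -> trunc I `<=` trunc J.
Proof.
move=> IJ u [Su uI [z [z1 z2 z3 zu]]]; split => //.
  by apply: cube_subset uI; rewrite ler_nat.
by exists z; split => //; [exact: leq_trans z1 IJ|exact: leq_trans z2 IJ].
Qed.

Lemma measurable_superlevel : measurable (superlevel lam b k l f).
Proof.
rewrite (_ : superlevel _ _ _ _ _ =
  (snd @^-1` ~` cube 0 0) `&` [set u | lam * enorm u.2 `^ (b + l%:R) < `|fdiff k u.2 f u.1|]).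
  apply: measurableI.
    rewrite -[X in measurable X]setTI; apply: measurable_snd => //.
    by apply: measurableC; exact: measurable_cube.
  have mD : measurable_fun setT (fun u : V * V => `|fdiff k u.2 f u.1| - lam * enorm u.2 `^ (b + l%:R)).
    apply: measurable_funB.
      apply: measurableT_comp => //.
      by apply: measurable_fdiff.
    apply: measurable_funM => //; apply: (measurableT_comp (measurable_powR _)).
    by apply: (measurableT_comp (@measurable_enorm R n)); exact: measurable_snd.
  rewrite (_ : [set u | _] = (fun u : V * V => `|fdiff k u.2 f u.1| - lam * enorm u.2 `^ (b + l%:R)) @^-1` `]0, +oo[).
    by rewrite -[X in measurable X]setTI; apply: mD => //; exact: measurable_itv.
  by apply/seteqP; split => u /=; rewrite in_itv/= andbT subr_gt0.
apply/seteqP; split => -[x h] /= [h0 hh]; split => //.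
  by move=> hc; move/eqP: h0; apply; apply/rowP => i; have := hc i; rewrite !mxE subr0 normr_le0 => /eqP.
by apply/eqP => /= hE; apply: h0; rewrite hE; exact: cube_refl.
Qed.

Lemma measurable_piece z : measurable (piece z).
Proof.
rewrite (_ : piece z = (snd @^-1` annulus (2 ^ z.1.1)) `&`
  ((fun u : V * V => u.1 + z.2%:R *: u.2) @^-1`
    nb (heavy_at (2 ^ z.1.1 / 2 ^+ z.1.2) z.1.2) (2 ^ z.1.1 / 2 ^+ z.1.2)))//.
apply: measurableI; rewrite -[X in measurable X]setTI.
  by apply: measurable_snd => //; exact: measurable_annulus.
have mm : measurable_fun setT (fun u : V * V => u.1 + z.2%:R *: u.2).
  apply: measurable_rV_add; first exact: measurable_fst.
  by apply: measurable_rV_scale; [exact: measurable_cst|exact: measurable_snd].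
by apply: mm => //; exact: measurable_nb.
Qed.

Lemma measurable_trunc I : measurable (trunc I).
Proof.
pose F (z : int * nat * nat) : set (V * V) :=
  if [&& (`|z.1.1| <= I)%N, (z.1.2 <= I)%N & (z.2 < k.+1)%N] then piece z else set0.
rewrite (_ : trunc I = superlevel lam b k l f `&` (fst @^-1` cube 0 I%:R) `&` \bigcup_z F z).
  apply: measurableI; [apply: measurableI|].
  - exact: measurable_superlevel.
  - by rewrite -[X in measurable X]setTI; apply: measurable_fst => //; exact: measurable_cube.
  - apply: countable_bigcupT_measurable; first exact: countableP.
    by move=> z; rewrite /F; case: ifP => _; [exact: measurable_piece|exact: measurable0].
apply/seteqP; split => u.
  move=> [Su uI [z [z1 z2 z3 zu]]]; split => //.
  by exists z => //; rewrite /F z1 z2 z3.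
move=> [[Su uI] [z _]]; rewrite /F; case: ifP => // /and3P[z1 z2 z3] zu.
by split => //; exists z.
Qed.

Lemma sup_norm_scale (h : V) : h != 0 -> exists a : int, annulus (2 ^ a) h.
Proof.
move=> hn0.
have [i0 hi0] : exists i, h ord0 i != 0.
  apply: contrapT => H; move/eqP: hn0; apply; apply/rowP => i; rewrite mxE.
  by apply/eqP; apply: contrapT => hi; apply: H; exists i; apply/negP.
pose i1 := [arg max_(i > i0) `|h ord0 i|]%O.
have [hmax h1] : (forall i, `|h ord0 i| <= `|h ord0 i1|) /\ 0 < `|h ord0 i1|.
  rewrite /i1; case: arg_maxP => // i _ Hi; split; first by move=> j; exact: Hi.
  by apply: lt_le_trans (Hi i0 isT); rewrite normr_gt0.
set M := `|h ord0 i1| in hmax h1.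
have l2 : 0 < ln 2 :> R by rewrite ln_gt0// ltr1n.
pose a := Num.ceil (ln M / ln 2).
have aE : (2 : R) ^ a = expR (a%:~R * ln 2).
  by rewrite -powR_intmul// /powR pnatr_eq0.
have Ma : M <= 2 ^ a.
  rewrite aE -[leLHS]lnK ?posrE// ler_expR -ler_pdivrMr//; exact: ceil_ge.
have aM : 2 ^ a / 2 < M.
  rewrite ltr_pdivrMr// aE -[X in _ < X * _]lnK ?posrE// -[X in _ < _ * X](@lnK _ 2)// ?posrE// -expRD ltr_expR.
  have := gt_pred_ceil (ln M / ln 2); rewrite -/a intrB ltr_pdivlMr//.
  by rewrite mulrBl mul1r ltrBlDr.
exists a; split.
  by move=> i; rewrite mxE subr0; exact: le_trans (hmax i) Ma.
by move=> /(_ i1); rewrite mxE subr0 leNgt aM.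
Qed.

Lemma regular_good (y : V) (a : int) (d : R) : regular k f y -> 0 < d ->
  exists M : nat, good k f y (2 ^ a / 2 ^+ M) d.
Proof.
move=> ry d0; have [M' aM' gM] := ry d d0 `|a|%N.
exists (absz (a + M'%:Z)).
have aM : 0 <= a + M'%:Z.
  by rewrite -lerBlDl sub0r; apply: le_trans (_ : `|a| <= _); rewrite ?ler_normr ?lexx ?orbT// -abszE lez_nat.
rewrite (_ : 2 ^ a / 2 ^+ (absz (a + M'%:Z)) = 2 ^- M')//.
have -> : (2 : R) ^+ (absz (a + M'%:Z)) = 2 ^ (a + M'%:Z) by rewrite -{2}(gez0_abs aM).
rewrite expfzDr ?pnatr_eq0// invfM mulrA divff ?mul1r//.
by rewrite expfz_neq0// pnatr_eq0.
Qed.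

(** [bad_heavy] on the dyadic annulus of [h]. *)
Lemma trunc_cover (x h : V) : (forall j, (j < k.+1)%N -> regular k f (x + j%:R *: h)) ->
  superlevel lam b k l f (x, h) -> exists I, trunc I (x, h).
Proof.
move=> reg Sx; have [hn0 big] := Sx.
have [a ha] := sup_norm_scale hn0.
have r0 : 0 < (2 : R) ^ a by rewrite exprz_gt0.
set r := (2 : R) ^ a in ha r0.
pose T := lam * ((@dist R n (b + l%:R))^-1 * r `^ (b + l%:R)).
have di := @dist_gt0 R n n0 (b + l%:R).
have rb : 0 < r `^ (b + l%:R) by rewrite powR_gt0.
have T0 : 0 < T by rewrite /T !mulr_gt0// invr_gt0.
have Tf : T < `|fdiff k h f x|.
  apply: le_lt_trans big; rewrite /T ler_pM2l//.
  by have /andP[] := powR_annulus n0 (b + l%:R) r0 ha.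
have hr : cube 0 r h by case: ha.
have [j jk d d0|j [m [jk hv]]] := bad_heavy k0 mf th01 r0 T0 hr Tf.
  by apply: regular_good => //; exact: reg.
have s0 : 0 < r / 2 ^+ m by rewrite divr_gt0// exprn_gt0.
pose I0 := Num.bound (\sum_(i < n) `|x ord0 i|).
exists (maxn (maxn `|a|%N m) I0); split => //.
  move=> i /=; rewrite mxE subr0.
  apply: (@le_trans _ _ (\sum_(i < n) `|x ord0 i|)).
    by rewrite (bigD1 i)//= lerDl sumr_ge0.
  apply: (@le_trans _ _ I0%:R).
    by apply/ltW/archi_boundP; rewrite sumr_ge0.
  by rewrite ler_nat leq_maxr.
exists (a, m, j); split => //=.
- by rewrite !leq_max leqnn.
- by rewrite !leq_max leqnn orbT.
- suff H : heavy_at (r / 2 ^+ m) m (x + j%:R *: h).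
    exact: (conj ha (nb_cube H s0 (cube_refl _ (lexx 0)))).
  rewrite /heavy_at/=; move: hv; congr (is_true (heavy _ _ _ _ _)).
  set s := r / 2 ^+ m in s0 *.
  have rs : r = s * 2 ^+ m by rewrite /s divfK// expf_neq0.
  rewrite /T /level_at /eta /cover_cst rs.
  have m0 : 0 <= (2 : R) ^+ m by rewrite exprn_ge0.
  rewrite (powRM _ (ltW s0) m0) (powRX _ _ (ler0n R 2)) exprMn powRD; last first.
    by rewrite (gt_eqF s0) implybT.
  by rewrite (powR_mulrn _ (ltW s0)); ring.
Qed.

(** Bounds the distance to the origin of every heavy point of a truncated pair. *)
Definition trunc_radius (I : nat) : R := I%:R + k.+1%:R * 2 ^+ I.

(** The dyadic scales from [2 ^ - 2 I] to [2 ^ I], reindexed by natural numbers. *)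
Lemma trunc_thick (I : nat) (x h : V) : trunc I (x, h) ->
  exists z : 'I_(3 * I).+1 * 'I_(3 * I).+1 * 'I_k.+1,
   [/\ (z.1.2 <= z.1.1)%N, annulus (sc (2 ^- (2 * I)) z.1.1) h &
     thick k l b f (level_at l b lam eta th (z.1.1 - z.1.2)) (2 ^- (2 * I)) (trunc_radius I) z.1.2
       (x + z.2%:R *: h)].
Proof.
move=> [_ xI [[[a m] j] /= [aI mI jk [ha nx]]]].
have aE : a + (2 * I)%N%:Z = absz (a + (2 * I)%N%:Z).
  rewrite gez0_abs//; lia.
pose i := absz (a + (2 * I)%N%:Z).
have iE : (i : int) = a + (2 * I)%N%:Z by rewrite -aE.
have iL : (i < (3 * I).+1)%N by lia.
have mi : (m <= i)%N by lia.
have scE c : sc (2 ^- (2 * I)) c = (2 : R) ^ (c%:Z - (2 * I)%N%:Z).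
  by rewrite /sc expfzDr ?pnatr_eq0// mulrC exprnN.
have sci : sc (2 ^- (2 * I)) i = (2 : R) ^ a by rewrite scE iE addrK.
have scc : sc (2 ^- (2 * I)) (i - m) = (2 : R) ^ a / 2 ^+ m.
  by rewrite -sci (sc_shift _ (leq_subr m i)) subKn// mulfK// expf_neq0.
have imL : (i - m < (3 * I).+1)%N by exact: leq_ltn_trans (leq_subr _ _) iL.
exists (Ordinal iL, Ordinal imL, Ordinal jk); split => /=; first exact: leq_subr.
  by rewrite sci.
rewrite /thick scc subKn//; case: nx => y [t [hy ts yx]].
suff yI : cube 0 (trunc_radius I) y.
  have hv : hset k l b f (level_at l b lam eta th m) (2 ^- (2 * I)) (trunc_radius I) (i - m) y.
    by apply: (conj yI); rewrite /lev scc; exact: hy.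
  exact: (nb_cube hv ts yx).
have I2 : (2 : R) ^ a <= 2 ^+ I.
  rewrite -[2 ^+ I]/(2 ^ (I%:Z)); apply: ler_weXz2l; first by rewrite ler1n.
  lia.
have tI : t <= 2 ^+ I.
  apply: (le_trans (ltW ts)); apply: le_trans I2.
  by rewrite ler_pdivrMr ?exprn_gt0// ler_peMr ?exprz_ge0// exprn_ege1// ler1n.
have xy : cube (x + j%:R *: h) (2 ^+ I) y by apply/cubeC; exact: cube_subset yx.
apply: (@cube_trans _ _ 0 (x + j%:R *: h) y (I%:R + k%:R * 2 ^+ I) (2 ^+ I)) => //.
  by rewrite /trunc_radius -natr1; lra.
move=> c; rewrite !mxE subr0; have := xI c; rewrite mxE subr0 => xc.
have := ha.1 c; rewrite mxE subr0 => hc.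
apply: le_trans (ler_normD _ _) _; rewrite /= in xc; rewrite normrM ger0_norm ?ler0n//.
have jh : j%:R * `|h ord0 c| <= k%:R * 2 ^+ I.
  by apply: ler_pM => //; [rewrite ler_nat -ltnS|exact: le_trans hc I2].
lra.
Qed.

End Cover.

Section BorelEstimate.
Context {R : realType} {n : nat}.
Hypothesis n0 : (0 < n)%N.
Local Notation V := 'rV[R]_n.
Local Notation mu := (@borel_rV R n).
Variables (k l : nat) (CL b p : R).
Hypotheses (k0 : (0 < k)%N) (l0 : (0 < l)%N) (CL0 : 0 <= CL) (p1 : 1 <= p) (b0 : b != 0).
Hypothesis pb : p = 1 -> 0 < b \/ b < -1.

Let p0 : 0 < p. Proof. exact: lt_le_trans p1. Qed.

Lemma decay_lt1 q : 0 < q -> n%:R * (p^-1 - q^-1) < l%:R ->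
  exists2 th : R, 0 < th < 1 & @decay R n l p q th < 1.
Proof.
move=> q0 npq; have pn : p != 0 by rewrite gt_eqF.
pose d : R := l%:R * p - n%:R * (1 - p / q).
have d0 : 0 < d.
  rewrite subr_gt0 -ltr_pdivrMr// (_ : _ / p = n%:R * (p^-1 - q^-1))//.
  by field; rewrite pn gt_eqF.
exists (2^-1 `^ (d / (2 * p))).
  by apply: powR_lt1; [lra|rewrite divr_gt0// mulr_gt0].
rewrite /decay -powRrM -(@powR_inv1 _ 2)// -powRrM -powRD; last by rewrite pnatr_eq0 implybT.
rewrite [X in 2 `^ X](_ : _ = -1 * (d / 2)); last by rewrite /d; field; rewrite pn gt_eqF.
rewrite powRrM powR_inv1//.
by have /andP[] : 0 < (2^-1 : R) `^ (d / 2) < 1 by apply: powR_lt1; [lra|rewrite divr_gt0].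
Qed.

Section Hyps.
Variables (f g v : V -> R) (A : R).

Definition admissible := [/\ measurable_fun setT f, measurable_fun setT g,
   (forall x, 0 <= g x), line_estimate k l f g CL & forall x, 0 <= v x] /\
  [/\ measurable_fun setT v, 0 <= A, A1_at v A,
   (forall r, (\int[mu]_z (ind (cube 0 r) z * (v z)%:E) < +oo)%E) &
   (forall r, (\int[mu]_z (ind (cube 0 r) z * (g z)%:E) < +oo)%E)].

End Hyps.

Lemma trunc_le_ge q th : p <= q -> 0 < th < 1 -> @decay R n l p q th < 1 ->
  exists2 C, 0 <= C & forall f g v A lam I, admissible f g v A -> 0 < lam ->
  ((lam `^ p)%:E * \int[mu]_x ((\int[mu]_h (ind (trunc k l b th lam f I) (x, h) *
       (enorm h `^ (b * q - n%:R))%:E)) `^ (p / q) * (v x)%:E) <=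
   (C * (1 + A) ^+ 3)%:E * \int[mu]_x (g x `^ p * v x)%:E)%E.
Proof.
move=> pq th01 dec1; have /andP[t0 _] := th01.
have q0 : 0 < q by exact: lt_le_trans p0 pq.
have eta0 := cover_cst_gt0 n0 k l b th01.
have [C C0 HC] := double_sum_le k0 CL0 p1 b0 pb pq t0 eta0 dec1.
pose d := @dist R n (b * q - n%:R); have d0 : 0 < d by exact: dist_gt0.
have pq0 : 0 < p / q by rewrite divr_gt0.
exists (d `^ (p / q) * C); first by rewrite mulr_ge0// powR_ge0.
move=> f g v A lam I [[mf mg g0 Lfg v0] [mv A0 Av lv _]] lam0.
have s0 : 0 < 2 ^- (2 * I) :> R by rewrite invr_gt0 exprn_gt0.
have {HC}HC := HC f g v A lam (2 ^- (2 * I)) (trunc_radius k I) (3 * I).+1 mf mg g0 Lfg v0 mv A0 Av lv lam0 s0.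
rewrite -mulrA [X in (_ <= X * _)%E]EFinM -[leRHS]muleA.
have dp0 : (0 <= (d `^ (p / q))%:E)%E by rewrite lee_fin powR_ge0.
apply: le_trans (lee_wpmul2l dp0 HC); rewrite muleCA; apply: lee_wpmul2l; first by rewrite lee_fin powR_ge0.
set Ph := (X in (_ <= _ * \int[mu]_x ((\int[mu]_h X x h) `^ _ * _))%E).
have T0 (z : 'I_(3 * I).+1 * 'I_(3 * I).+1 * 'I_k.+1) (x h : V) : (0 <= (sc (2 ^- (2 * I)) z.1.1 `^ (b * q - n%:R))%:E *
        (ind (cube 0 (sc (2 ^- (2 * I)) z.1.1)) h *
         ind (thick k l b f (level_at l b lam (@cover_cst R n k l b th) th (z.1.1 - z.1.2)) (2 ^- (2 * I)) (trunc_radius k I) z.1.2)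
             (x + z.2%:R *: h)%R))%E.
  by apply: mule_ge0; [rewrite lee_fin powR_ge0|apply: mule_ge0; exact: ind_ge0].
have Ph0 x h : (0 <= Ph x h)%E.
  by apply: sume_ge0 => z _; case: ifP => // _; exact: T0.
have mPh : measurable_fun setT (fun z : V * V => Ph z.1 z.2).
  apply: emeasurable_sum => z; case: (_ <= _)%N; last exact: measurable_cst.
  apply: measurable_funeM; apply: emeasurable_funM.
    by apply: measurable_ind_comp; [exact: measurable_cube|exact: measurable_snd].
  apply: measurable_ind_comp; first exact: measurable_nb.
  apply: measurable_rV_add; first exact: measurable_fst.
  by apply: measurable_rV_scale; [exact: measurable_cst|exact: measurable_snd].
have IPh0 x : (0 <= \int[mu]_h Ph x h)%E by exact: integral_ge0.
have mIPh : measurable_fun setT (fun x => \int[mu]_h Ph x h)%E.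
  by apply: (@measurable_fun_fubini_tonelli_F _ _ V V R mu (fun z => Ph z.1 z.2)).
rewrite -ge0_integralZl//; last 2 first.
- apply: emeasurable_funM; last exact/measurable_EFinP.
  exact: (measurableT_comp (measurable_poweR _)).
- by move=> x _; rewrite mule_ge0 ?poweR_ge0 ?lee_fin.
have F0 x : (0 <= \int[mu]_h (ind (trunc k l b th lam f I) (x, h) * (enorm h `^ (b * q - n%:R))%:E))%E.
  by apply: integral_ge0 => h _; rewrite mule_ge0 ?ind_ge0// lee_fin powR_ge0.
apply: le_integral_ge0 => x; first by rewrite mule_ge0 ?poweR_ge0 ?lee_fin.
rewrite muleA; apply: lee_wpmul2r; first by rewrite lee_fin.
rewrite -poweR_EFin -poweRM//; last by rewrite lee_fin ltW.
apply: le_poweR => //; first exact: ltW.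
rewrite -ge0_integralZl//; last 2 first.
- exact: (measurable_section x mPh).
- by rewrite lee_fin ltW.
apply: le_integral_ge0 => h; first by rewrite mule_ge0 ?ind_ge0// lee_fin powR_ge0.
have [Th|nT] := pselect (trunc k l b th lam f I (x, h)); last first.
  by rewrite ind_out// mul0e mule_ge0// lee_fin ltW.
have [z [zz za zt]] := trunc_thick n0 k0 th01 lam0 Th.
rewrite ind_in// mul1e /Ph (bigD1 z)//= zz.
rewrite ge0_muleDr; last 2 first.
- exact: T0.
- by apply: sume_ge0 => z' _; case: ifP => // _; exact: T0.
rewrite -[leLHS]adde0; apply: leeD; last first.
  by rewrite mule_ge0 ?lee_fin ?(ltW d0)//; apply: sume_ge0 => z' _; case: ifP => // _; exact: T0.
rewrite [ind (cube 0 _) h]ind_in; last by case: za.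
rewrite ind_in// mul1e mule1 -EFinM lee_fin.
by have /andP[] := powR_annulus n0 (b * q - n%:R) (sc_gt0 s0 z.1.1) za.
Qed.

Lemma trunc_le q : 0 < q -> n%:R * (p^-1 - q^-1) < l%:R ->
  exists2 th, 0 < th < 1 & exists2 C, 0 <= C & forall f g v A lam I, admissible f g v A -> 0 < lam ->
  ((lam `^ p)%:E * \int[mu]_x ((\int[mu]_h (ind (trunc k l b th lam f I) (x, h) *
       (enorm h `^ (b * q - n%:R))%:E)) `^ (p / q) * (v x)%:E) <=
   (C * (1 + A) ^+ 3)%:E * \int[mu]_x (g x `^ p * v x)%:E)%E.
Proof.
move=> q0 npq; have [pq|qp] := leP p q.
  have [th th01 dec1] := decay_lt1 q0 npq.
  by exists th => //; exact: trunc_le_ge.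
have npp : n%:R * (p^-1 - p^-1) < l%:R :> R by rewrite subrr mulr0 ltr0n.
have [th th01 dec1] := decay_lt1 p0 npp.
exists th => //.
have [C C0 HC] := trunc_le_ge (lexx p) th01 dec1.
have [D D0 HD] := exponent_reduction n0 b0 q0 qp.
exists (D * C); first by rewrite mulr_ge0// ltW.
move=> f g v A lam I adm lam0; have [[mf _ _ _ v0] [mv _ _ _ _]] := adm.
have {HC}HC := HC f g v A lam I adm lam0.
have s0 : 0 < 2 ^- (2 * I) :> R by rewrite invr_gt0 exprn_gt0.
rewrite -mulrA [X in (_ <= X * _)%E]EFinM -[leRHS]muleA.
have De0 : (0 <= D%:E)%E by rewrite lee_fin ltW.
apply: le_trans (lee_wpmul2l De0 HC); rewrite muleCA; apply: lee_wpmul2l; first by rewrite lee_fin powR_ge0.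
have mT : measurable (trunc k l b th lam f I) by exact: measurable_trunc.
have mi : measurable_fun setT (fun z : V * V => ind (trunc k l b th lam f I) z * (enorm z.2 `^ (b * p - n%:R))%:E)%E.
  apply: emeasurable_funM; first exact: measurable_ind.
  by apply: (measurableT_comp (measurable_enorm_pow _)); exact: measurable_snd.
have F0 a x : (0 <= \int[mu]_h (ind (trunc k l b th lam f I) (x, h) * (enorm h `^ a)%:E))%E.
  by apply: integral_ge0 => h _; rewrite mule_ge0 ?ind_ge0// lee_fin powR_ge0.
rewrite -ge0_integralZl//; last 2 first.
- apply: emeasurable_funM; last exact/measurable_EFinP.
  apply: (measurableT_comp (measurable_poweR _)).
  apply: (@measurable_fun_fubini_tonelli_F _ _ V V R mu (fun z : V * V => ind (trunc k l b th lam f I) z * (enorm z.2 `^ (b * p - n%:R))%:E)%E) => //.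
  by move=> z; rewrite mule_ge0 ?ind_ge0// lee_fin powR_ge0.
- by move=> x _; rewrite mule_ge0 ?poweR_ge0 ?lee_fin.
apply: le_integral_ge0 => x; first by rewrite mule_ge0 ?poweR_ge0 ?lee_fin.
rewrite muleA; apply: lee_wpmul2r; first by rewrite lee_fin.
rewrite divff ?gt_eqF// poweRe1//.
have := HD [set h | trunc k l b th lam f I (x, h)] (2 ^- (2 * I)) (3 * I).+1.
have E (a : R) : (\int[mu]_h (ind [set h | trunc k l b th lam f I (x, h)] h * (enorm h `^ a)%:E) =
    \int[mu]_h (ind (trunc k l b th lam f I) (x, h) * (enorm h `^ a)%:E))%E.
  by apply: eq_integral => h _; congr (_ * _)%E; exact: ind_eq.
rewrite !E; apply => //.
  have := measurable_xsection x mT; congr measurable.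
  by apply/seteqP; split => h; rewrite /xsection/= inE.
move=> h Th; have [z [_ za _]] := trunc_thick n0 k0 th01 lam0 Th.
by exists z.1.1.
Qed.

(** For almost every [x], all points [x + j h] are regular for almost every [h]; so the
    truncations exhaust the superlevel set up to null sets. *)
Theorem borel_estimate q : 0 < q -> n%:R * (p^-1 - q^-1) < l%:R ->
  exists2 C, 0 <= C & forall f g v A lam, admissible f g v A -> 0 < lam ->
  ((lam `^ p)%:E * \int[mu]_x ((\int[mu]_h (ind (superlevel lam b k l f) (x, h) *
       (enorm h `^ (b * q - n%:R))%:E)) `^ (p / q) * (v x)%:E) <=
   (C * (1 + A) ^+ 3)%:E * \int[mu]_x (g x `^ p * v x)%:E)%E.
Proof.
move=> q0 npq; have [th th01 [C C0 HC]] := trunc_le q0 npq.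
exists C => // f g v A lam adm lam0.
pose B : \bar R := ((C * (1 + A) ^+ 3)%:E * \int[mu]_x (g x `^ p * v x)%:E)%E.
have {}HC I : ((lam `^ p)%:E * \int[mu]_x ((\int[mu]_h (ind (trunc k l b th lam f I) (x, h) *
       (enorm h `^ (b * q - n%:R))%:E)) `^ (p / q) * (v x)%:E) <= B)%E.
  exact: (HC f g v A lam I adm lam0).
have [[mf mg g0 Lfg v0] [mv A0 Av lv lg]] := adm.
have lp : 0 < lam `^ p by rewrite powR_gt0.
have lpe : (0 <= (lam `^ p)^-1%:E)%E by rewrite lee_fin invr_ge0 ltW.
rewrite -/B.
suff H : (\int[mu]_x ((\int[mu]_h (ind (superlevel lam b k l f) (x, h) *
       (enorm h `^ (b * q - n%:R))%:E)) `^ (p / q) * (v x)%:E) <= (lam `^ p)^-1%:E * B)%E.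
  apply: le_trans (lee_wpmul2l _ H) _; first by rewrite lee_fin ltW.
  by rewrite muleA -EFinM divff ?gt_eqF// mul1e.
have [N [mN N0 HN]] := ae_regular mf mg g0 CL0 Lfg lg l0.
have regN x : ~ N x -> regular k f x by move=> Nx; apply: contrapT => r; apply: Nx; exact: HN.
apply: (@mixed_integral_le R n (trunc k l b th lam f) _ _ _ _ _ N) => //.
- by move=> I; exact: measurable_trunc.
- by move=> I J IJ; exact: trunc_mono.
- exact: measurable_enorm_pow.
- by move=> h; rewrite lee_fin powR_ge0.
- by rewrite divr_gt0.
- move=> x Nx.
  have [M [mM M0 HM]] := null_dilates x mN N0; exists M; split => // h Mh Sh.
  apply: (trunc_cover n0 k0 th01 lam0 mf) => // -[|j] _; first by rewrite scale0r addr0; exact: regN.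
  by apply: regN; exact: HM.
- move=> I; have := lee_wpmul2l lpe (HC I).
  by rewrite muleA -EFinM mulVf ?gt_eqF// mul1e.
Qed.

End BorelEstimate.

(** * Smooth plateau functions *)

Section FlatFunctions.
Context {R : realType}.
Implicit Types (P : {poly R}) (t : R).

(** The functions [P(1/t) exp(-1/t)], extended by zero: a class of functions that
    is stable under derivation and whose members vanish on the negative half line. *)
Definition flat P t : R := if 0 < t then P.[t^-1] * expR (- t^-1) else 0.

Definition flat_next P : {poly R} := 'X^2 * (P - P^`()).

Lemma flat_bound P : exists2 C, 0 <= C & forall t, `|flat P t| <= C * t ^+ 2.
Proof.
exists (\sum_(i < size P) `|P`_i| * (i.+2)`!%:R).
  by apply: sumr_ge0 => i _; rewrite mulr_ge0.
move=> t; rewrite /flat; case: ltP => t0; last first.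
  by rewrite normr0 mulr_ge0 ?sqr_ge0// sumr_ge0// => i _; rewrite mulr_ge0.
have x0 : 0 < t^-1 by rewrite invr_gt0.
rewrite normrM (ger0_norm (expR_ge0 _)) expRN ler_pdivrMr ?expR_gt0//.
rewrite horner_coef; apply: le_trans (ler_norm_sum _ _ _) _.
rewrite -mulrA mulr_suml; apply: ler_sum => i _.
rewrite normrM -mulrA ler_wpM2l// ger0_norm ?exprn_ge0 ?(ltW x0)//.
have := expR_ge1Dxn i.+1 (ltW x0).
set e := expR _; set x := t^-1 in x0 *.
have -> : t ^+ 2 = x ^- 2 by rewrite /x exprVn invrK.
have f0 : 0 < (i.+2)`!%:R :> R by rewrite ltr0n fact_gt0.
move=> h; have : x ^+ i.+2 <= (i.+2)`!%:R * e.
  by rewrite mulrC -ler_pdivrMr//; apply: le_trans h; rewrite lerDr.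
move=> {}h; have x2 : 0 < x ^+ 2 by rewrite exprn_gt0.
rewrite (_ : _ * _ = (i.+2)`!%:R * e / x ^+ 2); last by ring.
by rewrite ler_pdivlMr// -exprD addn2.
Qed.

(** At zero, differentiability follows from the quadratic bound [flat_bound]. *)
Lemma is_derive_flat P t : is_derive t (1 : R) (flat P) (flat (flat_next P) t).
Proof.
have [t0|t0|t0] := ltgtP t 0.
- rewrite {2}/flat ltNge (ltW t0)/=.
  apply: (@near_eq_is_derive _ _ _ (cst 0)).
    near=> s; rewrite /flat ltNge ltW//; near: s; exact: lt_nbhsl.
- have tn : t != 0 by rewrite gt_eqF.
  rewrite {2}/flat t0.
  apply: (@near_eq_is_derive _ _ _ ((horner P \o GRing.inv) * (expR \o (fun s => - s^-1)))).
    near=> s; rewrite /flat ifT//; near: s; exact: lt_nbhsr.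
  have dV : is_derive t (1 : R) (GRing.inv : R -> R) (- t ^- 2).
    have := @is_deriveV R id t 1 1 tn (is_derive_id _ _).
    by rewrite /GRing.scale/= mulr1.
  have d1 := is_derive1_comp (is_derive_poly P t^-1) dV.
  have dN : is_derive t (1 : R) (fun s : R => - s^-1) (t ^- 2).
    by have := is_deriveN dV; rewrite opprK.
  have d2 := @is_derive1_comp _ expR (fun s => - s^-1) t _ _ (is_derive_expR (- t^-1)) dN.
  have := is_deriveM d1 d2; congr is_derive.
  rewrite /GRing.scale/= /flat_next hornerM hornerXn hornerD hornerN exprVn.
  ring.
- rewrite {}t0; apply/is_derive1_caratheodory.
  have [C C0 HC] := flat_bound P.
  have f00 Q : flat Q 0 = 0 by rewrite /flat ltxx.
  exists (fun z => if z == 0 then 0 else flat P z / z); split; last by rewrite eqxx f00.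
    move=> z; rewrite f00 !subr0; have [->|zn] := eqVneq z 0; first by rewrite f00 mulr0.
    by rewrite divfK.
  rewrite /prop_for /continuous_at eqxx; apply/cvgr0Pnorm_le => e e0.
  have C1 : 0 < C + 1 by rewrite ltr_wpDl.
  exists (e / (C + 1)) => /= [|z]; first by rewrite divr_gt0.
  rewrite /ball_/= sub0r normrN => /ltW ze.
  have [_|zn] := eqVneq z 0; first by rewrite normr0 ltW.
  rewrite normrM normfV ler_pdivrMr ?normr_gt0//; apply: le_trans (HC z) _.
  rewrite -(ger0_norm (sqr_ge0 z)) normrX expr2 mulrA ler_wpM2r//.
  apply: (@le_trans _ _ ((C + 1) * `|z|)); first by rewrite ler_wpM2r// lerDl.
  by rewrite mulrC -ler_pdivlMr.
Unshelve. all: by end_near. Qed.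

Lemma flat_bounded P : exists2 M, 0 <= M & forall t, `|flat P t| <= M.
Proof.
have M0 : 0 <= \sum_(i < size P) `|P`_i| * (1 + i`!%:R) :> R.
  by apply: sumr_ge0 => i _; rewrite mulr_ge0// addr_ge0.
exists (\sum_(i < size P) `|P`_i| * (1 + i`!%:R)) => // t.
rewrite /flat; case: ltP => t0; last by rewrite normr0.
have x0 : 0 < t^-1 by rewrite invr_gt0.
rewrite normrM (ger0_norm (expR_ge0 _)) expRN ler_pdivrMr ?expR_gt0//.
rewrite horner_coef; apply: le_trans (ler_norm_sum _ _ _) _.
rewrite mulr_suml; apply: ler_sum => i _.
rewrite normrM -mulrA ler_wpM2l// ger0_norm ?exprn_ge0 ?(ltW x0)//.
have e1 : 1 <= expR t^-1 by rewrite -expR0 ler_expR ltW.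
case: (i : nat) => [|j].
  by rewrite expr0 (le_trans e1)// ler_peMl ?expR_ge0// lerDl.
have f0 : 0 < (j.+1)`!%:R :> R by rewrite ltr0n fact_gt0.
have := expR_ge1Dxn j (ltW x0) => h.
apply: (@le_trans _ _ ((j.+1)`!%:R * expR t^-1)).
  by rewrite mulrC -ler_pdivrMr//; apply: le_trans h; rewrite lerDr.
by rewrite ler_wpM2r ?expR_ge0// lerDr.
Qed.

End FlatFunctions.

Section SmoothPlateaus.
Context {R : realType}.
Implicit Types (D : nat -> R -> R) (t : R).

(** Smoothness is carried by the explicit sequence of derivatives. *)
Record family D (Z : set R) : Prop := Family {
  family_derive : forall m t, is_derive t (1 : R) (D m) (D m.+1 t);
  family_bounded : forall m, exists2 M, 0 <= M & forall t, `|D m t| <= M;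
  family_zero : forall m t, Z t -> D m t = 0 }.

Lemma flat_family (P : {poly R}) : family (fun m => flat (iter m flat_next P)) [set t | t <= 0].
Proof.
split=> m; [move=> t; exact: is_derive_flat|exact: flat_bounded|].
by move=> t /= t0; rewrite /flat ltNge t0.
Qed.

Lemma family_affine D Z c d : family D Z ->
  family (fun m t => c ^+ m * D m (c * t + d)) ((fun t => c * t + d) @^-1` Z).
Proof.
move=> [dD bD zD]; split => m.
- move=> t; have da : is_derive t (1 : R) (fun t => c * t + d) c.
    have h1 : is_derive t (1 : R) (fun t => c * t) c.
      by have := is_deriveZ c (is_derive_id t (1 : R)); rewrite /GRing.scale/= mulr1.
    by have := is_deriveD h1 (is_derive_cst d t 1); rewrite addr0.
  have h := is_deriveZ (c ^+ m) (@is_derive1_comp _ (D m) (fun t => c * t + d) t _ _ (dD m (c * t + d)) da).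
  by apply: (is_derive_eq h); rewrite /GRing.scale/= exprSr; ring.
- have [M M0 HM] := bD m; exists (`|c ^+ m| * M) => [|t]; first by rewrite mulr_ge0.
  by rewrite normrM ler_wpM2l.
- by move=> t /= Zt; rewrite zD// mulr0.
Qed.

(** The iterated derivatives of a product, by the recursion of Leibniz' rule. *)
Fixpoint leibniz D1 D2 m a b t : R :=
  if m is m'.+1 then leibniz D1 D2 m' a.+1 b t + leibniz D1 D2 m' a b.+1 t
  else D1 a t * D2 b t.

Lemma family_mul D1 D2 Z1 Z2 : family D1 Z1 -> family D2 Z2 ->
  family (fun m => leibniz D1 D2 m 0 0) (Z1 `|` Z2).
Proof.
move=> [d1 b1 z1] [d2 b2 z2]; split => m.
- move=> t; move: 0%N {2 4}0%N; elim: m => [|m IH] a b.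
    apply: (is_derive_eq (is_deriveM (d1 a t) (d2 b t))).
    by rewrite /GRing.scale/=; ring.
  exact: is_deriveD (IH a.+1 b) (IH a b.+1).
- move: 0%N {2}0%N; elim: m => [|m IH] a b.
    have [M1 M10 HM1] := b1 a; have [M2 M20 HM2] := b2 b.
    exists (M1 * M2) => [|t]; first exact: mulr_ge0.
    by rewrite normrM ler_pM.
  have [M1 M10 HM1] := IH a.+1 b; have [M2 M20 HM2] := IH a b.+1.
  exists (M1 + M2) => [|t]; first exact: addr_ge0.
  by apply: le_trans (ler_normD _ _) _; exact: lerD.
- move=> t Zt; move: 0%N {2}0%N; elim: m => [|m IH] a b /=.
    by case: Zt => Zt; [rewrite z1// mul0r|rewrite z2// mulr0].
  by rewrite !IH addr0.
Qed.

Definition eta : R -> R := flat 1.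

Lemma eta01 t : 0 <= eta t <= 1.
Proof.
rewrite /eta /flat; case: ltP => t0; last by rewrite lexx ler01.
by rewrite hornerC mul1r expR_ge0 -expR0 ler_expR oppr_le0 invr_ge0 ltW.
Qed.

(** Approximations of the indicator function of an interval, from [a] to [b]: the
    argument of the left factor is at least [N + 1] right of [a], and eventually
    negative at each point left of [a]. *)
Definition plateau_left (N : nat) (a : R) (m : nat) (t : R) : R :=
  (N.+1%:R ^+ 2) ^+ m * flat (iter m flat_next 1) (N.+1%:R ^+ 2 * t + (N.+1%:R - N.+1%:R ^+ 2 * a)).

Definition plateau_right (N : nat) (b : R) (m : nat) (t : R) : R :=
  (- N.+1%:R ^+ 2) ^+ m * flat (iter m flat_next 1) (- N.+1%:R ^+ 2 * t + (N.+1%:R + N.+1%:R ^+ 2 * b)).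

Definition plateau (N : nat) (a b : R) (m : nat) : R -> R :=
  leibniz (plateau_left N a) (plateau_right N b) m 0 0.

Lemma plateauE N a b t : plateau N a b 0 t =
  eta (N.+1%:R ^+ 2 * (t - a) + N.+1%:R) * eta (N.+1%:R ^+ 2 * (b - t) + N.+1%:R).
Proof.
rewrite /plateau/= /plateau_left /plateau_right !expr0 !mul1r /eta.
by congr (flat _ _ * flat _ _); ring.
Qed.

Lemma plateau01 N a b t : 0 <= plateau N a b 0 t <= 1.
Proof.
rewrite plateauE; have /andP[h1 h2] := eta01 (N.+1%:R ^+ 2 * (t - a) + N.+1%:R).
have /andP[h3 h4] := eta01 (N.+1%:R ^+ 2 * (b - t) + N.+1%:R).
by rewrite mulr_ge0//= -[leRHS]mulr1 ler_pM.
Qed.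

Lemma plateau_family N a b : family (plateau N a b) [set t | t <= a - 1 \/ b + 1 <= t].
Proof.
have M1 : 1 <= N.+1%:R :> R by rewrite ler1n.
have M2 : N.+1%:R <= N.+1%:R ^+ 2 :> R by rewrite expr2 ler_peMl// ltW// (lt_le_trans ltr01).
have [d1 b1 z1] := family_mul (family_affine (N.+1%:R ^+ 2) (N.+1%:R - N.+1%:R ^+ 2 * a) (flat_family 1))
  (family_affine (- N.+1%:R ^+ 2) (N.+1%:R + N.+1%:R ^+ 2 * b) (flat_family 1)).
split => //; move=> m t Zt; apply: z1; case: Zt => h; [left|right]; rewrite /=.
  have : N.+1%:R ^+ 2 * (t - a) <= N.+1%:R ^+ 2 * (-1) by apply: ler_wpM2l; [exact: sqr_ge0|lra].
  lra.
have : N.+1%:R ^+ 2 * (b - t) <= N.+1%:R ^+ 2 * (-1) by apply: ler_wpM2l; [exact: sqr_ge0|lra].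
lra.
Qed.

Lemma eta_near1 (M s : R) : 0 < M -> M <= s -> 1 - M^-1 <= eta s.
Proof.
move=> M0 Ms; have s0 : 0 < s by exact: lt_le_trans Ms.
rewrite /eta /flat s0 hornerC mul1r; apply: le_trans (expR_ge1Dx _).
by rewrite lerD2l lerN2 lef_pV2.
Qed.

Lemma plateau_inside N a b t : a <= t <= b -> `|1 - plateau N a b 0 t| <= 2 / N.+1%:R.
Proof.
move=> /andP[at_ tb]; have M0 : 0 < N.+1%:R :> R by rewrite ltr0n.
have /andP[h0 h1] := plateau01 N a b t.
rewrite ger0_norm ?subr_ge0// plateauE.
have e1 : 1 - N.+1%:R^-1 <= eta (N.+1%:R ^+ 2 * (t - a) + N.+1%:R).
  by apply: eta_near1 => //; rewrite lerDr mulr_ge0 ?sqr_ge0// subr_ge0.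
have e2 : 1 - N.+1%:R^-1 <= eta (N.+1%:R ^+ 2 * (b - t) + N.+1%:R).
  by apply: eta_near1 => //; rewrite lerDr mulr_ge0 ?sqr_ge0// subr_ge0.
have /andP[e3 e4] := eta01 (N.+1%:R ^+ 2 * (t - a) + N.+1%:R).
have /andP[e5 e6] := eta01 (N.+1%:R ^+ 2 * (b - t) + N.+1%:R).
set u := eta _ in e1 e3 e4 *; set w := eta _ in e2 e5 e6 *.
have : 0 <= (1 - u) * (1 - w) by rewrite mulr_ge0// subr_ge0.
set r := N.+1%:R^-1 in e1 e2 *; nra.
Qed.

Lemma plateau_outside a b t : ~ (a <= t <= b) ->
  exists N0 : nat, forall N, (N0 <= N)%N -> plateau N a b 0 t = 0.
Proof.
have key (d : R) : 0 < d -> exists N0 : nat, forall N, (N0 <= N)%N ->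
    N.+1%:R ^+ 2 * (- d) + N.+1%:R <= 0 :> R.
  move=> d0; exists (Num.bound d^-1) => N hN.
  have M0 : 0 < N.+1%:R :> R by rewrite ltr0n.
  have : d^-1 <= N.+1%:R.
    have := archi_boundP (ltW (_ : 0 < d^-1)); rewrite invr_gt0 => /(_ d0) h.
    by apply: le_trans (ltW h) _; rewrite ler_nat ltnW.
  rewrite -[d^-1]mul1r ler_pdivrMr// => h.
  rewrite expr2 mulrN addrC subr_le0 -mulrA ler_peMr//; exact: ltW.
have out s : s <= 0 -> eta s = 0 by move=> s0; rewrite /eta /flat ltNge s0.
move=> nt; have [ta|at_] := ltP t a.
  have [N0 H] := key (a - t) (ltac:(by rewrite subr_gt0)).
  by exists N0 => N /H h; rewrite plateauE [eta (_ * (t - a) + _)]out ?mul0r// -opprB.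
have bt : b < t by rewrite ltNge; apply/negP => tb; apply: nt; rewrite at_ tb.
have [N0 H] := key (t - b) (ltac:(by rewrite subr_gt0)).
by exists N0 => N /H h; rewrite plateauE [eta (_ * (b - t) + _)]out ?mulr0// -opprB.
Qed.

End SmoothPlateaus.

(** * Products of plateau functions as test functions *)

Section ProductFunctions.
Context {R : realType} {n : nat}.
Local Notation V := 'rV[R]_n.

Lemma is_derive_prod (I : eqType) (s : seq I) (u du : I -> R -> R) (t : R) : uniq s ->
  (forall i, is_derive t (1 : R) (u i) (du i t)) ->
  is_derive t (1 : R) (fun t => \prod_(i <- s) u i t)
    (\sum_(i <- s) \prod_(j <- s) (if j == i then du j t else u j t)).
Proof.
move=> us hu; elim: s us => [_|a s IH /= /andP[as_ us]].
  rewrite big_nil; have -> : (fun t => \prod_(i <- [::]) u i t) = cst (1 : R).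
    by apply/funext => x; rewrite big_nil.
  exact: is_derive_cst.
have -> : (fun t => \prod_(i <- a :: s) u i t) = u a * (fun t => \prod_(i <- s) u i t).
  by apply/funext => x; rewrite big_cons.
apply: (is_derive_eq (is_deriveM (hu a) (IH us))).
rewrite /GRing.scale/= big_cons big_cons eqxx addrC; congr (_ + _).
  rewrite mulrC; congr (_ * _); apply: eq_big_seq => j js.
  by case: eqP => // ja; move: as_; rewrite -ja js.
rewrite mulr_sumr; apply: eq_big_seq => i is_.
by rewrite big_cons; case: eqP => // ai; move: as_; rewrite ai is_.
Qed.

Variables (phi : 'I_n -> nat -> R -> R) (lo hi : V).
Hypothesis phiP : forall i, family (phi i) [set t | t <= lo ord0 i \/ hi ord0 i <= t].

(** The partial derivative of multi-index [e] of a product of functions of one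
    variable. *)
Definition prodf (e : 'I_n -> nat) (x : V) : R := \prod_(i < n) phi i (e i) (x ord0 i).

Definition incr (i : 'I_n) (e : 'I_n -> nat) : 'I_n -> nat := fun j => (e j + (j == i))%N.

Lemma is_derive_prodf_line e (x v : V) (t : R) :
  is_derive t (1 : R) (fun s => prodf e (x + s *: v)) (\sum_(i < n) v ord0 i * prodf (incr i e) (x + t *: v)).
Proof.
have hu i : is_derive t (1 : R) (fun s => phi i (e i) ((x + s *: v) ord0 i))
    (phi i (e i).+1 ((x + t *: v) ord0 i) * v ord0 i).
  have dl : is_derive t (1 : R) (fun s => (x + s *: v) ord0 i) (v ord0 i).
    rewrite (_ : (fun s => _) = (fun s => v ord0 i * s + x ord0 i)); last first.
      by apply/funext => s; rewrite !mxE addrC mulrC.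
    have h1 : is_derive t (1 : R) (fun s => v ord0 i * s) (v ord0 i).
      by have := is_deriveZ (v ord0 i) (is_derive_id t (1 : R)); rewrite /GRing.scale/= mulr1.
    by have := is_deriveD h1 (is_derive_cst (x ord0 i) t 1); rewrite addr0.
  exact: (@is_derive1_comp _ (phi i (e i)) (fun s => (x + s *: v) ord0 i) t _ _ (family_derive (phiP i) (e i) _) dl).
have := @is_derive_prod 'I_n (index_enum 'I_n) _ (fun i s => phi i (e i).+1 ((x + s *: v) ord0 i) * v ord0 i) t (index_enum_uniq _) hu.
move=> h; apply: (is_derive_eq h); apply: eq_bigr => i _.
rewrite (bigD1 i)//= eqxx /prodf [in RHS](bigD1 i)//= mulrA /incr eqxx addn1 [v _ _ * _]mulrC; congr (_ * _).
by apply: eq_bigr => j ji; rewrite (negbTE ji) addn0.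
Qed.

Lemma is_derive_line (f : V -> R) (x v : V) (d : R) :
  is_derive (0 : R) (1 : R) (fun s => f (x + s *: v)) d -> is_derive x v f d.
Proof.
move=> [h1 h2].
have E : (fun s : R => s^-1 *: (f (s *: v + x) - f x)) =
    (fun s : R => s^-1 *: (f (x + (s *: (1 : R) + 0) *: v) - f (x + 0 *: v))).
  apply/funext => s; have sE : s *: (1 : R) = s by exact: mulr1.
  by rewrite sE scale0r !addr0 [s *: v + x]addrC.
by split; [rewrite /derivable E|rewrite /derive E].
Qed.

Lemma is_derive_prodf e (x : V) (i : 'I_n) :
  is_derive x (delta_mx ord0 i : V) (prodf e) (prodf (incr i e) x).
Proof.
apply: is_derive_line; apply: (is_derive_eq (is_derive_prodf_line e x _ 0)).
rewrite (bigD1 i)//= big1 ?addr0; first by rewrite mxE !eqxx mul1r scale0r addr0.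
by move=> j ji; rewrite mxE (negbTE ji) andbF mul0r.
Qed.

Lemma partial_prodf i e : partial i (prodf e) = prodf (incr i e).
Proof. by apply/funext => x; have [_] := is_derive_prodf e x i. Qed.

Lemma continuous_prodf e : continuous (prodf e).
Proof.
move=> x; rewrite /prodf; move: (index_enum _) => s.
elim: s => [|i s IH].
  rewrite (_ : (fun y : V => \prod_(i <- [::]) phi i (e i) (y ord0 i)) = cst 1); first exact: cst_continuous.
  by apply/funext => y; rewrite big_nil.
rewrite (_ : (fun x : V => _) = (fun x : V => phi i (e i) (x ord0 i) * \prod_(i <- s) phi i (e i) (x ord0 i))); last first.
  by apply/funext => y; rewrite big_cons.
apply: continuousM IH.
apply: (@continuous_comp _ _ _ (fun x : V => x ord0 i) (phi i (e i))).
  exact: coord_continuous.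
apply: differentiable_continuous; apply/derivable1_diffP.
by have [] := family_derive (phiP i) (e i) (x ord0 i).
Qed.

Lemma foldr_partial_prodf s e : foldr (@partial R n) (prodf e) s = prodf (foldr incr e s).
Proof. by elim: s => [//|i s IH] /=; rewrite IH partial_prodf. Qed.

Lemma smooth_prodf e : smooth (prodf e).
Proof.
move=> s; rewrite foldr_partial_prodf; split; first exact: continuous_prodf.
by move=> i x; have [] := is_derive_prodf (foldr incr e s) x i.
Qed.

Lemma prodf_out e (x : V) : ~ box lo hi x -> prodf e x = 0.
Proof.
move=> nx; have [i hi_] : exists i, ~ (lo ord0 i <= x ord0 i <= hi ord0 i).
  by apply: contrapT => H; apply: nx => i; apply: contrapT => h; apply: H; exists i.
rewrite /prodf (bigD1 i)//= (family_zero (phiP i)) ?mul0r//.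
have [h|h] := leP (x ord0 i) (lo ord0 i); [by left|right].
by rewrite leNgt; apply/negP => h2; apply: hi_; rewrite !ltW.
Qed.

Lemma test_prodf e : test_function (prodf e).
Proof.
split; first exact: smooth_prodf.
have cb : compact (box lo hi).
  have := @rV_compact R n (fun i => `[lo ord0 i, hi ord0 i]%classic) (fun i => @segment_compact _ _ _).
  by congr compact; apply/seteqP; split => x h i; have := h i; rewrite /= in_itv.
have clb : closed (box lo hi) by apply: compact_closed => //; exact: norm_hausdorff.
apply: (subclosed_compact _ cb); first exact: closed_closure.
rewrite [X in _ `<=` X]((closure_id (box lo hi)).1 clb); apply: closure_subset => x /= /eqP h.
by apply: contrapT => /(prodf_out e).
Qed.

Lemma partial_multi_prodf (a : 'I_n -> nat) : partial_multi a (prodf (fun=> 0%N)) = prodf a.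
Proof.
have iterE m i e : iter m (partial i) (prodf e) = prodf (fun j => e j + (j == i) * m)%N.
  elim: m => [|m IH] /=; first by congr prodf; apply/funext => j; rewrite muln0 addn0.
  rewrite IH partial_prodf; congr prodf; apply/funext => j; rewrite /incr.
  by rewrite mulnS -addnA [(_ * m + _)%N]addnC.
have fE s : foldr (fun i g => iter (a i) (partial i) g) (prodf (fun=> 0%N)) s =
    prodf (fun j => \sum_(i <- s) (j == i) * a i)%N.
  elim: s => [|i s IH] /=; first by congr prodf; apply/funext => j; rewrite big_nil.
  by rewrite IH iterE; congr prodf; apply/funext => j; rewrite big_cons addnC.
rewrite /partial_multi fE; congr prodf; apply/funext => j.
rewrite big_enum/= (bigD1 j)//= eqxx mul1n big1 ?addn0// => i ij.
by rewrite eq_sym (negbTE ij) mul0n.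
Qed.

Lemma prodf_bounded e : exists2 M, 0 <= M & forall x, `|prodf e x| <= M.
Proof.
rewrite /prodf; move: (index_enum _) => s; elim: s => [|i s [M M0 HM]].
  by exists 1 => // x; rewrite big_nil normr1.
have [M1 M10 HM1] := family_bounded (phiP i) (e i).
exists (M1 * M) => [|x]; first exact: mulr_ge0.
by rewrite big_cons normrM ler_pM.
Qed.

Lemma measurable_prodf e d (T : measurableType d) (p : T -> V) : measurable_fun setT p ->
  measurable_fun setT (fun z => prodf e (p z)).
Proof.
move=> mp; apply: measurable_prod => i _.
apply: (@measurableT_comp _ _ _ _ _ _ (phi i (e i) : R -> R)); last exact: measurable_coord_comp.
apply: continuous_measurable_fun => t.
apply: differentiable_continuous; apply/derivable1_diffP.
by have [] := family_derive (phiP i) (e i) t.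
Qed.

End ProductFunctions.

(** * Peano kernels of differences *)

Section DifferenceCoefficients.
Context {R : realType}.

Lemma dcoef_rec k (u : nat -> R) :
  \sum_(j < k.+2) dcoef k.+1 j * u j = \sum_(j < k.+1) dcoef k j * (u j.+1 - u j).
Proof.
have d0 : dcoef k.+1 0 = - dcoef k 0 :> R by rewrite /dcoef !subn0 !bin0 exprS !mulr1 mulN1r.
have dS j : (j <= k)%N -> dcoef k.+1 j.+1 = dcoef k j - dcoef k j.+1 :> R.
  rewrite /dcoef subSS binS natrD => jk; have [jk1|jk1] := ltnP j k.
    have -> : (k - j = (k - j.+1).+1)%N by rewrite subnSK.
    by rewrite exprS; ring.
  by rewrite (bin_small (_ : k < j.+1)%N)// add0r mulr0 subr0.
rewrite big_ord_recl/= d0.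
rewrite (eq_bigr (fun j : 'I_k.+1 => dcoef k j * u j.+1 - dcoef k j.+1 * u j.+1)); last first.
  by move=> j _; rewrite /fintype.bump/= add1n dS ?mulrBl// -ltnS.
rewrite sumrB [RHS](eq_bigr (fun j : 'I_k.+1 => dcoef k j * u j.+1 - dcoef k j * u j)); last first.
  by move=> j _; rewrite mulrBr.
rewrite sumrB addrCA; congr (_ + _).
have : \sum_(j < k.+2) dcoef k j * u j = \sum_(j < k.+1) dcoef k j * u j.
  by rewrite big_ord_recr/= [dcoef k k.+1]/dcoef bin_small// mulr0 mul0r addr0.
by rewrite big_ord_recl/= => <-; rewrite mulNr -opprD.
Qed.

(** Differences of order [k] annihilate powers of smaller exponent. *)
Lemma sum_dcoef_pow k i : (i < k)%N -> \sum_(j < k.+1) dcoef k j * j%:R ^+ i = 0 :> R.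
Proof.
elim: k i => [//|k IH] i ik; rewrite (dcoef_rec k (fun j => j%:R ^+ i)).
rewrite (eq_bigr (fun j : 'I_k.+1 => \sum_(m < i) 'C(i, m)%:R * (dcoef k j * j%:R ^+ m))).
  rewrite exchange_big/= big1// => m _; rewrite -mulr_sumr IH ?mulr0//.
  exact: leq_trans (ltn_ord m) _.
move=> j _; have -> : j.+1%:R ^+ i = \sum_(m < i) j%:R ^+ m *+ 'C(i, m) + j%:R ^+ i :> R.
  rewrite -natr1 addrC exprDn big_ord_recr/= subnn binn mulr1n expr0 mul1r; congr (_ + _).
  by apply: eq_bigr => m _; rewrite expr1n mul1r.
rewrite addrK mulr_sumr; apply: eq_bigr => m _.
by rewrite -mulr_natl mulrCA.
Qed.

End DifferenceCoefficients.

Section Taylor.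
Context {R : realType}.
Local Notation leb := (@lebesgue_measure R).
Variable D : nat -> R -> R.
Hypothesis dD : forall m t, is_derive t (1 : R) (D m) (D m.+1 t).

Lemma is_derive_shifted_pow (T t : R) m :
  is_derive t (1 : R) (fun s => (T - s) ^+ m.+1) (- (m.+1%:R * (T - t) ^+ m)).
Proof.
have dT : is_derive t (1 : R) (fun s => T - s) (-1).
  by have := is_deriveB (is_derive_cst T t 1) (is_derive_id t (1 : R)); rewrite sub0r.
have := @is_derive1_comp _ (horner 'X^(m.+1)) (fun s => T - s) t _ _ (is_derive_poly _ _) dT.
rewrite (_ : horner 'X^(m.+1) \o _ = fun s => (T - s) ^+ m.+1); last first.
  by apply/funext => s; rewrite /= hornerXn.
move=> h; apply: (is_derive_eq h).
by rewrite derivXn hornerMn hornerXn -mulr_natl /= mulrN1.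
Qed.

Lemma is_derive_taylor (l : nat) (T t : R) :
  is_derive t (1 : R) (fun t => \sum_(i < l.+1) D i t * ((T - t) ^+ i / i`!%:R))
    (D l.+1 t * ((T - t) ^+ l / l`!%:R)).
Proof.
elim: l => [|l IH].
  rewrite (_ : (fun t => _) = D 0%N); first by rewrite expr0 fact0 divr1 mulr1.
  by apply/funext => s; rewrite big_ord_recl big_ord0/= expr0 fact0 divr1 mulr1 addr0.
rewrite (_ : (fun t => _) = (fun t => \sum_(i < l.+1) D i t * ((T - t) ^+ i / i`!%:R)) +
   D l.+1 * ((l.+1)`!%:R^-1 *: (fun t => (T - t) ^+ l.+1))); last first.
  by apply/funext => s; rewrite big_ord_recr/=; congr (_ + _ * _); rewrite mulrC.
have h := is_deriveD IH (is_deriveM (dD l.+1 t) (is_deriveZ (l.+1)`!%:R^-1 (is_derive_shifted_pow T t l))).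
apply: (is_derive_eq h); rewrite /GRing.scale/=.
have -> : (l.+1)`!%:R = l.+1%:R * l`!%:R :> R by rewrite factS natrM.
have f0 : l`!%:R != 0 :> R by rewrite pnatr_eq0 -lt0n fact_gt0.
have l0 : l.+1%:R != 0 :> R by rewrite pnatr_eq0.
rewrite -[_^-1 *: _]/(_^-1 * _) exprS.
move: (l.+1%:R) l0 (l`!%:R) f0 => a a0 c f0.
by field; rewrite f0 a0.
Qed.

Lemma continuous_family m : continuous (D m).
Proof.
by move=> t; apply: differentiable_continuous; apply/derivable1_diffP; case: (dD m t).
Qed.

Lemma taylor_remainder (l : nat) (T : R) : 0 < T ->
  (\int[leb]_(t in `[0%R, T]) (D l.+1 t * ((T - t) ^+ l / l`!%:R))%:E =
   (D 0%N T - \sum_(i < l.+1) D i 0 * (T ^+ i / i`!%:R))%:E)%E.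
Proof.
move=> T0; pose F t := \sum_(i < l.+1) D i t * ((T - t) ^+ i / i`!%:R).
have dF t : is_derive t (1 : R) F (D l.+1 t * ((T - t) ^+ l / l`!%:R)) by exact: is_derive_taylor.
have cF : continuous F.
  by move=> t; apply: differentiable_continuous; apply/derivable1_diffP; case: (dF t).
rewrite (@continuous_FTC2 _ _ F 0 T)//.
- rewrite -EFinB; congr (_ - _)%:E.
    rewrite /F big_ord_recl/= subrr expr0 fact0 divr1 mulr1 big1 ?addr0// => i _.
    by rewrite /fintype.bump/= add1n expr0n/= mul0r mulr0.
  by rewrite /F; apply: eq_bigr => i _; rewrite subr0.
- apply: continuous_subspaceT.
  suff : continuous (fun t : R => D l.+1 t * ((T - t) ^+ l / l`!%:R)) by [].
  have c0 m' : continuous (fun t : R => (T - t) ^+ m').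
    case: m' => [|m] t; last first.
      by apply: differentiable_continuous; apply/derivable1_diffP; case: (is_derive_shifted_pow T t m).
    rewrite (_ : (fun t : R => (T - t) ^+ 0) = cst 1); first exact: cst_continuous.
    by apply/funext => x; rewrite expr0.
  have c1 : continuous (fun t : R => (T - t) ^+ l / l`!%:R).
    by move=> t; apply: (@continuousM _ _ (fun t : R => (T - t) ^+ l) (cst l`!%:R^-1)); [exact: c0|exact: cst_continuous].
  by move=> t; exact: (continuousM (@continuous_family l.+1 t) (c1 t)).
- split; first by move=> t _; case: (dF t).
  - exact: cvg_at_right_filter (cF 0).
  - exact: cvg_at_left_filter (cF T).
- by move=> t _; rewrite derive1E; case: (dF t).
Qed.

Lemma taylor_remainder0 (l : nat) (T : R) : 0 <= T ->
  (\int[leb]_(t in `[0%R, T]) (D l.+1 t * ((T - t) ^+ l / l`!%:R))%:E =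
   (D 0%N T - \sum_(i < l.+1) D i 0 * (T ^+ i / i`!%:R))%:E)%E.
Proof.
rewrite le_eqVlt => /predU1P[<-|]; last exact: taylor_remainder.
rewrite set_itv1 integral_set1 big_ord_recl/= expr0 fact0 divr1 mulr1 big1 ?addr0 ?subrr// => i _.
by rewrite /fintype.bump/= add1n expr0n/= mul0r mulr0.
Qed.

(** The Peano kernel of the difference of order [k]. *)
Definition kernel_term (l j : nat) (t : R) : R :=
  \1_(`[0%R, j%:R]%classic : set R) t * ((j%:R - t) ^+ l / l`!%:R).

Definition kernel (k l : nat) (t : R) : R := \sum_(j < k.+1) dcoef k j * kernel_term l j t.

Lemma measurable_kernel_term l j : measurable_fun setT (kernel_term l j).
Proof.
apply: measurable_funM; first exact: measurable_indic.
apply: measurable_funM => //; apply: measurable_funX; exact: measurable_funB.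
Qed.

Lemma measurable_kernel k l : measurable_fun setT (kernel k l).
Proof.
by apply: measurable_sum => j; apply: measurable_funM => //; exact: measurable_kernel_term.
Qed.

Lemma kernel_term_le l j k t : (j <= k)%N ->
  `|kernel_term l j t| <= k%:R ^+ l * \1_(tseg k : set R) t.
Proof.
move=> jk; rewrite /kernel_term !indicE; have [jt|jt] := boolP (t \in _); last first.
  by rewrite mul0r normr0 mulr_ge0// exprn_ge0.
move: jt; rewrite inE/= in_itv/= => /andP[t0 tj].
have jkR : j%:R <= k%:R :> R by rewrite ler_nat.
rewrite mem_set; last by rewrite /tseg/= in_itv/= t0 (le_trans tj).
have f1 : 1 <= l`!%:R :> R by rewrite ler1n fact_gt0.
rewrite mul1r mulr1 normrM normfV (ger0_norm (ler0n _ _)) ler_pdivrMr ?(lt_le_trans ltr01)//.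
apply: (@le_trans _ _ (k%:R ^+ l)); last by rewrite ler_peMr// exprn_ge0.
rewrite ger0_norm ?exprn_ge0 ?subr_ge0//; apply: lerXn2r; rewrite ?nnegrE ?subr_ge0//; lra.
Qed.

Lemma kernel_le k l t : `|kernel k l t| <= 2 ^+ k * k%:R ^+ l * \1_(tseg k : set R) t.
Proof.
apply: le_trans (ler_norm_sum _ _ _) _.
rewrite -[2 ^+ k](@sum_norm_dcoef R k) -mulrA mulr_suml; apply: ler_sum => j _.
by rewrite normrM ler_wpM2l// kernel_term_le// -ltnS.
Qed.

(** Taylor's formula at each node; the Taylor polynomials cancel by
    [sum_dcoef_pow]. *)
Lemma integral_kernel (k l : nat) (M : R) : (l < k)%N -> 0 <= M -> (forall t, `|D l.+1 t| <= M) ->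
  (\int[leb]_t (kernel k l t * D l.+1 t)%:E = (\sum_(j < k.+1) dcoef k j * D 0%N j%:R)%:E)%E.
Proof.
move=> lk M0 HM.
have mD : measurable_fun setT (D l.+1) by apply: continuous_measurable_fun; exact: continuous_family.
have mts : measurable (tseg k : set R) by exact: measurable_itv.
have int j : (j <= k)%N -> leb.-integrable setT (fun t => (kernel_term l j t * D l.+1 t)%:E).
  move=> jk; apply: (@le_integrable _ _ _ leb setT _ _ (fun t => (k%:R ^+ l * M * \1_(tseg k : set R) t)%:E)) => //.
  - apply/measurable_EFinP; apply: measurable_funM => //; exact: measurable_kernel_term.
  - move=> t _; rewrite !abse_EFin lee_fin normrM.
    have h := kernel_term_le l t jk.
    rewrite [leRHS]ger0_norm; last by rewrite !mulr_ge0// ?exprn_ge0// indicE.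
    by rewrite mulrAC; apply: ler_pM.
  - apply/integrableP; split.
      by apply/measurable_EFinP; apply: measurable_funM => //; exact: measurable_indic.
    have -> : (\int[leb]_t `|(k%:R ^+ l * M * \1_(tseg k : set R) t)%:E| = \int[leb]_t ((k%:R ^+ l * M)%:E * ind (tseg k) t))%E.
      apply: eq_integral => t _; rewrite abse_EFin ger0_norm ?EFinM//.
      by rewrite !mulr_ge0// ?exprn_ge0// indicE.
    rewrite ge0_integralZl//; last 3 first.
    - exact: measurable_ind.
    - by move=> t _; exact: ind_ge0.
    - by rewrite lee_fin mulr_ge0// exprn_ge0.
    by rewrite integral_tseg -EFinM ltry.
transitivity (\int[leb]_t (\sum_(j < k.+1) (dcoef k j)%:E * (kernel_term l j t * D l.+1 t)%:E))%E.
  apply: eq_integral => t _; rewrite /kernel mulr_suml -sumEFin; apply: eq_bigr => j _.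
  by rewrite -mulrA EFinM.
rewrite integral_sum//; last by move=> j; apply: integrableZl => //; apply: int; rewrite -ltnS.
rewrite (eq_bigr (fun j : 'I_k.+1 => (dcoef k j * (D 0%N j%:R - \sum_(i < l.+1) D i 0 * (j%:R ^+ i / i`!%:R)))%:E)); last first.
  move=> j _; rewrite integralZl//; last by apply: int; rewrite -ltnS.
  rewrite [RHS]EFinM; congr (_ * _)%E; rewrite -(taylor_remainder0 l (ler0n _ _)) [in RHS]integral_mkcond.
  apply: eq_integral => t _; rewrite patchE /kernel_term indicE.
  by case: ifP => _; rewrite ?mul0r// mul1r mulrC.
rewrite sumEFin; congr (_%:E).
rewrite (eq_bigr (fun j : 'I_k.+1 => dcoef k j * D 0%N j%:R - \sum_(i < l.+1) D i 0 / i`!%:R * (dcoef k j * j%:R ^+ i))); last first.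
  move=> j _; rewrite mulrBr mulr_sumr; congr (_ - _); apply: eq_bigr => i _.
  by rewrite mulrCA; ring.
rewrite sumrB [X in _ - X]exchange_big/= [X in _ - X]big1 ?subr0// => i _.
by rewrite -mulr_sumr sum_dcoef_pow ?mulr0//; exact: leq_trans (ltn_ord i) lk.
Qed.

End Taylor.

(** * From weak derivatives to differences along a line *)

Section DirectionalDerivatives.
Context {R : realType} {n : nat}.
Local Notation V := 'rV[R]_n.
Local Notation mu := (@borel_rV R n).
Implicit Types (phi : 'I_n -> nat -> R -> R) (lo hi w : V) (e : 'I_n -> nat).

Definition bumps phi lo hi := forall i, family (phi i) [set t | t <= lo ord0 i \/ hi ord0 i <= t].

(** Iterated derivatives in the direction [w], of products and, formally, of the
    weak derivatives. *)
Fixpoint along (w : V) (G : ('I_n -> nat) -> V -> R) m e (x : V) : R :=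
  if m is m'.+1 then \sum_(i < n) w ord0 i * along w G m' (incr i e) x else G e x.

Lemma is_derive_along phi lo hi w m e (y : V) (t : R) : bumps phi lo hi ->
  is_derive t (1 : R) (fun s => along w (prodf phi) m e (y + s *: w))
    (along w (prodf phi) m.+1 e (y + t *: w)).
Proof.
move=> B; elim: m e => [|m IH] e; first exact: is_derive_prodf_line B _ _ _ _.
rewrite (_ : (fun s => _) = \sum_(i < n) (fun s => w ord0 i * along w (prodf phi) m (incr i e) (y + s *: w))).
  have h i : is_derive t (1 : R) (fun s => w ord0 i * along w (prodf phi) m (incr i e) (y + s *: w))
      (w ord0 i * along w (prodf phi) m.+1 (incr i e) (y + t *: w)).
    exact: (is_deriveZ (w ord0 i) (IH (incr i e))).
  exact: (is_derive_sum h).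
by apply/funext => s; rewrite fct_sumE.
Qed.

Lemma along_bounded phi lo hi w m e : bumps phi lo hi ->
  exists2 M, 0 <= M & forall x, `|along w (prodf phi) m e x| <= M.
Proof.
move=> B; elim: m e => [|m IH] e; first exact: prodf_bounded B e.
pose M i := sval (cid2 (IH (incr i e))).
have MP i : 0 <= M i /\ forall x, `|along w (prodf phi) m (incr i e) x| <= M i.
  by rewrite /M; case: cid2.
exists (\sum_(i < n) `|w ord0 i| * M i) => [|x].
  by apply: sumr_ge0 => i _; rewrite mulr_ge0//; case: (MP i).
apply: le_trans (ler_norm_sum _ _ _) _; apply: ler_sum => i _.
by rewrite normrM ler_wpM2l//; case: (MP i).
Qed.

Lemma along_out phi lo hi w m e x : bumps phi lo hi -> ~ box lo hi x -> along w (prodf phi) m e x = 0.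
Proof.
move=> B nx; elim: m e => [|m IH] e; first exact: (prodf_out B).
by rewrite /= big1// => i _; rewrite IH mulr0.
Qed.

Lemma measurable_along w (G : ('I_n -> nat) -> V -> R) m e d (T : measurableType d) (p : T -> V) :
  (forall e, measurable_fun setT (fun z => G e (p z))) ->
  measurable_fun setT (fun z => along w G m e (p z)).
Proof.
move=> mG; elim: m e => [//|m IH] e /=.
by apply: measurable_sum => i; apply: measurable_funM.
Qed.

Lemma along_le w (G : ('I_n -> nat) -> V -> R) (g : V -> R) (l m : nat) e x :
  (forall e, (\sum_(i < n) e i)%N = l -> `|G e x| <= g x) ->
  (\sum_(i < n) e i + m)%N = l ->
  `|along w G m e x| <= (\sum_(i < n) `|w ord0 i|) ^+ m * g x.
Proof.
move=> HG; elim: m e => [|m IH] e /= em; first by rewrite mul1r; apply: HG; rewrite -em addn0.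
apply: le_trans (ler_norm_sum _ _ _) _; rewrite exprS -mulrA mulr_suml; apply: ler_sum => i _.
rewrite normrM ler_wpM2l//; apply: IH; rewrite -em addnS -addSn; congr (_ + _)%N.
rewrite /incr big_split/= -[RHS]addn1; congr (_ + _)%N.
by rewrite (bigD1 i)//= eqxx big1// => j ji; rewrite (negbTE ji).
Qed.

Definition translate (a : V) phi : 'I_n -> nat -> R -> R := fun i m t => phi i m (t + a ord0 i).

Lemma bumps_translate phi lo hi a : bumps phi lo hi -> bumps (translate a phi) (lo - a) (hi - a).
Proof.
move=> B i; have [d b z] := family_affine 1 (a ord0 i) (B i).
have E m : translate a phi i m = (fun t => 1 ^+ m * phi i m (1 * t + a ord0 i)).
  by apply/funext => t; rewrite expr1n !mul1r.
split; [by move=> m t; rewrite !E; exact: d|by move=> m; rewrite E; exact: b|].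
move=> m t Zt; rewrite E; apply: z => /=; rewrite mul1r.
by move: Zt; rewrite /= !mxE lerBrDr lerBlDr.
Qed.

Lemma prodf_translate phi a e x : prodf (translate a phi) e x = prodf phi e (x + a).
Proof. by apply: eq_bigr => i _; rewrite /translate mxE. Qed.

Lemma along_translate phi a w m e x :
  along w (prodf (translate a phi)) m e x = along w (prodf phi) m e (x + a).
Proof.
elim: m e => [|m IH] e; first exact: prodf_translate.
by rewrite /=; apply: eq_bigr => i _; rewrite IH.
Qed.

End DirectionalDerivatives.

Section WeakIdentity.
Context {R : realType} {n : nat}.
Local Notation V := 'rV[R]_n.
Local Notation mu := (@borel_rV R n).
Local Notation leb := (@lebesgue_measure R).

Lemma box_cube (lo hi : V) : exists2 r, 0 <= r & box lo hi `<=` cube 0 r.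
Proof.
have r0 : 0 <= \sum_(i < n) (`|lo ord0 i| + `|hi ord0 i|) by apply: sumr_ge0.
exists (\sum_(i < n) (`|lo ord0 i| + `|hi ord0 i|)) => // x xb i; rewrite mxE subr0.
have /andP[h1 h2] := xb i.
apply: (@le_trans _ _ (`|lo ord0 i| + `|hi ord0 i|)).
  have := ler_norm (hi ord0 i); have := ler_norm (- lo ord0 i); rewrite normrN.
  have := normr_ge0 (lo ord0 i); have := normr_ge0 (hi ord0 i).
  by rewrite ler_norml => *; apply/andP; split; lra.
by rewrite (bigD1 i)//= lerDl sumr_ge0.
Qed.

Definition local_int (q : V -> R) := measurable_fun setT q /\
  forall r, (\int[mu]_z (ind (cube 0 r) z * `|q z|%:E) < +oo)%E.

Lemma integrable_local (q u : V -> R) (M r : R) : local_int q -> measurable_fun setT u ->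
  (forall x, `|u x| <= M) -> (forall x, ~ cube 0 r x -> u x = 0) ->
  mu.-integrable setT (fun x => (q x * u x)%:E).
Proof.
move=> [mq lq] mu_ uM ur; have M0 : 0 <= M by exact: le_trans (uM 0).
apply/integrableP; split; first by apply/measurable_EFinP; exact: measurable_funM.
apply: (@le_lt_trans _ _ (\int[mu]_z (M%:E * (ind (cube 0 r) z * `|q z|%:E)))%E).
  apply: le_integral_ge0 => x //; rewrite abse_EFin normrM.
  have [xr|nx] := pselect (cube 0 r x); last by rewrite ur// normr0 mulr0 ind_out// mul0e mule0.
  by rewrite ind_in// mul1e -EFinM lee_fin mulrC ler_wpM2r.
rewrite ge0_integralZl//; last 2 first.
- apply: emeasurable_funM; first by apply: measurable_ind; exact: measurable_cube.
  by apply/measurable_EFinP; exact: measurableT_comp.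
- by move=> x _; rewrite mule_ge0 ?ind_ge0.
by rewrite lte_mul_pinfty// lee_fin.
Qed.

Lemma integral_translateR (a : V) (F : V -> R) : measurable_fun setT F ->
  (\int[mu]_x (F (a + x)%R)%:E = \int[mu]_x (F x)%:E)%E.
Proof.
move=> mF; have mE : measurable_fun setT (fun x => (F x)%:E) by exact/measurable_EFinP.
have p0 x : (0 <= (fun y => (F y)%:E)^\+%E x)%E by exact: funepos_ge0.
have n0 x : (0 <= (fun y => (F y)%:E)^\-%E x)%E by exact: funeneg_ge0.
rewrite integralE [RHS]integralE -(integral_translate a (measurable_funepos mE) p0).
rewrite -(integral_translate a (measurable_funeneg mE) n0).
by congr (_ - _)%E; apply: eq_integral => x _; rewrite ?funeposE ?funenegE.
Qed.

Variables (k l : nat) (f g : V -> R) (G : ('I_n -> nat) -> V -> R).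
Hypotheses (lk : (l < k)%N) (lf : local_int f) (lg : local_int g).
Hypotheses (g0 : forall x, 0 <= g x) (mG : forall e, measurable_fun setT (G e)).
Hypothesis Gg : forall e x, (\sum_(i < n) e i)%N = l.+1 -> `|G e x| <= g x.
Let sgn : R := (-1) ^+ l.+1.
Hypothesis weak : forall e phi lo hi, (\sum_(i < n) e i)%N = l.+1 -> bumps phi lo hi ->
  (\int[mu]_x (f x * prodf phi e x)%:E = sgn%:E * \int[mu]_x (G e x * prodf phi (fun=> 0%N) x)%:E)%E.

Let mf : measurable_fun setT f. Proof. by case: lf. Qed.
Let mg : measurable_fun setT g. Proof. by case: lg. Qed.

Lemma local_along w m e : (\sum_(i < n) e i + m)%N = l.+1 -> local_int (along w G m e).
Proof.
move=> em; split; first exact: (measurable_along _ _ _ (p := id)).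
move=> r; pose c := (\sum_(i < n) `|w ord0 i|) ^+ m.
have c0 : 0 <= c by rewrite exprn_ge0// sumr_ge0.
apply: (@le_lt_trans _ _ (\int[mu]_z (c%:E * (ind (cube 0 r) z * `|g z|%:E)))%E).
  apply: le_integral_ge0 => x; first by rewrite mule_ge0 ?ind_ge0.
  rewrite muleCA lee_wpmul2l ?ind_ge0// -EFinM lee_fin (ger0_norm (g0 x)).
  by apply: (along_le w (l := l.+1)) em => e' he; exact: Gg.
rewrite ge0_integralZl//; last 2 first.
- apply: emeasurable_funM; first by apply: measurable_ind; exact: measurable_cube.
  by apply/measurable_EFinP; exact: measurableT_comp.
- by move=> x _; rewrite mule_ge0 ?ind_ge0.
by rewrite lte_mul_pinfty// lg.2.
Qed.

Lemma integrable_prodf (q : V -> R) phi lo hi w m e a : local_int q -> bumps phi lo hi ->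
  mu.-integrable setT (fun x => (q x * along w (prodf phi) m e (x + a))%:E).
Proof.
move=> lq B; have B' := bumps_translate a B.
have [M M0 HM] := along_bounded w m e B.
have [r r0 Hr] := box_cube (lo - a) (hi - a).
apply: (integrable_local lq (M := M) (r := r)) => //.
- apply: measurable_along => e'; apply: (measurable_prodf B).
  by apply: measurable_rV_add; [exact: measurable_id|exact: measurable_cst].
- move=> x nx; rewrite -along_translate (along_out _ _ _ B')//.
  by move=> xb; apply: nx; exact: Hr.
Qed.

(** A directional derivative expands into partial derivatives, for the test function
    and for the weak derivatives alike. *)
Lemma weak_along phi lo hi w m e : (\sum_(i < n) e i + m)%N = l.+1 -> bumps phi lo hi ->
  (\int[mu]_x (f x * along w (prodf phi) m e x)%:E =
   sgn%:E * \int[mu]_x (along w G m e x * prodf phi (fun=> 0%N) x)%:E)%E.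
Proof.
move=> em B; elim: m e em => [|m IH] e em; first by apply: weak B; rewrite -em addn0.
have em' i : (\sum_(j < n) incr i e j + m)%N = l.+1.
  rewrite -em addnS -addSn; congr (_ + _)%N.
  rewrite /incr big_split/= -[RHS]addn1; congr (_ + _)%N.
  by rewrite (bigD1 i)//= eqxx big1// => j ji; rewrite (negbTE ji).
have i1 i : mu.-integrable setT (fun x => (f x * along w (prodf phi) m (incr i e) x)%:E).
  have := integrable_prodf w m (incr i e) 0 lf B.
  by apply: eq_integrable => // x _; rewrite addr0.
have i2 i : mu.-integrable setT (fun x => (along w G m (incr i e) x * prodf phi (fun=> 0%N) x)%:E).
  have := integrable_prodf w 0 (fun=> 0%N) 0 (local_along w (em' i)) B.
  by apply: eq_integrable => // x _; rewrite /= addr0.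
transitivity (\int[mu]_x (\sum_(i < n) (w ord0 i)%:E * (f x * along w (prodf phi) m (incr i e) x)%:E))%E.
  apply: eq_integral => x _; rewrite /= mulr_sumr -sumEFin; apply: eq_bigr => i _.
  by rewrite mulrCA EFinM.
rewrite integral_sum//; last by move=> i; exact: integrableZl.
transitivity (sgn%:E * \int[mu]_x (\sum_(i < n) (w ord0 i)%:E * (along w G m (incr i e) x * prodf phi (fun=> 0%N) x)%:E))%E.
  rewrite integral_sum//; last by move=> i; exact: integrableZl.
  have fin2 i : (\int[mu]_x (along w G m (incr i e) x * prodf phi (fun=> 0%N) x)%:E)%E \is a fin_num.
    exact: integrable_fin_num.
  rewrite fin_num_sume_distrr//; last first.
    by move=> i j _ _; apply: fin_num_adde_defl; rewrite integralZl// fin_numM.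
  by apply: eq_bigr => i _; rewrite !integralZl// (IH _ (em' i)) muleCA.
congr (_ * _)%E; apply: eq_integral => x _; rewrite /= mulr_suml -sumEFin; apply: eq_bigr => i _.
by rewrite -mulrA EFinM.
Qed.

Variables (h : V) (phi : 'I_n -> nat -> R -> R) (lo hi : V).
Hypothesis B : bumps phi lo hi.
Let w : V := - h.
Let U : V -> R := along w G l.+1 (fun=> 0%N).
Let Phi : V -> R := prodf phi (fun=> 0%N).
Let Hd : V -> R := along w (prodf phi) l.+1 (fun=> 0%N).

Let e0 : (\sum_(i < n) (fun=> 0%N : nat) i + l.+1)%N = l.+1.
Proof. by rewrite big1. Qed.

Let lU : local_int U. Proof. exact: local_along. Qed.
Let mU : measurable_fun setT U. Proof. by case: lU. Qed.

Lemma measurable_line (q : V -> R) (a : V) : measurable_fun setT q ->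
  measurable_fun setT (fun z : V * measurableTypeR R => q (z.1 + z.2 *: a)).
Proof.
move=> mq; apply: (measurableT_comp mq); apply: measurable_rV_add; first exact: measurable_fst.
by apply: measurable_rV_scale; [exact: measurable_snd|exact: measurable_cst].
Qed.

Lemma weak_shift (t : R) :
  (\int[mu]_y (f y * Hd (y + t *: w))%:E = sgn%:E * \int[mu]_x (U (x + t *: h) * Phi x)%:E)%E.
Proof.
have := weak_along w e0 (bumps_translate (t *: w) B) => H.
transitivity (\int[mu]_x (f x * along w (prodf (translate (t *: w) phi)) l.+1 (fun=> 0%N) x)%:E)%E.
  by apply: eq_integral => x _; rewrite along_translate.
rewrite {}H; congr (_ * _)%E; rewrite -(integral_translateR (t *: h)); last first.
  apply: measurable_funM => //; exact: (measurable_prodf (bumps_translate (t *: w) B) _ (p := id)).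
apply: eq_integral => x _; rewrite prodf_translate /U /Phi [t *: h + x]addrC; congr ((_ * prodf _ _ _)%:E).
by rewrite /w scalerN addrK.
Qed.

(** Covers both sides of the representation: a locally integrable function is
    integrable along segments that start in a bounded set. *)
Lemma integrable_strip (q : V -> R) (a : V) (r M : R) (F : V * measurableTypeR R -> R) :
  local_int q -> 0 <= M -> measurable_fun setT F ->
  (forall x t, `|F (x, t)| <= M * \1_(cube 0 r) x * \1_(tseg k : set R) t * `|q (x + t *: a)|) ->
  (mu \x leb)%E.-integrable setT (EFin \o F).
Proof.
move=> [mq lq] M0 mF HF.
have [r1 r10 ha] : exists2 r1, 0 <= r1 & cube 0 r1 a.
  have [r1 r10 H] := box_cube a a; exists r1 => //; apply: H => i; exact/andP.
have mq' : measurable_fun setT (fun z => `|q z|%:E).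
  by apply/measurable_EFinP; exact: measurableT_comp.
apply/integrable12ltyP; first exact/measurable_EFinP.
apply: (@le_lt_trans _ _ (\int[mu]_x (M%:E * (ind (cube 0 r) x *
   \int[leb]_t (ind (tseg k) t * `|q (x + t *: a)%R|%:E))))%E).
  apply: le_integral_ge0 => x; first exact: integral_ge0.
  have mqx : measurable_fun setT (fun t : measurableTypeR R => ind (tseg k) t * `|q (x + t *: a)%R|%:E)%E.
    apply: emeasurable_funM; first by apply: measurable_ind; exact: measurable_itv.
    apply/measurable_EFinP; apply: measurableT_comp => //.
    apply: (measurableT_comp mq); apply: measurable_rV_add; first exact: measurable_cst.
    by apply: measurable_rV_scale; [exact: measurable_id|exact: measurable_cst].
  rewrite muleA -ge0_integralZl//; last 2 first.
  - by move=> t _; rewrite mule_ge0 ?ind_ge0.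
  - by rewrite mule_ge0 ?ind_ge0.
  apply: le_integral_ge0 => t //.
  rewrite /ind -!EFinM lee_fin; apply: le_trans (HF x t) _.
  by rewrite -!mulrA.
rewrite ge0_integralZl//; last 2 first.
- apply: emeasurable_funM; first by apply: measurable_ind; exact: measurable_cube.
  apply: (@measurable_fun_fubini_tonelli_F _ _ V (measurableTypeR R) R leb (fun z => ind (tseg k) z.2 * `|q (z.1 + z.2 *: a)%R|%:E)%E).
    apply: emeasurable_funM; first by apply: measurable_ind_comp; [exact: measurable_itv|exact: measurable_snd].
    by apply/measurable_EFinP; apply: measurableT_comp => //; exact: measurable_line.
  by move=> z; rewrite mule_ge0 ?ind_ge0.
- by move=> x _; rewrite mule_ge0 ?ind_ge0//; apply: integral_ge0 => t _; rewrite mule_ge0 ?ind_ge0.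
rewrite lte_mul_pinfty ?lee_fin//.
apply: le_lt_trans (line_integral_le k 0 r r10 mq' (fun z => _) ha) _ => //.
by rewrite lte_mul_pinfty// lee_fin.
Qed.

Lemma integrable_translate (a : V) (F : V -> R) : mu.-integrable setT (EFin \o F) ->
  mu.-integrable setT (fun x => (F (a + x))%:E).
Proof.
move=> /integrableP[/measurable_EFinP mF iF]; apply/integrableP; split.
  apply/measurable_EFinP; apply: (measurableT_comp mF).
  by apply: measurable_rV_add; [exact: measurable_cst|exact: measurable_id].
have mE : measurable_fun setT (fun x => `|(F x)%:E|%E).
  by apply: measurableT_comp => //; exact/measurable_EFinP.
by rewrite (integral_translate a mE (fun x => abse_ge0 _)).
Qed.

Let Fshift (j : nat) (x : V) : R := f (x + j%:R *: h) * Phi x.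

Let FshiftE (j : nat) x : Fshift j x = f (j%:R *: h + x) * Phi (j%:R *: h + x + j%:R *: w).
Proof. by rewrite /Fshift /w scalerN addrC addrAC subrr add0r. Qed.

Let integrable_Fshift j : mu.-integrable setT (fun x => (Fshift j x)%:E).
Proof.
have := integrable_translate (j%:R *: h) (integrable_prodf w 0 (fun=> 0%N) (j%:R *: w) lf B).
by apply: eq_integrable => // x _; rewrite FshiftE.
Qed.

Lemma integrable_difference : mu.-integrable setT (fun x => (fdiff k h f x * Phi x)%:E).
Proof.
have i1 : mu.-integrable setT (fun x => \sum_(j < k.+1) (dcoef k j)%:E * (Fshift j x)%:E)%E.
  by apply: integrable_sum => // j _; exact: integrableZl.
apply: eq_integrable i1 => // x _; rewrite fdiffE mulr_suml -sumEFin.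
by apply: eq_bigr => j _; rewrite -EFinM -mulrA.
Qed.

Lemma integral_difference : (\int[mu]_x (fdiff k h f x * Phi x)%:E =
  \int[mu]_y (\sum_(j < k.+1) dcoef k j * (f y * Phi (y + j%:R *: w)))%:E)%E.
Proof.
have ip j : mu.-integrable setT (fun y => (f y * Phi (y + j%:R *: w))%:E).
  exact: (integrable_prodf w 0 (fun=> 0%N) (j%:R *: w) lf B).
transitivity (\int[mu]_x (\sum_(j < k.+1) (dcoef k j)%:E * (Fshift j x)%:E))%E.
  apply: eq_integral => x _; rewrite fdiffE mulr_suml -sumEFin.
  by apply: eq_bigr => j _; rewrite -EFinM -mulrA.
transitivity (\int[mu]_y (\sum_(j < k.+1) (dcoef k j)%:E * (f y * Phi (y + j%:R *: w))%:E))%E; last first.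
  by apply: eq_integral => y _; rewrite -sumEFin; apply: eq_bigr => j _; rewrite -EFinM.
rewrite integral_sum//; last by move=> j; exact: integrableZl.
rewrite integral_sum//; last by move=> j; exact: integrableZl.
apply: eq_bigr => j _; rewrite !integralZl//; congr (_ * _)%E.
rewrite -[RHS](integral_translateR (j%:R *: h)); last first.
  by have /integrableP[mj _] := ip j; exact/measurable_EFinP.
by apply: eq_integral => x _; rewrite FshiftE.
Qed.

(** The integrand of the representation of the difference by an integral over the
    segment from [x] to [x + k h]. *)
Definition line_part (z : V * measurableTypeR R) : R := sgn * kernel k l z.2 * U (z.1 + z.2 *: h).

Lemma measurable_line_part : measurable_fun setT line_part.
Proof.
apply: measurable_funM; last exact: measurable_line.
apply: measurable_funM => //; apply: measurableT_comp => //; exact: measurable_kernel.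
Qed.

Let K0 : R := 2 ^+ k * k%:R ^+ l.
Let K00 : 0 <= K0. Proof. by rewrite mulr_ge0// exprn_ge0. Qed.

Lemma integrable_line_part : (mu \x leb)%E.-integrable setT (fun z => (line_part z * Phi z.1)%:E).
Proof.
have [M M0 HM] := along_bounded w 0 (fun=> 0%N) B.
have [r r0 Hr] := box_cube lo hi.
apply: (@integrable_strip U h r (K0 * M) (fun z => line_part z * Phi z.1)) => //.
- exact: mulr_ge0.
- apply: measurable_funM; first exact: measurable_line_part.
  by apply: (measurable_prodf B); exact: measurable_fst.
move=> x t; rewrite /line_part/= !normrM normrX normrN normr1 expr1n mul1r.
have kt := kernel_le k l t.
have px : `|Phi x| <= M * \1_(cube 0 r) x.
  rewrite indicE; have [xr|nx] := boolP (x \in _); first by rewrite mulr1 HM.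
  rewrite /Phi (prodf_out B) ?normr0 ?mulr0//.
  by move=> xb; move: nx; rewrite mem_set//; exact: Hr.
rewrite -/K0 in kt.
have -> : K0 * M * \1_(cube 0 r) x * \1_(tseg k : set R) t * `|U (x + t *: h)| =
   K0 * \1_(tseg k : set R) t * `|U (x + t *: h)| * (M * \1_(cube 0 r) x) by ring.
by apply: ler_pM => //; rewrite ler_wpM2r.
Qed.

Let F1 (z : V * measurableTypeR R) : R := f z.1 * (kernel k l z.2 * Hd (z.1 + z.2 *: w)).

Let mHd : measurable_fun setT Hd.
Proof. by apply: (measurable_along _ _ _ (p := id)) => e; exact: (measurable_prodf B e (p := id)). Qed.

Lemma integrable_F1 : (mu \x leb)%E.-integrable setT (fun z => (F1 z)%:E).
Proof.
have [M M0 HM] := along_bounded w l.+1 (fun=> 0%N) B.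
have [r r0 Hr] := box_cube lo hi; have [r1 r10 Hr1] := box_cube h h.
have h1 : cube 0 r1 h by apply: Hr1 => i; exact/andP.
apply: (@integrable_strip f 0 (r + k%:R * r1) (K0 * M) F1) => //.
- exact: mulr_ge0.
- apply: measurable_funM; first exact: measurableT_comp.
  apply: measurable_funM; last exact: measurable_line.
  by apply: measurableT_comp => //; exact: measurable_kernel.
move=> x t; rewrite scaler0 addr0 /F1/= !normrM.
have kt := kernel_le k l t; rewrite -/K0 in kt.
have [tk|tk] := pselect (tseg k t); last first.
  move: kt; rewrite [X in _ * X]indicE memNset// mulr0 normr_le0 => /eqP ->.
  by rewrite normr0 mul0r mulr0 !mulr_ge0// indicE.
have hx : `|Hd (x + t *: w)| <= M * \1_(cube 0 (r + k%:R * r1)) x.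
  rewrite indicE; have [xr|nx] := boolP (x \in _); first by rewrite mulr1 HM.
  rewrite /Hd (along_out _ _ _ B) ?normr0 ?mulr0// => /Hr xb.
  move: nx; rewrite mem_set// => i; rewrite mxE subr0.
  have := xb i; have := h1 i; rewrite !mxE !subr0 => hi1 xi.
  move: tk; rewrite /tseg/= in_itv/= => /andP[t0 tk].
  have ti : `|t * h ord0 i| <= k%:R * r1 by rewrite normrM (ger0_norm t0) ler_pM.
  have := ler_normD (x ord0 i + t * - h ord0 i) (t * h ord0 i).
  rewrite (_ : _ + _ + _ = x ord0 i); last by ring.
  lra.
have -> : K0 * M * \1_(cube 0 (r + k%:R * r1)) x * \1_(tseg k : set R) t * `|f x| =
   `|f x| * (K0 * \1_(tseg k : set R) t * (M * \1_(cube 0 (r + k%:R * r1)) x)) by ring.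
by rewrite ler_wpM2l// ler_pM.
Qed.

(** The difference moves to the test function by translation, is represented there by
    the Peano kernel, and the derivatives move back to [f] for each [t] separately. *)
Lemma weak_difference : (\int[mu]_x (fdiff k h f x * Phi x)%:E =
  \int[mu]_x \int[leb]_t (line_part (x, t) * Phi x)%:E)%E.
Proof.
have [M M0 HM] := along_bounded w l.+1 (fun=> 0%N) B.
rewrite integral_difference.
transitivity (\int[mu]_y \int[leb]_t (F1 (y, t))%:E)%E.
  apply: eq_integral => y _.
  pose D m t := f y * along w (prodf phi) m (fun=> 0%N) (y + t *: w).
  have dD m t : is_derive t (1 : R) (D m) (D m.+1 t).
    exact: (is_deriveZ (f y) (is_derive_along w m (fun=> 0%N) y t B)).
  have := integral_kernel dD lk (mulr_ge0 (normr_ge0 (f y)) M0) => /(_ _)/esym H.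
  rewrite (_ : \sum_(j < k.+1) _ = \sum_(j < k.+1) dcoef k j * D 0%N j%:R)// H.
    by apply: eq_integral => t _; rewrite /F1 /D mulrCA.
  by move=> t; rewrite /D normrM ler_wpM2l.
transitivity (\int[leb]_t \int[mu]_y (F1 (y, t))%:E)%E.
  exact: (Fubini integrable_F1).
transitivity (\int[leb]_t \int[mu]_x (line_part (x, t) * Phi x)%:E)%E; last first.
  exact/esym/(Fubini integrable_line_part).
apply: eq_integral => t _.
have iH : mu.-integrable setT (fun y => (f y * Hd (y + t *: w))%:E).
  exact: (integrable_prodf w l.+1 (fun=> 0%N) (t *: w) lf B).
transitivity ((kernel k l t)%:E * \int[mu]_y (f y * Hd (y + t *: w))%:E)%E.
  rewrite -integralZl//; apply: eq_integral => y _.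
  by rewrite /F1/= mulrCA EFinM.
rewrite weak_shift.
have iU : mu.-integrable setT (fun x => (U (x + t *: h) * Phi x)%:E).
  have := integrable_translate (t *: h) (integrable_prodf w 0 (fun=> 0%N) (t *: w) lU B).
  apply: eq_integrable => // x _; rewrite [t *: h + x]addrC; congr ((_ * prodf _ _ _)%:E).
  by rewrite /w scalerN addrK.
rewrite muleA -EFinM -integralZl//; apply: eq_integral => x _.
by rewrite -EFinM /line_part/= mulrA [kernel _ _ _ * _]mulrC.
Qed.

End WeakIdentity.

(** * Inequalities almost everywhere from test functions *)

Section Densities.
Context {R : realType} {n : nat}.
Local Notation V := 'rV[R]_n.
Local Notation mu := (@borel_rV R n).

Section Density.
Variable Q : V -> \bar R.
Hypotheses (mQ : measurable_fun setT Q) (Q0 : forall x, (0 <= Q x)%E).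

Definition density (A : set V) : \bar R := (\int[mu]_(x in A) Q x)%E.

Let density0 : density set0 = 0%E. Proof. exact: integral_set0. Qed.

Let density_ge0 A : (0 <= density A)%E. Proof. by apply: integral_ge0 => x _; exact: Q0. Qed.

Let density_sigma_additive : semi_sigma_additive density.
Proof.
move=> F mF tF mUF; rewrite /density ge0_integral_bigcup//.
  by apply: is_cvg_nneseries => i _ _; exact: integral_ge0.
exact: measurable_funTS.
Qed.

Definition density_measure : {measure set V -> \bar R} :=
  HB.pack density (isMeasure.Build _ _ _ density density0 density_ge0 density_sigma_additive).

End Density.

Definition plateaus (N : nat) (lo hi : V) : 'I_n -> nat -> R -> R :=
  fun i => plateau N (lo ord0 i) (hi ord0 i).

Lemma bumps_plateaus N lo hi : bumps (plateaus N lo hi) (lo - const_mx 1) (hi + const_mx 1).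
Proof. by move=> i; have := @plateau_family R N (lo ord0 i) (hi ord0 i); rewrite !mxE. Qed.

Let Phi N lo hi : V -> R := prodf (plateaus N lo hi) (fun=> 0%N).

Lemma plateaus01 N lo hi x : 0 <= Phi N lo hi x <= 1.
Proof.
rewrite /Phi /prodf; elim/big_ind: _ => [|a b /andP[a0 a1] /andP[b0 b1]|i _].
- by rewrite lexx ler01.
- by rewrite mulr_ge0//= -[leRHS]mulr1 ler_pM.
- exact: plateau01.
Qed.

Lemma plateaus_half N lo hi x : (3 <= N)%N -> box lo hi x -> 2^-1 ^+ n <= Phi N lo hi x.
Proof.
move=> N3 xb; rewrite /Phi /prodf -{1}[n]card_ord -prodr_const.
apply: ler_prod => i _; rewrite invr_ge0 ler0n/=.
have := plateau_inside N (xb i); have /andP[h0 h1] := plateau01 N (lo ord0 i) (hi ord0 i) (x ord0 i).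
rewrite ger0_norm ?subr_ge0// => h.
have H : 2 / N.+1%:R <= 2^-1 :> R.
  by rewrite ler_pdivrMr ?ltr0n// ler_pdivlMl// -natrM ler_nat.
have {}h := le_trans h H; rewrite /plateaus; lra.
Qed.

Lemma plateaus_cvg lo hi x : Phi N lo hi x @[N --> \oo] --> (\1_(box lo hi) x : R).
Proof.
have [xb|nx] := pselect (box lo hi x); last first.
  rewrite indicE memNset//.
  have [i hi_] : exists i, ~ (lo ord0 i <= x ord0 i <= hi ord0 i).
    by apply: contrapT => H; apply: nx => i; apply: contrapT => h; apply: H; exists i.
  have [N0 HN] := plateau_outside hi_.
  apply: cvg_near_cst; exists N0 => // N /= N0N.
  by rewrite /Phi /prodf (bigD1 i)//= /plateaus HN// mul0r.
rewrite indicE mem_set// /Phi /prodf; move: (index_enum _) => s.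
elim: s => [|i s IH].
  by apply: cvg_near_cst; apply: nearW => N; rewrite big_nil.
rewrite (_ : (fun N => _) = (fun N => plateaus N lo hi i 0%N (x ord0 i) * \prod_(i <- s) plateaus N lo hi i 0%N (x ord0 i))); last first.
  by apply/funext => N; rewrite big_cons.
rewrite -[X in _ --> X]mulr1; apply: cvgM IH.
apply/cvgrPdist_le => e e0; exists (Num.bound (2 / e)) => // N /= hN.
apply: le_trans (plateau_inside N (xb i)) _.
rewrite ler_pdivrMr ?ltr0n// -ler_pdivrMl// mulrC.
apply: ltW; apply: lt_le_trans (archi_boundP _) _; first by rewrite divr_ge0// ltW.
by rewrite ler_nat ltnW.
Qed.

Lemma measurable_plateaus N lo hi : measurable_fun setT (Phi N lo hi).
Proof. exact: (measurable_prodf (bumps_plateaus N lo hi) _ (p := id)). Qed.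

Section Limit.
Variable Q : V -> \bar R.
Hypotheses (mQ : measurable_fun setT Q) (Q0 : forall x, (0 <= Q x)%E).
Hypothesis fQ : forall N lo hi, (\int[mu]_x ((Phi N lo hi x)%:E * Q x) < +oo)%E.

(** The box is inside the set where one fixed plateau is bounded below. *)
Lemma box_density_fin lo hi : (\int[mu]_(x in box lo hi) Q x < +oo)%E.
Proof.
have mb : measurable (box lo hi) by exact: measurable_box.
apply: (@le_lt_trans _ _ (\int[mu]_x ((2 ^+ n)%:E * ((Phi 3 lo hi x)%:E * Q x)))%E).
  rewrite integral_mkcond; apply: le_integral_ge0 => x; rewrite patchE.
    by case: ifP => // _; exact: Q0.
  have /andP[p0 p1] := plateaus01 3 lo hi x.
  case: ifPn => [/set_mem xb|_]; last by rewrite !mule_ge0// lee_fin// exprn_ge0.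
  rewrite muleA -EFinM -[leLHS]mul1e; apply: lee_wpmul2r => //; rewrite lee_fin.
  have := plateaus_half (leqnn 3) xb; rewrite exprVn => h.
  by rewrite mulrC -ler_pdivrMr ?exprn_gt0// mul1r.
rewrite ge0_integralZl//; last 2 first.
- apply: emeasurable_funM => //; apply/measurable_EFinP; exact: measurable_plateaus.
- by move=> x _; rewrite mule_ge0 ?lee_fin//; case/andP: (plateaus01 3 lo hi x).
by rewrite lte_mul_pinfty// lee_fin exprn_ge0.
Qed.

Lemma plateaus_density lo hi :
  (\int[mu]_x ((Phi N lo hi x)%:E * Q x))%E @[N --> \oo] --> (\int[mu]_(x in box lo hi) Q x)%E.
Proof.
have mb (a b : V) : measurable (box a b) by exact: measurable_box.
pose lo' := lo - const_mx 1; pose hi' := hi + const_mx 1.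
pose gQ (x : V) : \bar R := (Q \_ (box lo' hi')) x.
have mg : measurable_fun setT gQ by apply/(measurable_restrictT Q (mb _ _)); exact: measurable_funTS.
have ig : mu.-integrable setT gQ.
  apply/integrableP; split => //.
  rewrite (_ : (\int[mu]_x `|gQ x|)%E = (\int[mu]_(x in box lo' hi') Q x)%E); first exact: box_density_fin.
  rewrite [RHS]integral_mkcond; apply: eq_integral => x _; rewrite gee0_abs// /gQ patchE.
  by case: ifP => // _; exact: Q0.
have mf_ N : measurable_fun setT (fun x => (Phi N lo hi x)%:E * Q x)%E.
  by apply: emeasurable_funM => //; apply/measurable_EFinP; exact: measurable_plateaus.
have out N x : ~ box lo' hi' x -> Phi N lo hi x = 0 by move=> nx; exact: (prodf_out (bumps_plateaus N lo hi)).
have sub x : box lo hi x -> box lo' hi' x.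
  by move=> xb i; have := xb i; rewrite !mxE => /andP[? ?]; apply/andP; split; lra.
rewrite [X in _ --> X]integral_mkcond.
have mQb : measurable_fun setT (Q \_ (box lo hi)).
  by apply/(measurable_restrictT Q (mb _ _)); exact: measurable_funTS.
have f_f : {ae mu, forall x, setT x -> ((Phi N lo hi x)%:E * Q x)%E @[N --> \oo] --> (Q \_ (box lo hi)) x}.
  have := integrable_ae measurableT ig; apply: filterS => x /(_ Logic.I) fx _.
  rewrite patchE; have [xb|nx] := boolP (x \in box lo hi).
    have Qf : Q x \is a fin_num.
      by move: fx; rewrite /gQ patchE mem_set//; apply: sub; exact: set_mem.
    rewrite -(fineK Qf) -[X in _ --> X]mul1e -EFinM.
    rewrite (_ : (fun N => _) = (fun N => (Phi N lo hi x * fine (Q x))%:E)); last first.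
      by apply/funext => N; rewrite EFinM.
    apply: cvg_EFin; first exact: nearW.
    apply: cvgMl; have := @plateaus_cvg lo hi x; by rewrite indicE xb.
  have [i hi_] : exists i, ~ (lo ord0 i <= x ord0 i <= hi ord0 i).
    by apply: contrapT => H; move: nx; rewrite mem_set// => i; apply: contrapT => h; apply: H; exists i.
  have [N0 HN] := plateau_outside hi_.
  apply: cvg_near_cst; exists N0 => // N /= N0N.
  by rewrite /Phi /prodf (bigD1 i)//= /plateaus HN// mul0r mul0e.
have f_g : {ae mu, forall x N, setT x -> (`|(Phi N lo hi x)%:E * Q x| <= gQ x)%E}.
  apply: aeW => x N _; have /andP[p0 p1] := plateaus01 N lo hi x.
  rewrite gee0_abs; last by rewrite mule_ge0.
  rewrite /gQ patchE; case: ifPn => [_|nx]; last by rewrite out ?mul0e// => /mem_set; apply/negP.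
  by rewrite -[leRHS]mul1e; apply: lee_wpmul2r.
by have [_ _ H] := dominated_convergence measurableT mf_ mQb f_f ig f_g.
Qed.

End Limit.

(** The plateaus converge to indicators of boxes, so the two densities agree on
    boxes, hence as measures. *)
Lemma ae_eq_plateaus (Q1 Q2 : V -> \bar R) :
  measurable_fun setT Q1 -> measurable_fun setT Q2 ->
  (forall x, 0 <= Q1 x)%E -> (forall x, 0 <= Q2 x)%E ->
  (forall N lo hi, (\int[mu]_x ((Phi N lo hi x)%:E * Q1 x) < +oo)%E) ->
  (forall N lo hi, (\int[mu]_x ((Phi N lo hi x)%:E * Q1 x) = \int[mu]_x ((Phi N lo hi x)%:E * Q2 x))%E) ->
  exists N, [/\ measurable N, mu N = 0%E & forall x, ~ N x -> Q1 x = Q2 x].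
Proof.
move=> m1 m2 q1 q2 f1 f12.
have f2 N lo hi : (\int[mu]_x ((Phi N lo hi x)%:E * Q2 x) < +oo)%E by rewrite -f12.
have eqA A : measurable A -> (\int[mu]_(x in A) Q1 x = \int[mu]_(x in A) Q2 x)%E.
  apply: (boxes_unique (m1 := density_measure m1 q1) (m2 := density_measure m2 q2)).
    move=> a b _; rewrite /= /density.
    have h1 := plateaus_density m1 q1 f1 (lo := a) (hi := b).
    have h2 := plateaus_density m2 q2 f2 (lo := a) (hi := b).
    apply: (@cvg_unique _ (@ereal_hausdorff R) _ _ _ _ h1).
    by rewrite (eq_fun (fun N => f12 N a b)).
  by move=> a b; exact: box_density_fin.
have ae N : ae_eq mu (cube 0 N%:R) Q1 Q2.
  have mc : measurable (cube (0 : V) N%:R) by exact: measurable_cube.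
  apply: integral_ae_eq => //.
  - apply/integrableP; split; first exact: measurable_funTS.
    under eq_integral do rewrite gee0_abs//.
    have := box_density_fin m1 q1 f1 (0 - const_mx N%:R) (0 + const_mx N%:R).
    apply: le_lt_trans; apply: ge0_subset_integral => //.
    - exact: measurable_box.
    - exact: measurable_funTS.
    - move=> x xc i; have := xc i; rewrite !mxE subr0 sub0r add0r ler_norml.
      by [].
  - exact: measurable_funTS.
  - by move=> A _ mA; exact: eqA.
pose NN N := sval (cid (ae N)).
have NNP N : [/\ measurable (NN N), mu (NN N) = 0%E & ~` [set x | cube 0 N%:R x -> Q1 x = Q2 x] `<=` NN N].
  by rewrite /NN; case: cid.
exists (\bigcup_N NN N); split.
- by apply: bigcupT_measurable => N; case: (NNP N).
- apply/(@negligibleP _ _ _ mu); first by apply: bigcupT_measurable => N; case: (NNP N).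
  by apply: negligible_bigcup => N; have [mN N0 _] := NNP N; apply/(@negligibleP _ _ _ mu).
- move=> x nx; have [N xN] : exists N : nat, cube 0 N%:R x.
    exists (Num.bound (\sum_(i < n) `|x ord0 i|)) => i; rewrite mxE subr0.
    apply: (@le_trans _ _ (\sum_(i < n) `|x ord0 i|)).
      by rewrite (bigD1 i)//= lerDl sumr_ge0.
    by apply/ltW/archi_boundP; rewrite sumr_ge0.
  apply: contrapT => h; apply: nx; exists N => //.
  by have [_ _] := NNP N; apply => /(_ xN).
Qed.

End Densities.

(** * Weak derivatives satisfy the line estimate *)

Section WeakLineEstimate.
Context {R : realType} {n : nat}.
Local Notation V := 'rV[R]_n.
Local Notation mu := (@borel_rV R n).
Local Notation leb := (@lebesgue_measure R).

Lemma funepos_scale T (a : R) (u : T -> R) (x : T) : 0 <= a ->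
  ((fun y => (u y * a)%:E)^\+ x = a%:E * (EFin \o u)^\+ x)%E.
Proof.
move=> a0; rewrite !funeposE /= -!EFin_max -EFinM; congr (_%:E).
by rewrite mulrC -[X in Num.max _ X](mulr0 a) maxr_pMr.
Qed.

Lemma funeneg_scale T (a : R) (u : T -> R) (x : T) : 0 <= a ->
  ((fun y => (u y * a)%:E)^\- x = a%:E * (EFin \o u)^\- x)%E.
Proof.
move=> a0; rewrite !funenegE /= -?EFinN -!EFin_max -EFinM; congr (_%:E).
by rewrite -mulNr mulrC -[X in Num.max _ X](mulr0 a) maxr_pMr.
Qed.

Lemma rearrange_parts (a b c d : \bar R) : (a < +oo -> b < +oo -> c < +oo -> d < +oo ->
  0 <= a -> 0 <= b -> 0 <= c -> 0 <= d -> a - b = c - d -> a + d = b + c)%E.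
Proof.
case: a => [a| |]//; case: b => [b| |]//; case: c => [c| |]//; case: d => [d| |]//.
by move=> _ _ _ _ _ _ _ _ [] ed; rewrite -!EFinD; congr (_%:E); lra.
Qed.

Variables (k l : nat) (f g : V -> R) (G : ('I_n -> nat) -> V -> R).
Hypotheses (lk : (l < k)%N) (lf : local_int f) (lg : local_int g).
Hypotheses (g0 : forall x, 0 <= g x) (mG : forall e, measurable_fun setT (G e)).
Hypothesis Gg : forall e x, (\sum_(i < n) e i)%N = l.+1 -> `|G e x| <= g x.
Hypothesis weak : forall e phi lo hi, (\sum_(i < n) e i)%N = l.+1 -> bumps phi lo hi ->
  (\int[mu]_x (f x * prodf phi e x)%:E = ((-1) ^+ l.+1)%:E * \int[mu]_x (G e x * prodf phi (fun=> 0%N) x)%:E)%E.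

Let mf : measurable_fun setT f. Proof. by case: lf. Qed.
Let mg : measurable_fun setT g. Proof. by case: lg. Qed.

Variable h : V.
Let D x := fdiff k h f x.
Let LP := line_part k l G h.
Let Dp := (EFin \o D)^\+%E.
Let Dn := (EFin \o D)^\-%E.
Let Wp x : \bar R := (\int[leb]_t (EFin \o LP)^\+%E (x, t))%E.
Let Wn x : \bar R := (\int[leb]_t (EFin \o LP)^\-%E (x, t))%E.

Let mD : measurable_fun setT D.
Proof. by apply: measurable_fdiff. Qed.
Let mLP : measurable_fun setT LP. Proof. exact: (measurable_line_part k lg g0 mG Gg h). Qed.
Let mLPE : measurable_fun setT (EFin \o LP). Proof. by apply/measurable_EFinP; exact: mLP. Qed.
Let mDp : measurable_fun setT Dp. Proof. by apply: measurable_funepos; exact/measurable_EFinP. Qed.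
Let mDn : measurable_fun setT Dn. Proof. by apply: measurable_funeneg; exact/measurable_EFinP. Qed.
Let mWp : measurable_fun setT Wp.
Proof. by apply: measurable_fun_fubini_tonelli_F => //; apply: measurable_funepos; exact: mLPE. Qed.
Let mWn : measurable_fun setT Wn.
Proof. by apply: measurable_fun_fubini_tonelli_F => //; apply: measurable_funeneg; exact: mLPE. Qed.
Let Dp0 x : (0 <= Dp x)%E. Proof. exact: funepos_ge0. Qed.
Let Dn0 x : (0 <= Dn x)%E. Proof. exact: funeneg_ge0. Qed.
Let Wp0 x : (0 <= Wp x)%E. Proof. by apply: integral_ge0 => t _; exact: funepos_ge0. Qed.
Let Wn0 x : (0 <= Wn x)%E. Proof. by apply: integral_ge0 => t _; exact: funeneg_ge0. Qed.

Let WE x : (Wp x + Wn x = \int[leb]_t `|LP (x, t)|%:E)%E.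
Proof.
have mpos : measurable_fun setT (fun t => (EFin \o LP)^\+%E (x, t)).
  apply: (measurableT_comp (measurable_funepos mLPE)); exact: pair1_measurable.
have mneg : measurable_fun setT (fun t => (EFin \o LP)^\-%E (x, t)).
  apply: (measurableT_comp (measurable_funeneg mLPE)); exact: pair1_measurable.
rewrite /Wp /Wn -ge0_integralD//.
apply: eq_integral => t _; have := congr1 (fun F => F (x, t)) (fune_abse (EFin \o LP)).
by move=> /= ->.
Qed.

Section OneBump.
Variables (phi : 'I_n -> nat -> R -> R) (lo hi : V).
Hypothesis B : bumps phi lo hi.
Let Phi := prodf phi (fun=> 0%N).
Hypothesis Phi0 : forall x, 0 <= Phi x.
Let mPhi : measurable_fun setT (fun x => (Phi x)%:E).
Proof. by apply/measurable_EFinP; exact: (measurable_prodf B _ (p := id)). Qed.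

Let iD := integrable_difference k lf h B.
Let iL := integrable_line_part k lg g0 mG Gg h B.

Let fin_le (Q : V -> \bar R) (F : V -> \bar R) : (forall x, 0 <= Q x)%E ->
  (forall x, (Phi x)%:E * Q x <= F x)%E -> (\int[mu]_x F x < +oo)%E -> (\int[mu]_x ((Phi x)%:E * Q x) < +oo)%E.
Proof.
move=> Q0 QF; apply: le_lt_trans; apply: le_integral_ge0 => // x.
by rewrite mule_ge0// lee_fin.
Qed.

Let LPabs : (\int[mu]_x \int[leb]_t (`|LP (x, t)| * Phi x)%:E < +oo)%E.
Proof.
have mL : measurable_fun setT (fun z : V * measurableTypeR R => (LP z * Phi z.1)%:E).
  by have /integrableP[] := iL.
have /integrable12ltyP - /(_ mL) := iL; apply: le_lt_trans.
apply: le_integral_ge0 => x; first by apply: integral_ge0 => t _; rewrite lee_fin mulr_ge0.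
apply: le_integral_ge0 => t; first by rewrite lee_fin mulr_ge0.
by rewrite -[X in `|_| * X](ger0_norm (Phi0 x)) -normrM.
Qed.

Let PhiW x : (\int[leb]_t (`|LP (x, t)| * Phi x)%:E = (Phi x)%:E * (Wp x + Wn x))%E.
Proof.
rewrite WE -ge0_integralZl//.
- by apply: eq_integral => t _; rewrite -EFinM mulrC.
- apply/measurable_EFinP; apply: measurableT_comp => //.
  by apply: (measurableT_comp mLP); exact: pair1_measurable.
- by rewrite lee_fin.
Qed.

Let LPabs' : (\int[mu]_x ((Phi x)%:E * (Wp x + Wn x)) < +oo)%E.
Proof. by have := LPabs; congr (_ < _)%E; apply: eq_integral => x _; rewrite PhiW. Qed.

Let fWp : (\int[mu]_x ((Phi x)%:E * Wp x) < +oo)%E.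
Proof.
apply: (fin_le Wp0 _ LPabs') => x; apply: lee_wpmul2l; first by rewrite lee_fin.
by rewrite leeDl.
Qed.

Let fWn : (\int[mu]_x ((Phi x)%:E * Wn x) < +oo)%E.
Proof.
apply: (fin_le Wn0 _ LPabs') => x; apply: lee_wpmul2l; first by rewrite lee_fin.
by rewrite leeDr.
Qed.

Let absD : (\int[mu]_x (`|D x| * Phi x)%:E < +oo)%E.
Proof.
have /integrableP[_] := iD; apply: le_lt_trans; apply: le_integral_ge0 => x.
  by rewrite lee_fin mulr_ge0.
by have := Phi0 x; rewrite /Phi => P0; rewrite abse_EFin normrM /= (ger0_norm P0).
Qed.

Let fDp : (\int[mu]_x ((Phi x)%:E * Dp x) < +oo)%E.
Proof.
apply: (fin_le Dp0 _ absD) => x; rewrite /Dp funeposE /= -EFin_max -EFinM lee_fin mulrC ler_wpM2r//.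
by rewrite ge_max ler_norm normr_ge0.
Qed.

Let fDn : (\int[mu]_x ((Phi x)%:E * Dn x) < +oo)%E.
Proof.
apply: (fin_le Dn0 _ absD) => x; rewrite /Dn funenegE /= -?EFinN -EFin_max -EFinM lee_fin mulrC ler_wpM2r//.
by rewrite ge_max normr_ge0 -normrN ler_norm.
Qed.

Let int_of (Q : V -> \bar R) : measurable_fun setT Q -> (forall x, 0 <= Q x)%E ->
  (\int[mu]_x ((Phi x)%:E * Q x) < +oo)%E -> mu.-integrable setT (fun x => (Phi x)%:E * Q x)%E.
Proof.
move=> mQ Q0 fQ; apply/integrableP; split; first exact: emeasurable_funM.
by under eq_integral do rewrite gee0_abs ?mule_ge0 ?lee_fin//.
Qed.

(** The identity [weak_difference] with positive and negative parts collected, so that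
    both sides are densities of measures. *)
Lemma parts_identity :
  (\int[mu]_x ((Phi x)%:E * (Dp x + Wn x)) = \int[mu]_x ((Phi x)%:E * (Dn x + Wp x)))%E /\
  (\int[mu]_x ((Phi x)%:E * (Dp x + Wn x)) < +oo)%E.
Proof.
have PhiE x : (0 <= (Phi x)%:E)%E by rewrite lee_fin.
have add (Q1 Q2 : V -> \bar R) : measurable_fun setT Q1 -> measurable_fun setT Q2 ->
    (forall x, 0 <= Q1 x)%E -> (forall x, 0 <= Q2 x)%E ->
    (\int[mu]_x ((Phi x)%:E * (Q1 x + Q2 x)) = \int[mu]_x ((Phi x)%:E * Q1 x) + \int[mu]_x ((Phi x)%:E * Q2 x))%E.
  move=> m1 m2 q1 q2; rewrite -ge0_integralD//.
  - by apply: eq_integral => x _; rewrite ge0_muleDr.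
  - by move=> x _; exact: mule_ge0.
  - exact: emeasurable_funM.
  - by move=> x _; exact: mule_ge0.
  - exact: emeasurable_funM.
rewrite (add _ _ mDp mWn Dp0 Wn0) (add _ _ mDn mWp Dn0 Wp0); split; last first.
  by apply: lte_add_pinfty; [exact: fDp|exact: fWn].
have I0 (Q : V -> \bar R) : (forall x, 0 <= Q x)%E -> (0 <= \int[mu]_x ((Phi x)%:E * Q x))%E.
  by move=> Q0; apply: integral_ge0 => x _; exact: mule_ge0.
have E1 : (\int[mu]_x (D x * Phi x)%:E = \int[mu]_x ((Phi x)%:E * Dp x) - \int[mu]_x ((Phi x)%:E * Dn x))%E.
  rewrite integralE; congr (_ - _)%E; apply: eq_integral => x _.
    by rewrite funeposE /Dp funeposE /= -!EFin_max -EFinM; congr (_%:E); rewrite mulrC -[X in Num.max _ X](mulr0 (Phi x)) maxr_pMr.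
  by rewrite funenegE /Dn funenegE /= -?EFinN -!EFin_max -EFinM; congr (_%:E); rewrite -mulNr mulrC -[X in Num.max _ X](mulr0 (Phi x)) maxr_pMr.
have E2 : (\int[mu]_x \int[leb]_t (LP (x, t) * Phi x)%:E = \int[mu]_x ((Phi x)%:E * Wp x) - \int[mu]_x ((Phi x)%:E * Wn x))%E.
  rewrite -integralB//; last 2 first.
  - exact: int_of.
  - exact: int_of.
  apply: eq_integral => x _; rewrite integralE; congr (_ - _)%E.
    rewrite /Wp -ge0_integralZl//.
    - apply: eq_integral => t _; rewrite funepos_scale// funeposE.
      by congr (_ * _)%E; rewrite funeposE.
    - by apply: (measurableT_comp (measurable_funepos mLPE)); exact: pair1_measurable.
  rewrite /Wn -ge0_integralZl//.
  - apply: eq_integral => t _; rewrite funeneg_scale// funenegE.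
    by congr (_ * _)%E; rewrite funenegE.
  - by apply: (measurableT_comp (measurable_funeneg mLPE)); exact: pair1_measurable.
have := weak_difference lk lf lg g0 mG Gg weak h B; rewrite -/Phi -/LP.
move=> E; have {E} : (\int[mu]_x (D x * Phi x)%:E = \int[mu]_x \int[leb]_t (LP (x, t) * Phi x)%:E)%E by [].
rewrite E1 E2.
by apply: rearrange_parts; [exact: fDp|exact: fDn|exact: fWp|exact: fWn|exact: I0..].
Qed.

End OneBump.

Definition line_cst : R := 2 ^+ k * k%:R ^+ l * n%:R ^+ l.+1.

Lemma ae_difference_le (rho : R) : 0 < rho -> cube 0 rho h ->
  {ae mu, forall x, (`|D x|%:E <= (line_cst * rho ^+ l.+1)%:E * \int[leb]_t (ind (tseg k) t * (g (x + t *: h))%:E))%E}.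
Proof.
move=> r0 hr.
pose Q1 x := (Dp x + Wn x)%E; pose Q2 x := (Dn x + Wp x)%E.
have m1 : measurable_fun setT Q1 by exact: emeasurable_funD.
have m2 : measurable_fun setT Q2 by exact: emeasurable_funD.
have q1 x : (0 <= Q1 x)%E by exact: adde_ge0.
have q2 x : (0 <= Q2 x)%E by exact: adde_ge0.
have PhiN N (lo hi x : V) : 0 <= prodf (plateaus N lo hi) (fun=> 0%N) x.
  by have /andP[] := plateaus01 N lo hi x.
have [N [mN N0 HN]] : exists N, [/\ measurable N, mu N = 0%E & forall x, ~ N x -> Q1 x = Q2 x].
  apply: (ae_eq_plateaus m1 m2 q1 q2) => N lo hi.
    exact: (proj2 (parts_identity (bumps_plateaus N lo hi) (PhiN N lo hi))).
  exact: (proj1 (parts_identity (bumps_plateaus N lo hi) (PhiN N lo hi))).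
exists N; split => // x /= nle; apply: contrapT => Nx; apply: nle.
have := HN x Nx; rewrite /Q1 /Q2 => E.
have W0 : (Wp x + Wn x <= (line_cst * rho ^+ l.+1)%:E * \int[leb]_t (ind (tseg k) t * (g (x + t *: h))%:E))%E.
  rewrite WE; have c0 : 0 <= line_cst * rho ^+ l.+1.
    by rewrite !mulr_ge0 ?exprn_ge0// ltW.
  have mI : measurable_fun setT (fun t : measurableTypeR R => ind (tseg k) t * (g (x + t *: h))%:E)%E.
    apply: emeasurable_funM; first by apply: measurable_ind; exact: measurable_itv.
    apply/measurable_EFinP; apply: (measurableT_comp mg); apply: measurable_rV_add; first exact: measurable_cst.
    by apply: measurable_rV_scale; [exact: measurable_id|exact: measurable_cst].
  rewrite -ge0_integralZl//; last by move=> t _; rewrite mule_ge0 ?ind_ge0// lee_fin.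
  apply: le_integral_ge0 => t //; rewrite /ind -!EFinM lee_fin.
  rewrite /LP /line_part/= !normrM normrX normrN normr1 expr1n mul1r.
  have kt := kernel_le k l t.
  have ut : `|along (- h) G l.+1 (fun=> 0%N) (x + t *: h)| <= (n%:R * rho) ^+ l.+1 * g (x + t *: h).
    apply: le_trans (along_le (- h) (l := l.+1) (g := g) _ _) _.
    - by move=> e he; exact: Gg.
    - by rewrite big1.
    rewrite ler_wpM2r//; apply: lerXn2r; rewrite ?nnegrE ?mulr_ge0 ?sumr_ge0 ?(ltW r0)//.
    apply: (@le_trans _ _ (\sum_(i < n) rho)).
      by apply: ler_sum => i _; have := hr i; rewrite !mxE subr0 normrN.
    by rewrite sumr_const card_ord mulr_natl.
  have -> : line_cst * rho ^+ l.+1 * (\1_(tseg k : set R) t * g (x + t *: h)) =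
     2 ^+ k * k%:R ^+ l * \1_(tseg k : set R) t * ((n%:R * rho) ^+ l.+1 * g (x + t *: h)).
    by rewrite exprMn /line_cst; ring.
  exact: ler_pM.
(* One part of D vanishes, so the equality of densities bounds the other one. *)
apply: le_trans W0; have [d0|d0] := leP 0 (D x).
  have Dp_ : Dp x = (D x)%:E by rewrite /Dp funeposE /= -EFin_max max_l.
  have Dn_ : Dn x = 0%E by rewrite /Dn funenegE /= -?EFinN -EFin_max max_r// oppr_le0.
  rewrite ger0_norm// -Dp_; apply: (@le_trans _ _ (Dp x + Wn x)%E); first by rewrite leeDl.
  by rewrite E Dn_ add0e leeDl.
have Dp_ : Dp x = 0%E by rewrite /Dp funeposE /= -EFin_max max_r// ltW.
have Dn_ : Dn x = (- D x)%:E by rewrite /Dn funenegE /= -?EFinN -EFin_max max_l// oppr_ge0 ltW.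
rewrite ltr0_norm// -Dn_; apply: (@le_trans _ _ (Dn x + Wp x)%E); first by rewrite leeDl.
by rewrite -E Dp_ add0e leeDr.
Qed.

End WeakLineEstimate.

Lemma weak_line_estimate {R : realType} {n : nat} (k l : nat) (f g : 'rV[R]_n -> R) (G : ('I_n -> nat) -> 'rV[R]_n -> R) :
  (l < k)%N -> local_int f -> local_int g -> (forall x, 0 <= g x) ->
  (forall e, measurable_fun setT (G e)) ->
  (forall e x, (\sum_(i < n) e i)%N = l.+1 -> `|G e x| <= g x) ->
  (forall e phi lo hi, (\sum_(i < n) e i)%N = l.+1 -> bumps phi lo hi ->
    (\int[borel_rV n]_x (f x * prodf phi e x)%:E =
     ((-1) ^+ l.+1)%:E * \int[borel_rV n]_x (G e x * prodf phi (fun=> 0%N) x)%:E)%E) ->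
  line_estimate k l.+1 f g (@line_cst R n k l).
Proof.
move=> lk lf lg g0 mG Gg weak rho h r0 hr.
exact: (ae_difference_le lk lf lg g0 mG Gg weak r0 hr).
Qed.

(** * Completion of a Borel measure *)

Section Completion.
Context d (T : measurableType d) (R : realType) (m : {sigma_finite_measure set T -> \bar R}).
Local Notation cT := (caratheodory_type (m^*)%mu).
Local Notation cm := (@completed_measure_extension _ T R m : {measure set cT -> \bar R}).

Lemma completion_measurable (A : set T) : measurable A -> measurable (A : set cT).
Proof. exact: caratheodory_measurable_mu_ext. Qed.

Lemma completion_measure (A : set T) : measurable A -> cm A = m A.
Proof. exact: measurable_mu_extE. Qed.

Lemma completion_measurable_fun d' (U : measurableType d') (f : T -> U) :
  measurable_fun setT f -> measurable_fun [set: cT] (f : cT -> U).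
Proof.
by move=> mf _ Y mY; apply: completion_measurable; exact: (mf measurableT Y mY).
Qed.

(** Intersect covers of [E] whose measures tend to the outer measure. *)
Lemma measurable_envelope (E : set T) : exists F, [/\ measurable F, E `<=` F & m F = cm E].
Proof.
have [Eoo|Eoo] := eqVneq (cm E) +oo%E.
  exists setT; split => //; apply/eqP; rewrite eq_le {1}Eoo leey/=.
  by rewrite -completion_measure//; exact: le_mu_ext.
have Efin : cm E \is a fin_num by rewrite fin_numE Eoo andbT -ltNye (lt_le_trans _ (mu_ext_ge0 _ _)).
have cover (i : nat) : exists A : (set T)^nat, [/\ forall j, measurable (A j), E `<=` \bigcup_j A j &
    (\sum_(j <oo) m (A j) < cm E + i.+1%:R^-1%:E)%E].
  have i0 : (0 < i.+1%:R^-1 :> R) by rewrite invr_gt0.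
  by have [_ [A [mA EA] <-] Ai] := lb_ereal_inf_adherent i0 Efin; exists A.
pose A i := projT1 (cid (cover i)).
have HA i : [/\ forall j, measurable (A i j), E `<=` \bigcup_j A i j &
    (\sum_(j <oo) m (A i j) < cm E + i.+1%:R^-1%:E)%E] := projT2 (cid (cover i)).
exists (\bigcap_i \bigcup_j A i j).
have mF : measurable (\bigcap_i \bigcup_j A i j).
  by apply: bigcapT_measurable => i; apply: bigcupT_measurable => j; have [] := HA i.
have EF : E `<=` \bigcap_i \bigcup_j A i j by apply: sub_bigcap => i _; have [] := HA i.
split => //; apply/eqP; rewrite eq_le; apply/andP; split; last first.
  by rewrite -completion_measure//; exact: le_mu_ext.
apply/lee_addgt0Pr => e e0.
have [i ie] : exists i : nat, i.+1%:R^-1 <= e :> R.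
  exists (Num.truncn e^-1); rewrite invf_ple ?posrE//.
  by apply/ltW; rewrite truncnS_gt.
have [mAi _ Ai] := HA i.
have h : (m (\bigcap_i \bigcup_j A i j) <= \sum_(j <oo) m (A i j))%E.
  by apply: measure_sigma_subadditive => // x Fx; exact: Fx.
by apply: (le_trans h); apply: (le_trans (ltW Ai)); rewrite leeD2l.
Qed.

Lemma completion_null (E : set T) : cm E = 0%E -> m.-negligible E.
Proof. by move=> E0; have [F [mF EF FE]] := measurable_envelope E; exists F; rewrite FE. Qed.

(** On a set of finite measure, the difference between [E] and its envelope has outer
    measure zero, by additivity. *)
Lemma completion_modulo_null (E : set T) : measurable (E : set cT) ->
  exists B N, [/\ measurable B, m.-negligible N & forall x, ~ N x -> (B x <-> E x)].
Proof.
move=> mE; have /sigma_finiteP[S [ST ndS Soo]] := sigma_finiteT m.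
have env (i : nat) := cid (measurable_envelope (E `&` S i)).
pose F i := projT1 (env i); have HF i : [/\ measurable (F i), E `&` S i `<=` F i & m (F i) = cm (E `&` S i)] := projT2 (env i).
have mES i : measurable (E `&` S i : set cT).
  by apply: measurableI => //; apply: completion_measurable; case: (Soo i).
exists (\bigcup_i F i), (\bigcup_i (F i `\` (E `&` S i))); split.
- by apply: bigcupT_measurable => i; case: (HF i).
- apply: negligible_bigcup => i; apply: completion_null; have [mF EF mFE] := HF i.
  have mF' := completion_measurable mF.
  have fin : (cm (F i) < +oo)%E.
    rewrite completion_measure// mFE; apply: (@le_lt_trans _ _ (cm (S i))).
      by apply: le_mu_ext; exact: subIsetr.
    by rewrite completion_measure; case: (Soo i).
  rewrite measureD// setIidr// [X in (X - _)%E](_ : _ = cm (E `&` S i)) ?subee//.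
    by rewrite ge0_fin_numE// -mFE -completion_measure.
  by rewrite -mFE; exact: completion_measure.
move=> x nx; split=> [[i _ Fx]|Ex].
  by apply: contrapT => nEx; apply: nx; exists i => //; split => // -[].
have [i _ Si] : (\bigcup_i S i) x by rewrite -ST.
by exists i => //; have [_ + _] := HF i; apply.
Qed.

(** The exceptional set collects those of the countably many level sets [f > q], [q]
    rational. Enlarging it does no harm, so several functions can share one. *)
Lemma completion_fun (f : T -> R) : measurable_fun [set: cT] (f : cT -> R) ->
  exists2 N, m.-negligible N & forall N', measurable N' -> N `<=` N' -> measurable_fun setT (fun x => f x * \1_(~` N') x).
Proof.
move=> mf.
have lev (i : nat) : exists B N, [/\ measurable B, m.-negligible N &
    forall x, ~ N x -> (B x <-> if unpickle i is Some q then f x > ratr (q : rat) else true)].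
  case: (unpickle i : option rat) => [q|]; last by exists setT, set0; split => //; exact: negligible_set0.
  have mq : measurable ([set x | ratr q < f x] : set cT).
    have := mf measurableT _ (measurable_itv `]ratr q : R, +oo[); rewrite setTI.
    by congr measurable; apply/seteqP; split => x /=; rewrite in_itv/= andbT.
  by have [B [N [mB N0 HB]]] := completion_modulo_null mq; exists B, N.
pose B i := projT1 (cid (lev i)).
pose N i := projT1 (cid (projT2 (cid (lev i)))).
have HB i : [/\ measurable (B i), m.-negligible (N i) &
    forall x, ~ N i x -> (B i x <-> if unpickle i is Some q then f x > ratr (q : rat) else true)].
  exact: (projT2 (cid (projT2 (cid (lev i))))).
exists (\bigcup_i N i); first by apply: negligible_bigcup => i; case: (HB i).
move=> N' mN' NN'.
apply: (measurability _ (RGenOInfty.measurableE R)).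
move=> _ [_ [y ->] <-]; rewrite setTI.
have -> : (fun x => f x * \1_(~` N') x) @^-1` `]y, +oo[ =
    (N' `&` [set x | y < 0]) `|` (~` N' `&` \bigcup_(q in [set q : rat | y < ratr q]) B (pickle q)).
  apply/seteqP; split => x /=; rewrite in_itv/= andbT indicE.
    have [/set_mem nx|/negP nx] := boolP (x \in _).
      rewrite mulr1 => /rat_in_itvoo[q]; rewrite in_itv/= => /andP[yq qf]; right; split => //.
      exists q => //; have [_ _ H] := HB (pickle q).
      by apply/H; [move=> Nx; apply: nx; apply: NN'; exists (pickle q)|rewrite pickleK].
    by rewrite mulr0 => y0; left; split => //; apply: contrapT => h; apply: nx; exact: mem_set.
  move=> [[N'x y0]|[nx [q /= yq Bx]]]; first by rewrite memNset ?mulr0//= => /(_ N'x).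
  rewrite mem_set// mulr1; apply: (lt_trans yq).
  have [_ _ H] := HB (pickle q); move: Bx => /H; rewrite pickleK; apply.
  by move=> Nx; apply: nx; apply: NN'; exists (pickle q).
apply: measurableU.
  have [y0|y0] := pselect (y < 0).
    by rewrite (_ : [set x | _] = setT) ?setIT//; apply/seteqP; split.
  by rewrite (_ : [set x | _] = set0) ?setI0//; apply/seteqP; split.
apply: measurableI; first exact: measurableC.
rewrite bigcup_mkcond; apply: bigcupT_measurable_rat => q.
by case: ifP => // _; have [] := HB (pickle q).
Qed.

Lemma ge0_integral_completion (f : T -> \bar R) : measurable_fun setT f ->
  (forall x, 0 <= f x)%E -> (\int[cm]_x f x = \int[m]_x f x)%E.
Proof.
move=> mf f0; have mid : measurable_fun [set: cT] (id : cT -> T).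
  by apply: (@completion_measurable_fun _ T id); exact: measurable_id.
rewrite (@eq_measure_integral _ _ _ _ (pushforward cm (id : cT -> T))); last first.
  by move=> A mA _; rewrite /pushforward /= completion_measure.
by rewrite ge0_integral_pushforward//; move=> x _; exact: f0.
Qed.

Lemma integral_completion (f : T -> \bar R) : measurable_fun setT f ->
  (\int[cm]_x f x = \int[m]_x f x)%E.
Proof.
move=> mf; rewrite integralE [RHS]integralE; congr (_ - _)%E; apply: ge0_integral_completion => //.
  exact: measurable_funepos.
exact: measurable_funeneg.
Qed.

Lemma ae_le_integral_completion (f g : T -> \bar R) (N : set T) : measurable N -> m N = 0%E ->
  (forall x, 0 <= f x)%E -> (forall x, 0 <= g x)%E -> measurable_fun setT g ->
  (forall x, ~ N x -> f x <= g x)%E -> (\int[cm]_x f x <= \int[m]_x g x)%E.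
Proof.
move=> mN N0 f0 g0 mg fg; rewrite -ge0_integral_completion//.
apply: (@ae_le_integral_ge0 _ cT R cm f g N) => //; first exact: completion_measurable.
by rewrite -N0; exact: completion_measure.
Qed.

Lemma ae_ge_integral_completion (f g : T -> \bar R) (N : set T) : measurable N -> m N = 0%E ->
  (forall x, 0 <= f x)%E -> (forall x, 0 <= g x)%E -> measurable_fun setT f ->
  (forall x, ~ N x -> f x <= g x)%E -> (\int[m]_x f x <= \int[cm]_x g x)%E.
Proof.
move=> mN N0 f0 g0 mf fg; rewrite -ge0_integral_completion//.
apply: (@ae_le_integral_ge0 _ cT R cm f g N) => //; first exact: completion_measurable.
by rewrite -N0; exact: completion_measure.
Qed.

Lemma ae_eq_integral_completion (f g : T -> \bar R) (N : set T) : measurable N -> m N = 0%E ->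
  measurable_fun [set: cT] (f : cT -> \bar R) -> measurable_fun setT g ->
  (forall x, ~ N x -> f x = g x) -> (\int[cm]_x f x = \int[m]_x g x)%E.
Proof.
move=> mN N0 mf mg fg; rewrite -integral_completion//; apply: ae_eq_integral => //.
  exact: completion_measurable_fun.
exists N; split; [exact: completion_measurable|by rewrite -N0; exact: completion_measure|].
by move=> x /= h; apply: contrapT => nx; apply: h => _; rewrite fg.
Qed.

Lemma ae_completion (P : set T) : {ae cm, forall x, P x} -> {ae m, forall x, P x}.
Proof.
move=> [A [mA A0 PA]]; have [F [mF F0 AF]] := completion_null A0.
by exists F; split => // x /PA /AF.
Qed.

End Completion.

(** * Borel representatives *)

Section LebesgueBridge.
Context {R : realType} {n : nat}.
Local Notation V := 'rV[R]_n.
Local Notation mu := (@borel_rV R n).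
Local Notation leb := (lebesgue_rV R n).

(** The value [0] on an exceptional set makes a Lebesgue measurable function Borel. *)
Definition off (N : set V) (u : V -> R) : V -> R := fun x => u x * \1_(~` N) x.

Lemma off_eq N u x : ~ N x -> off N u x = u x.
Proof. by move=> nx; rewrite /off indicE mem_set// mulr1. Qed.

Lemma off_in N u x : N x -> off N u x = 0.
Proof. by move=> Nx; rewrite /off indicE memNset ?mulr0//= => /(_ Nx). Qed.

Lemma off_ge0 N u x : 0 <= u x -> 0 <= off N u x.
Proof. by move=> u0; rewrite mulr_ge0// indicE. Qed.

Lemma compact_cube (c : V) r : compact (cube c r).
Proof.
have := @rV_compact R n (fun i => `[c ord0 i - r, c ord0 i + r]%classic) (fun i => @segment_compact _ _ _).
congr compact; apply/seteqP; split => x h i; have := h i; rewrite /= in_itv/= ler_norml.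
  by move=> /andP[h1 h2]; apply/andP; split; lra.
by move=> /andP[h1 h2]; apply/andP; split; lra.
Qed.

Lemma local_int_off N u : measurable N -> mu N = 0%E -> loc_integrable u ->
  measurable_fun setT (off N u) -> local_int (off N u).
Proof.
move=> mN N0 [mu_ lu] mo; split=> // r; apply: le_lt_trans (lu _ (@compact_cube 0 r)).
rewrite [leRHS]integral_mkcond; apply: (ae_ge_integral_completion mN N0).
- by move=> x; rewrite mule_ge0 ?ind_ge0// lee_fin.
- by move=> x; rewrite patchE; case: ifP => // _; rewrite lee_fin.
- apply: emeasurable_funM; first by apply: measurable_ind; exact: measurable_cube.
  by apply/measurable_EFinP; exact: measurableT_comp.
move=> x nx; rewrite off_eq// patchE /ind indicE.
by case: ifP => _; rewrite ?mul1e ?mul0e.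
Qed.

Lemma A1_const_ge (v : V -> R) (c : V) (r : R) : (forall x, 0 <= v x) -> (A1_const v < +oo)%E -> 0 < r ->
  (0 <= fine (A1_const v)) /\
  (((2 * r) ^- n)%:E * \int[leb]_(x in cube c r) (v x)%:E * ess_sup leb ((fun x => (v x)%:E^-1) \_ (cube c r))
    <= (fine (A1_const v))%:E)%E.
Proof.
move=> v0 Av r0; have lQ : leb (cube c r) = ((2 * r) ^+ n)%:E.
  rewrite -(mu_cube c (ltW r0)); apply: completion_measure; exact: measurable_cube.
have rn : 0 < (2 * r) ^+ n by rewrite exprn_gt0// mulr_gt0.
have S0 : (0 <= ess_sup leb ((fun x => (v x)%:E^-1) \_ (cube c r)))%E.
  apply: ess_sup_gee.
    apply: (@lt_le_trans _ _ (leb (cube c r))); first by rewrite lQ lte_fin.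
    by apply: le_measure; rewrite ?inE//; apply: completion_measurable; exact: measurable_cube.
  apply: nearW => x; rewrite patchE; case: ifP => // _; rewrite inve_ge0 lee_fin; exact: v0.
have I0 : (0 <= \int[leb]_(x in cube c r) (v x)%:E)%E by apply: integral_ge0 => x _; rewrite lee_fin.
have H : (((2 * r) ^- n)%:E * \int[leb]_(x in cube c r) (v x)%:E * ess_sup leb ((fun x => (v x)%:E^-1) \_ (cube c r))
    <= A1_const v)%E.
  apply: ereal_sup_ubound; exists (cube c r); first by exists c, r.
  by rewrite lQ inver gt_eqF.
have P0 : (0 <= ((2 * r) ^- n)%:E * \int[leb]_(x in cube c r) (v x)%:E * ess_sup leb ((fun x => (v x)%:E^-1) \_ (cube c r)))%E.
  by rewrite !mule_ge0// lee_fin invr_ge0 ltW.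
have A0 : (0 <= A1_const v)%E := le_trans P0 H.
by rewrite fineK ?ge0_fin_numE// fine_ge0.
Qed.

(** The essential supremum bounds the weight from below almost everywhere on the cube.
    Where the weight vanishes the supremum is infinite, and then finiteness of the
    constant forces the weight to have mean zero on the cube. *)
Lemma A1_at_off N (v : V -> R) : measurable N -> mu N = 0%E -> A1_weight v ->
  measurable_fun setT (off N v) -> A1_at (off N v) (fine (A1_const v)).
Proof.
move=> mN N0 [v0 lv Av] mo c r r0.
have [A0 H] := A1_const_ge c v0 Av r0; set A := fine _ in A0 H *.
have rn : 0 < (2 * r) ^+ n by rewrite exprn_gt0// mulr_gt0.
set I := (\int[leb]_(x in cube c r) (v x)%:E)%E in H; set S := ess_sup _ _ in H.
have I0 : (0 <= I)%E by apply: integral_ge0 => x _; rewrite lee_fin.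
have I'I : (\int[mu]_w (ind (cube c r) w * (off N v w)%:E) <= I)%E.
  rewrite /I integral_mkcond; apply: (ae_ge_integral_completion mN N0).
  - by move=> x; rewrite mule_ge0 ?ind_ge0// lee_fin off_ge0.
  - by move=> x; rewrite patchE; case: ifP => // _; rewrite lee_fin.
  - apply: emeasurable_funM; first by apply: measurable_ind; exact: measurable_cube.
    exact/measurable_EFinP.
  move=> x nx; rewrite off_eq// patchE /ind indicE.
  by case: ifP => _; rewrite ?mul1e ?mul0e.
have aeN : {ae mu, forall z, ~ N z} by exists N; split => // z /= /contrapT.
have aeS : {ae mu, forall z, (((fun x => (v x)%:E^-1) \_ (cube c r)) z <= S)%E}.
  exact: ae_completion (ess_sup_ge leb _).
apply: filterS2 aeN aeS => z nz Sz Qz; apply: (le_trans I'I); rewrite off_eq//.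
move: Sz; rewrite patchE mem_set// => Sz.
have [vz|vz] := eqVneq (v z) 0.
  rewrite vz mulr0; move: Sz; rewrite vz inver eqxx leye_eq => /eqP Soo.
  rewrite leNgt; apply/negP => Ip; move: H; rewrite Soo gt0_muley ?leye_eq//.
  by rewrite mule_gt0// lte_fin invr_gt0.
have vp : 0 < v z by rewrite lt_neqAle eq_sym vz v0.
have {}H : (((2 * r) ^- n)%:E * I * (v z)^-1%:E <= A%:E)%E.
  apply: le_trans H; apply: lee_wpmul2l; first by rewrite mule_ge0// lee_fin invr_ge0 ltW.
  by move: Sz; rewrite inver (negbTE vz).
case: I I0 {I'I} H => [I| |] // I0; last first.
  by rewrite gt0_muley ?lte_fin ?invr_gt0// gt0_mulye ?lte_fin ?invr_gt0// leye_eq.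
by rewrite -!EFinM !lee_fin ler_pdivrMr// ler_pdivrMl// mulrA.
Qed.

Lemma integral_off N u (psi : V -> R) (M r : R) : measurable N -> mu N = 0%E -> loc_integrable u ->
  measurable_fun setT (off N u) -> measurable_fun setT psi -> (forall x, `|psi x| <= M) ->
  (forall x, ~ cube 0 r x -> psi x = 0) ->
  (\int[leb]_x (u x * psi x))%:E = (\int[mu]_x (off N u x * psi x)%:E)%E.
Proof.
move=> mN N0 lu mo mpsi pM pr; rewrite /Rintegral.
have -> : (\int[leb]_x (u x * psi x)%:E = \int[mu]_x (off N u x * psi x)%:E)%E.
  have mop : measurable_fun setT (fun x => (off N u x * psi x)%:E).
    by apply/measurable_EFinP; exact: measurable_funM.
  apply: (ae_eq_integral_completion mN N0) => [| |x nx]; last by rewrite off_eq.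
    apply/measurable_EFinP; apply: measurable_funM; first by case: lu.
    exact: (@completion_measurable_fun _ _ _ mu _ _ psi mpsi).
  exact: mop.
rewrite fineK//; apply: integrable_fin_num => //.
exact: (integrable_local (local_int_off mN N0 lu mo) mpsi pM pr).
Qed.

End LebesgueBridge.

Section BorelRepresentatives.
Context {R : realType} {n : nat}.
Local Notation V := 'rV[R]_n.
Local Notation mu := (@borel_rV R n).
Local Notation leb := (lebesgue_rV R n).

Lemma off_family (I : countType) (F : I -> V -> R) :
  (forall i, measurable_fun [set: lebesgue_space R n] (F i)) ->
  exists N, [/\ measurable N, mu N = 0%E & forall i, measurable_fun setT (off N (F i))].
Proof.
move=> mF; have /choice[M HM] (j : nat) : exists M, mu.-negligible M /\
    forall i, unpickle j = Some i -> forall N', measurable N' -> M `<=` N' -> measurable_fun setT (off N' (F i)).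
  case E : (unpickle j : option I) => [i|].
    by have [M M0 HM] := completion_fun (mF i); exists M; split=> // _ [<-].
  by exists set0; split => //; exact: negligible_set0.
have [N [mN N0 MN]] : mu.-negligible (\bigcup_j M j) by apply: negligible_bigcup => j; case: (HM j).
exists N; split => // i; have [_ H] := HM (pickle i); apply: H => //; first exact: pickleK.
by move=> x Mx; apply: MN; exists (pickle i).
Qed.

Lemma prodf_cube phi lo hi : @bumps R n phi lo hi ->
  exists r, forall e x, ~ cube 0 r x -> prodf phi e x = 0.
Proof.
move=> B; have [r _ Hr] := box_cube lo hi; exists r => e x nx; apply: (prodf_out B).
by move=> xb; apply: nx; exact: Hr.
Qed.

Variables (k l : nat) (v f : V -> R).
Hypotheses (lk : (l < k)%N) (Av : A1_weight v) (lf : loc_integrable f).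
Hypothesis wf : forall a : 'I_n -> nat, (\sum_(i < n) a i)%N = l.+1 -> exists g, is_weak_partial a f g.

Local Notation mi := {ffun 'I_n -> 'I_l.+2}.
Let ord (a : mi) := (\sum_(i < n) a i == l.+1)%N.
Let W (a : mi) : V -> R := weak_partial (fun i => a i : nat) f.

Let isW a : ord a -> is_weak_partial (fun i => a i : nat) f (W a).
Proof. by move=> /eqP /wf h; rewrite /W /weak_partial; exact: xgetPex. Qed.

Let idx (e : 'I_n -> nat) : mi := [ffun i => inord (e i)].

Let idxE e : (\sum_(i < n) e i)%N = l.+1 -> (fun i => idx e i : nat) = e.
Proof.
move=> he; apply/funext => i; rewrite ffunE inordK// ltnS -he.
by rewrite (bigD1 i)//= leq_addr.
Qed.

Let ord_idx e : (\sum_(i < n) e i)%N = l.+1 -> ord (idx e).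
Proof. by move=> he; rewrite /ord -[X in _ == X]he -[in X in _ == X](idxE he). Qed.

(** One null set serves for [f], the weight and the finitely many weak derivatives of
    order [l + 1]; the gradient inherits it. *)
Lemma admissible_off : exists N, [/\ measurable N, mu N = 0%E &
  admissible k l.+1 (@line_cst R n k l) (off N f) (off N (grad_norm l.+1 f)) (off N v) (fine (A1_const v))].
Proof.
pose F (i : option (option mi)) : V -> R :=
  if i is Some j then (if j is Some a then (if ord a then W a else fun=> 0) else v) else f.
have [v0 lv Avoo] := Av.
have mF i : measurable_fun [set: lebesgue_space R n] (F i).
  case: i => [[a|]|] /=; [|by case: lv|by case: lf].
  by case: ifP => [/isW [[]]//|_]; exact: measurable_cst.
have [N [mN N0 HN]] := off_family mF; exists N; split => //.
have mf := HN None; have mv := HN (Some None).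
have mW a : ord a -> measurable_fun setT (off N (W a)).
  by move=> oa; have := HN (Some (Some a)); rewrite /F oa.
set g := off N (grad_norm l.+1 f).
have gE x : g x = Num.sqrt (\sum_(a : mi | ord a) off N (W a) x ^+ 2).
  rewrite /g; have [Nx|nx] := pselect (N x).
    rewrite off_in// big1 ?sqrtr0// => a _; rewrite off_in//; exact: expr0n.
  by rewrite off_eq//; rewrite /grad_norm; congr (Num.sqrt _); apply: eq_bigr => a _; rewrite off_eq.
have g0 x : 0 <= g x by rewrite gE sqrtr_ge0.
have Wg a x : ord a -> `|off N (W a) x| <= g x.
  move=> oa; rewrite gE -sqrtr_sqr ler_wsqrtr// (bigD1 a)//= lerDl.
  by apply: sumr_ge0 => b _; exact: sqr_ge0.
have gW x : g x <= \sum_(a : mi | ord a) `|off N (W a) x|.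
  rewrite gE -[leRHS]ger0_norm ?sumr_ge0// -sqrtr_sqr ler_wsqrtr//.
  apply: (@proj2 (0 <= \sum_(a : mi | ord a) `|off N (W a) x|)).
  elim/big_rec2: _ => [|a t s _ [t0 st]]; first by rewrite expr0n.
  split; first exact: addr_ge0.
  rewrite sqrrD real_normK ?num_real// -addrA lerD2l; apply: (le_trans st).
  by rewrite lerDr mulrn_wge0// mulr_ge0.
have mg : measurable_fun setT g.
  rewrite (funext gE); apply: measurableT_comp; first by apply: continuous_measurable_fun; exact: sqrt_continuous.
  under eq_fun do rewrite big_mkcond; apply: measurable_sum => a.
  by case: (boolP (ord a)) => [oa|_]; [apply: measurable_funX; exact: mW|exact: measurable_cst].
have lW a : ord a -> local_int (off N (W a)).
  by move=> oa; apply: (local_int_off mN N0); [case: (isW oa)|exact: mW].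
have mi_ r : measurable_fun setT (fun z : V => ind (cube 0 r) z) by apply: measurable_ind; exact: measurable_cube.
have lg : local_int g.
  split=> // r; apply: (@le_lt_trans _ _ (\int[mu]_z \sum_(a <- index_enum mi) (if ord a then ind (cube 0 r) z * `|off N (W a) z|%:E else 0))%E).
    apply: le_integral_ge0 => z; first by rewrite mule_ge0 ?ind_ge0// lee_fin.
    rewrite ger0_norm// -big_mkcond/= -ge0_sume_distrr//.
    by rewrite sumEFin; apply: lee_wpmul2l; [exact: ind_ge0|rewrite lee_fin].
  have mt a : measurable_fun setT (fun z => if ord a then (ind (cube 0 r) z * `|off N (W a) z|%:E)%E else 0%E).
    case: (boolP (ord a)) => [oa|_]; last exact: measurable_cst.
    by apply: emeasurable_funM => //; apply/measurable_EFinP; apply: measurableT_comp => //; exact: mW.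
  rewrite ge0_integral_sum//; last first.
    by move=> a z _; case: ifP => // _; rewrite mule_ge0 ?ind_ge0// lee_fin.
  apply: lte_sum_pinfty => a _; case: (boolP (ord a)) => [oa|_]; last by rewrite integral0.
  by have [_] := lW a oa; apply.
have lf' : local_int (off N f) by exact: (local_int_off mN N0 lf mf).
have lv' : local_int (off N v) by exact: (local_int_off mN N0 lv mv).
pose G (e : 'I_n -> nat) : V -> R := if ord (idx e) then off N (W (idx e)) else fun=> 0.
have [A0 _] := @A1_const_ge _ _ v 0 1 v0 Avoo ltr01.
have abs_int (u : V -> R) : (forall x, 0 <= u x) -> local_int u ->
    forall r, (\int[mu]_z (ind (cube 0 r) z * (u z)%:E) < +oo)%E.
  move=> u0 [_ lu] r; apply: le_lt_trans (lu r).
  by under [leRHS]eq_integral do rewrite ger0_norm//.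
split; [split => //|split => //].
- apply: (@weak_line_estimate R n k l (off N f) g G) => //.
  + by move=> e; rewrite /G; case: ifP => [/mW|_]//; exact: measurable_cst.
  + by move=> e x he; rewrite /G ord_idx//; apply: Wg; exact: ord_idx.
  move=> e phi lo hi he B; rewrite /G ord_idx//.
  have [lWe we] := isW (ord_idx he).
  have [r Hr] := prodf_cube B.
  have [M1 _ HM1] := prodf_bounded B e.
  have [M0 _ HM0] := prodf_bounded B (fun=> 0%N).
  have mp e' : measurable_fun setT (prodf phi e') by exact: (measurable_prodf B e' (p := id)).
  rewrite -(integral_off mN N0 lf mf (mp e) HM1 (Hr e)).
  rewrite -(integral_off mN N0 lWe (mW _ (ord_idx he)) (mp _) HM0 (Hr _)).
  rewrite -EFinM; congr (_%:E).
  have := we _ (test_prodf B (fun=> 0%N)); rewrite (idxE he) (partial_multi_prodf B) => ->.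
  by rewrite (eqP (ord_idx he)).
- by move=> x; exact: off_ge0.
- exact: (A1_at_off mN N0 Av mv).
- by apply: abs_int => // x; exact: off_ge0.
- exact: abs_int.
Qed.

End BorelRepresentatives.

(** * The estimate for Lebesgue measurable functions *)

Section LebesgueComparison.
Context {R : realType} {n : nat}.
Local Notation V := 'rV[R]_n.
Local Notation mu := (@borel_rV R n).
Local Notation leb := (lebesgue_rV R n).
Variable N : set V.
Hypotheses (mN : measurable N) (N0 : mu N = 0%E).

Variables (k : nat) (lam b : R) (m : nat).

(** For almost every [h], no point [x + j h] with [j > 0] is exceptional, so [f] and its
    representative have the same difference. *)
Lemma section_off_le (f w : V -> R) (x : V) : ~ N x -> measurable_fun setT (off N f) ->
  measurable_fun setT w -> (forall h, 0 <= w h) ->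
  (\int[leb]_h (\1_(superlevel lam b k m f) (x, h) * w h)%:E <=
   \int[mu]_h (ind (superlevel lam b k m (off N f)) (x, h) * (w h)%:E))%E.
Proof.
move=> nx mf mw w0; have [M [mM M0 HM]] := null_dilates x mN N0.
apply: (ae_le_integral_completion mM M0).
- by move=> h; rewrite lee_fin mulr_ge0// indicE.
- by move=> h; rewrite mule_ge0 ?ind_ge0// lee_fin.
- apply: emeasurable_funM; last exact/measurable_EFinP.
  apply: (measurable_ind_comp (p := fun h : V => (x, h))); first exact: measurable_superlevel.
  exact: pair1_measurable.
move=> h nh; rewrite EFinM; suff -> : \1_(superlevel lam b k m f) (x, h) = \1_(superlevel lam b k m (off N f)) (x, h) :> R by [].
rewrite !indicE; congr ((_ : bool)%:R).
suff E : fdiff k h (off N f) x = fdiff k h f x.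
  by apply/idP/idP => /set_mem H; apply: mem_set; move: H; rewrite /superlevel /= E.
apply: eq_bigr => -[j jk] _ /=; congr (_ * _); rewrite off_eq//.
by case: j jk => [|j] _; [rewrite scale0r addr0|exact: HM].
Qed.

End LebesgueComparison.

Lemma line_cst_ge0 {R : realType} n k l : 0 <= @line_cst R n k l.
Proof. by rewrite !mulr_ge0// ?exprn_ge0. Qed.

Unset Implicit Arguments.

Theorem theorem3p3 (R : realType) (n k l : nat) (p q gamma : R)
  (n_gt0 : (0 < n)%N) (l_gt0 : (0 < l)%N) (le_lk : (l <= k)%N)
  (p_ge1 : 1 <= p) (q_gt0 : 0 < q)
  (npq : n%:R * (p^-1 - q^-1) < l%:R)
  (gammaP : Gamma p q gamma) :
  exists (C : R) (psi : R -> R),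
    [/\ 0 < C,
        {within `[0, +oo[, continuous psi},
        {in `[0, +oo[ &, {homo psi : s t / s < t}} &
        forall (v : 'rV[R]_n -> R), A1_weight v ->
        forall (f : 'rV[R]_n -> R), dotW l p v f ->
          (ereal_sup
             [set (lam `^ p)%:E *
                  \int[lebesgue_rV R n]_x
                    ((\int[lebesgue_rV R n]_h
                        (\1_(superlevel lam (gamma / q) k l f) (x, h)
                         * enorm h `^ (gamma - n%:R))%:E) `^ (p / q)
                     * (v x)%:E)
             | lam in [set lam : R | (0 < lam)%R]]
           <= (C * psi (fine (A1_const v)))%:E *
              \int[lebesgue_rV R n]_x (grad_norm l f x `^ p * v x)%:E)%E].
Proof.
have q_neq0 : q != 0 by rewrite gt_eqF.
have bq : gamma / q * q = gamma by rewrite divfK.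
have [b0 pb] : gamma / q != 0 /\ (p = 1 -> 0 < gamma / q \/ gamma / q < -1).
  move: gammaP; rewrite /Gamma; have [->|p1] := eqVneq p 1.
    move=> [g|g]; split.
    - by rewrite mulf_neq0 ?invr_eq0// lt_eqF// (lt_trans g)// oppr_lt0.
    - by move=> _; right; rewrite ltr_pdivrMr// mulN1r.
    - by rewrite gt_eqF// divr_gt0.
    - by move=> _; left; rewrite divr_gt0.
  move=> /= g0; split; first by rewrite mulf_neq0 ?invr_eq0.
  by move=> p1'; rewrite p1' eqxx in p1.
case: l l_gt0 le_lk npq => // l _ lk npq.
have k0 : (0 < k)%N by exact: leq_ltn_trans lk.
have [C C0 HC] := borel_estimate n_gt0 k0 (ltn0Sn l) (line_cst_ge0 n k l) p_ge1 b0 pb q_gt0 npq.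
(* Adding one makes the constant positive. *)
exists (C + 1), (fun t => (1 + t) ^+ 3); split.
- by rewrite ltr_wpDl.
- apply: continuous_subspaceT => t.
  apply: (@continuous_comp _ _ _ (fun t : R => 1 + t) (fun s => s ^+ 3)); last exact: exprn_continuous.
  by apply: continuousD; [exact: cst_continuous|move=> ?; exact: cvg_id].
- move=> s t; rewrite !in_itv/= !andbT => s0 t0 st.
  by rewrite ltrXn2r// ?nnegrE ?addr_ge0// ltrD2l.
move=> v Av f [lf wf _]; apply: ge_ereal_sup => _ [lam lam0 <-].
have [N [mN N0 adm]] := admissible_off lk Av lf wf.
have A0 : 0 <= fine (A1_const v) by case: adm => _ [].
have [v0 _ _] := Av.
have [[mf mg g0 _ v0'] [mv _ _ _ _]] := adm.
have mw : measurable_fun setT (fun h : 'rV[R]_n => enorm h `^ (gamma - n%:R)).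
  by apply: (measurableT_comp (measurable_powR _)); exact: measurable_enorm.
have lp0 : (0 <= (lam `^ p)%:E)%E by rewrite lee_fin powR_ge0.
have K0 : 0 <= (C + 1) * (1 + fine (A1_const v)) ^+ 3 by rewrite mulr_ge0 ?exprn_ge0 ?addr_ge0.
apply: (@le_trans _ _ ((C * (1 + fine (A1_const v)) ^+ 3)%:E *
    \int[borel_rV n]_x (off N (grad_norm l.+1 f) x `^ p * off N v x)%:E)%E); last first.
  apply: (@le_trans _ _ (((C + 1) * (1 + fine (A1_const v)) ^+ 3)%:E *
    \int[borel_rV n]_x (off N (grad_norm l.+1 f) x `^ p * off N v x)%:E)%E).
    apply: lee_wpmul2r; first by apply: integral_ge0 => x _; rewrite lee_fin mulr_ge0 ?powR_ge0.
    by rewrite lee_fin ler_wpM2r ?exprn_ge0 ?addr_ge0// lerDl.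
  apply: lee_wpmul2l; first by rewrite lee_fin.
  apply: (ae_ge_integral_completion mN N0).
  - by move=> x; rewrite lee_fin mulr_ge0 ?powR_ge0.
  - by move=> x; rewrite lee_fin mulr_ge0 ?powR_ge0.
  - apply/measurable_EFinP; apply: measurable_funM => //.
    exact: (measurableT_comp (measurable_powR _)).
  by move=> x nx; rewrite !off_eq.
apply: le_trans (HC _ _ _ _ _ adm lam0); rewrite bq; apply: lee_wpmul2l => //.
have I0 x : (0 <= \int[borel_rV n]_h (ind (superlevel lam (gamma / q) k l.+1 (off N f)) (x, h) * (enorm h `^ (gamma - n%:R))%:E))%E.
  by apply: integral_ge0 => h _; rewrite mule_ge0 ?ind_ge0// lee_fin powR_ge0.
have I0' x : (0 <= \int[lebesgue_rV R n]_h (\1_(superlevel lam (gamma / q) k l.+1 f) (x, h) * enorm h `^ (gamma - n%:R))%:E)%E.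
  by apply: integral_ge0 => h _; rewrite lee_fin mulr_ge0 ?powR_ge0// indicE.
apply: (ae_le_integral_completion mN N0).
- by move=> x; rewrite mule_ge0 ?poweR_ge0 ?lee_fin.
- by move=> x; rewrite mule_ge0 ?poweR_ge0 ?lee_fin.
- apply: emeasurable_funM; last exact/measurable_EFinP.
  apply: (measurableT_comp (measurable_poweR _)).
  apply: (@measurable_fun_fubini_tonelli_F _ _ 'rV[R]_n 'rV[R]_n R (borel_rV n) (fun z => ind (superlevel lam (gamma / q) k l.+1 (off N f)) z * (enorm z.2 `^ (gamma - n%:R))%:E)%E).
  + apply: emeasurable_funM; first by apply: measurable_ind; exact: measurable_superlevel.
    by apply/measurable_EFinP; apply: (measurableT_comp mw); exact: measurable_snd.
  + by move=> z; rewrite mule_ge0 ?ind_ge0// lee_fin powR_ge0.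
move=> x nx; rewrite off_eq//; apply: lee_wpmul2r; first by rewrite lee_fin.
apply: le_poweR => //; first by rewrite divr_ge0 ?(le_trans ler01 p_ge1)// ltW.
by apply: (section_off_le mN N0) => // h; exact: powR_ge0.
Qed.
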